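(* Let $(\mu,\nu)$ vary within the closure of a chamber in the parameter space in $\mathbb{R}^{m+n}$. Then the double Hurwitz numbers $h^0_{\mu;\nu}$ are given by a homogeneous polynomial of degree $m+n-3$ in $\mu_1,\dots,\mu_m,\nu_1,\dots,\nu_n$.
   Context: Double Hurwitz numbers: for partitions $\mu=(\mu_1,\dots,\mu_m)$ and $\nu=(\nu_1,\dots,\nu_n)$ of the same integer $d$, $h^0_{\mu;\nu}$ is the number of genus $0$ degree $d$ branched covers $f:\mathbb{CP}^1\to\mathbb{CP}^1$ with branching $\mu$ over $\infty$, branching $\nu$ over $0$, and simple branching over $m+n-2$ other fixed points, where the preimages of $\infty$ and of $0$ are labelled (the $i$th preimage of $\infty$ has multiplicity $\mu_i$, the $j$th preimage of $0$ has multiplicity $\nu_j$), and each cover is counted with weight $1/c$, $c$ being the number of its automorphisms. A pair $(\mu,\nu)$ is regarded as the point of $\mathbb{R}^{m+n}$ with coordinates $x_1=\mu_1,\dots,x_m=\mu_m,y_1=\nu_1,\dots,y_n=\nu_n$. Parameter space: the cone in $\mathbb{R}^{m+n}$ given by $x_1\ge\dots\ge x_m\ge 0$, $y_1\ge\dots\ge y_n\ge 0$ and $\sum_{i=1}^m x_i=\sum_{j=1}^n y_j$. For a sequence $a_1,\dots,a_k$ and $K\subseteq[1,k]=\{1,\dots,k\}$ put $a_K=\sum_{i\in K}a_i$. A resonance is a hyperplane $x_I=y_J$ with $I\subset[1,m]$, $J\subset[1,n]$ nonempty proper subsets. Chambers are the connected components of the complement to the union of all resonances (in the parameter space). *)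

(* Defs.v *)
From HB Require Import structures.
From mathcomp Require Import all_boot all_order all_algebra.
From mathcomp Require Import finmap.
From mathcomp Require Import all_classical all_reals all_analysis.
From mathcomp Require Import complex.
From mathcomp Require Import -(notations) mpoly.

Set Implicit Arguments.
Unset Strict Implicit.
Unset Printing Implicit Defensive.

Import Order.TTheory GRing.Theory Num.Theory.
Import numFieldNormedType.Exports.

Local Open Scope classical_set_scope.
Local Open Scope ring_scope.

(* CP^1 = C + {oo}, with [None] the point oo. *)
Definition CP1 (R : realType) : Type := option (complex R).

(* Holomorphic maps CP^1 -> CP^1 are the rational functions, written here as
   num / den in lowest terms.  The pair (num, den) is unique only up to a
   scalar; everything below depends on the map alone, and isomorphism of covers
   identifies the different presentations of one map. *)
Record ratmap (R : realType) := RatMap {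
  num : {poly complex R};
  den : {poly complex R};
  num_den_coprime : coprimep num den }.

Definition degree (R : realType) (f : ratmap R) : nat :=
  (maxn (size (num f)) (size (den f))).-1.

Definition reval (R : realType) (f : ratmap R) (z : CP1 R) : CP1 R :=
  let: (u, v) :=
    if z is Some a then ((num f).[a], (den f).[a])
    else ((num f)`_(degree f), (den f)`_(degree f)) in
  if v == 0 then None else Some (u / v).

(* In homogeneous coordinates, the fibre of f over b is the zero locus of a
   binary form of degree [degree f]; this is that form in the affine chart, and
   its order of vanishing at oo is the drop in degree. *)
Definition fibre_poly (R : realType) (f : ratmap R) (b : CP1 R) :
    {poly complex R} :=
  if b is Some w then num f - w *: den f else den f.

(* Local degree of f at z. *)
Definition ram_index (R : realType) (f : ratmap R) (z : CP1 R) : nat :=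
  let F := fibre_poly f (reval f z) in
  if z is Some a then mup a F else (degree f - (size F).-1)%N.

Definition simple_branching (R : realType) (f : ratmap R) (b : CP1 R) : Prop :=
  exists z, [/\ reval f z = b, ram_index f z = 2%N &
    forall z', reval f z' = b -> z' <> z -> ram_index f z' = 1%N].

Definition unramified_over (R : realType) (f : ratmap R) (b : CP1 R) : Prop :=
  forall z, reval f z = b -> ram_index f z = 1%N.

Record labelled_map (R : realType) (m n : nat) := LabelledMap {
  cover_map : ratmap R;
  pole : 'I_m -> CP1 R;
  zero : 'I_n -> CP1 R }.

HB.instance Definition _ (R : realType) (m n : nat) :=
  gen_eqMixin (labelled_map R m n).
HB.instance Definition _ (R : realType) (m n : nat) :=
  gen_choiceMixin (labelled_map R m n).

Section Hurwitz.
Variables (R : realType) (m n : nat).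
Implicit Types (mu : 'I_m -> nat) (nu : 'I_n -> nat).
Implicit Types (w : 'I_(m + n - 2) -> complex R).

(* The covers counted by h^0_{mu;nu}: the w k are the m + n - 2 simple branch
   points, meant to be pairwise distinct and different from 0 and oo. *)
Definition is_cover mu nu w (c : labelled_map R m n) : Prop :=
  let f := cover_map c in
  [/\ degree f = (\sum_(i < m) mu i)%N,
      [/\ injective (pole c), range (pole c) = reval f @^-1` [set None] &
          forall i, ram_index f (pole c i) = mu i],
      [/\ injective (zero c), range (zero c) = reval f @^-1` [set Some 0] &
          forall j, ram_index f (zero c j) = nu j],
      forall k, simple_branching f (Some (w k)) &
      forall b : complex R, b != 0 -> (forall k, b != w k) ->
        unramified_over f (Some b)].

(* phi ranges over the automorphisms of CP^1, i.e. the maps of degree 1. *)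
Definition isomorphism (c c' : labelled_map R m n) (phi : CP1 R -> CP1 R) :
    Prop :=
  [/\ exists2 g : ratmap R, degree g = 1%N & phi = reval g,
      reval (cover_map c') \o phi = reval (cover_map c),
      forall i, phi (pole c i) = pole c' i &
      forall j, phi (zero c j) = zero c' j].

Definition automorphisms (c : labelled_map R m n) : set (CP1 R -> CP1 R) :=
  [set phi | isomorphism c c phi].

Definition iso_class mu nu w (c : labelled_map R m n) :
    set (labelled_map R m n) :=
  [set c' | is_cover mu nu w c' /\ exists phi, isomorphism c c' phi].

(* One cover in each isomorphism class: [xget] selects an element of
   [iso_class c] depending only on that set, not on c. *)
Definition cover_reps mu nu w : set (labelled_map R m n) :=
  [set xget c (iso_class mu nu w c) | c in is_cover mu nu w].

(* The sum is taken in the extended reals: it would be +oo if there were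
   infinitely many isomorphism classes. *)
Definition hurwitz0 mu nu w : \bar R :=
  \esum_(c in cover_reps mu nu w)
    ((#|` fset_set (automorphisms c) |)%:R^-1)%:E.

Definition xcoord (v : 'rV[R]_(m + n)) (i : 'I_m) : R := v 0 (lshift n i).
Definition ycoord (v : 'rV[R]_(m + n)) (j : 'I_n) : R := v 0 (rshift m j).

Definition parameter_space : set 'rV[R]_(m + n) :=
  [set v | [/\ (forall i i' : 'I_m, (i <= i')%N -> xcoord v i' <= xcoord v i),
               (forall i, 0 <= xcoord v i),
               (forall j j' : 'I_n, (j <= j')%N -> ycoord v j' <= ycoord v j),
               (forall j, 0 <= ycoord v j) &
               \sum_(i < m) xcoord v i = \sum_(j < n) ycoord v j]].

Definition resonance (I : {set 'I_m}) (J : {set 'I_n}) : set 'rV[R]_(m + n) :=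
  [set v | \sum_(i in I) xcoord v i = \sum_(j in J) ycoord v j].

Definition resonances : set 'rV[R]_(m + n) :=
  [set v | exists I J, [/\ I != finset.set0, I \proper [set: 'I_m]%SET,
     J != finset.set0, J \proper [set: 'I_n]%SET & resonance I J v]].

Definition chamber (C : set 'rV[R]_(m + n)) : Prop :=
  exists2 v, (parameter_space `\` resonances) v &
    C = connected_component (parameter_space `\` resonances) v.

Definition param_point mu nu : 'rV[R]_(m + n) :=
  row_mx (\row_i (mu i)%:R) (\row_j (nu j)%:R).

End Hurwitz.

Definition is_partition (d k : nat) (lam : 'I_k -> nat) : Prop :=
  [/\ forall i j : 'I_k, (i <= j)%N -> (lam j <= lam i)%N,
      forall i, (0 < lam i)%N & (\sum_(i < k) lam i)%N = d].

(* Main.v *)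
(** A cover is f = w_r * prod_a (z - q_a)^{s_a} with s_a = nu_j or -mu_i, and is rigid because
    m + n >= 3 points are labelled; moving the critical point over w_r to infinity and two
    labelled points to 0 and 1 turns isomorphism classes into solutions (q, c) of a square
    algebraic system with c_k the critical point over w_k.  Multiply the other critical values
    by tau.  The number of solutions is locally constant in tau as long as no tau * w_k meets
    w_r (inverse function theorem, plus properness), and as tau tends to 0 the labelled points
    collect in exactly three clusters, the ones with more than one label having positive weight
    s_A; the rescaled cluster A is a cover of the same kind with one more label, of weight
    -s_A, and arises in s_A ways.  This gives a recursion for the Hurwitz number whose terms
    are products of subset sums s_A, with one condition s_A > 0 for each.  On the closure of a
    chamber no subset sum changes sign, and each term has m + n - 3 factors, so the Hurwitz
    number is a homogeneous polynomial of that degree.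

    Limits are taken in an ultrapower of C, with the standard part as a place to C.  A disc that
    contains several special points gives a rational function over C whose zeros count the
    critical points; comparing critical values between nested discs excludes all other
    degenerations. *)

(* Near tau = 0 the system for (q, c) is singular, as the labels of a cluster collide. A cluster A
   shrinks like tau^(1/s_A), so with tau = th^L, L a common multiple of the positive subset sums,
   its radius is th^(L/s_A) times a unit. With this unit, the dilation, as a further unknown the
   system becomes regular at th = 0. In the limit the s_A-th power of the dilation is prescribed,
   hence the s_A ways.

   The obstacle is to exclude all other degenerations. On each disc the rescaled logarithmic
   differential has a limit, but a zero limit would say nothing about the clusters. Count -1 for a
   label and 1 for a critical point; the total is -3. On a disc where the differential is smallest,
   this Euler characteristic count produces two critical points with the same limiting value, or one
   with the value 1 taken at infinity, and both are excluded. So no limit is zero, every cluster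
   other than a lone critical point has sum -1, and when all critical values are small there are
   three clusters.

   Derivatives are also computed through places, so that one set of algebraic rules gives both the
   uniqueness of nearby solutions and, by the inverse function theorem, their existence. *)
From HB Require Import structures.
From mathcomp Require Import all_boot all_order all_algebra all_field.
From mathcomp Require Import finmap generic_quotient ring_quotient.
From mathcomp Require Import all_classical all_reals all_analysis.
From mathcomp Require Import complex.
From mathcomp Require Import -(notations) mpoly.
From mathcomp Require Import zify ring lra.
Require Import Defs.

Set Implicit Arguments.
Unset Strict Implicit.
Unset Printing Implicit Defensive.

Import Order.TTheory GRing.Theory Num.Theory.
Import numFieldNormedType.Exports.
Import Normc.
Local Open Scope classical_set_scope.
Local Open Scope quotient_scope.
Local Open Scope ring_scope.

(** * Places *)

(* st is only meaningful on fin, the valuation ring. *)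
Record place (F K : fieldType) := Place {
  fin : pred F;
  st : F -> K;
  emb : K -> F;
  fin1 : fin 1;
  finB : forall x y, fin x -> fin y -> fin (x - y);
  finM : forall x y, fin x -> fin y -> fin (x * y);
  finV : forall x, ~~ fin x -> fin x^-1;
  st1 : st 1 = 1;
  stB : forall x y, fin x -> fin y -> st (x - y) = st x - st y;
  stM : forall x y, fin x -> fin y -> st (x * y) = st x * st y;
  stV_inf : forall x, ~~ fin x -> st x^-1 = 0;
  fin_unitV : forall x, fin x -> st x != 0 -> fin x^-1;
  fin_emb : forall a, fin (emb a);
  st_emb : forall a, st (emb a) = a }.

Section PlaceTheory.
Variables (F K : fieldType) (p : place F K).
Implicit Types (x y : F) (a b : K).

Definition spec x a := fin p x /\ st p x = a.

Lemma specP x : fin p x -> spec x (st p x). Proof. by []. Qed.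

Lemma spec_emb a : spec (emb p a) a.
Proof. by split; [exact: fin_emb | exact: st_emb]. Qed.

Lemma spec_uniq x a b : spec x a -> spec x b -> a = b.
Proof. by move=> [_ <-] [_ <-]. Qed.

Lemma spec1 : spec 1 1.
Proof. by split; [exact: fin1 | exact: st1]. Qed.

Lemma specB x y a b : spec x a -> spec y b -> spec (x - y) (a - b).
Proof. by move=> [fx <-] [fy <-]; split; [exact: finB | exact: stB]. Qed.

Lemma specM x y a b : spec x a -> spec y b -> spec (x * y) (a * b).
Proof. by move=> [fx <-] [fy <-]; split; [exact: finM | exact: stM]. Qed.

Lemma spec0 : spec 0 0.
Proof. by rewrite -(subrr 1) -[0 in X in spec _ X](subrr 1); apply: specB spec1 spec1. Qed.

Lemma specN x a : spec x a -> spec (- x) (- a).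
Proof. by move=> h; rewrite -[- x]sub0r -[- a]sub0r; apply: specB spec0 h. Qed.

Lemma specD x y a b : spec x a -> spec y b -> spec (x + y) (a + b).
Proof. by move=> hx hy; rewrite -[y]opprK -[b]opprK; apply: specB hx (specN hy). Qed.

Lemma spec_neq0 x a : spec x a -> a != 0 -> x != 0.
Proof.
by move=> h; apply: contra_neq => x0; apply: spec_uniq h _; rewrite x0; exact: spec0.
Qed.

Lemma specV x a : spec x a -> a != 0 -> spec x^-1 a^-1.
Proof.
move=> h a0; have x0 := spec_neq0 h a0; case: (h) => fx sx.
have fV : fin p x^-1 by apply: fin_unitV; rewrite ?sx.
have hV := specP fV.
suff -> : a^-1 = st p x^-1 by [].
have := specM h hV; rewrite mulfV// => /(spec_uniq spec1) e.
by apply: (mulfI a0); rewrite mulfV.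
Qed.

Lemma specV_inf x : ~~ fin p x -> spec x^-1 0.
Proof. by move=> h; split; [exact: finV | exact: stV_inf]. Qed.

Lemma spec0V x : spec x 0 -> x != 0 -> ~~ fin p x^-1.
Proof.
move=> h x0; apply/negP => /specP hV.
have := specM h hV; rewrite mulfV// mul0r => /(spec_uniq spec1)/eqP.
by rewrite oner_eq0.
Qed.

Lemma spec_sum (I : Type) (r : seq I) (P : pred I) (f : I -> F) (g : I -> K) :
  (forall i, P i -> spec (f i) (g i)) ->
  spec (\sum_(i <- r | P i) f i) (\sum_(i <- r | P i) g i).
Proof. move=> h; elim/big_ind2: _ => //; first exact: spec0.
by move=> *; apply: specD. Qed.

Lemma spec_prod (I : Type) (r : seq I) (P : pred I) (f : I -> F) (g : I -> K) :
  (forall i, P i -> spec (f i) (g i)) ->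
  spec (\prod_(i <- r | P i) f i) (\prod_(i <- r | P i) g i).
Proof. move=> h; elim/big_ind2: _ => //; first exact: spec1.
by move=> *; apply: specM. Qed.

Lemma specX x a n : spec x a -> spec (x ^+ n) (a ^+ n).
Proof.
by move=> h; elim: n => [|n ih]; rewrite ?expr0 ?exprS; [exact: spec1 | exact: specM].
Qed.

Lemma specXz x a (n : int) : spec x a -> a != 0 -> spec (x ^ n) (a ^ n).
Proof.
move=> h a0; case: n => n; first exact: specX.
by rewrite NegzE -!invr_expz; apply: specV; rewrite ?expf_neq0//; exact: specX.
Qed.

Lemma spec_nat n : spec n%:R n%:R.
Proof.
by elim: n => [|n ih]; rewrite ?mulr0n ?mulrS; [exact: spec0 | exact: specD spec1 ih].
Qed.

Lemma spec_int (n : int) : spec n%:~R n%:~R.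
Proof.
case: n => n; first exact: spec_nat.
by rewrite NegzE !mulrNz; apply/specN/spec_nat.
Qed.

Lemma spec0Xz x (n : int) : spec x 0 -> 0 < n -> spec (x ^ n) 0.
Proof.
case: n => [[|n]|n]// h _; rewrite -exprnP.
by have := specX n.+1 h; rewrite expr0n.
Qed.

Lemma spec0Xz_inf x (n : int) : spec x 0 -> x != 0 -> n <= 0 -> ~ spec (x ^ n) 0.
Proof.
move=> h x0 n0; rewrite -[n]opprK; have : 0 <= - n by rewrite oppr_ge0.
case: (- n) => // k _; rewrite -invr_expz -exprnP => hV.
have xk0 : x ^+ k != 0 by rewrite expf_neq0.
have := specM hV (specX k h); rewrite mulVf// mul0r => /(spec_uniq spec1)/eqP.
by rewrite oner_eq0.
Qed.

(** Used to force exponents to vanish: a power of an infinitesimal is infinitesimal for a positive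
    exponent and infinite for a negative one. *)
Lemma specXz_unit x (n : int) a : spec x 0 -> x != 0 -> spec (x ^ n) a -> a != 0 -> n = 0.
Proof.
move=> h x0 hn a0; case: (ltrgt0P n) => // n0.
  by move: a0; rewrite (spec_uniq hn (spec0Xz h n0)) eqxx.
have n1 : 0 < - n by rewrite oppr_gt0.
have := specM hn (spec0Xz h n1); rewrite -expfzDr// subrr expr0z mulr0.
by move=> /(spec_uniq spec1)/eqP; rewrite oner_eq0.
Qed.

Lemma fin_or x : fin p x \/ spec x^-1 0.
Proof. by case: (boolP (fin p x)) => h; [left | right; apply: specV_inf]. Qed.

(** Valuation rings are closed under roots: if x were infinite, a power of x^-1 would be
    infinitesimal. *)
Lemma fin_expr x n : (0 < n)%N -> fin p (x ^+ n) -> fin p x.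
Proof.
move=> n0 h; case: (fin_or x) => // hV; apply/negPn/negP => nf.
have x0 : x != 0 by apply: contraNneq nf => ->; case: spec0.
have hVn : spec (x^-1 ^+ n) 0 by have := specX n hV; rewrite expr0n eqn0Ngt n0.
have := spec0V hVn; rewrite exprVn invrK invr_eq0 expf_neq0// => /(_ isT).
by rewrite h.
Qed.

(** The valuation order, to be read as |x| = O(|y|). It is total on nonzero elements, so
    [exists_min] finds extremal members of finite families. *)
Definition dom x y := fin p (x / y).

Lemma dom_total x y : x != 0 -> y != 0 -> dom x y || dom y x.
Proof.
move=> x0 y0; rewrite /dom; case: (boolP (fin p (x / y))) => //= /finV.
by rewrite invf_div.
Qed.

Lemma dom_trans y x z : y != 0 -> dom x y -> dom y z -> dom x z.
Proof. by move=> y0 h1 h2; have := finM h1 h2; rewrite mulrA mulfVK. Qed.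

Lemma dom_refl x : dom x x.
Proof.
rewrite /dom; case: (eqVneq x 0) => [->|x0]; first by rewrite mul0r; case: spec0.
by rewrite mulfV//; exact: fin1.
Qed.

End PlaceTheory.

Lemma exists_min (T : finType) (P : pred T) (r : rel T) x0 : P x0 ->
  (forall x y, P x -> P y -> r x y || r y x) ->
  (forall y x z, P x -> P y -> P z -> r x y -> r y z -> r x z) ->
  exists x, P x /\ forall y, P y -> r x y.
Proof.
move=> Px0 tot tr.
have rr x : P x -> r x x by move=> h; have := tot x x h h; rewrite orbb.
suff [x [Px hx]] : exists x, P x /\ forall y, y \in enum T -> P y -> r x y.
  by exists x; split => // y; apply: hx; rewrite mem_enum.
elim: (enum T) => [|z l [x [Px hx]]]; first by exists x0.
case: (boolP (P z)) => Pz; last first.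
  by exists x; split => // y; rewrite inE => /orP[/eqP->|/hx//]; rewrite (negbTE Pz).
case/orP: (tot x z Px Pz) => h.
  by exists x; split => // y; rewrite inE => /orP[/eqP-> //|/hx]; apply.
exists z; split => // y; rewrite inE => /orP[/eqP-> _|yl Py]; first exact: rr.
by apply: (tr x) => //; apply: hx.
Qed.

(** * Sums of simple fractions *)

Section PartialFractions.
Variables (F : fieldType) (I : finType).
Implicit Types (A : pred I) (q y : I -> F).

Definition denom A q : {poly F} := \prod_(a | A a) ('X - (q a)%:P).
Definition codenom A q a : {poly F} := \prod_(b | A b && (b != a)) ('X - (q b)%:P).
Definition numer A q y : {poly F} := \sum_(a | A a) y a *: codenom A q a.

Lemma denomE A q a : A a -> denom A q = ('X - (q a)%:P) * codenom A q a.
Proof. by move=> Aa; rewrite /denom (bigD1 a). Qed.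

Lemma horner_denom A q x : (denom A q).[x] = \prod_(a | A a) (x - q a).
Proof. by rewrite /denom horner_prod; apply: eq_bigr => a _; rewrite hornerXsubC. Qed.

Lemma horner_numer A q y x : (forall a, A a -> x != q a) ->
  (numer A q y).[x] = (denom A q).[x] * \sum_(a | A a) y a / (x - q a).
Proof.
move=> h; rewrite /numer horner_sum mulr_sumr; apply: eq_bigr => a Aa.
rewrite (denomE _ Aa) hornerZ hornerM hornerXsubC.
by field; rewrite subr_eq0 h.
Qed.

Lemma horner_numer_root A q y a : A a ->
  (numer A q y).[q a] = y a * \prod_(b | A b && (b != a)) (q a - q b).
Proof.
move=> Aa; rewrite /numer horner_sum (bigD1 a)//= big1 ?addr0; last first.
  move=> b /andP[Ab ba]; rewrite hornerZ /codenom horner_prod (bigD1 a) ?Aa 1?eq_sym//=.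
  by rewrite hornerXsubC subrr mul0r mulr0.
rewrite hornerZ /codenom horner_prod; congr (_ * _).
by apply: eq_bigr => b _; rewrite hornerXsubC.
Qed.

Lemma size_denom A q : size (denom A q) = #|A|.+1.
Proof. by have := size_prod_XsubC (enum A) q; rewrite big_enum -cardE. Qed.

Lemma size_codenom A q a : A a -> size (codenom A q a) = #|A|.
Proof.
move=> Aa; have /eqP := size_denom A q; rewrite (denomE _ Aa) size_monicM ?monicXsubC//; last first.
  by rewrite monic_neq0// /codenom monic_prod// => b _; exact: monicXsubC.
by rewrite size_XsubC /= eqSS => /eqP.
Qed.

Lemma size_numer A q y : (size (numer A q y) <= #|A|)%N.
Proof.
apply: (leq_trans (size_sum _ _ _)); apply/bigmax_leqP => a Aa.
by rewrite (leq_trans (size_scale_leq _ _))// size_codenom.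
Qed.

(** The polynomial form of z y / (z - q) = y + y q / (z - q). Iterated, it lowers the degree of
    [numer] by one for each vanishing moment of y; this measures the order of vanishing at
    infinity. *)
Lemma mulX_numer A q y :
  'X * numer A q y = (\sum_(a | A a) y a) *: denom A q + numer A q (fun a => y a * q a).
Proof.
rewrite /numer mulr_sumr scaler_suml -big_split; apply: eq_bigr => a Aa /=.
rewrite (denomE _ Aa) -!mul_polyC polyCM; ring.
Qed.

Lemma size_mulX (p : {poly F}) m : (size ('X * p)%R <= m.+1)%N -> (size p <= m)%N.
Proof.
have [->|p0] := eqVneq p 0; first by rewrite size_poly0.
by rewrite mulrC size_mulX.
Qed.

Lemma size_numer_sum0 A q y m : \sum_(a | A a) y a = 0 -> #|A| = m.+1 ->
  (size (numer A q y) <= m)%N.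
Proof.
move=> s0 cA; apply: size_mulX; rewrite mulX_numer s0 scale0r add0r -cA.
exact: size_numer.
Qed.

Lemma size_numer_sum00 A q y m : \sum_(a | A a) y a = 0 -> \sum_(a | A a) y a * q a = 0 ->
  #|A| = m.+2 -> (size (numer A q y) <= m)%N.
Proof.
move=> s0 s1 cA; apply: size_mulX; rewrite mulX_numer s0 scale0r add0r.
exact: size_numer_sum0.
Qed.

Variables (W : finType).
Implicit Types (V : pred W) (c : W -> F).

Lemma roots_factor V c (p : {poly F}) : {in V &, injective c} ->
  (forall k, V k -> root p (c k)) -> exists r, p = r * \prod_(k | V k) ('X - (c k)%:P).
Proof.
move=> ci h; have [] := @uniq_roots_prod_XsubC _ p [seq c k | k <- enum V].
- by apply/allP => x /mapP[k]; rewrite mem_enum => /h rk ->.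
- rewrite uniq_rootsE map_inj_in_uniq ?enum_uniq// => k l.
  by rewrite !mem_enum; exact: ci.
by move=> r ->; exists r; rewrite big_map big_enum.
Qed.

Lemma numer_neq0 A q y a : {in A &, injective q} -> A a -> y a != 0 -> numer A q y != 0.
Proof.
move=> qi Aa ya; apply/negP => /eqP n0; have := horner_numer_root q y Aa.
rewrite n0 horner0 => /eqP; rewrite eq_sym mulf_eq0 (negbTE ya) /= => /prodf_eq0[b /andP[Ab ba]].
by rewrite subr_eq0 => /eqP/qi e; move: ba; rewrite e ?eqxx.
Qed.

Section Critical.
Variables (A : pred I) (V : pred W) (q : I -> F) (c : W -> F) (s : I -> F).
Hypotheses (qi : {in A &, injective q}) (ci : {in V &, injective c}).
Hypothesis cq : forall k a, V k -> A a -> c k != q a.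
Hypothesis s0 : forall a, A a -> s a != 0.
Hypothesis crit : forall k, V k -> \sum_(a | A a) s a / (c k - q a) = 0.
Hypothesis sz : (size (numer A q s) <= #|V|.+1)%N.
Variables (a0 : I) (Aa0 : A a0).

(** The c k are distinct roots of the numerator, and the size bound leaves room only for a constant
    factor. *)
Lemma critical_factor :
  exists2 sg, sg != 0 & numer A q s = sg *: \prod_(k | V k) ('X - (c k)%:P).
Proof.
have [k Vk|r e] := roots_factor ci (p := numer A q s).
  apply/rootP; rewrite horner_numer ?crit ?mulr0// => a; exact: cq.
have n0 := numer_neq0 qi Aa0 (s0 Aa0).
have r0 : r != 0 by apply: contraNneq n0; rewrite e => ->; rewrite mul0r.
have pm : \prod_(k | V k) ('X - (c k)%:P) \is monic.
  by apply: monic_prod => k _; exact: monicXsubC.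
have sV : size (\prod_(k | V k) ('X - (c k)%:P)) = #|V|.+1.
  by have := size_prod_XsubC (enum V) c; rewrite big_enum -cardE.
have : (size r <= 1)%N.
  move: sz; rewrite e size_Mmonic// sV addnS /=; move: (size r) => t.
  by rewrite -[#|V|.+1]add1n leq_add2r.
move=> /size1_polyC er; exists r`_0; last by rewrite {1}e {1}er mul_polyC.
by move: r0; rewrite {1}er polyC_eq0.
Qed.

(* The vector fields annihilating all critical values are the affine ones. *)
Lemma critical_affine y h :
  (forall k, V k -> h + \sum_(a | A a) y a / (c k - q a) = 0) ->
  (size (h *: denom A q + numer A q y)%R <= #|V|.+2)%N ->
  exists al be, forall a, A a -> y a = s a * (al * q a + be).
Proof.
move=> hy szy; have [sg sg0 e] := critical_factor.
have [k Vk|r er] := roots_factor ci (p := h *: denom A q + numer A q y).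
  apply/rootP; rewrite hornerD hornerZ horner_numer; last by move=> a; exact: cq.
  by rewrite mulrC -mulrDr hy ?mulr0.
have pm : \prod_(k | V k) ('X - (c k)%:P) \is monic.
  by apply: monic_prod => k _; exact: monicXsubC.
have sV : size (\prod_(k | V k) ('X - (c k)%:P)) = #|V|.+1.
  by have := size_prod_XsubC (enum V) c; rewrite big_enum -cardE.
have sr : (size r <= 2)%N.
  have [->|r0] := eqVneq r 0; first by rewrite size_poly0.
  move: szy; rewrite er size_Mmonic// sV addnS /=; move: (size r) => t.
  by rewrite -[#|V|.+2]add2n leq_add2r.
have rE x : r.[x] = r`_1 * x + r`_0.
  rewrite (horner_coef_wide _ sr) !big_ord_recl big_ord0 /=.
  by rewrite expr0 mulr1 addr0 addrC expr1.
(* The quotient r is affine. At the pole q a only the term of index a survives in either numerator,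
   so comparing them there gives y a = s a * r(q a) / sg. *)
exists (r`_1 / sg), (r`_0 / sg) => a Aa.
set d := \prod_(b | A b && (b != a)) (q a - q b).
have d0 : d != 0.
  apply/prodf_neq0 => b /andP[Ab ba]; rewrite subr_eq0; apply: contraNneq ba => /qi -> //.
have e1 : y a * d = r.[q a] * (\prod_(k | V k) ('X - (c k)%:P)).[q a].
  rewrite -hornerM -er hornerD hornerZ (denomE _ Aa) hornerM hornerXsubC subrr.
  by rewrite mul0r mulr0 add0r horner_numer_root.
have e2 : s a * d = sg * (\prod_(k | V k) ('X - (c k)%:P)).[q a].
  by rewrite -hornerZ -e horner_numer_root.
apply: (mulIf d0); rewrite e1 rE.
have -> : s a * (r`_1 / sg * q a + r`_0 / sg) * d =
  (s a * d) * ((r`_1 * q a + r`_0) / sg) by ring.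
by rewrite e2; field.
Qed.

(* Critical points are simple roots of numer A q s. *)
Lemma critical_simple k : V k -> \sum_(a | A a) s a / (c k - q a) ^+ 2 != 0.
Proof.
move=> Vk; have [sg sg0 e] := critical_factor.
(* With these residues the sum of simple fractions is minus the logarithmic derivative divided by z
   - c k, so the root c k is removed once; the value at c k is the sum in question. *)
pose y a := s a / (c k - q a).
have e1 : ('X - (c k)%:P) * numer A q y = - numer A q s.
  have -> : - numer A q s = (\sum_(a | A a) y a) *: denom A q - numer A q s.
    by rewrite (crit Vk) scale0r sub0r.
  rewrite scaler_suml /numer mulr_sumr -sumrB; apply: eq_bigr => a Aa.
  have ca : c k - q a != 0 by rewrite subr_eq0 cq.
  have -> : s a = y a * (c k - q a) by rewrite /y mulfVK.
  rewrite (denomE _ Aa) -!mul_polyC; move: (codenom _ _ _) (y a) => w ya.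
  by rewrite (rmorphM polyC) (rmorphB polyC) /=; ring.
have e2 : numer A q y = - sg *: \prod_(l | V l && (l != k)) ('X - (c l)%:P).
  have Xn0 : 'X - (c k)%:P != 0 by rewrite polyXsubC_eq0.
  apply: (mulfI Xn0); rewrite e1 e (bigD1 k)//=.
  by rewrite -!mul_polyC (rmorphN polyC) /=; ring.
apply/eqP => z; have := congr1 (horner^~ (c k)) e2.
rewrite horner_numer; last by move=> a; exact: cq.
have -> : \sum_(a | A a) y a / (c k - q a) = 0.
  by rewrite -[RHS]z; apply: eq_bigr => a Aa; rewrite /y -mulrA -invfM.
rewrite mulr0 hornerZ horner_prod => /esym/eqP; rewrite mulf_eq0 oppr_eq0 (negbTE sg0) /=.
move=> /prodf_eq0[l /andP[Vl lk]]; rewrite hornerXsubC subr_eq0 => /eqP/ci h.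
by move: lk; rewrite h ?eqxx.
Qed.

End Critical.
End PartialFractions.

Lemma poly_eq0_cofinite (K : numDomainType) (bad : seq K) (p : {poly K}) :
  (forall u, u \notin bad -> p.[u] = 0) -> p = 0.
Proof.
move=> h; apply/eqP; apply/negPn/negP => p0.
pose b := size bad; pose s := [seq u <- [seq n%:R | n <- iota 0 (size p + b)] | u \notin bad].
have us : uniq s.
  by rewrite filter_uniq// map_inj_uniq ?iota_uniq// => m n /eqP; rewrite eqr_nat => /eqP.
have as_ : all (root p) s by apply/allP => u; rewrite mem_filter => /andP[/h/rootP].
have := max_poly_roots p0 as_ us; apply/negP; rewrite -leqNgt size_filter.
set t := map _ _; have ut : uniq t.
  by rewrite map_inj_uniq ?iota_uniq// => m n /eqP; rewrite eqr_nat => /eqP.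
have := count_predC (mem bad) t; rewrite /t size_map size_iota -/t => e.
have : (count (mem bad) t <= b)%N.
  rewrite -size_filter; apply: uniq_leq_size; first exact: filter_uniq.
  by move=> u; rewrite mem_filter => /andP[].
have -> : count (fun u => u \notin bad) t = count (predC (mem bad)) t by [].
by move: (count (mem bad) t) (count (predC (mem bad)) t) (size p : nat) (b) e => c1 c2 n1 b1; lia.
Qed.

(** * Residues of a sum of simple fractions whose poles have merged *)

Section Residues.
Variables (K : numFieldType) (I W : finType) (JI : pred I) (JW : pred W).
Variables (eq : I -> K) (ec : W -> K) (s : I -> K) (k : K) (bad : seq K).
Hypothesis form : forall u, u \notin bad -> (forall a, JI a -> u != eq a) ->
  (forall w, JW w -> u != ec w) ->
  \sum_(a | JI a) s a / (u - eq a) = k * \prod_(w | JW w) (u - ec w) / \prod_(a | JI a) (u - eq a).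

Let bad' := bad ++ codom eq ++ codom ec.

Let ressum e : \sum_(a | JI a && (eq a == e)) s a *: denom (fun a => JI a && (eq a != e)) eq
   + ('X - e%:P) * numer (fun a => JI a && (eq a != e)) eq s = 0 :> {poly K} -> 
  \sum_(a | JI a && (eq a == e)) s a = 0.
Proof.
move=> /(congr1 (horner^~ e)); rewrite hornerD hornerM hornerXsubC subrr mul0r addr0.
rewrite -scaler_suml hornerZ horner0 horner_denom => /eqP; rewrite mulf_eq0 => /orP[/eqP//|].
by move=> /prodf_eq0[a /andP[_ ae]]; rewrite subr_eq0 eq_sym (negbTE ae).
Qed.

(** Multiplying [form] by u - e and by the factors of the poles away from e gives a polynomial whose
    value at e is the total residue of the poles merged at e, times a nonzero product. *)
Lemma residue_poly e u : u \notin bad' -> u != e ->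
  ((\sum_(a | JI a && (eq a == e)) s a) *: denom (fun a => JI a && (eq a != e)) eq
   + ('X - e%:P) * numer (fun a => JI a && (eq a != e)) eq s).[u] =
  (u - e) * (\prod_(a | JI a && (eq a != e)) (u - eq a)) *
  (k * \prod_(w | JW w) (u - ec w) / \prod_(a | JI a) (u - eq a)).
Proof.
rewrite !mem_cat !negb_or => /and3P[ub ue uc] une.
have uq a : u != eq a by apply: contraNneq ue => ->; exact: codom_f.
have uw a : u != ec a by apply: contraNneq uc => ->; exact: codom_f.
rewrite -form// [\sum_(a | JI a) s a / (u - eq a)](bigID (fun a => eq a == e)) /=.
rewrite hornerD hornerZ hornerM hornerXsubC horner_numer; last by move=> a _; exact: uq.
rewrite horner_denom mulrDr; congr (_ + _); last by ring.
have -> : \sum_(i | JI i && (eq i == e)) s i / (u - eq i) =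
   (\sum_(i | JI i && (eq i == e)) s i) / (u - e).
  by rewrite mulr_suml; apply: eq_bigr => i /andP[_ /eqP->].
by field; rewrite subr_eq0.
Qed.

Lemma residue_eq0 e : k = 0 -> \sum_(a | JI a && (eq a == e)) s a = 0.
Proof.
move=> k0; apply: ressum; rewrite -scaler_suml.
apply: (@poly_eq0_cofinite _ (e :: bad')) => u; rewrite inE negb_or => /andP[ue ub].
by rewrite residue_poly// k0 !mul0r mulr0.
Qed.

(** At e the poles outnumber the zeros by exactly one, so the right-hand side of [form] has a
    genuine simple pole there. *)
Lemma residue_neq0 e : k != 0 ->
  #|[pred a | JI a && (eq a == e)]| = #|[pred w | JW w && (ec w == e)]|.+1 ->
  \sum_(a | JI a && (eq a == e)) s a != 0.
Proof.
move=> k0 cd; apply/negP => /eqP z.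
pose r : {poly K} := k *: \prod_(w | JW w && (ec w != e)) ('X - (ec w)%:P).
pose p := ((\sum_(a | JI a && (eq a == e)) s a) *: denom (fun a => JI a && (eq a != e)) eq
   + ('X - e%:P) * numer (fun a => JI a && (eq a != e)) eq s).
have : p - r = 0.
  apply: (@poly_eq0_cofinite _ (e :: bad')) => u; rewrite inE negb_or => /andP[ue ub].
  rewrite hornerD hornerN /p residue_poly// /r hornerZ horner_prod.
  rewrite [\prod_(a | JI a) _](bigID (fun a => eq a == e)) /= [\prod_(w | JW w) _](bigID (fun a => ec a == e)) /=.
  have -> : \prod_(i | JI i && (eq i == e)) (u - eq i) = (u - e) * (u - e) ^+ #|[pred w | JW w && (ec w == e)]|.
    rewrite -exprS -cd -prodr_const; by apply: eq_bigr => i /andP[_ /eqP->].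
  have -> : \prod_(i | JW i && (ec i == e)) (u - ec i) = (u - e) ^+ #|[pred w | JW w && (ec w == e)]|.
    by rewrite -prodr_const; apply: eq_bigr => i /andP[_ /eqP->].
  have -> : \prod_(w | JW w && (ec w != e)) ('X - (ec w)%:P).[u] = \prod_(w | JW w && (ec w != e)) (u - ec w).
    by apply: eq_bigr => w _; rewrite hornerXsubC.
  have u0 : u - e != 0 by rewrite subr_eq0.
  have uq : \prod_(i | JI i && (eq i != e)) (u - eq i) != 0.
    apply/prodf_neq0 => i _; rewrite subr_eq0; apply: contraNneq ub => ->.
    by rewrite !mem_cat codom_f orbT.
  have := expf_neq0 #|[pred w | JW w && (ec w == e)]| u0.
  move: (_ ^+ _) => v v0; by field; rewrite uq v0 u0.
move=> /(congr1 (horner^~ e)); rewrite hornerD hornerN /p z scale0r add0r hornerM hornerXsubC subrr mul0r.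
rewrite sub0r /r hornerZ horner0 horner_prod => /eqP; rewrite oppr_eq0 mulf_eq0 (negbTE k0) /=.
by move=> /prodf_eq0[w /andP[_ we]]; rewrite hornerXsubC subr_eq0 eq_sym (negbTE we).
Qed.

End Residues.

(** * Euler characteristic counts over the clusters of a disc *)

Section ClusterCount.
Variables (T : finType) (C : eqType) (S : pred T) (e : T -> C) (chi : T -> int).
Let m x := \sum_(y | S y && (e y == e x)) chi y.
Let leaf x := S x && (chi x == 1) && [forall y, S y ==> (e y == e x) ==> (y == x)].

Let rep x := odflt x [pick y | S y && (e y == e x)].
Let E := [pred x | S x && (rep x == x)].

Let repP x : S x -> S (rep x) /\ e (rep x) = e x.
Proof.
rewrite /rep; case: pickP => [y /andP[Sy /eqP]|/(_ x)] //=.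
Qed.

Let rep_eq x y : e x = e y -> S x -> S y -> rep x = rep y.
Proof.
move=> exy Sx Sy; rewrite /rep.
have -> : [pick z | S z && (e z == e x)] = [pick z | S z && (e z == e y)].
  by apply: eq_pick => z; rewrite exy.
by case: pickP => // /(_ y); rewrite Sy eqxx.
Qed.

Lemma cluster_sum : \sum_(x | S x) chi x = \sum_(x | E x) m x.
Proof.
rewrite (partition_big rep E) /=; last first.
  move=> x Sx; have [Sr er] := repP Sx; rewrite Sr; apply/eqP.
  exact: rep_eq.
apply: eq_bigr => y /andP[Sy /eqP ry]; apply: eq_bigl => x.
case Sx : (S x) => //=; apply/eqP/eqP => h; last by rewrite (rep_eq h).
by have [_ <-] := repP Sx; rewrite h.
Qed.

Hypothesis clusters : forall x, S x -> leaf x \/ m x <= -1.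
Variables (x0 x1 : T) (Sx0 : S x0) (Sx1 : S x1) (ne01 : e x0 != e x1).

Let leaf_m x : leaf x -> m x = 1.
Proof.
move=> /andP[/andP[Sx /eqP cx] /forallP h]; rewrite /m (bigD1 x) ?Sx ?eqxx//= cx.
rewrite big1 ?addr0// => y /andP[/andP[Sy ey] yx].
by move: (h y); rewrite Sy ey (negbTE yx).
Qed.

Let card_E : (2 <= #|E|)%N.
Proof.
have [S0 e0] := repP Sx0; have [S1 e1] := repP Sx1.
rewrite (cardD1 (rep x0)) (cardD1 (rep x1)).
have -> : rep x0 \in E by rewrite inE S0 /=; apply/eqP; exact: rep_eq.
have -> : rep x1 \in [predD1 E & rep x0].
  rewrite !inE S1 (rep_eq e1 S1 Sx1) eqxx !andbT.
  by apply: contraNneq ne01 => h; rewrite -e0 -e1 h.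
by [].
Qed.

Let nL := #|[pred x | E x && leaf x]|.
Let nB := #|[pred x | E x && ~~ leaf x]|.

Let sum_split : \sum_(x | S x) chi x = nL%:Z + \sum_(x | E x && ~~ leaf x) m x.
Proof.
rewrite cluster_sum (bigID leaf) /=; congr (_ + _).
rewrite (eq_bigr (fun _ => 1)) => [|x /andP[_ /leaf_m//]].
by rewrite sumr_const natz.
Qed.

Let nLB : (2 <= nL + nB)%N.
Proof.
have := cardID leaf E; have := card_E.
rewrite /nL /nB => h1 h2.
have -> : #|[pred x | E x && leaf x]| = #|[predI E & leaf]| by [].
have -> : #|[pred x | E x && ~~ leaf x]| = #|[predD E & leaf]|.
  by apply: eq_card => x; rewrite !inE andbC.
by rewrite h2.
Qed.

Let sum_le b : (forall x, E x -> ~~ leaf x -> m x <= b) ->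
  \sum_(x | S x) chi x <= nL%:Z + b *+ nB.
Proof.
move=> h; rewrite sum_split lerD2l /nB -sumr_const; apply: ler_sum => x /andP[Ex lx].
exact: h.
Qed.

Let nonleaf x : E x -> ~~ leaf x -> m x <= -1.
Proof. by move=> /andP[Sx _]; case: (clusters Sx) => // ->. Qed.

(** Without a leaf, the two or more clusters would contribute at most -1 each, hence at most -2 in
    total. *)
Lemma leaf_of_sumN1 : \sum_(x | S x) chi x = -1 -> exists x, leaf x.
Proof.
move=> h; have := sum_le nonleaf; rewrite h => hh.
have : (0 < nL)%N by move: hh nLB; rewrite -mulr_natr; lia.
by move=> /card_gt0P[x /andP[_ lx]]; exists x.
Qed.

(** Without a leaf and without a cluster of sum -1, the two or more clusters would contribute at
    most -2 each, hence at most -4. *)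
Lemma leaf_of_sumN3 : \sum_(x | S x) chi x = -3 ->
  (exists x, leaf x) \/ (exists2 x, S x & m x = -1).
Proof.
move=> h; have [l0|] := posnP nL; last first.
  by move=> /card_gt0P[x /andP[_ lx]]; left; exists x.
right; have [/existsP[x /andP[Sx /eqP mx]]|] := boolP [exists x, S x && (m x == -1)].
  by exists x.
rewrite negb_exists => /forallP hn; have := @sum_le (-2) _.
have hx : forall x, E x -> ~~ leaf x -> m x <= - 2%:Z.
  move=> x Ex lx; have := nonleaf Ex lx; have := hn x; case/andP: Ex => -> _ /=; lia.
move=> /(_ hx); rewrite h l0 -mulr_natr; move: nLB; rewrite l0; lia.
Qed.

(** The total is at most [nL - nB] while [nL + nB] is at least 2. So a single leaf leaves room for
    exactly one other cluster, whose sum must be -1. *)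
Lemma leaf_of_sum_ge0 : 0 <= \sum_(x | S x) chi x ->
  (exists x y, [/\ leaf x, leaf y & x != y]) \/ 
  ((exists x, leaf x) /\ (exists2 x, S x & m x = -1)).
Proof.
move=> h; have [l2|] := leqP 2 nL.
  left; move: l2; rewrite /nL => /card_gt1P[x [y [/andP[_ lx] /andP[_ ly] xy]]].
  by exists x, y.
move=> l1; right; have := sum_le nonleaf; rewrite -mulr_natr => hs.
have [L1 B1] : nL = 1%N /\ nB = 1%N by move: nLB h hs l1; lia.
split; first by have : (0 < nL)%N by [rewrite L1]; move=> /card_gt0P[x /andP[_ lx]]; exists x.
have /card_gt0P[x Bx] : (0 < nB)%N by rewrite B1.
have /card_le1_eqP B1' : (nB <= 1)%N by rewrite B1.
move: h; rewrite sum_split L1 (bigD1 x)//= big1 ?addr0; last first.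
  by move=> y /andP[By]; rewrite (B1' _ _ Bx By) eqxx.
move: Bx => /andP[/andP[Sx rx] lx] h.
exists x => //; have := nonleaf _ lx; rewrite /E /= Sx rx => /(_ isT); lia.
Qed.

Lemma three_clusters : (forall x, S x -> m x = -1) -> \sum_(x | S x) chi x = -3 ->
  exists x y z, [/\ S x, S y & S z] /\ [/\ e x != e y, e x != e z, e y != e z &
    forall t, S t -> e t \in [:: e x; e y; e z]].
Proof.
move=> hm; rewrite cluster_sum (eq_bigr (fun _ => -1)) => [|x /andP[/hm//]].
rewrite sumr_const => h3; have cE : #|E| = 3%N.
  by have : -1 *+ #|E| = -3%:Z := h3; rewrite -mulr_natr; move: #|E| => k; lia.
move: (cE); rewrite cardE; move: (enum_uniq E) (mem_enum E).
case: (enum E) => [|x [|y [|z [|? ?]]]]//= /andP[xn /andP[yn _]] hE _.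
have eE t : t \in [:: x; y; z] -> S t /\ rep t = t by rewrite hE => /andP[? /eqP].
have [Sx rx] := eE x (mem_head _ _).
have [|Sy ry] := eE y; first by rewrite !inE eqxx orbT.
have [|Sz rz] := eE z; first by rewrite !inE eqxx !orbT.
move: xn yn; rewrite !inE negb_or => /andP[xy xz] yz.
exists x, y, z; split=> //; split.
- by apply: contra_neq xy => h; rewrite -rx -ry; apply: rep_eq.
- by apply: contra_neq xz => h; rewrite -rx -rz; apply: rep_eq.
- by apply: contra_neq yz => h; rewrite -ry -rz; apply: rep_eq.
move=> t St; have [Sr <-] := repP St.
have : rep t \in [:: x; y; z].
  by rewrite hE inE Sr; apply/eqP/rep_eq => //; have [_ ->] := repP St.
by rewrite !inE => /or3P[]/eqP->; rewrite eqxx ?orbT.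
Qed.

End ClusterCount.

(** * Clusters of a degenerating function *)

Lemma exists_notin (K : numDomainType) (bad : seq K) : exists u, u \notin bad.
Proof.
have [/hasP[u _ ub]|/hasPn h] := boolP (has (fun u => u \notin bad) [seq n%:R | n <- iota 0 (size bad).+1]).
  by exists u.
suff : (size [seq (n%:R : K) | n <- iota 0 (size bad).+1] <= size bad)%N.
  by rewrite size_map size_iota ltnn.
apply: uniq_leq_size => [|u /h]; last by rewrite negbK.
by rewrite map_inj_uniq ?iota_uniq// => m n /eqP; rewrite eqr_nat => /eqP.
Qed.

Lemma prod_expz (F : fieldType) (T : finType) (P : pred T) (x : F) (n : T -> int) : x != 0 ->
  \prod_(i | P i) x ^ n i = x ^ (\sum_(i | P i) n i).
Proof. by move=> x0; rewrite (big_morph (fun n => x ^ n) (id1 := 1) (op1 := *%R))// => i j; rewrite expfzDr. Qed.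

Lemma prod_clusters1 (F : fieldType) (C : choiceType) (T : finType) (P : pred T) (e : T -> C)
    (f : C -> F) (n : T -> int) :
  (forall c, \sum_(x | P x && (e x == c)) n x = 0) -> (forall x, P x -> f (e x) != 0) ->
  \prod_(x | P x) f (e x) ^ n x = 1.
Proof.
move=> h0 hf; pose r x : seq_sub (codom e) := SeqSub (codom_f e x).
rewrite (partition_big r predT)//= big1// => i _.
case: (pickP [pred x | P x && (r x == i)]) => [x /andP[Px /eqP rx]|h]; last by rewrite big_pred0.
have fi : f (val i) != 0 by rewrite -rx; apply: hf.
rewrite (eq_bigr (fun y => f (val i) ^ n y)) => [|y /andP[_ /eqP <-]//].
rewrite prod_expz// (eq_bigl (fun x => P x && (e x == val i))) ?h0 ?expr0z// => y.
Qed.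

Section Vertex.
Variables (F : fieldType) (K : numFieldType) (p : place F K) (I W : finType).
Variables (q : I -> F) (c : W -> F) (s : I -> int) (sg : F).
Implicit Types (x y : I + W) (al ro : F).

(* A disc with centre al and radius ro has the coordinate coor al ro; x lies in the disc when
   inn al ro x, and ee al ro x is then the cluster of x.  Up to a unit, kap al ro and
   hgt al ro are the sizes of the logarithmic differential and of fval on the disc away from
   the clusters, gg al ro x being the size of z - pt x there. *)
Definition pt x := match x with inl a => q a | inr k => c k end.
Definition chi x : int := if x is inl _ then -1 else 1.
Definition swt x : int := if x is inl a then s a else 0.

Definition coor al ro (z : F) := (z - al) / ro.
Definition inn al ro x := fin p (coor al ro (pt x)).
Definition ee al ro x : K := st p (coor al ro (pt x)).
Definition gg al ro x := if inn al ro x then ro else al - pt x.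
Definition kap al ro := ro * sg * \prod_x gg al ro x ^ chi x.
Definition hgt al ro := \prod_x gg al ro x ^ swt x.
Definition fval z := \prod_a (z - q a) ^ s a.

Lemma gg_neq0 al ro x : ro != 0 -> gg al ro x != 0.
Proof.
rewrite /gg; case: ifPn => // h _; apply: contraNneq h => /eqP; rewrite subr_eq0 => /eqP e.
by rewrite /inn /coor e subrr mul0r; case: (spec0 p).
Qed.

Lemma coorK al ro z : ro != 0 -> al + ro * coor al ro z = z.
Proof. by move=> r0; rewrite /coor; field. Qed.

(** Seen from inside the disc, the factor of a point outside is constant up to infinitesimals. *)
Lemma spec_gg al ro ut u x : ro != 0 -> spec p ut u ->
  spec p ((al + ro * ut - pt x) / gg al ro x) (if inn al ro x then u - ee al ro x else 1).
Proof.
move=> r0 hu; have := gg_neq0 al x r0; rewrite /gg; case: ifPn => h g0.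
  have -> : (al + ro * ut - pt x) / ro = ut - coor al ro (pt x) by rewrite /coor; field.
  exact: specB.
have -> : (al + ro * ut - pt x) / (al - pt x) = 1 - ut * (coor al ro (pt x))^-1.
  rewrite /coor invf_div; field.
  by rewrite g0 -(opprB al) oppr_eq0 g0.
rewrite -[1 in X in spec _ _ X]subr0 -(mulr0 u); apply: specB; first exact: spec1.
by apply: specM => //; apply: specV_inf.
Qed.

Lemma spec_gprod al ro ut u (n : I + W -> int) (A : pred (I + W)) : ro != 0 -> spec p ut u ->
  (forall x, A x -> inn al ro x -> n x != 0 -> u != ee al ro x) ->
  spec p (\prod_(x | A x) ((al + ro * ut - pt x) / gg al ro x) ^ n x)
         (\prod_(x | A x && inn al ro x) (u - ee al ro x) ^ n x).
Proof.
move=> r0 hu hA; rewrite big_mkcondr; apply: spec_prod => x Ax.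
have := spec_gg al x r0 hu.
case: ifPn => h; last by move=> /(@specXz _ _ _ _ _ (n x)); rewrite exp1rz oner_eq0; apply.
have [->|nx] := eqVneq (n x) 0; first by rewrite !expr0z => _; exact: spec1.
by move=> /specXz; apply; rewrite subr_eq0 hA.
Qed.

Lemma fvalE z : fval z = \prod_x (z - pt x) ^ swt x.
Proof. by rewrite big_sumType /= [X in _ * X]big1 ?mulr1// => k _; rewrite expr0z. Qed.

Hypothesis ptI : injective pt.
Hypothesis omE : forall z, (forall a, z != q a) ->
  \sum_a (s a)%:~R / (z - q a) = sg * (\prod_k (z - c k)) / \prod_a (z - q a).

Lemma prod_chi (R : fieldType) (P : pred (I + W)) (f : I + W -> R) :
  \prod_(x | P x) f x ^ chi x =
  (\prod_(k | P (inr k)) f (inr k)) / \prod_(a | P (inl a)) f (inl a).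
Proof.
by rewrite big_sumType /= mulrC -prodfV; congr (_ * _); apply: eq_bigr => k _; rewrite ?expr1z ?exprN1.
Qed.

Lemma kap_form al ro : ro != 0 -> exists k, spec p (kap al ro) k /\
  forall u, (forall x, inn al ro x -> u != ee al ro x) ->
  \sum_(a | inn al ro (inl a)) (s a)%:~R / (u - ee al ro (inl a)) =
  k * (\prod_(w | inn al ro (inr w)) (u - ee al ro (inr w))) /
      \prod_(a | inn al ro (inl a)) (u - ee al ro (inl a)).
Proof.
move=> r0; set J := inn al ro; set e := ee al ro.
pose T u := \sum_(a | J (inl a)) (s a)%:~R / (u - e (inl a)).
pose Q u := \prod_(x | J x) (u - e x) ^ chi x.
have main u : (forall x, J x -> u != e x) -> Q u != 0 /\ spec p (kap al ro) (T u / Q u).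
  move=> hu; have Q0 : Q u != 0.
    by apply/prodf_neq0 => x Jx; rewrite expfz_neq0// subr_eq0 hu.
  split=> //; have hut := spec_emb p u; set ut := emb p u in hut.
  have hP : spec p (\prod_x ((al + ro * ut - pt x) / gg al ro x) ^ chi x) (Q u).
    by apply: spec_gprod => // x _ Jx _; exact: hu.
  have nz x : al + ro * ut != pt x.
    apply/negP => /eqP e1; have cu : coor al ro (pt x) = ut by rewrite /coor -e1; field.
    have Jx : J x by rewrite /J /inn cu; case: hut.
    by have /eqP[] := hu x Jx; rewrite /e /ee cu; case: hut.
  have hT : spec p (ro * \sum_a (s a)%:~R / (al + ro * ut - q a)) (T u).
    rewrite /T [X in spec _ _ X]big_mkcond mulr_sumr; apply: spec_sum => a _.
    have -> : ro * ((s a)%:~R / (al + ro * ut - q a)) =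
       (s a)%:~R * (ut - coor al ro (q a))^-1.
      have -> : ut - coor al ro (q a) = (al + ro * ut - q a) / ro by rewrite /coor; field.
      by rewrite invf_div; ring.
    case: ifPn => h.
      apply: specM; first exact: spec_int.
      by apply: specV; [apply: specB => // | rewrite subr_eq0 hu].
    rewrite -[0](mulr0 (s a)%:~R); apply: specM; first exact: spec_int.
    apply: specV_inf; apply: contra h => h; rewrite /J /inn /=.
    have -> : coor al ro (q a) = ut - (ut - coor al ro (q a)) by ring.
    by apply: finB => //; case: hut.
  have -> : kap al ro = (ro * \sum_a (s a)%:~R / (al + ro * ut - q a)) /
     \prod_x ((al + ro * ut - pt x) / gg al ro x) ^ chi x.
    rewrite omE => [|a]; last exact: (nz (inl a)).
    have -> : \prod_x ((al + ro * ut - pt x) / gg al ro x) ^ chi x =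
       (\prod_x (al + ro * ut - pt x) ^ chi x) / \prod_x gg al ro x ^ chi x.
      by rewrite -prodf_div; apply: eq_bigr => x _; rewrite expfzMl exprz_inv -invr_expz.
    rewrite [\prod_x (al + ro * ut - pt x) ^ chi x]prod_chi /= /kap.
    set A := \prod_(k : W) _; set B := \prod_(a : I) _; set G := \prod_x _.
    have A0 : A != 0 by apply/prodf_neq0 => k _; rewrite subr_eq0 (nz (inr k)).
    have B0 : B != 0 by apply/prodf_neq0 => k _; rewrite subr_eq0 (nz (inl k)).
    have G0 : G != 0 by apply/prodf_neq0 => x _; rewrite expfz_neq0// gg_neq0.
    by field; rewrite A0 B0 G0.
  by apply: specM => //; apply: specV.
(* The value at one generic point determines k; as standard parts are unique, the identity then
   holds at all other points. *)
have [u0 hu0] := exists_notin (codom e).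
have gen0 x : J x -> u0 != e x by move=> _; apply: contraNneq hu0 => ->; exact: codom_f.
have [_ h0] := main u0 gen0.
exists (T u0 / Q u0); split=> // u hu; have [Q0 h1] := main u hu.
have e1 : Q u = _ := prod_chi J (fun x => u - e x).
by rewrite (spec_uniq h0 h1) -/(T u) -mulrA -e1; field.
Qed.

(** An infinitely smaller disc that contains exactly the special points of the cluster e. *)
Definition child al ro e al' ro' := [/\ ro' != 0, spec p (ro' / ro) 0,
  spec p (coor al ro al') e & forall x, inn al' ro' x = inn al ro x && (ee al ro x == e)].

Lemma child_prod al ro e al' ro' (n : I + W -> int) : ro != 0 -> child al ro e al' ro' ->
  exists2 U, spec p U (\prod_(x | inn al ro x && (ee al ro x != e)) (e - ee al ro x) ^ n x) &
  \prod_x gg al' ro' x ^ n x =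
  (ro' / ro) ^ (\sum_(x | inn al ro x && (ee al ro x == e)) n x) * (\prod_x gg al ro x ^ n x) * U.
Proof.
move=> r0 [r0' hr hal hin]; pose cl x := inn al ro x && (ee al ro x == e).
exists (\prod_(x | ~~ cl x) ((al' - pt x) / gg al ro x) ^ n x).
  rewrite -(coorK al al' r0).
  rewrite [X in spec _ _ X](eq_bigl (fun x => ~~ cl x && inn al ro x)); last first.
    by move=> x; rewrite /cl; case: (inn al ro x); rewrite ?andbT.
  by apply: spec_gprod => // x; rewrite /cl => /nandP[/negbTE->//|]; rewrite eq_sym.
rewrite (bigID cl) /= [\prod_x gg al ro x ^ n x](bigID cl) /=.
rewrite (eq_bigr (fun x => ro' ^ n x)) => [|x]; last by move=> h; rewrite /gg hin -/(cl x) h.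
rewrite [X in _ * X = _](eq_bigr (fun x => (al' - pt x) ^ n x)) => [|x]; last first.
  by move=> /negbTE h; rewrite /gg hin -/(cl x) h.
rewrite [\prod_(x | cl x) gg al ro x ^ n x](eq_bigr (fun x => ro ^ n x)) => [|x]; last first.
  by case/andP => h _; rewrite /gg h.
rewrite -(prod_expz cl) ?mulf_neq0 ?invr_neq0//.
have -> : \prod_(x | ~~ cl x) ((al' - pt x) / gg al ro x) ^ n x =
   (\prod_(x | ~~ cl x) (al' - pt x) ^ n x) / \prod_(x | ~~ cl x) gg al ro x ^ n x.
  by rewrite -prodf_div; apply: eq_bigr => x _; rewrite expfzMl exprz_inv -invr_expz.
have -> : \prod_(i | cl i) (ro' / ro) ^ n i =
   (\prod_(i | cl i) ro' ^ n i) / \prod_(i | cl i) ro ^ n i.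
  by rewrite -prodf_div; apply: eq_bigr => x _; rewrite expfzMl exprz_inv -invr_expz.
set A := \prod_(x | cl x) ro ^ n x; set G := \prod_(x | ~~ cl x) gg al ro x ^ _.
have A0 : A != 0 by apply/prodf_neq0 => k _; rewrite expfz_neq0.
have G0 : G != 0 by apply/prodf_neq0 => x _; rewrite expfz_neq0// gg_neq0.
by field; rewrite A0 G0.
Qed.

Lemma exists_child al ro e x0 x1 : ro != 0 -> x0 != x1 ->
  inn al ro x0 -> inn al ro x1 -> ee al ro x0 = e -> ee al ro x1 = e ->
  exists y0 y1, y0 != y1 /\ child al ro e (pt y0) (pt y1 - pt y0).
Proof.
move=> r0 x01 i0 i1 e0 e1.
pose P x := [&& inn al ro x, ee al ro x == e & x != x0].
have Px1 : P x1 by rewrite /P i1 e1 eqxx eq_sym x01.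
have nz x : P x -> pt x - pt x0 != 0.
  by case/and3P => _ _; apply: contra_neq => /eqP; rewrite subr_eq0 => /eqP/ptI.
(* The radius is the largest distance from x0 within the cluster, so the new disc contains the whole
   cluster. *)
have [||y [Py hy]] := @exists_min _ P (fun x y => dom p (pt y - pt x0) (pt x - pt x0)) x1 Px1.
- by move=> x y Px Py; apply: dom_total; exact: nz.
- by move=> y x z Px Py Pz h1 h2; apply: dom_trans h2 h1; exact: nz.
case/and3P: (Py) => iy /eqP ey yx0.
have r1 := nz y Py.
have small : spec p ((pt y - pt x0) / ro) 0.
  have -> : (pt y - pt x0) / ro = coor al ro (pt y) - coor al ro (pt x0) by rewrite /coor; field.
  by rewrite -(subrr e); apply: specB; split.
exists x0, y; rewrite eq_sym; split=> //; split=> // x.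
apply/idP/andP => [h|[ix /eqP ex]].
  have hc : spec p (coor al ro (pt x)) e.
    have -> : coor al ro (pt x) = coor al ro (pt x0) +
       (coor (pt x0) (pt y - pt x0) (pt x)) * ((pt y - pt x0) / ro).
      by rewrite /coor; field; rewrite r0 r1.
    rewrite -(addr0 e) -[0](mulr0 (ee (pt x0) (pt y - pt x0) x)).
    by apply: specD; [split | apply: specM => //; exact: specP].
  by case: hc => ? ?; split=> //; apply/eqP.
have [->|xx0] := eqVneq x x0; first by rewrite /inn /coor subrr mul0r; case: (spec0 p).
by apply: hy; rewrite /P ix ex eqxx.
Qed.

Lemma exists_parent x0 ro y0 : ro != 0 -> ~~ inn (pt x0) ro y0 ->
  exists y, y != x0 /\ child (pt x0) (pt y - pt x0) 0 (pt x0) ro.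
Proof.
move=> r0 oy0; set al := pt x0.
have nz x : ~~ inn al ro x -> pt x - al != 0.
  apply: contraNneq => e; rewrite /inn /coor e mul0r; by case: (spec0 p).
(* The radius is the smallest distance to a point outside, so the old disc is exactly the cluster at
   0 of the new one. *)
have [||y [oy hy]] := @exists_min _ (fun x => ~~ inn al ro x)
   (fun x y => dom p (pt x - al) (pt y - al)) y0 oy0.
- by move=> x y ox oy; apply: dom_total; exact: nz.
- by move=> y x z ox oy oz h1 h2; apply: dom_trans h1 h2; exact: nz.
have r1 := nz y oy.
have small : spec p (ro / (pt y - al)) 0.
  by rewrite -invf_div; apply: specV_inf.
exists y; split; first by apply: contraNneq r1 => ->; rewrite subrr.
split=> //; first by rewrite /coor subrr mul0r; exact: spec0.
move=> x; apply/idP/andP => [h|[ix /eqP ex]].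
  have : spec p (coor al (pt y - al) (pt x)) 0.
    have -> : coor al (pt y - al) (pt x) = coor al ro (pt x) * (ro / (pt y - al)).
      by rewrite /coor; field; rewrite r0 r1.
    by rewrite -(mulr0 (ee al ro x)); apply: specM => //; exact: specP.
  by case=> ? ?; split=> //; apply/eqP.
apply/negPn/negP => ox; have := hy x ox.
have e0 : spec p (coor al (pt y - al) (pt x)) 0 by split.
have := spec0V e0; rewrite /coor mulf_eq0 invr_eq0 (negbTE (nz x ox)) (negbTE r1) => /(_ isT).
by rewrite invf_div /dom => /negP.
Qed.

Definition leafc al ro k :=
  inn al ro (inr k) /\ forall x, inn al ro x -> ee al ro x = ee al ro (inr k) -> x = inr k.

Lemma leaf_val al ro k : ro != 0 -> leafc al ro k ->
  spec p (fval (c k) / hgt al ro)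
    (\prod_(a | inn al ro (inl a)) (ee al ro (inr k) - ee al ro (inl a)) ^ s a) /\
  \prod_(a | inn al ro (inl a)) (ee al ro (inr k) - ee al ro (inl a)) ^ s a != 0.
Proof.
move=> r0 [ik lk].
have ne a : inn al ro (inl a) -> ee al ro (inr k) != ee al ro (inl a).
  by move=> ia; apply/eqP => e; have := lk (inl a) ia (esym e).
split; last by apply/prodf_neq0 => a ia; rewrite expfz_neq0// subr_eq0 ne.
have h := @spec_gprod al ro (coor al ro (c k)) (ee al ro (inr k)) swt predT r0 (specP ik).
have -> : fval (c k) / hgt al ro = \prod_x ((c k - pt x) / gg al ro x) ^ swt x.
  rewrite fvalE /hgt -prodf_div; apply: eq_bigr => x _.
  by rewrite expfzMl exprz_inv -invr_expz.
have -> : \prod_(a | inn al ro (inl a)) (ee al ro (inr k) - ee al ro (inl a)) ^ s a =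
   \prod_(x | inn al ro x) (ee al ro (inr k) - ee al ro x) ^ swt x.
  by rewrite big_sumType /= [X in _ = _ * X]big1 ?mulr1 => [|w _] //; rewrite expr0z.
rewrite coorK// in h; apply: h => -[a|w] _ ia //= _; exact: ne.
Qed.

(** If every cluster has total weight 0, the limit of f / [hgt] is constant on the disc, as zeros
    and poles cancel within each cluster. *)
Lemma clusters_flat al ro u : (forall e, \sum_(a | inn al ro (inl a) && (ee al ro (inl a) == e)) s a = 0) ->
  (forall a, inn al ro (inl a) -> u != ee al ro (inl a)) ->
  \prod_(a | inn al ro (inl a)) (u - ee al ro (inl a)) ^ s a = 1.
Proof.
move=> h hu; have := @prod_clusters1 K K I (fun a => inn al ro (inl a)) (fun a => ee al ro (inl a)) (fun y : K => u - y) s h.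
by apply=> a ia; rewrite subr_eq0 hu.
Qed.


Hypotheses (s0 : forall a, s a != 0) (ssum : \sum_a s a = 0) (sg0 : sg != 0).
Hypothesis cardIW : (#|I| = #|W| + 3)%N.

Definition excess al ro e := \sum_(x | inn al ro x && (ee al ro x == e)) chi x.
Definition swtc al ro e := \sum_(a | inn al ro (inl a) && (ee al ro (inl a) == e)) s a.
Definition leafb al ro x := inn al ro x && (chi x == 1) &&
  [forall y, inn al ro y ==> (ee al ro y == ee al ro x) ==> (y == x)].
Notation kapp y0 y1 := (kap (pt y0) (pt y1 - pt y0)).

Lemma kap_neq0 al ro : ro != 0 -> kap al ro != 0.
Proof.
move=> r0; rewrite /kap !mulf_neq0//; apply/prodf_neq0 => x _.
by rewrite expfz_neq0// gg_neq0.
Qed.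

Lemma pt_sub_neq0 y0 y1 : y0 != y1 -> pt y1 - pt y0 != 0.
Proof. by move=> h; rewrite subr_eq0; apply: contra_neq h => /ptI. Qed.

Lemma leafbP al ro x : leafb al ro x -> exists2 k, x = inr k & leafc al ro k.
Proof.
case/andP => /andP[ix]; case: x ix => [a|k] // ik _ /forallP h; exists k => //.
by split=> // y iy ey; apply/eqP; move: (h y); rewrite iy ey eqxx.
Qed.

Lemma leafcP al ro k : leafc al ro k -> leafb al ro (inr k).
Proof.
case=> ik h; rewrite /leafb ik eqxx /=; apply/forallP => y.
by apply/implyP => iy; apply/implyP => /eqP ey; apply/eqP/h.
Qed.

(** In the exponent, [excess] comes from the special points of the cluster and the additional 1 from
    the rescaling of dz. *)
Lemma kap_child al ro e al' ro' : ro != 0 -> child al ro e al' ro' ->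
  exists U u, [/\ spec p U u, u != 0 &
    kap al' ro' = kap al ro * (ro' / ro) ^ (excess al ro e + 1) * U].
Proof.
move=> r0 hc; have [U hU e1] := child_prod chi r0 hc.
exists U, (\prod_(x | inn al ro x && (ee al ro x != e)) (e - ee al ro x) ^ chi x); split=> //.
  by apply/prodf_neq0 => x /andP[_ h]; rewrite expfz_neq0// subr_eq0 eq_sym.
case: hc => r0' _ _ _; rewrite /kap e1 -/(excess al ro e) expfzDr ?mulf_neq0 ?invr_neq0// expr1z.
by field.
Qed.

(** The unit is given explicitly because on a disc with all cluster weights 0 it specialises to 1,
    which makes critical values on the two discs comparable. *)
Lemma hgt_child al ro e al' ro' : ro != 0 -> child al ro e al' ro' ->
  exists U, [/\ spec p U (\prod_(a | inn al ro (inl a) && (ee al ro (inl a) != e)) (e - ee al ro (inl a)) ^ s a),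
    \prod_(a | inn al ro (inl a) && (ee al ro (inl a) != e)) (e - ee al ro (inl a)) ^ s a != 0 &
    hgt al' ro' = (ro' / ro) ^ (swtc al ro e) * hgt al ro * U].
Proof.
move=> r0 hc; have [U hU e1] := child_prod swt r0 hc.
exists U; split.
- move: hU; rewrite big_sumType /= [X in _ * X]big1 ?mulr1// => k _; by rewrite expr0z.
- by apply/prodf_neq0 => x /andP[_ h]; rewrite expfz_neq0// subr_eq0 eq_sym.
rewrite /hgt e1; congr (_ ^ _ * _ * _).
by rewrite big_sumType /= [X in _ + X]big1 ?addr0.
Qed.

Lemma swtc_intr al ro e : (swtc al ro e)%:~R =
  \sum_(a | inn al ro (inl a) && (ee al ro (inl a) == e)) (s a)%:~R :> K.
Proof. by rewrite /swtc rmorph_sum. Qed.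

(** The limiting sum of simple fractions vanishes identically, hence so does the total residue at
    every cluster. *)
Lemma swtc_eq0 al ro e : ro != 0 -> spec p (kap al ro) 0 -> swtc al ro e = 0.
Proof.
move=> r0 k0; apply/eqP; rewrite -(intr_eq0 K) swtc_intr; apply/eqP.
have [k [/(spec_uniq k0) <- hk]] := kap_form al r0.
apply: (residue_eq0 (k := 0) (bad := [::]) (ec := fun w => ee al ro (inr w))
   (JW := fun w => inn al ro (inr w))) => // u _ h1 h2.
by apply: hk => -[a|w]; [exact: h1 | exact: h2].
Qed.

(** Excess -1 means that the nonzero limiting differential has a simple pole at the cluster, and the
    weight of the cluster is its residue. *)
Lemma swtc_neq0 al ro e k : ro != 0 -> spec p (kap al ro) k -> k != 0 ->
  excess al ro e = -1 -> swtc al ro e != 0.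
Proof.
move=> r0 hk k0 hm; rewrite -(intr_eq0 K) swtc_intr.
have [k' [/(spec_uniq hk) <- hk']] := kap_form al r0.
apply: (residue_neq0 (k := k) (bad := [::]) (ec := fun w => ee al ro (inr w))
   (JW := fun w => inn al ro (inr w))) => //.
  by move=> u _ h1 h2; apply: hk' => -[a|w]; [exact: h1 | exact: h2].
move: hm; rewrite /excess big_sumType /= sumr_const sumr_const.
set A := #|_|; set B := #|_|.
rewrite mulNrn !natz => h; suff : A = B.+1 by []; clearbody A B; lia.
Qed.

Lemma mult_leaf al ro k : leafc al ro k -> excess al ro (ee al ro (inr k)) = 1.
Proof.
case=> ik h; rewrite /excess (bigD1 (inr k)) ?ik ?eqxx//= big1 ?addr0//.
by move=> y /andP[/andP[iy /eqP /(h y iy) ->]]; rewrite eqxx.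
Qed.

Lemma single_or_multi al ro x : inn al ro x ->
  (exists2 y, y != x & inn al ro y /\ ee al ro y = ee al ro x) \/
  (forall y, inn al ro y -> ee al ro y = ee al ro x -> y = x).
Proof.
move=> ix; case: (pickP [pred y | [&& y != x, inn al ro y & ee al ro y == ee al ro x]]).
  by move=> y /and3P[yx iy /eqP ey]; left; exists y.
move=> h; right=> y iy ey; move: (h y); rewrite /= iy ey eqxx !andbT.
by move=> /negbFE/eqP.
Qed.

Lemma inn_base y0 y1 : y0 != y1 -> 
  [/\ inn (pt y0) (pt y1 - pt y0) y0, inn (pt y0) (pt y1 - pt y0) y1 &
  ee (pt y0) (pt y1 - pt y0) y0 != ee (pt y0) (pt y1 - pt y0) y1].
Proof.
move=> h; have r0 := pt_sub_neq0 h.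
rewrite /inn /ee /coor subrr mul0r mulfV//; have [f0 s00] := spec0 p.
by rewrite f0 fin1 s00 st1 eq_sym oner_eq0.
Qed.

Lemma sum_chi_all : \sum_x chi x = -3.
Proof.
rewrite big_sumType /= !sumr_const mulNrn !natz.
have -> : #|xpredT : pred I| = #|I| by [].
have -> : #|xpredT : pred W| = #|W| by [].
by rewrite cardIW; lia.
Qed.

Lemma hgt_top al ro : ro != 0 -> (forall x, inn al ro x) -> hgt al ro = 1.
Proof.
move=> r0 h; rewrite /hgt (eq_bigr (fun x => ro ^ swt x)) => [|x _]; last by rewrite /gg h.
rewrite prod_expz// big_sumType /= [X in _ + X]big1// addr0 ssum; exact: expr0z.
Qed.

Lemma mult_child al ro e al' ro' : child al ro e al' ro' ->
  \sum_(x | inn al' ro' x) chi x = excess al ro e.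
Proof. by case=> _ _ _ h; apply: eq_bigl. Qed.

Lemma fval_neq0 k : fval (c k) != 0.
Proof.
apply/prodf_neq0 => a _; rewrite expfz_neq0// subr_eq0.
by apply/negP => /eqP h; have /ptI : pt (inr k) = pt (inl a) by [].
Qed.

Lemma hgt_neq0 al ro : ro != 0 -> hgt al ro != 0.
Proof. by move=> r0; apply/prodf_neq0 => x _; rewrite expfz_neq0// gg_neq0. Qed.

(** * The logarithmic differential survives on every disc *)

Section Nondegenerate.
Hypothesis noncoll : forall j k, j != k -> ~ spec p (fval (c j) / fval (c k)) 1.
Hypothesis noncoll_inf : forall k, ~ spec p (fval (c k)) 1.

Definition minimal y0 y1 := forall z0 z1, z0 != z1 -> dom p (kapp y0 y1) (kapp z0 z1).

(** A cluster of several points and excess at least 0 would have a child with smaller [kap], by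
    [kap_child]. A lone label would have weight 0, by [swtc_eq0]. *)
Lemma minimal_clusters y0 y1 (al := pt y0) (ro := pt y1 - pt y0) :
  y0 != y1 -> spec p (kap al ro) 0 -> minimal y0 y1 ->
  forall x, inn al ro x -> leafb al ro x \/ excess al ro (ee al ro x) <= -1.
Proof.
move=> y01 k0 hmin x ix; have r0 : ro != 0 := pt_sub_neq0 y01.
have [[y yx [iy ey]]|single] := single_or_multi ix.
  right; have [z0 [z1 [z01 hc]]] := exists_child r0 yx iy ix ey erefl.
  have [U [u [hU u0 ek]]] := kap_child r0 hc.
  rewrite leNgt; apply/negP => hm; have := hmin _ _ z01; rewrite /dom -/al -/ro.
  have kz := kap_neq0 (pt z0) (pt_sub_neq0 z01).
  rewrite -invf_div; apply/negP; apply: spec0V; last first.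
    by rewrite mulf_neq0 ?invr_neq0// kap_neq0.
  case: hc => r0' hr _ _; rewrite ek.
  have -> : kap al ro * ((pt z1 - pt z0) / ro) ^ (excess al ro (ee al ro x) + 1) * U / kap al ro
    = ((pt z1 - pt z0) / ro) ^ (excess al ro (ee al ro x) + 1) * U.
    by field; rewrite kap_neq0.
  have := specM (spec0Xz (n := excess al ro (ee al ro x) + 1) hr _) hU.
  by rewrite mul0r; apply; rewrite -ltrBlDr sub0r.
case: x ix single => [a|k] ix single; last first.
  by left; apply: leafcP; split.
have := swtc_eq0 (ee al ro (inl a)) r0 k0; rewrite /swtc (bigD1 a) ?ix ?eqxx//= big1 ?addr0.
  by move=> h; have := s0 a; rewrite h eqxx.
by move=> b /andP[/andP[ib /eqP /(single _ ib) [->]]]; rewrite eqxx.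
Qed.

Lemma flat_leaf al ro k : ro != 0 -> spec p (kap al ro) 0 -> leafc al ro k ->
  spec p (fval (c k) / hgt al ro) 1.
Proof.
move=> r0 k0 lk; have [] := leaf_val r0 lk; rewrite clusters_flat//.
  by move=> e; exact: swtc_eq0.
by move=> a ia; apply/negP => /eqP h; case: lk => _ /(_ _ ia (esym h)).
Qed.

(** If some [kap] is infinitesimal, consider a disc of minimal [kap] and, among these, of maximal
    radius. There f is constant to first order, so all its leaves share one limiting value; counting
    [chi] produces enough leaves to contradict [noncoll] or [noncoll_inf]. *)
Lemma kap_unit y0 y1 : y0 != y1 -> ~ spec p (kapp y0 y1) 0.
Proof.
move=> y01 ky.
pose P (v : (I + W) * (I + W)) := v.1 != v.2.
pose kv (v : (I + W) * (I + W)) := kapp v.1 v.2.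
pose rv (v : (I + W) * (I + W)) := pt v.2 - pt v.1.
have kv0 v : P v -> kv v != 0 by move=> h; apply/kap_neq0/pt_sub_neq0.
have rv0 v : P v -> rv v != 0 by move=> h; apply/pt_sub_neq0.
have [||v1 [Pv1 hv1]] := @exists_min _ P (fun v w => dom p (kv v) (kv w)) (y0, y1) y01.
- by move=> v w Pv Pw; apply: dom_total; exact: kv0.
- by move=> w v z Pv Pw Pz; apply: dom_trans; exact: kv0.
have Pv1' : P v1 && dom p (kv v1) (kv v1) by rewrite Pv1 dom_refl.
(* The relation is reversed here: among the discs of minimal [kap] the largest radius is
   selected. *)
have [||[x0 x1] [/andP[x01 kx] hx]] := @exists_min _ (fun v => P v && dom p (kv v) (kv v1))
   (fun v w => dom p (rv w) (rv v)) v1 Pv1'.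
- by move=> v w /andP[Pv _] /andP[Pw _]; apply: dom_total; exact: rv0.
- by move=> w v z /andP[Pv _] /andP[Pw _] /andP[Pz _] h1 h2; apply: dom_trans h2 h1; exact: rv0.
rewrite /P /= in x01; rewrite /kv /= in kx.
have hmin : minimal x0 x1.
  move=> z0 z1 z01; apply: (dom_trans (kv0 _ Pv1) kx).
  exact: (hv1 (z0, z1)).
have k0 : spec p (kapp x0 x1) 0.
  have ky0 := kap_neq0 (pt y0) (pt_sub_neq0 y01).
  have -> : kapp x0 x1 = kapp x0 x1 / kapp y0 y1 * kapp y0 y1 by field.
  rewrite -(mulr0 (st p (kapp x0 x1 / kapp y0 y1))); apply: specM => //.
  by apply: specP; exact: hmin.
set al := pt x0 in k0 *; set ro := pt x1 - pt x0 in k0 *.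
have r0 : ro != 0 := pt_sub_neq0 x01.
have [ix0 ix1 ne01] := inn_base x01.
have cl := minimal_clusters x01 k0 hmin.
(* For excess -1 the exponent in [kap_child] is 0. So the child is minimal and flat too, it has a
   leaf by the count for total -1, and the critical value there agrees to first order with [hgt] of
   the present disc. *)
have childleaf x : inn al ro x -> excess al ro (ee al ro x) = -1 ->
  exists k, [/\ spec p (fval (c k) / hgt al ro) 1, inn al ro (inr k) & ~ leafc al ro k].
  move=> ix mx.
  have [[y yx [iy ey]]|single] := single_or_multi ix; last first.
    have [/leafbP[k ek lk]|] := cl x ix.
      by move: mx; rewrite ek mult_leaf.
    move=> _; case: x ix mx single => [a|k] ix mx single; last first.
      by have : leafc al ro k by []; move=> /mult_leaf; rewrite mx.
    have := swtc_eq0 (ee al ro (inl a)) r0 k0; rewrite /swtc (bigD1 a) ?ix ?eqxx//= big1 ?addr0.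
      by move=> h; have := s0 a; rewrite h eqxx.
    by move=> b /andP[/andP[ib /eqP /(single _ ib) [->]]]; rewrite eqxx.
  have [z0 [z1 [z01 hc]]] := exists_child r0 yx iy ix ey erefl.
  have [U [u [hU u0 ek]]] := kap_child r0 hc.
  rewrite mx addNr expr0z mulr1 in ek.
  have k0' : spec p (kapp z0 z1) 0 by rewrite ek -[0 in X in spec _ _ X](mul0r u); apply: specM.
  have min' : minimal z0 z1.
    move=> w0 w1 w01; rewrite /dom ek mulrAC; apply: finM; first exact: hmin.
    by case: hU.
  have r0' := pt_sub_neq0 z01.
  have [iz0 iz1 nez] := inn_base z01.
  have [k /leafbP[j _ lj]] := leaf_of_sumN1 (minimal_clusters z01 k0' min') iz0 iz1 nez
     (etrans (mult_child hc) mx).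
  exists j; have [U' []] := hgt_child r0 hc; rewrite (swtc_eq0 _ r0 k0) expr0z mul1r => hU' U0' eh.
  have sumz e : swtc al ro e = 0 by exact: swtc_eq0.
  have P1 : \prod_(a | inn al ro (inl a) && (ee al ro (inl a) != ee al ro x))
     (ee al ro x - ee al ro (inl a)) ^ s a = 1.
    have := @prod_clusters1 K K I (fun a => inn al ro (inl a) && (ee al ro (inl a) != ee al ro x))
       (fun a => ee al ro (inl a)) (fun y : K => ee al ro x - y) s.
    apply=> [e|a /andP[_ h]]; last by rewrite subr_eq0 eq_sym.
    have [->|en] := eqVneq e (ee al ro x).
      by rewrite big_pred0// => a; case: (ee al ro (inl a) == _); rewrite ?andbF.
    rewrite -[RHS](sumz e) /swtc; apply: eq_bigl => a.
    by case: (ee al ro (inl a) =P e) => [->|_]; rewrite ?en ?andbT ?andbF.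
  rewrite P1 in hU'.
  have lf := flat_leaf r0' k0' lj.
  have hn := hgt_neq0 al r0.
  have U'0 := spec_neq0 hU' (oner_neq0 _).
  split.
  - have -> : fval (c j) / hgt al ro = fval (c j) / hgt (pt z0) (pt z1 - pt z0) * U'.
      by rewrite eh; field; rewrite hn U'0.
    by rewrite -[1 in X in spec _ _ X]mulr1; apply: specM.
  - by case: lj => ij _; case: hc => _ _ _ /(_ (inr j)); rewrite ij => /esym/andP[].
  case: lj => ij _; case: hc => _ _ _ /(_ (inr j)); rewrite ij => /esym/andP[ijv /eqP ej] [_ lj].
  have := mult_leaf (conj ijv lj); rewrite ej mx => h.
  by [].
have two k1 k2 : k1 != k2 -> spec p (fval (c k1) / hgt al ro) 1 -> spec p (fval (c k2) / hgt al ro) 1 -> False.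
  move=> k12 h1 h2; apply: (noncoll k12).
  have -> : fval (c k1) / fval (c k2) = (fval (c k1) / hgt al ro) * (fval (c k2) / hgt al ro)^-1.
    by field; rewrite hgt_neq0// fval_neq0.
  by have := specM h1 (specV h2 (oner_neq0 _)); rewrite invr1 mulr1.
(* If the disc contains everything, then [hgt] is 1 and the total is -3; the leaf found contradicts
   the hypothesis on the value 1 at infinity. *)
have [/forallP allin|] := boolP [forall x, inn al ro x].
  have h1 := hgt_top r0 allin.
  have [||||[x /leafbP[k _ lk]]|[x ix mx]] := @leaf_of_sumN3 _ _ (inn al ro) (ee al ro) chi cl x0 x1.
  - exact: ix0.
  - exact: ix1.
  - exact: ne01.
  - by rewrite (eq_bigl predT) ?sum_chi_all.
  - have := flat_leaf r0 k0 lk; rewrite h1 divr1; exact: noncoll_inf.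
  have [k [h _ _]] := childleaf x ix mx; move: h; rewrite h1 divr1; exact: noncoll_inf.
rewrite negb_forall => /existsP[y0' oy].
have [y [yx hc]] := exists_parent r0 oy.
have r0'' : pt y - pt x0 != 0 by apply: pt_sub_neq0; rewrite eq_sym.
have [U [u [hU u0 ek]]] := kap_child r0'' hc.
have hM := mult_child hc.
have nd : ~~ dom p (kapp x0 y) (kapp x0 x1).
  apply/negP => h; have : dom p (rv (x0, y)) (rv (x0, x1)).
    apply: hx; rewrite /P /= eq_sym yx /kv /=.
    apply: dom_trans h kx; apply: kap_neq0; exact: r0.
  by case: hc => _ /spec0V + _ _; rewrite mulf_neq0 ?invr_neq0// invf_div => /(_ isT)/negP.
(* The parent has larger radius, so its [kap] is not minimal. This forces a positive exponent M + 1
   in [kap_child]. *)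
have sumge0 : 0 <= \sum_(x | inn al ro x) chi x.
  rewrite leNgt; apply/negP => hneg; move/negP: nd; apply.
  rewrite /dom ek; set k' := kapp x0 y; have k'0 : k' != 0 by apply: kap_neq0.
  rewrite -hM; set M := \sum_(x | _) _ in hneg *.
  case: hc => _ hr _ _.
  have rr0 : ro / (pt y - pt x0) != 0 by rewrite mulf_neq0 ?invr_neq0.
  have U0 := spec_neq0 hU u0.
  have -> : k' / (k' * (ro / (pt y - pt x0)) ^ (M + 1) * U) = (ro / (pt y - pt x0)) ^ (- (M + 1)) / U.
    by rewrite -invr_expz; field; rewrite k'0 U0 expfz_neq0.
  apply: finM; last by case: (specV hU u0).
  have : 0 <= - (M + 1) by rewrite oppr_ge0 lezD1.
  by case: (- (M + 1)) => // n _; case: (specX n hr).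
have [||||[x [y' [/leafbP[k1 e1 l1] /leafbP[k2 e2 l2] xy]]]|[[x /leafbP[k1 _ l1]] [z iz mz]]] :=
   @leaf_of_sum_ge0 _ _ (inn al ro) (ee al ro) chi cl x0 x1.
- exact: ix0.
- exact: ix1.
- exact: ne01.
- exact: sumge0.
- apply: (two k1 k2); [|exact: flat_leaf|exact: flat_leaf].
  by apply: contra_neq xy => e; rewrite e1 e2 e.
have [k2 [h2 _ nl]] := childleaf z iz mz.
apply: (two k1 k2) => //; last exact: flat_leaf.
by apply/eqP => e; apply: nl; rewrite -e.
Qed.

Lemma kap_spec y0 y1 : y0 != y1 -> exists2 k, k != 0 & spec p (kapp y0 y1) k.
Proof.
move=> y01; have [k [hk _]] := kap_form (pt y0) (pt_sub_neq0 y01).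
by exists k => //; apply/negP => /eqP k0; apply: (kap_unit y01); rewrite -k0.
Qed.

(** For a cluster with several points both [kap] are now units, so by [kap_child] the power with
    exponent excess + 1 of an infinitesimal is a unit and the exponent is 0. *)
Lemma unit_clusters y0 y1 (al := pt y0) (ro := pt y1 - pt y0) : y0 != y1 ->
  forall x, inn al ro x -> leafb al ro x \/ excess al ro (ee al ro x) = -1.
Proof.
move=> y01 x ix; have r0 : ro != 0 := pt_sub_neq0 y01.
have [[y yx [iy ey]]|single] := single_or_multi ix.
  right; have [z0 [z1 [z01 hc]]] := exists_child r0 yx iy ix ey erefl.
  have [U [u [hU u0 ek]]] := kap_child r0 hc.
  have [k kn hk] := kap_spec y01; have [k' kn' hk'] := kap_spec z01.
  have U0 := spec_neq0 hU u0.
  case: hc => r0' hr _ _; have rr0 : (pt z1 - pt z0) / ro != 0 by rewrite mulf_neq0 ?invr_neq0.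
  have e1 : ((pt z1 - pt z0) / ro) ^ (excess al ro (ee al ro x) + 1) = kapp z0 z1 * (kap al ro)^-1 * U^-1.
    by rewrite ek; field; rewrite U0 kap_neq0.
  have h1 : spec p (((pt z1 - pt z0) / ro) ^ (excess al ro (ee al ro x) + 1)) (k' * k^-1 * u^-1).
    by rewrite e1; apply: specM (specM hk' (specV hk kn)) (specV hU u0).
  have : excess al ro (ee al ro x) + 1 = 0.
    by apply: (specXz_unit hr rr0 h1); rewrite !mulf_neq0 ?invr_neq0.
  by move/eqP; rewrite addr_eq0 => /eqP.
case: x ix single => [a|k] ix single; last by left; apply: leafcP.
right; rewrite /excess (bigD1 (inl a)) ?ix ?eqxx//= big1 ?addr0//.
by move=> y /andP[/andP[iy /eqP /(single _ iy) ->]]; rewrite eqxx.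
Qed.

Lemma unit_clusters_le y0 y1 (al := pt y0) (ro := pt y1 - pt y0) : y0 != y1 ->
  forall x, inn al ro x -> leafb al ro x \/ excess al ro (ee al ro x) <= -1.
Proof. by move=> y01 x /(unit_clusters y01)[|->]; [left | right]. Qed.

Lemma multi_mult y0 y1 (al := pt y0) (ro := pt y1 - pt y0) x y : y0 != y1 -> x != y ->
  inn al ro x -> inn al ro y -> ee al ro x = ee al ro y ->
  excess al ro (ee al ro x) = -1 /\ swtc al ro (ee al ro x) != 0.
Proof.
move=> y01 xy ix iy exy; have [/leafbP[k xk [_ lk]]|hm] := unit_clusters y01 ix.
  by have := lk y iy; rewrite -xk => /(_ (esym exy)) e; rewrite e eqxx in xy.
split=> //; have [k k0 hk] := kap_spec y01.
exact: swtc_neq0 (pt_sub_neq0 y01) hk k0 hm.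
Qed.

(* Every proper disc cuts out a critical point of its own size, whose critical
   value is, up to a unit, rho' ^ s_e times the size of f on the parent disc. *)
Lemma child_leaf y0 y1 (al := pt y0) (ro := pt y1 - pt y0) x y z0 z1
    (al' := pt z0) (ro' := pt z1 - pt z0) : y0 != y1 -> x != y ->
  inn al ro x -> inn al ro y -> ee al ro x = ee al ro y -> z0 != z1 ->
  child al ro (ee al ro x) al' ro' ->
  exists k u, [/\ leafc al' ro' k, u != 0 &
    spec p (fval (c k) / (hgt al ro * (ro' / ro) ^ swtc al ro (ee al ro x))) u].
Proof.
move=> y01 xy ix iy exy z01 hc; have [hm _] := multi_mult y01 xy ix iy exy.
have r0 : ro != 0 := pt_sub_neq0 y01; have r0' : ro' != 0 := pt_sub_neq0 z01.
have [iz0 iz1 nez] := inn_base z01.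
have [_ /leafbP[k _ lk]] := leaf_of_sumN1 (unit_clusters_le z01) iz0 iz1 nez (etrans (mult_child hc) hm).
have [U [hU U0 eh]] := hgt_child r0 hc.
have [hv v0] := leaf_val r0' lk.
exists k; eexists; split; [exact: lk | | ]; last first.
  have -> : fval (c k) / (hgt al ro * (ro' / ro) ^ swtc al ro (ee al ro x)) =
     fval (c k) / hgt al' ro' * U.
    rewrite eh; field; rewrite (hgt_neq0 _ r0) (spec_neq0 hU U0) expfz_neq0// mulf_neq0 ?invr_neq0//.
  exact: specM hv hU.
exact: mulf_neq0.
Qed.

Lemma top_disc (x0 x1 : I + W) : x0 != x1 -> exists y0 y1, y0 != y1 /\ forall x, inn (pt y0) (pt y1 - pt y0) x.
Proof.
move=> x01; pose P y := y != x0.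
have nz y : P y -> pt y - pt x0 != 0 by move=> h; apply: pt_sub_neq0; rewrite eq_sym.
have [|||y [Py hy]] := @exists_min _ P (fun y z => dom p (pt z - pt x0) (pt y - pt x0)) x1.
- by rewrite /P eq_sym.
- by move=> y z /nz hy /nz hz; apply: dom_total.
- by move=> y w z /nz h1 /nz h2 /nz h3 h4 h5; apply: dom_trans h5 h4.
exists x0, y; split; first by rewrite eq_sym.
move=> x; have [->|xx0] := eqVneq x x0; last exact: hy.
by rewrite /inn /coor subrr mul0r; case: (spec0 p).
Qed.

End Nondegenerate.

(** * The two regimes: critical values of unit size and infinitesimal critical values *)

Section Regimes.
Variables (v : W -> F) (vb : W -> K) (tau : F).
Hypotheses (hv : forall k, spec p (v k) (vb k)) (vb0 : forall k, vb k != 0).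
Hypothesis vbI : injective vb.
Hypothesis fvalE' : forall k, fval (c k) = tau * v k.
Variables (y0 y1 : I + W) (y01 : y0 != y1).
Let al := pt y0.
Let ro := pt y1 - pt y0.
Hypothesis top : forall x, inn al ro x.

Let r0 : ro != 0 := pt_sub_neq0 y01.

Let tau0 : W -> tau != 0.
Proof. by move=> k; have := fval_neq0 k; rewrite fvalE' mulf_eq0 negb_or => /andP[]. Qed.

Let ncoll j k : j != k -> ~ spec p (fval (c j) / fval (c k)) 1.
Proof.
move=> jk; rewrite !fvalE'.
have -> : tau * v j / (tau * v k) = v j / v k.
  by field; rewrite tau0// (spec_neq0 (hv k) (vb0 k)).
move=> /spec_uniq => /(_ _ (specM (hv j) (specV (hv k) (vb0 k)))) e.
move: jk; suff -> : j = k by rewrite eqxx.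
apply: vbI; have := congr1 (fun x : K => x * vb k) e; rewrite mul1r mulfVK//.
Qed.

(** A cluster of several points has a critical point inside whose value is, up to a unit, the
    relative radius to the power of the cluster weight. All critical values are units here, so the
    weight would be 0, against [multi_mult]. *)
Lemma interior_separated t : spec p tau t -> t != 0 -> (forall k, t * vb k != 1) ->
  injective (ee al ro).
Proof.
move=> ht t0 tv1 x y exy; apply/eqP; apply/negPn/negP => xy.
have ninf k : ~ spec p (fval (c k)) 1.
  rewrite fvalE' => /spec_uniq/(_ (specM ht (hv k))) e.
  by have := tv1 k; rewrite -e eqxx.
have [z0 [z1 [z01 hc]]] := exists_child r0 xy (top x) (top y) erefl (esym exy).
have [k [u [lk u0 hu]]] := child_leaf ncoll ninf y01 xy (top x) (top y) exy z01 hc.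
have [_ /eqP] := multi_mult ncoll ninf y01 xy (top x) (top y) exy; apply.
have rr0 : (pt z1 - pt z0) / ro != 0 by rewrite mulf_neq0 ?invr_neq0 ?pt_sub_neq0.
have [_ hr _ _] := hc.
apply: (specXz_unit hr rr0 (a := t * vb k * u^-1)); last by rewrite !mulf_neq0 ?invr_neq0.
have -> : ((pt z1 - pt z0) / ro) ^ swtc al ro (ee al ro x) =
  fval (c k) * (fval (c k) / (hgt al ro * ((pt z1 - pt z0) / ro) ^ swtc al ro (ee al ro x)))^-1.
  by rewrite hgt_top// mul1r; field; rewrite fval_neq0 expfz_neq0.
by apply: specM (specV hu u0); rewrite fvalE'; apply: specM.
Qed.

Hypothesis htau : spec p tau 0.

Let ninf k : ~ spec p (fval (c k)) 1.
Proof.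
rewrite fvalE' => /spec_uniq/(_ (specM htau (hv k)))/eqP.
by rewrite mul0r oner_eq0.
Qed.

(** A lone critical point of the top disc would have a critical value of unit size, while all of
    them are infinitesimal. *)
Lemma degenerate_mult x : excess al ro (ee al ro x) = -1.
Proof.
have [/leafbP[k _ lk]|//] := unit_clusters ncoll ninf y01 (top x).
have [h1 h2] := leaf_val r0 lk; move: h1; rewrite hgt_top// divr1 fvalE'.
move=> /spec_uniq/(_ (specM htau (hv k))) e.
by move: h2; rewrite e mul0r eqxx.
Qed.

Lemma degenerate_three : exists x y z, 
  [/\ ee al ro x != ee al ro y, ee al ro x != ee al ro z, ee al ro y != ee al ro z &
    forall t, ee al ro t \in [:: ee al ro x; ee al ro y; ee al ro z]].
Proof.
have [i0 i1 ne] := inn_base y01.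
have [||x [y [z [_ [h1 h2 h3 h4]]]]] := three_clusters i0 i1 ne (chi := chi).
- by move=> x _; exact: degenerate_mult.
- by rewrite (eq_bigl predT) ?sum_chi_all.
by exists x, y, z; split=> // t; apply: h4.
Qed.

(** The relative radius to the power of the weight has the size of a critical value, hence is
    infinitesimal, and the weight is positive. A further collision inside would give critical values
    on two nested discs whose ratio is not a unit, against [fvalE']. *)
Lemma degenerate_child x y z0 z1 (al' := pt z0) (ro' := pt z1 - pt z0) : x != y ->
  ee al ro x = ee al ro y -> z0 != z1 -> child al ro (ee al ro x) al' ro' ->
  0 < swtc al ro (ee al ro x) /\
  (forall w w', inn al' ro' w -> inn al' ro' w' -> ee al' ro' w = ee al' ro' w' -> w = w').
Proof.
move=> xy exy z01 hc.
have [k [u [lk u0 hu]]] := child_leaf ncoll ninf y01 xy (top x) (top y) exy z01 hc.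
have rr0 : ro' / ro != 0 by rewrite mulf_neq0 ?invr_neq0 ?pt_sub_neq0.
have [_ hr _ _] := hc.
have hs : spec p ((ro' / ro) ^ swtc al ro (ee al ro x)) 0.
  have -> : (ro' / ro) ^ swtc al ro (ee al ro x) =
    fval (c k) * (fval (c k) / (hgt al ro * (ro' / ro) ^ swtc al ro (ee al ro x)))^-1.
    by rewrite hgt_top// mul1r; field; rewrite fval_neq0 expfz_neq0.
  rewrite -[0 in X in spec _ _ X](mul0r u^-1); apply: specM (specV hu u0).
  rewrite fvalE' -[0 in X in spec _ _ X](mul0r (vb k)).
  exact: specM.
split.
  by rewrite ltNge; apply/negP => h; apply: (spec0Xz_inf hr rr0 h).
move=> w w' iw iw' eww; apply/eqP/negPn/negP => nww.
have r0' : ro' != 0 := pt_sub_neq0 z01.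
have [t0 [t1 [t01 hc']]] := exists_child r0' nww iw iw' erefl (esym eww).
have [k' [u' [lk' u0' hu']]] := child_leaf ncoll ninf z01 nww iw iw' eww t01 hc'.
have [_ /eqP] := multi_mult ncoll ninf z01 nww iw iw' eww; apply.
have rr0' : (pt t1 - pt t0) / ro' != 0 by rewrite mulf_neq0 ?invr_neq0 ?pt_sub_neq0.
have [_ hr' _ _] := hc'.
have [hl l0] := leaf_val r0' lk; set l := \prod_(a | _) _ in hl l0.
apply: (specXz_unit hr' rr0' (a := vb k' * (vb k)^-1 * l * u'^-1)); last first.
  by rewrite !mulf_neq0 ?invr_neq0.
set X := (_ / ro') ^ _ in hu' *.
have X0 : X != 0 by rewrite expfz_neq0.
have hn : hgt al' ro' != 0 by apply: hgt_neq0.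
have -> : X = v k' * (v k)^-1 * (fval (c k) / hgt al' ro') * (fval (c k') / (hgt al' ro' * X))^-1.
  rewrite !fvalE'; field.
  by rewrite X0 hn (spec_neq0 (hv k) (vb0 k)) (tau0 k) (spec_neq0 (hv k') (vb0 k')).
apply: specM (specV hu' u0'); apply: specM hl.
exact: specM (hv k') (specV (hv k) (vb0 k)).
Qed.

End Regimes.
End Vertex.

(** * Ultrapowers of the complex numbers *)

Section NormC.
Variable R : rcfType.
Implicit Types x y : R[i].

Lemma normc_ge0 x : 0 <= normc x.
Proof. by case: x => a b /=; exact: sqrtr_ge0. Qed.

Lemma normc_eq0 x : (normc x == 0) = (x == 0).
Proof. by apply/eqP/eqP => [/eq0_normc//|->]; exact: normc0. Qed.

Lemma normc_gt0 x : (0 < normc x) = (x != 0).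
Proof. by rewrite lt_def normc_ge0 andbT normc_eq0. Qed.

Lemma normcD x y : normc (x + y) <= normc x + normc y.
Proof. exact: le_normcD. Qed.

Lemma normcN' x : normc (- x) = normc x.
Proof. exact: normcN. Qed.

Lemma normcB x y : normc (x - y) <= normc x + normc y.
Proof. by rewrite (le_trans (normcD _ _))// normcN'. Qed.

Lemma normc_distC x y : normc (x - y) = normc (y - x).
Proof. by rewrite -normcN' opprB. Qed.

Lemma normc_sub_ge x y : normc x - normc y <= normc (x - y).
Proof. by rewrite lerBlDr (le_trans _ (normcD _ _))// subrK. Qed.

Lemma normc_sum (I : Type) (r : seq I) (P : pred I) (f : I -> R[i]) :
  normc (\sum_(i <- r | P i) f i) <= \sum_(i <- r | P i) normc (f i).
Proof.
elim/big_rec2: _ => [|i x y _ h]; first by rewrite normc0.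
by rewrite (le_trans (normcD _ _))// lerD2l.
Qed.

Lemma normc_real (a : R) : normc (a%:C)%C = `|a|.
Proof. by rewrite /normc /= expr0n /= addr0 sqrtr_sqr. Qed.

Lemma ge_normc_Re x : `|complex.Re x| <= normc x.
Proof. by case: x => a b /=; rewrite -sqrtr_sqr ler_sqrt ?addr_ge0 ?sqr_ge0// lerDl sqr_ge0. Qed.

Lemma ge_normc_Im x : `|complex.Im x| <= normc x.
Proof. by case: x => a b /=; rewrite -sqrtr_sqr ler_sqrt ?addr_ge0 ?sqr_ge0// lerDr sqr_ge0. Qed.

Lemma normc_le_ReIm x : normc x <= `|complex.Re x| + `|complex.Im x|.
Proof.
case: x => a b /=; have h0 : 0 <= `|a| + `|b| by rewrite addr_ge0.
rewrite -[leRHS](ger0_norm h0) -[leRHS]sqrtr_sqr ler_sqrt ?sqr_ge0//.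
rewrite -(real_normK (num_real a)) -(real_normK (num_real b)) sqrrD.
by rewrite lerD2r lerDl mulrn_wge0// mulr_ge0.
Qed.

End NormC.

Record ultra (T : Type) := Ultra { uset :> set T -> Prop; ultraP : UltraFilter uset }.
#[global] Existing Instance ultraP.

Section Limits.
Variables (R : realType) (T : Type) (u : ultra T).
Implicit Types f g : T -> R[i].

Definition ulim f (l : R[i]) := forall e : R, 0 < e -> u [set t | normc (f t - l) < e].
Definition ubnd f := exists M : R, u [set t | normc (f t) <= M].

Lemma ultraS (A B : set T) : A `<=` B -> u A -> u B.
Proof. by move=> AB; apply: filterS. Qed.

Lemma ulim_uniq f l l' : ulim f l -> ulim f l' -> l = l'.
Proof.
move=> h h'; apply/eqP; rewrite -subr_eq0 -normc_eq0; apply/eqP/le_anti.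
rewrite normc_ge0 andbT; apply/ler_addgt0Pl => e e0; rewrite addr0.
have e2 : 0 < e / 2 by lra.
have [t [h1 h2]] := filter_ex (filterI (h _ e2) (h' _ e2)).
rewrite /= in h1 h2; have -> : l - l' = (f t - l') - (f t - l) by ring.
by rewrite (le_trans (normcB _ _))//; lra.
Qed.

Lemma real_ulim (r : T -> R) (M : R) : u [set t | `|r t| <= M] ->
  exists l, forall e, 0 < e -> u [set t | `|r t - l| < e].
Proof.
move=> hM; have hc := @segment_compact R (- M) M.
have FF : ProperFilter (fmap r (uset u)) by exact: fmap_proper_filter.
have [|l [_ hl]] := hc (fmap r (uset u)) FF.
  by apply: ultraS hM => t /=; rewrite ler_norml in_itv.
exists l => e e0.
have [//|h] := in_ultra_setVsetC [set t | `|r t - l| < e] (ultraP u).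
have [] := hl [set x | ~ `|x - l| < e] (ball l e).
- exact: h.
- exact: nbhsx_ballx.
by move=> x []; rewrite /ball /= distrC.
Qed.

Lemma ubnd_ulim f : ubnd f -> exists l, ulim f l.
Proof.
move=> [M hM].
have [a ha] : exists l, forall e, 0 < e -> u [set t | `|complex.Re (f t) - l| < e].
  apply: (@real_ulim _ M); apply: ultraS hM => t; apply: le_trans; exact: ge_normc_Re.
have [b hb] : exists l, forall e, 0 < e -> u [set t | `|complex.Im (f t) - l| < e].
  apply: (@real_ulim _ M); apply: ultraS hM => t; apply: le_trans; exact: ge_normc_Im.
exists (Complex a b) => e e0; have e2 : 0 < e / 2 by lra.
apply: filterS (filterI (ha _ e2) (hb _ e2)) => t [/= h1 h2].
rewrite (le_lt_trans (normc_le_ReIm _))//.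
by move: h1 h2; case: (f t) => x y /= h1 h2; lra.
Qed.

Lemma ulim_bnd f l : ulim f l -> ubnd f.
Proof.
move=> h; exists (normc l + 1); apply: ultraS (h 1 ltr01) => t /= ht.
have := normcD (f t - l) l; rewrite subrK; lra.
Qed.

Lemma ulim_ae f g l : u [set t | f t = g t] -> ulim f l -> ulim g l.
Proof. by move=> fg h e /h he; apply: filterS (filterI fg he) => t [/= ->]. Qed.

Lemma ulim_cst l : ulim (fun=> l) l.
Proof.
by move=> e e0; apply: ultraS (filterT) => t _ /=; rewrite subrr normc0.
Qed.

Lemma ulimB f g a b : ulim f a -> ulim g b -> ulim (fun t => f t - g t) (a - b).
Proof.
move=> hf hg e e0; have e2 : 0 < e / 2 by lra.
apply: filterS (filterI (hf _ e2) (hg _ e2)) => t [/= h1 h2].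
have -> : f t - g t - (a - b) = (f t - a) - (g t - b) by ring.
by rewrite (le_lt_trans (normcB _ _))//; lra.
Qed.

Lemma ulimM f g a b : ulim f a -> ulim g b -> ulim (fun t => f t * g t) (a * b).
Proof.
move=> hf hg e e0; have [M hM] := ulim_bnd hf.
pose C := `|M| + normc b + 1.
have C0 : 0 < C by rewrite /C; have := normc_ge0 b; have := normr_ge0 M; lra.
have e2 : 0 < e / (2 * C) by rewrite divr_gt0//; lra.
apply: filterS (filterI hM (filterI (hf _ e2) (hg _ e2))) => t [/= h1 [h2 h3]].
have -> : f t * g t - a * b = f t * (g t - b) + b * (f t - a) by ring.
apply: (le_lt_trans (normcD _ _)); rewrite !normcM.
have n1 := normc_ge0 (f t); have n2 := normc_ge0 (g t - b).
have n3 := normc_ge0 (f t - a); have n4 := normc_ge0 b.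
have hMC : normc (f t) <= C by rewrite /C; have := ler_norm M; lra.
have hbC : normc b <= C by rewrite /C; have := normr_ge0 M; lra.
have k1 : normc (f t) * normc (g t - b) <= C * normc (g t - b) by apply: ler_wpM2r.
have k2 : normc b * normc (f t - a) <= C * normc (f t - a) by apply: ler_wpM2r.
have k3 : C * normc (g t - b) < C * (e / (2 * C)) by rewrite ltr_pM2l.
have k4 : C * normc (f t - a) < C * (e / (2 * C)) by rewrite ltr_pM2l.
have k5 : C * (e / (2 * C)) = e / 2 by field; rewrite gt_eqF.
lra.
Qed.

Lemma ulimV_inf f : ~ ubnd f -> ulim (fun t => (f t)^-1) 0.
Proof.
move=> h e e0; have [//|hc] := in_ultra_setVsetC [set t | normc ((f t)^-1 - 0) < e] (ultraP u).
exfalso; apply: h; exists e^-1; apply: ultraS hc => t /=; rewrite subr0 normcV => /negP.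
rewrite -leNgt; have [->|f0] := eqVneq (f t) 0; first by rewrite normc0 invr0; lra.
by move=> h; rewrite -[leLHS]invrK lef_pV2// posrE invr_gt0 normc_gt0.
Qed.

Lemma ulimV f a : a != 0 -> ulim f a -> ubnd (fun t => (f t)^-1).
Proof.
move=> a0 h; have na : 0 < normc a by rewrite normc_gt0.
have n2 : 0 < normc a / 2 by lra.
exists (normc a / 2)^-1; apply: ultraS (h _ n2) => t /= ht.
have hf : normc a / 2 <= normc (f t).
  by have := normc_sub_ge a (f t); rewrite normc_distC; lra.
by rewrite normcV lef_pV2// posrE (lt_le_trans n2).
Qed.

End Limits.

Section Ultrapower.
Variables (R : realType) (T : pointedType) (u : ultra T).

Definition null : {pred T -> R[i]} := fun f => `[< u [set t | f t = 0] >].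

Lemma null_idealr : idealr_closed null.
Proof.
split.
- by apply/asboolP; apply: ultraS (@filterT _ u _) => t _.
- apply/negP => /asboolP /filter_ex[t /= /eqP]; by rewrite oner_eq0.
move=> a f g /asboolP hf /asboolP hg; apply/asboolP.
apply: filterS (filterI hf hg) => t [/= f0 g0]; rewrite /= /GRing.add /= /GRing.mul /=.
by rewrite f0 g0 mulr0 addr0.
Qed.

HB.instance Definition _ := isIdealr.Build (T -> R[i]) null null_idealr.

Definition omega := {ideal_quot null}.
HB.instance Definition _ := GRing.ComNzRing.on omega.

Definition upi (f : T -> R[i]) : omega := \pi_({ideal_quot null}) f.

Lemma upi_eq f g : upi f = upi g <-> u [set t | f t = g t].
Proof.
have e : (upi f == upi g) = ((f - g : T -> R[i]) \in null).
  by rewrite /upi -Quotient.idealrBE.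
split=> [/eqP|h].
  rewrite e => /asboolP; apply: ultraS => t /= /eqP.
  by rewrite /GRing.add /= subr_eq0 => /eqP.
apply/eqP; rewrite e; apply/asboolP; apply: ultraS h => t /= ft.
by rewrite /GRing.add /= /GRing.opp /= ft subrr.
Qed.

Lemma upi_surj (x : omega) : exists f, x = upi f.
Proof. by exists (repr x); rewrite /upi reprK. Qed.

Lemma upiB f g : upi f - upi g = upi (fun t => f t - g t).
Proof. by rewrite /upi -rmorphB. Qed.
Lemma upiD f g : upi f + upi g = upi (fun t => f t + g t).
Proof. by rewrite /upi -rmorphD. Qed.
Lemma upiM f g : upi f * upi g = upi (fun t => f t * g t).
Proof. by rewrite /upi -rmorphM. Qed.
Lemma upi1 : 1 = upi (fun=> 1).
Proof. by rewrite /upi -(rmorph1 (\pi_({ideal_quot null}))). Qed.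
Lemma upi0 : 0 = upi (fun=> 0).
Proof. by rewrite /upi -(rmorph0 (\pi_({ideal_quot null}))). Qed.

(** Pointwise inversion; at indices where the representative vanishes the convention 0^-1 = 0
    applies, and for a nonzero class these indices are negligible. *)
Definition oinv (x : omega) : omega := upi (fun t => (repr x t)^-1).

Lemma oinv_upi f : oinv (upi f) = upi (fun t => (f t)^-1).
Proof.
apply/upi_eq; have /upi_eq : upi (repr (upi f)) = upi f by rewrite /upi reprK.
by apply: ultraS => t /= ->.
Qed.

Lemma omulV x : x != 0 -> oinv x * x = 1.
Proof.
have [f ->] := upi_surj x; rewrite oinv_upi => f0; rewrite upiM upi1; apply/upi_eq.
have [h|h] := in_ultra_setVsetC [set t | f t = 0] (ultraP u).
  by move: f0; have /upi_eq -> : u [set t | f t = (fun=> 0) t] by []; rewrite -upi0 eqxx.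
by apply: ultraS h => t /= /eqP; exact: mulVf.
Qed.

Lemma oinv0 : oinv 0 = 0.
Proof. by rewrite upi0 oinv_upi; congr upi; apply/funext => t; rewrite invr0. Qed.

HB.instance Definition _ := GRing.ComNzRing_isField.Build omega omulV oinv0.

Lemma upiV f : (upi f)^-1 = upi (fun t => (f t)^-1).
Proof. exact: oinv_upi. Qed.

Definition ofin (x : omega) : bool := `[< ubnd u (repr x) >].
Definition ost (x : omega) : R[i] := xget 0 [set l | ulim u (repr x) l].

Lemma repr_ae f : u [set t | repr (upi f) t = f t].
Proof. by apply/upi_eq; rewrite /upi reprK. Qed.

Lemma ofin_upi f : ofin (upi f) <-> ubnd u f.
Proof.
split=> [/asboolP|] [M hM]; [|apply/asboolP]; exists M.
  by apply: filterS (filterI (repr_ae f) hM) => t [/= ->].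
by apply: filterS (filterI (repr_ae f) hM) => t [/= ->].
Qed.

Lemma ost_upi f l : ulim u f l -> ost (upi f) = l.
Proof.
move=> h; have h' : ulim u (repr (upi f)) l.
  apply: ulim_ae h; by apply: ultraS (repr_ae f) => t /= ->.
rewrite /ost; case: xgetP => [x _ hx|/(_ l)//].
exact: ulim_uniq hx h'.
Qed.

Lemma ofin_lim f : ofin (upi f) -> ulim u f (ost (upi f)).
Proof. by move=> /ofin_upi/ubnd_ulim[l hl]; rewrite (ost_upi hl). Qed.

Lemma uplace_fin1 : ofin 1.
Proof. rewrite upi1; apply/ofin_upi; apply: ulim_bnd; exact: ulim_cst. Qed.
Lemma uplace_finB x y : ofin x -> ofin y -> ofin (x - y).
Proof.
have [f ->] := upi_surj x; have [g ->] := upi_surj y => hf hg; rewrite upiB.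
by apply/ofin_upi; apply: ulim_bnd; apply: ulimB; exact: ofin_lim.
Qed.
Lemma uplace_finM x y : ofin x -> ofin y -> ofin (x * y).
Proof.
have [f ->] := upi_surj x; have [g ->] := upi_surj y => hf hg; rewrite upiM.
by apply/ofin_upi; apply: ulim_bnd; apply: ulimM; exact: ofin_lim.
Qed.
Lemma uplace_stV x : ~~ ofin x -> ofin x^-1 /\ ost x^-1 = 0.
Proof.
have [f ->] := upi_surj x => hf; rewrite upiV.
have h : ulim u (fun t => (f t)^-1) 0.
  by apply: ulimV_inf => h; move/negP: hf; apply; apply/ofin_upi.
by split; [apply/ofin_upi; exact: ulim_bnd h | exact: ost_upi].
Qed.
Lemma uplace_st1 : ost 1 = 1.
Proof. by rewrite upi1; apply: ost_upi; exact: ulim_cst. Qed.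
Lemma uplace_stB x y : ofin x -> ofin y -> ost (x - y) = ost x - ost y.
Proof.
have [f ->] := upi_surj x; have [g ->] := upi_surj y => hf hg; rewrite upiB.
by apply: ost_upi; apply: ulimB; exact: ofin_lim.
Qed.
Lemma uplace_stM x y : ofin x -> ofin y -> ost (x * y) = ost x * ost y.
Proof.
have [f ->] := upi_surj x; have [g ->] := upi_surj y => hf hg; rewrite upiM.
by apply: ost_upi; apply: ulimM; exact: ofin_lim.
Qed.
Lemma uplace_fin_unitV x : ofin x -> ost x != 0 -> ofin x^-1.
Proof.
have [f ->] := upi_surj x => hf s0; rewrite upiV; apply/ofin_upi.
by apply: ulimV s0 _; exact: ofin_lim.
Qed.
Lemma uplace_fin_emb a : ofin (upi (fun=> a)).
Proof. apply/ofin_upi; apply: ulim_bnd; exact: ulim_cst. Qed.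
Lemma uplace_st_emb a : ost (upi (fun=> a)) = a.
Proof. by apply: ost_upi; exact: ulim_cst. Qed.

Definition uplace : place omega R[i] :=
  Place uplace_fin1 uplace_finB uplace_finM (fun x h => proj1 (uplace_stV h))
    uplace_st1 uplace_stB uplace_stM (fun x h => proj2 (uplace_stV h))
    uplace_fin_unitV uplace_fin_emb uplace_st_emb.

(** The bridge between statements about places and limits of sequences. *)
Lemma spec_upi f l : spec uplace (upi f) l <-> ulim u f l.
Proof.
split=> [[hf <-]|h]; first exact: ofin_lim.
by split; [apply/ofin_upi; exact: ulim_bnd h | exact: ost_upi].
Qed.

Lemma upiN f : - upi f = upi (fun t => - f t).
Proof. by rewrite -sub0r upi0 upiB; congr upi; apply/funext => t; rewrite sub0r. Qed.

Lemma upi_sum (J : finType) (P : pred J) (f : J -> T -> R[i]) :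
  \sum_(j | P j) upi (f j) = upi (fun t => \sum_(j | P j) f j t).
Proof.
elim: (index_enum J) => [|j r ih].
  by rewrite big_nil upi0; congr upi; apply/funext => t; rewrite big_nil.
rewrite big_cons; case: ifPn => Pj; rewrite ih ?upiD; congr upi; apply/funext => t;
  by rewrite big_cons ?Pj // (negbTE Pj).
Qed.

Lemma upi_prod (J : finType) (P : pred J) (f : J -> T -> R[i]) :
  \prod_(j | P j) upi (f j) = upi (fun t => \prod_(j | P j) f j t).
Proof.
elim: (index_enum J) => [|j r ih].
  by rewrite big_nil upi1; congr upi; apply/funext => t; rewrite big_nil.
rewrite big_cons; case: ifPn => Pj; rewrite ih ?upiM; congr upi; apply/funext => t;
  by rewrite big_cons ?Pj // (negbTE Pj).
Qed.

Lemma upiX f n : upi f ^+ n = upi (fun t => f t ^+ n).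
Proof.
elim: n => [|n ih]; first by rewrite expr0 upi1; congr upi; apply/funext => t; rewrite expr0.
by rewrite exprS ih upiM; congr upi; apply/funext => t; rewrite exprS.
Qed.

Lemma upiXz f (n : int) : upi f ^ n = upi (fun t => f t ^ n).
Proof.
case: n => n; first by rewrite -exprnP upiX.
rewrite NegzE -invr_expz -exprnP upiX upiV; by congr upi; apply/funext => t.
Qed.

Lemma upi_nat n : n%:R = upi (fun=> n%:R).
Proof.
elim: n => [|n ih]; first by rewrite mulr0n upi0.
by rewrite mulrS ih upi1 upiD; congr upi; apply/funext => t; rewrite mulrS.
Qed.

Lemma upi_int (n : int) : n%:~R = upi (fun=> n%:~R).
Proof.
case: n => n; first exact: upi_nat.
by rewrite NegzE mulrNz -pmulrn upi_nat upiN; congr upi; apply/funext => t.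
Qed.

End Ultrapower.

Lemma exists_ultra_nat : exists u : ultra nat, forall n, u [set m | (n <= m)%N].
Proof.
have [G [GU sG]] := ultraFilterLemma (F := eventually) _.
by exists (Ultra GU) => n; apply: sG; exact: nbhs_infty_ge.
Qed.

Lemma ultra_all (T : Type) (u : ultra T) (Z : eqType) (s : seq Z) (P : Z -> set T) :
  (forall z, z \in s -> u (P z)) -> u [set t | forall z, z \in s -> P z t].
Proof.
elim: s => [|z s ih] h; first by apply: ultraS (@filterT _ u _).
have h1 := h z (mem_head _ _).
have h2 : u [set t | forall z, z \in s -> P z t].
  by apply: ih => w ws; apply: h; rewrite inE ws orbT.
apply: filterS (filterI h1 h2) => t [/= p1 p2] w.
by rewrite inE => /orP[/eqP->//|/p2].
Qed.

Lemma ultra_allT (T : Type) (u : ultra T) (Z : finType) (P : Z -> set T) :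
  (forall z, u (P z)) -> u [set t | forall z, P z t].
Proof.
move=> h; apply: ultraS (@ultra_all T u Z (enum Z) P _) => [t /= ht z|z _]; last exact: h.
by apply: ht; rewrite mem_enum.
Qed.

(** * The inverse function theorem *)

Lemma right_inverse (K : fieldType) (X Y : finType) (M : Y -> X -> K) : #|X| = #|Y| ->
  (forall v : X -> K, (forall y, \sum_i M y i * v i = 0) -> forall i, v i = 0) ->
  exists B : X -> Y -> K, forall (z : Y -> K) y, \sum_i M y i * (\sum_j B i j * z j) = z y.
Proof.
move=> cXY inj; pose f (j : 'I_#|X|) : Y := enum_val (cast_ord cXY j).
pose g (y : Y) : 'I_#|X| := cast_ord (esym cXY) (enum_rank y).
have fg y : f (g y) = y by rewrite /f /g cast_ordKV enum_rankK.
have gf j : g (f j) = j by rewrite /f /g enum_valK cast_ordK.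
pose P : 'M[K]_#|X| := \matrix_(i, j) M (f j) (enum_val i).
have Pu : P \in unitmx.
  rewrite -row_free_unit -kermx_eq0; apply/eqP/row_matrixP => k; rewrite row0.
  set r := row k (kermx P); have rP : r *m P = 0.
    by apply/sub_kermxP; exact: row_sub.
  apply/rowP => j; rewrite [RHS]mxE.
  have h := inj (fun i => r 0 (enum_rank i)) _ (enum_val j); rewrite enum_valK in h; apply: h => y.
  have e0 := congr1 (fun A : 'rV_#|X| => A 0 (g y)) rP; rewrite mxE [RHS]mxE in e0.
  apply: etrans e0.
  rewrite [LHS](reindex_onto enum_val enum_rank) => [|i _]; last exact: enum_rankK.
  apply: eq_big => [i|i _]; first by rewrite enum_valK eqxx.
  by rewrite !mxE enum_valK fg mulrC.
exists (fun i y => (invmx P) (g y) (enum_rank i)) => z y.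
pose zr : 'rV[K]_#|X| := \row_j z (f j).
have : (zr *m invmx P *m P) 0 (g y) = z y by rewrite mulmxKV// mxE fg.
rewrite mxE => <-.
rewrite [LHS](reindex_onto enum_val enum_rank) => [|i _]; last exact: enum_rankK.
apply: eq_big => [i|i _]; first by rewrite enum_valK eqxx.
rewrite !mxE fg mulrC; congr (_ * _).
rewrite [LHS](reindex_onto f g) => [|j _]; last exact: fg.
apply: eq_big => [j|j _]; first by rewrite gf eqxx.
by rewrite !mxE gf enum_valK mulrC.
Qed.

Section InverseFunction.
Variable R : realType.
Local Notation K := R[i].

Section Norm.
Variable X : finType.
Implicit Types v w : X -> K.
Definition nrm v : R := \sum_i normc (v i).
Definition vsub v w : X -> K := fun i => v i - w i.

Lemma nrm_ge0 v : 0 <= nrm v.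
Proof. by apply: sumr_ge0 => i _; exact: normc_ge0. Qed.
Lemma nrm_coord v i : normc (v i) <= nrm v.
Proof. by rewrite /nrm (bigD1 i)//= lerDl sumr_ge0// => j _; exact: normc_ge0. Qed.
Lemma nrm_eq0 v : nrm v = 0 -> forall i, v i = 0.
Proof.
move=> h i; apply/eqP; rewrite -normc_eq0; apply/eqP/le_anti.
by rewrite normc_ge0 -h nrm_coord.
Qed.
Lemma nrm_tri v w z : nrm (vsub v z) <= nrm (vsub v w) + nrm (vsub w z).
Proof.
rewrite /nrm -big_split; apply: ler_sum => i _; rewrite /vsub /=.
by have -> : v i - z i = (v i - w i) + (w i - z i) by [ring]; exact: normcD.
Qed.
Lemma nrm_subC v w : nrm (vsub v w) = nrm (vsub w v).
Proof. by apply: eq_bigr => i _; rewrite /vsub normc_distC. Qed.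
Lemma nrm_sub0 v : nrm (vsub v v) = 0.
Proof. by rewrite /nrm big1// => i _; rewrite /vsub subrr normc0. Qed.
End Norm.

Lemma linear_bound (X Y : finType) (B : X -> Y -> K) : exists2 C : R, 0 < C &
  forall z : Y -> K, nrm (fun i => \sum_j B i j * z j) <= C * nrm z.
Proof.
exists (\sum_i \sum_j normc (B i j) + 1) => [|z].
  by apply: ltr_wpDl => //; do 2 (apply: sumr_ge0 => ? _); exact: normc_ge0.
rewrite mulrDl mul1r -[leLHS]addr0; apply: lerD; last exact: nrm_ge0.
rewrite /nrm mulr_suml; apply: ler_sum => i _; apply: (le_trans (normc_sum _ _ _)).
rewrite mulr_suml; apply: ler_sum => j _; rewrite normcM ler_wpM2l ?normc_ge0//.
exact: nrm_coord.
Qed.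

Variables (X Y : finType) (F : (X -> K) -> (Y -> K)) (x0 : X -> K) (M : Y -> X -> K).
Hypothesis cXY : #|X| = #|Y|.
Hypothesis Minj : forall v : X -> K, (forall y, \sum_i M y i * v i = 0) -> forall i, v i = 0.
Hypothesis der : forall (u : ultra nat) (x x' : nat -> X -> K) (N : nat -> K) (v : X -> K),
  (forall i, ulim u (fun t => x t i) (x0 i)) -> (forall i, ulim u (fun t => x' t i) (x0 i)) ->
  (forall t, N t != 0) -> (forall i, ulim u (fun t => (x t i - x' t i) / N t) (v i)) ->
  forall y, ulim u (fun t => (F (x t) y - F (x' t) y) / N t) (\sum_i M y i * v i).

Let L v y := \sum_i M y i * v i.

(** A failure yields pairs of points tending to x0. Dividing by the norm N of their difference makes
    the directions bounded, and their ultralimit v contradicts [der]. *)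
Lemma strict_differentiability e : 0 < e -> exists2 d, 0 < d & forall x x',
  nrm (vsub x x0) < d -> nrm (vsub x' x0) < d ->
  nrm (fun y => F x y - F x' y - L (vsub x x') y) <= e * nrm (vsub x x').
Proof.
move=> e0; apply: contrapT => h.
have ex n : exists p : (X -> K) * (X -> K), [/\ nrm (vsub p.1 x0) < n.+1%:R^-1,
   nrm (vsub p.2 x0) < n.+1%:R^-1 &
   e * nrm (vsub p.1 p.2) < nrm (fun y => F p.1 y - F p.2 y - L (vsub p.1 p.2) y)].
  apply: contrapT => h'; apply: h; exists n.+1%:R^-1; first by rewrite invr_gt0.
  move=> x x' hx hx'; rewrite leNgt; apply/negP => hh; apply: h'.
  by exists (x, x').
have {ex} [f hf] := choice ex.
have [u hu] := exists_ultra_nat.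
have small (g : nat -> X -> K) : (forall n, nrm (vsub (g n) x0) < n.+1%:R^-1) ->
    forall i, ulim u (fun t => g t i) (x0 i).
  move=> hg i d d0; have [n hn] := ltr_add_invr (y := 0) d0.
  apply: ultraS (hu n) => m /= nm; rewrite (le_lt_trans (nrm_coord (vsub (g m) x0) i))//.
  rewrite (lt_trans (hg m))// (le_lt_trans _ hn)// add0r lef_pV2 ?posrE// ler_nat ltnS.
  exact: nm.
pose x t := (f t).1; pose x' t := (f t).2.
pose N t : K := (nrm (vsub (x t) (x' t)))%:C%C.
have Npos t : 0 < nrm (vsub (x t) (x' t)).
  rewrite lt_def nrm_ge0 andbT; apply/eqP => n0; have [_ _] := hf t.
  rewrite -/(x t) -/(x' t) n0 mulr0.
  have e1 : x t = x' t by apply/funext => i; apply/eqP; rewrite -subr_eq0; apply/eqP/(nrm_eq0 n0).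
  rewrite e1 /nrm big1 ?ltxx// => y _; rewrite subrr sub0r normcN' /L big1 ?normc0// => i _.
  by rewrite /vsub subrr mulr0.
have N0 t : N t != 0 by rewrite -normc_eq0 normc_real normr_eq0 gt_eqF.
have nN t : normc (N t) = nrm (vsub (x t) (x' t)) by rewrite normc_real ger0_norm// nrm_ge0.
have bnd i : exists l, ulim u (fun t => (x t i - x' t i) / N t) l.
  apply: ubnd_ulim; exists 1; apply: ultraS (@filterT _ u _) => t _ /=.
  by rewrite normcM normcV nN ler_pdivrMr// mul1r (nrm_coord (vsub (x t) (x' t))).
have {bnd} [v hv] := choice bnd.
have hd := der (small x (fun n => let: And3 h _ _ := hf n in h))
   (small x' (fun n => let: And3 _ h _ := hf n in h)) N0 hv.
have small2 y : u [set t | normc (F (x t) y - F (x' t) y - L (vsub (x t) (x' t)) y) <=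
    e / (#|Y|%:R + 1) * nrm (vsub (x t) (x' t))].
  have hL : ulim u (fun t => \sum_i M y i * ((x t i - x' t i) / N t)) (\sum_i M y i * v i).
    move: (hv); rewrite -/X; elim: (index_enum X) => [|i r ih] hv'.
      by rewrite big_nil; apply: ulim_ae (ulim_cst _ _); apply: ultraS (@filterT _ u _) => t _; rewrite /= big_nil.
    rewrite big_cons; have := ulimB (ulimM (ulim_cst u (M y i)) (hv i)) (ulimB (ulim_cst u 0) (ih hv')).
    rewrite sub0r opprK; apply: ulim_ae; apply: ultraS (@filterT _ u _) => t _ /=.
    by rewrite big_cons; ring.
  have e1 : 0 < e / (#|Y|%:R + 1) by rewrite divr_gt0// ltr_wpDl.
  apply: ultraS (ulimB (hd y) hL e1) => t /=.
  rewrite subrr subr0.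
  have -> : (F (x t) y - F (x' t) y) / N t - \sum_i M y i * ((x t i - x' t i) / N t) =
     (F (x t) y - F (x' t) y - L (vsub (x t) (x' t)) y) / N t.
    rewrite [RHS]mulrBl; congr (_ - _); rewrite /L mulr_suml; apply: eq_bigr => i _.
    by rewrite mulrA.
  by rewrite normcM normcV nN ltr_pdivrMr// => /ltW.
have [t /= ht] := filter_ex (ultra_allT small2).
have [_ _] := hf t; rewrite -/(x t) -/(x' t) ltNge => /negP; apply.
apply: (@le_trans _ _ (\sum_(y : Y) e / (#|Y|%:R + 1) * nrm (vsub (x t) (x' t)))).
  by apply: ler_sum => y _; exact: ht.
rewrite sumr_const -[leLHS]mulr_natr [leLHS]mulrAC ler_wpM2r ?nrm_ge0//.
have -> : #|(xpredT : pred Y)| = #|Y| by apply: eq_card.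
rewrite -mulrA; apply: ler_piMr; first exact: ltW.
by rewrite ler_pdivrMl ?ltr_wpDl// mulr1 lerDl.
Qed.

(** Newton iteration with the fixed right inverse B of the derivative at x0: strict
    differentiability with constant 1/(2C), C bounding B, halves the error at each step. The limit
    of the iterates is taken along an ultrafilter. *)
Lemma inverse_function : exists C d : R, [/\ 0 < C, 0 < d & forall y : Y -> K,
  nrm (vsub y (F x0)) < d -> exists2 x, F x = y & nrm (vsub x x0) <= C * nrm (vsub y (F x0))].
Proof.
have [B hB] := right_inverse cXY Minj.
have [C C0 hC] := linear_bound B; have [D D0 hD] := linear_bound M.
have e0 : 0 < (2 * C)^-1 by rewrite invr_gt0 mulr_gt0.
have [d d0 hd] := strict_differentiability e0.
(* The steps form a geometric series of total length at most 2 C eta, which is below d for this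
   radius, so the iterates stay where [hd] applies. *)
exists (2 * C), (d / (2 * C)); split; rewrite ?divr_gt0 ?mulr_gt0// => y hy.
set eta := nrm (vsub y (F x0)) in hy *.
have eta0 : 0 <= eta by exact: nrm_ge0.
pose A z i := \sum_j B i j * z j.
pose stp x : X -> K := fun i => x i - A (fun j => F x j - y j) i.
pose xs n := iter n stp x0.
have hstep x : nrm (vsub x x0) < d -> nrm (vsub (stp x) x0) < d ->
   nrm (vsub (F (stp x)) y) <= nrm (vsub (F x) y) / 2.
  move=> h1 h2; have := hd _ _ h2 h1.
  have e1 : vsub (stp x) x = fun i => - A (fun j => F x j - y j) i.
    by apply/funext => i; rewrite /vsub /stp; ring.
  have -> : (fun y0 => F (stp x) y0 - F x y0 - L (vsub (stp x) x) y0) = vsub (F (stp x)) y.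
    apply/funext => j; rewrite e1 /L.
    have -> : \sum_i M j i * - A (fun j => F x j - y j) i = - (F x j - y j).
      by rewrite -(hB (fun j => F x j - y j) j) -sumrN; apply: eq_bigr => i _; rewrite mulrN.
    by rewrite /vsub; ring.
  have e2 : nrm (vsub (stp x) x) <= C * nrm (vsub (F x) y).
    rewrite e1 (_ : nrm _ = nrm (A (vsub (F x) y))); first exact: hC.
    by apply: eq_bigr => i _; rewrite normcN'.
  move=> /le_trans; apply; rewrite ler_pdivrMl ?mulr_gt0//.
  apply: (le_trans e2); rewrite [leRHS](_ : _ = C * nrm (vsub (F x) y))//; by field.
have hdist x : nrm (vsub (stp x) x) <= C * nrm (vsub (F x) y).
  rewrite (_ : nrm _ = nrm (A (vsub (F x) y))); first exact: hC.
  by apply: eq_bigr => i _; rewrite /vsub /stp -normcN'; congr normc; ring.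
have inv n : nrm (vsub (F (xs n)) y) <= eta / 2 ^+ n /\
   nrm (vsub (xs n) x0) <= 2 * C * eta * (1 - 2^-n).
  elim: n => [|n [ih1 ih2]].
    by rewrite expr0 divr1 nrm_subC lexx invr1 subrr mulr0 nrm_sub0 lexx.
  have hlt (k : nat) : 2 * C * eta * (1 - 2^-k) < d.
    move: hy; rewrite ltr_pdivlMr ?mulr_gt0// mulrC => hy; apply: le_lt_trans hy.
    apply: ler_piMr; first by rewrite !mulr_ge0// ltW.
    by rewrite gerBl invr_ge0 exprn_ge0.
  have h2 : nrm (vsub (xs n.+1) x0) <= 2 * C * eta * (1 - 2^-n.+1).
    apply: (le_trans (nrm_tri _ (xs n) _)).
    have : nrm (vsub (xs n.+1) (xs n)) <= C * (eta / 2 ^+ n).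
      by apply: (le_trans (hdist (xs n))); rewrite ler_pM2l.
    move: ih2; rewrite exprS; set p := 2 ^+ n.
    have p0 : p != 0 :> R by rewrite expf_neq0// pnatr_eq0.
    have -> : 2 * C * eta * (1 - (2 * p)^-1) = C * (eta / p) + 2 * C * eta * (1 - p^-1) by field.
    lra.
  split=> //; rewrite exprS invfM mulrA mulrAC.
  apply: (le_trans (hstep _ _ _)); [exact: le_lt_trans (hlt n)|exact: le_lt_trans (hlt n.+1)|].
  by rewrite ler_pM2r.
have [u hu] := exists_ultra_nat.
have xbnd n : nrm (vsub (xs n) x0) <= 2 * C * eta.
  have [_ /le_trans] := inv n; apply.
  apply: ler_piMr; first by rewrite !mulr_ge0// ltW.
    by rewrite gerBl invr_ge0 exprn_ge0.
have lim i : exists l, ulim u (fun n => xs n i) l.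
  apply: ubnd_ulim; exists (2 * C * eta + normc (x0 i)); apply: ultraS (@filterT _ u _) => n _ /=.
  have := normcD (xs n i - x0 i) (x0 i); rewrite subrK => /le_trans; apply.
  by rewrite lerD2r (le_trans (nrm_coord (vsub (xs n) x0) i)).
have {lim} [x hx] := choice lim.
have nx e : 0 < e -> u [set n | nrm (vsub (xs n) x) < e].
  move=> ee; have e1 : 0 < e / (#|X|%:R + 1) by rewrite divr_gt0// ltr_wpDl.
  apply: ultraS (ultra_allT (fun i => hx i _ e1)) => n /= hn.
  apply: (@le_lt_trans _ _ (\sum_(i : X) e / (#|X|%:R + 1))).
    by apply: ler_sum => i _; exact/ltW/hn.
  rewrite sumr_const -[ltLHS]mulr_natr -mulrA gtr_pMr// mulrC ltr_pdivrMr ?ltr_wpDl//.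
  by rewrite mul1r ltrDl.
have xx0 : nrm (vsub x x0) <= 2 * C * eta.
  apply/ler_addgt0Pl => e ee; have [n /= hn] := filter_ex (nx _ ee).
  by apply: (le_trans (nrm_tri _ (xs n) _)); rewrite nrm_subC lerD// ltW.
have xd : nrm (vsub x x0) < d.
  by apply: (le_lt_trans xx0); move: hy; rewrite ltr_pdivlMr ?mulr_gt0// mulrC.
exists x => //; apply/funext => j; apply/eqP; rewrite -subr_eq0 -normc_eq0; apply/eqP/le_anti.
rewrite normc_ge0 andbT; apply: (@le_trans _ _ (nrm (vsub (F x) y))).
  exact: nrm_coord (vsub (F x) y) j.
apply/ler_addgt0Pl => e ee; rewrite addr0.
pose e' := e / (2 * ((2 * C)^-1 + D)).
have e'0 : 0 < e' by rewrite divr_gt0// mulr_gt0// addr_gt0.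
have [n0 hn0] : exists n0, forall n, (n0 <= n)%N -> eta / 2 ^+ n < e / 2.
  have e2 : 0 < e / 2 / (eta + 1) by rewrite !divr_gt0// ltr_wpDl.
  have [n0 hn] := ltr_add_invr (y := 0) e2; exists n0 => n n0n.
  rewrite ltr_pdivrMr ?exprn_gt0//.
  have le1 : n0.+1%:R <= 2 ^+ n :> R.
    by rewrite -natrX ler_nat (leq_trans _ (ltn_expl n (ltnSn 1)))// ltnS.
  move: hn; rewrite add0r ltr_pdivlMr ?ltr_wpDl// ltr_pdivrMl// => hn.
  apply: (@lt_le_trans _ _ (n0.+1%:R * (e / 2))); last by rewrite mulrC ler_pM2l// divr_gt0.
  by apply: le_lt_trans hn; rewrite lerDl.
have [n [/= hn1 hn2]] := filter_ex (filterI (nx _ e'0) (hu n0)).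
have xsd : nrm (vsub (xs n) x0) < d.
  by apply: (le_lt_trans (xbnd n)); move: hy; rewrite ltr_pdivlMr ?mulr_gt0// mulrC.
apply: (le_trans (nrm_tri _ (F (xs n)) _)).
have h1 := hd _ _ xd xsd.
have h2 : nrm (vsub (F x) (F (xs n))) <= ((2 * C)^-1 + D) * nrm (vsub x (xs n)).
  have := hD (vsub x (xs n)) => hD'; rewrite mulrDl.
  apply: le_trans (lerD h1 hD'); rewrite /nrm -big_split; apply: ler_sum => i _ /=.
  apply: le_trans (normcD _ _); rewrite le_eqVlt; apply/orP; left; apply/eqP; congr normc.
  by rewrite /vsub /L; ring.
have [h3 _] := inv n; have h4 := hn0 n hn2.
have h5 : ((2 * C)^-1 + D) * nrm (vsub x (xs n)) < ((2 * C)^-1 + D) * e'.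
  by rewrite ltr_pM2l ?addr_gt0// nrm_subC.
have h6 : ((2 * C)^-1 + D) * e' = e / 2.
  rewrite /e'; set c := _ + D; have c0 : c != 0 by rewrite gt_eqF// addr_gt0.
  by field.
lra.
Qed.

End InverseFunction.

(** * Counting solutions along an ultrafilter *)

Definition card_is (T : eqType) (A : set T) (n : nat) :=
  exists s : seq T, [/\ uniq s, size s = n & forall x, A x <-> x \in s].

Lemma card_is_inj (T : eqType) (A : set T) n m : card_is A n -> card_is A m -> n = m.
Proof.
move=> [s [us <- hs]] [t [ut <- ht]]; apply/perm_size; apply: uniq_perm => // x.
by apply/idP/idP => [/hs/ht|/ht/hs].
Qed.

Lemma card_is_bij (S T : eqType) (A : set S) (B : set T) n (f : S -> T) :
  (forall x, A x -> B (f x)) -> (forall x y, A x -> A y -> f x = f y -> x = y) ->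
  (forall y, B y -> exists2 x, A x & f x = y) -> card_is A n -> card_is B n.
Proof.
move=> h1 h2 h3 [s [us ss hs]]; exists [seq f x | x <- s]; split.
- by rewrite map_inj_in_uniq// => x y /hs xA /hs yA; apply: h2.
- by rewrite size_map.
move=> y; split=> [/h3[x /hs xs <-]|/mapP[x /hs Ax ->]]; [exact: map_f | exact: h1].
Qed.

(** The germs along u of sections of A are exactly the listed branches, so almost every A n consists
    of the values of these branches. *)
Lemma count_limit (S Z : eqType) (s0 : S) (u : ultra nat) (A : nat -> set S) (zs : seq Z)
    (sol : Z -> nat -> S) : uniq zs ->
  (forall z, z \in zs -> u [set n | A n (sol z n)]) ->
  (forall z z', z \in zs -> z' \in zs -> u [set n | sol z n = sol z' n] -> z = z') ->
  (forall sg : nat -> S, u [set n | A n (sg n)] -> exists2 z, z \in zs & u [set n | sg n = sol z n]) ->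
  u [set n | card_is (A n) (size zs)].
Proof.
move=> uz h1 h2 h3.
have U1 := ultra_all h1.
have U2 : u [set n | forall z, z \in zs -> forall z', z' \in zs -> sol z n = sol z' n -> z = z'].
  apply: ultra_all => z zz; apply: ultra_all => z' zz'.
  have [/(h2 z z' zz zz') ->|] := in_ultra_setVsetC [set n | sol z n = sol z' n] (ultraP u).
    by apply: ultraS (@filterT _ u _).
  by apply: ultraS => n /= hn /hn.
(* [sg n] is an element of A n missed by all branches whenever there is one. If this happened for
   almost all n, [h3] would identify [sg] with a branch. *)
have /choice[sg hsg] : forall n, exists y, (exists2 x, A n x & forall z, z \in zs -> x <> sol z n) ->
    A n y /\ forall z, z \in zs -> y <> sol z n.
  move=> n; case: (pselect (exists2 x, A n x & forall z, z \in zs -> x <> sol z n)).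
    by move=> [x Ax hx]; exists x.
  by move=> h; exists s0.
have U3 : u [set n | ~ exists2 x, A n x & forall z, z \in zs -> x <> sol z n].
  have [h|//] := in_ultra_setVsetC [set n | exists2 x, A n x & forall z, z \in zs -> x <> sol z n] (ultraP u).
  have [|z zz hz] := h3 sg; first by apply: ultraS h => n /= /hsg[].
  by have [n [/= /hsg[_ /(_ z zz)]]] := filter_ex (filterI h hz).
apply: filterS (filterI U1 (filterI U2 U3)) => n [/= g1 [g2 g3]].
exists [seq sol z n | z <- zs]; split.
- by rewrite map_inj_in_uniq// => z z' zz zz'; apply: g2.
- by rewrite size_map.
move=> x; split=> [Ax|/mapP[z zz ->]]; last exact: g1.
apply/negPn/negP => nx; apply: g3; exists x => // z zz e.
by move/negP: nx; apply; rewrite e; exact: map_f.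
Qed.

(** * Derivatives through a place *)

Section Dual.
Variables (F : fieldType) (K : numFieldType) (p : place F K) (N : F) (X : finType) (v : X -> K).
Hypothesis N0 : N != 0.
Implicit Types (L : (X -> K) -> K).

Definition lin L := forall a w z, L (fun i => a * w i + z i) = a * L w + L z.

(* Forward differentiation through a place: for N infinitesimal, L v is the derivative at a0
   in the direction v. *)
Definition dd (a b : F) (a0 : K) L :=
  [/\ spec p a a0, spec p b a0, spec p ((a - b) / N) (L v) & lin L].

Lemma dd_const c c0 : spec p c c0 -> dd c c c0 (fun=> 0).
Proof.
move=> h; split=> //; first by rewrite subrr mul0r; exact: spec0.
by move=> a w z; rewrite mulr0 addr0.
Qed.

Lemma dd_ext a b a0 b0 L L' : a0 = b0 -> L =1 L' -> dd a b a0 L -> dd a b b0 L'.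
Proof. by move=> <- /funext <-. Qed.

Lemma dd_add a b a0 L c d c0 M : dd a b a0 L -> dd c d c0 M ->
  dd (a + c) (b + d) (a0 + c0) (fun w => L w + M w).
Proof.
move=> [h1 h2 h3 h4] [g1 g2 g3 g4]; split; try exact: specD.
  have -> : (a + c - (b + d)) / N = (a - b) / N + (c - d) / N by field.
  exact: specD.
by move=> k w z; rewrite h4 g4; ring.
Qed.

Lemma dd_scale c c0 a b a0 L : spec p c c0 -> dd a b a0 L ->
  dd (c * a) (c * b) (c0 * a0) (fun w => c0 * L w).
Proof.
move=> hc [h1 h2 h3 h4]; split; try exact: specM.
  have -> : (c * a - c * b) / N = c * ((a - b) / N) by field.
  exact: specM.
by move=> k w z; rewrite h4; ring.
Qed.

Lemma dd_opp a b a0 L : dd a b a0 L -> dd (- a) (- b) (- a0) (fun w => - L w).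
Proof.
move=> h; have := dd_scale (specN (spec1 p)) h; rewrite !mulN1r.
by apply: dd_ext => // w; rewrite mulN1r.
Qed.

Lemma dd_sub a b a0 L c d c0 M : dd a b a0 L -> dd c d c0 M ->
  dd (a - c) (b - d) (a0 - c0) (fun w => L w - M w).
Proof. by move=> h /dd_opp; exact: dd_add. Qed.

Lemma dd_mul a b a0 L c d c0 M : dd a b a0 L -> dd c d c0 M ->
  dd (a * c) (b * d) (a0 * c0) (fun w => a0 * M w + L w * c0).
Proof.
move=> [h1 h2 h3 h4] [g1 g2 g3 g4]; split; try exact: specM.
  have -> : (a * c - b * d) / N = a * ((c - d) / N) + (a - b) / N * d by field.
  by apply: specD; apply: specM.
by move=> k w z; rewrite h4 g4; ring.
Qed.

Lemma dd_inv a b a0 L : a0 != 0 -> dd a b a0 L ->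
  dd a^-1 b^-1 a0^-1 (fun w => - (L w / a0 ^+ 2)).
Proof.
move=> z0 [h1 h2 h3 h4].
have a1 := spec_neq0 h1 z0; have b1 := spec_neq0 h2 z0.
split; try exact: specV.
  have -> : (a^-1 - b^-1) / N = - ((a - b) / N * (a^-1 * b^-1)) by field; rewrite N0 a1 b1.
  by apply: specN; apply: specM => //; rewrite expr2 invfM; apply: specM; exact: specV.
by move=> k w z; rewrite h4; ring.
Qed.

Lemma dd_expn a b a0 L n : dd a b a0 L ->
  dd (a ^+ n) (b ^+ n) (a0 ^+ n) (fun w => n%:R * a0 ^+ n.-1 * L w).
Proof.
move=> h; elim: n => [|n ih].
  by rewrite !expr0; apply: dd_ext (dd_const (spec1 p)) => // w; rewrite !mul0r.
rewrite !exprS; apply: dd_ext (dd_mul h ih) => // w /=.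
case: n {ih} => [|n]; first by rewrite /= !expr0; ring.
by rewrite /= exprS (mulrS _ n.+1); ring.
Qed.

Lemma dd_expz a b a0 L (n : int) : a0 != 0 -> dd a b a0 L ->
  dd (a ^ n) (b ^ n) (a0 ^ n) (fun w => a0 ^ n * (n%:~R * (L w / a0))).
Proof.
move=> z0 h; case: n => n.
  apply: dd_ext (dd_expn n h) => // w; rewrite -exprnP -pmulrn.
  case: n => [|n]; rewrite ?mul0r ?mulr0//= exprS; by field.
rewrite NegzE -!invr_expz; apply: dd_ext (dd_inv _ (dd_expn n.+1 h)) => //.
  move=> w; have -> : (- n.+1%:Z)%:~R = - n.+1%:R :> K by rewrite mulrNz -pmulrn.
  rewrite -exprnP /= (exprS a0 n); move: (n.+1%:R) (a0 ^+ n) (expf_neq0 n z0) => m z hz.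
  by field; rewrite hz z0.
by rewrite expf_neq0.
Qed.

Lemma dd_sum (J : finType) (P : pred J) (a b : J -> F) (a0 : J -> K) (L : J -> (X -> K) -> K) :
  (forall j, P j -> dd (a j) (b j) (a0 j) (L j)) ->
  dd (\sum_(j | P j) a j) (\sum_(j | P j) b j) (\sum_(j | P j) a0 j) (fun w => \sum_(j | P j) L j w).
Proof.
move=> h; elim: (index_enum J) => [|j r ih].
  rewrite !big_nil; apply: dd_ext (dd_const (spec0 p)) => // w; by rewrite big_nil.
rewrite !big_cons; case: ifPn => Pj.
  by apply: dd_ext (dd_add (h j Pj) ih) => // w; rewrite big_cons Pj.
by apply: dd_ext ih => // w; rewrite big_cons (negbTE Pj).
Qed.

Lemma dd_prodz (J : finType) (P : pred J) (n : J -> int) (a b : J -> F) (a0 : J -> K)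
    (L : J -> (X -> K) -> K) :
  (forall j, P j -> a0 j != 0) -> (forall j, P j -> dd (a j) (b j) (a0 j) (L j)) ->
  dd (\prod_(j | P j) a j ^ n j) (\prod_(j | P j) b j ^ n j) (\prod_(j | P j) a0 j ^ n j)
   (fun w => (\prod_(j | P j) a0 j ^ n j) * \sum_(j | P j) (n j)%:~R * (L j w / a0 j)).
Proof.
move=> z0 h; elim: (index_enum J) => [|j r ih].
  rewrite !big_nil; apply: dd_ext (dd_const (spec1 p)) => // w; by rewrite big_nil mulr0.
rewrite !big_cons; case: ifPn => Pj.
  apply: dd_ext (dd_mul (dd_expz (n j) (z0 j Pj) (h j Pj)) ih) => // w.
  by rewrite big_cons Pj; ring.
by apply: dd_ext ih => // w; rewrite big_cons (negbTE Pj).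
Qed.

End Dual.

Lemma lin_sum (K : numFieldType) (X : finType) (L : (X -> K) -> K) (w : X -> K) : lin L ->
  L w = \sum_i L (fun j => (i == j)%:R) * w i.
Proof.
move=> hL; have L0 : L (fun=> 0) = 0.
  have := hL 1 (fun=> 0) (fun=> 0); rewrite (_ : (fun _ => _) = fun=> 0); last first.
    by apply/funext => i; rewrite mulr0 addr0.
  by rewrite mul1r => h; apply: (addrI (L (fun=> 0))); rewrite addr0 -h.
have -> : w = fun j => \sum_i w i * (i == j)%:R.
  apply/funext => j; rewrite (bigD1 j)//= eqxx mulr1 big1 ?addr0// => i /negbTE ->.
  by rewrite mulr0.
have gen (r : seq X) : L (fun j => \sum_(i <- r) w i * (i == j)%:R) =
   \sum_(i <- r) L (fun j => (i == j)%:R) * w i.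
  elim: r => [|i r ih].
    by rewrite big_nil -[RHS]L0; congr L; apply/funext => j; rewrite big_nil.
  rewrite big_cons -ih mulrC -hL; congr L; apply/funext => j; by rewrite big_cons.
rewrite gen; apply: eq_bigr => i _; congr (_ * _).
by rewrite (bigD1 i)//= eqxx mulr1 big1 ?addr0// => j /negbTE ->; rewrite mulr0.
Qed.

(* sys is evaluated over all fields at once so that its derivative can be computed through
   places. *)
Section System.
Variables (R : realType) (X Y : finType).
Local Notation K := R[i].
Variables (sys : forall F : fieldType, (X -> F) -> Y -> F) (x0 : X -> K) (L : Y -> (X -> K) -> K).
Hypothesis Linj : forall v : X -> K, (forall y, L y v = 0) -> forall i, v i = 0.
Hypothesis deriv : forall (F : fieldType) (p : place F K) (x x' : X -> F) (N : F) (v : X -> K),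
  N != 0 -> (forall i, dd p N v (x i) (x' i) (x0 i) (fun w => w i)) ->
  forall y, dd p N v (sys x y) (sys x' y) (sys x0 y) (L y).

(** Dividing the difference by its largest coordinate gives a direction with one coordinate equal to
    1 that the derivative kills, against [Linj]. *)
Lemma system_unique (F : fieldType) (p : place F K) (x x' : X -> F) :
  (forall i, spec p (x i) (x0 i)) -> (forall i, spec p (x' i) (x0 i)) ->
  (forall y, sys x y = sys x' y) -> forall i, x i = x' i.
Proof.
move=> h h' e i0; apply/eqP; rewrite -subr_eq0; apply/negPn/negP => ne.
have [||i [Pi hi]] := @exists_min _ (fun i => x i - x' i != 0)
   (fun i j => dom p (x j - x' j) (x i - x' i)) i0 ne.
- by move=> i j hi hj; apply: dom_total.
- by move=> i j k hi hj hk h1 h2; apply: dom_trans h2 h1.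
pose v j := st p ((x j - x' j) / (x i - x' i)).
have hv j : spec p ((x j - x' j) / (x i - x' i)) (v j).
  apply: specP; have [->|nj] := eqVneq (x j - x' j) 0; last exact: hi.
  by rewrite mul0r; case: (spec0 p).
have vi : v i = 1 by rewrite /v mulfV//; exact: st1.
have hd := deriv Pi (fun j => And4 (h j) (h' j) (hv j) (fun a w z => erefl)).
suff : v i = 0 by rewrite vi => /eqP; rewrite oner_eq0.
apply: Linj => y; have [_ _ + _] := hd y.
by rewrite e subrr mul0r => /spec_uniq/(_ (spec0 p)).
Qed.

Hypothesis cXY : #|X| = #|Y|.
Hypothesis sys_upi : forall (u : ultra nat) (x : nat -> X -> K) y,
  sys (fun i => upi u (fun t => x t i)) y = upi u (fun t => sys (x t) y).

Lemma system_solve : exists C d : R, [/\ 0 < C, 0 < d & forall y : Y -> K,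
  nrm (vsub y (sys x0)) < d ->
  exists2 x, (forall j, sys x j = y j) & nrm (vsub x x0) <= C * nrm (vsub y (sys x0))].
Proof.
have [u0 _] := exists_ultra_nat.
have Llin y : lin (L y).
  (* Linearity of L is part of the conclusion of [dd], so the identity place of K, with equal points
     and zero direction, is enough to extract it. *)
  have := @deriv K (Place (fin := predT) (st := id) (emb := id) isT (fun _ _ _ _ => isT)
    (fun _ _ _ _ => isT) (fun _ _ => isT) erefl (fun _ _ _ _ => erefl) (fun _ _ _ _ => erefl)
    (fun x (h : ~~ true) => False_ind _ (notF h)) (fun _ _ _ => isT) (fun _ => isT) (fun _ => erefl))
    x0 x0 1 (fun=> 0) (oner_neq0 _).
  case/(_ _ y) => // i; split=> //; split=> //=.
  by rewrite subrr mul0r.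
have [||C [d [C0 d0 h]]] := @inverse_function R X Y (@sys K) x0 (fun y i => L y (fun j => (i == j)%:R)) cXY.
- by move=> v hv; apply: Linj => y; rewrite (lin_sum _ (Llin y)).
- move=> u x x' N v hx hx' hN hv y; rewrite -(lin_sum v (Llin y)).
  apply/spec_upi; pose xo i := upi u (fun t => x t i); pose xo' i := upi u (fun t => x' t i).
  have No : upi u N != 0.
    apply/negP => /eqP; rewrite upi0 => /upi_eq/filter_ex[t /eqP]; exact/negP/hN.
  have [|_ _ + _] := deriv (p := uplace R u) (x := xo) (x' := xo') (v := v) No _ y.
    move=> i; split; [exact/spec_upi|exact/spec_upi| |by []].
    by rewrite /xo /xo' upiB upiV upiM; apply/spec_upi.
  by rewrite /xo /xo' !sys_upi upiB upiV upiM.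
exists C, d; split=> // y /h[x e1 e2]; exists x => // j; by rewrite e1.
Qed.

End System.

(** * Covers as solutions of a square system *)

Section Solutions.
Variables (I W : finType) (s : I -> int) (i0 i1 : I).

(* f = \prod_a (z - q a) ^ s a has value 1 and a critical point at infinity;
   c k is a critical point with critical value v k. *)
Definition sol_c (F : fieldType) (v : W -> F) (q : I -> F) (c : W -> F) : Prop :=
  [/\ injective q, forall k a, c k != q a, \sum_a (s a)%:~R * q a = 0,
      q i0 = 0 /\ q i1 = 1 &
      forall k, \sum_a (s a)%:~R / (c k - q a) = 0 /\ \prod_a (c k - q a) ^ s a = v k].

Hypotheses (s0 : forall a, s a != 0) (ssum : \sum_a s a = 0).
Hypothesis cardIW : (#|I| = #|W| + 3)%N.
Hypothesis i01 : i0 != i1.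

Section Factor.
Variables (F : fieldType) (char0 : forall n : int, n != 0 -> n%:~R != 0 :> F).
Variables (v : W -> F) (q : I -> F) (c : W -> F).
Hypotheses (vI : injective v) (hs : sol_c v q c).

Lemma sol_cI : injective c.
Proof. by case: hs => _ _ _ _ h k l e; apply: vI; rewrite -(h k).2 -(h l).2 e. Qed.

Lemma sol_ssum : \sum_a (s a)%:~R = 0 :> F.
Proof. by rewrite -(rmorph_sum intr) ssum. Qed.

(** Two moments vanish, the total weight and the sum of s q. The second expresses the critical point
    at infinity. *)
Lemma sol_size : (size (numer predT q (fun a => (s a)%:~R)) <= #|W|.+1)%N.
Proof.
apply: size_numer_sum00; first exact: sol_ssum.
  by case: hs.
by rewrite (_ : #|predT| = #|I|)// cardIW addn3.
Qed.

Lemma sol_numer : exists2 sg, sg != 0 &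
  numer predT q (fun a => (s a)%:~R) = sg *: \prod_k ('X - (c k)%:P).
Proof.
case: (hs) => qi cq _ _ h.
have [||||||sg sg0 e] := @critical_factor F I W predT predT q c (fun a => (s a)%:~R) _ _ _ _ _ _ i0 isT.
- by move=> a b _ _; exact: qi.
- by move=> k l _ _; exact: sol_cI.
- by move=> k a _ _; exact: cq.
- by move=> a _; apply: char0.
- by move=> k _; case: (h k).
- exact: sol_size.
by exists sg.
Qed.

Lemma sol_factor : exists2 sg, sg != 0 & forall z, (forall a, z != q a) ->
  \sum_a (s a)%:~R / (z - q a) = sg * (\prod_k (z - c k)) / \prod_a (z - q a).
Proof.
have [sg sg0 e] := sol_numer; exists sg => // z hz; have dz : \prod_a (z - q a) != 0.
  by apply/prodf_neq0 => a _; rewrite subr_eq0.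
apply: (mulfI dz); rewrite -[X in X * _ = _]horner_denom -horner_numer; last by move=> a _.
rewrite e hornerZ horner_prod [RHS]mulrC mulfVK//; congr (_ * _).
by apply: eq_bigr => k _; rewrite hornerXsubC.
Qed.

End Factor.

Lemma place_char0 (F : fieldType) (K : numFieldType) (p : place F K) (n : int) :
  n != 0 -> n%:~R != 0 :> F.
Proof. by move=> n0; apply: (spec_neq0 (spec_int p n)); rewrite intr_eq0. Qed.

Lemma sol_pt_inj (F : fieldType) (v : W -> F) (q : I -> F) (c : W -> F) :
  injective v -> sol_c v q c -> injective (pt q c).
Proof.
move=> vI hs; have cI := sol_cI vI hs; case: hs => qi cq _ _ _.
move=> [a|k] [b|l] //= e; first by rewrite (qi _ _ e).
- by move: (cq l a); rewrite e eqxx.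
- by move: (cq k b); rewrite e eqxx.
by rewrite (cI _ _ e).
Qed.

(** The top disc separates all points, and since q i0 = 0 and q i1 = 1 its radius is a unit; so all
    coordinates are finite and their standard parts stay distinct. *)
Lemma sol_interior (F : fieldType) (K : numFieldType) (p : place F K) (tau : F) (t : K)
    (v : W -> F) (vb : W -> K) (q : I -> F) (c : W -> F) :
  (forall k, spec p (v k) (vb k)) -> (forall k, vb k != 0) -> injective vb ->
  spec p tau t -> t != 0 -> (forall k, t * vb k != 1) ->
  sol_c (fun k => tau * v k) q c ->
  exists qb cb, [/\ sol_c (fun k => t * vb k) qb cb, forall a, spec p (q a) (qb a) &
    forall k, spec p (c k) (cb k)].
Proof.
move=> hv vb0 vbI ht t0 tv1 hs.
have tau0 := spec_neq0 ht t0.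
have vI : injective (fun k => tau * v k).
  move=> k l /(mulfI tau0) e; apply: vbI; apply: spec_uniq (hv k) _; rewrite e; exact: hv.
have ptI := sol_pt_inj vI hs.
have char0 := @place_char0 F K p.
have [sg sg0 omE] := sol_factor char0 vI hs.
have x01 : inl i0 != inl i1 :> (I + W)%type by apply: contra_neq i01 => -[].
have [y0 [y1 [y01 top]]] := top_disc p ptI x01.
have fE k : fval q s (c k) = tau * v k by case: hs => _ _ _ _ /(_ k)[].
have sep := interior_separated ptI omE s0 ssum sg0 cardIW hv vb0 vbI fE y01 top ht t0 tv1.
set al := pt q c y0 in top sep; set ro := pt q c y1 - pt q c y0 in top sep.
have r0 : ro != 0 := pt_sub_neq0 ptI y01.
have hsp x : spec p (coor al ro (pt q c x)) (ee p q c al ro x) by apply: specP; exact: top.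
have [q0 q1] : q i0 = 0 /\ q i1 = 1 by case: hs.
set e0 := ee p q c al ro (inl i0); set e1 := ee p q c al ro (inl i1).
have d0 : e1 - e0 != 0 by rewrite subr_eq0; apply/negP => /eqP/sep[] /eqP; rewrite eq_sym (negbTE i01).
have hro : spec p ro (e1 - e0)^-1.
  have -> : ro = (coor al ro (pt q c (inl i1)) - coor al ro (pt q c (inl i0)))^-1.
    rewrite /coor /= q0 q1 -mulrBl opprB addrA subrK subr0 div1r invrK//.
  by apply: specV => //; apply: specB; exact: hsp.
have hpt x : spec p (pt q c x) ((e1 - e0)^-1 * (ee p q c al ro x - e0)).
  have -> : pt q c x = ro * (coor al ro (pt q c x) - coor al ro (pt q c (inl i0))).
    by rewrite /coor /= q0; field.
  by apply: specM => //; apply: specB; exact: hsp.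
exists (fun a => (e1 - e0)^-1 * (ee p q c al ro (inl a) - e0)),
  (fun k => (e1 - e0)^-1 * (ee p q c al ro (inr k) - e0)).
have neq x y : x != y -> (e1 - e0)^-1 * (ee p q c al ro x - e0) != (e1 - e0)^-1 * (ee p q c al ro y - e0).
  move=> xy; apply/eqP => /(mulfI (invr_neq0 d0))/addIr/sep e; by rewrite e eqxx in xy.
split; [|by move=> a; exact: (hpt (inl a))|by move=> k; exact: (hpt (inr k))].
case: hs => qi cq sq [q00 q11] hk; split.
- move=> a b /eqP h; apply/eqP; apply: contraTT h => ab; apply: neq.
  by apply: contra_neq ab => -[].
- by move=> k a; apply: neq.
- have h0 : spec p (\sum_a (s a)%:~R * q a)
      (\sum_a (s a)%:~R * ((e1 - e0)^-1 * (ee p q c al ro (inl a) - e0))).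
    apply: spec_sum => a _; apply: specM (hpt (inl a)); exact: spec_int.
  by rewrite sq in h0; exact: spec_uniq h0 (spec0 p).
- by rewrite subrr mulr0 mulVf.
move=> k; have [h1 h2] := hk k.
have hd a : spec p (c k - q a) ((e1 - e0)^-1 * (ee p q c al ro (inr k) - e0) - (e1 - e0)^-1 * (ee p q c al ro (inl a) - e0)).
  by apply: specB; [exact: (hpt (inr k)) | exact: (hpt (inl a))].
have hn a : (e1 - e0)^-1 * (ee p q c al ro (inr k) - e0) - (e1 - e0)^-1 * (ee p q c al ro (inl a) - e0) != 0.
  by rewrite subr_eq0 neq.
have h3 := @spec_sum _ _ p _ (index_enum I) predT _ _ (fun a _ => specM (spec_int p (s a)) (specV (hd a) (hn a))).
have h4 := @spec_prod _ _ p _ (index_enum I) predT _ _ (fun a _ => specXz (s a) (hd a) (hn a)).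
rewrite h1 in h3; rewrite h2 in h4; split; first exact: spec_uniq h3 (spec0 p).
exact: spec_uniq h4 (specM ht (hv k)).
Qed.

Definition unk (F : Type) (q : I -> F) (c : W -> F) (x : I + W) : F :=
  match x with inl a => q a | inr k => c k end.

(** [option bool] indexes the three normalising equations; by [cardIW] there are then as many
    equations as unknowns. *)
Definition sys_c (F : fieldType) (x : I + W -> F) (y : option bool + (W + W)) : F :=
  match y with
  | inl (Some b) => x (inl (if b then i1 else i0))
  | inl None => \sum_a (s a)%:~R * x (inl a)
  | inr (inl k) => \sum_a (s a)%:~R * (x (inr k) - x (inl a))^-1
  | inr (inr k) => \prod_a (x (inr k) - x (inl a)) ^ s a
  end.

Definition tgt_c (F : fieldType) (v : W -> F) (y : option bool + (W + W)) : F :=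
  match y with
  | inl (Some b) => if b then 1 else 0
  | inr (inr k) => v k
  | _ => 0
  end.

Lemma sol_sys (F : fieldType) (v : W -> F) q c : sol_c v q c ->
  forall y, sys_c (unk q c) y = tgt_c v y.
Proof. by case=> _ _ h [h0 h1] hk [[[]|]|[k|k]] //=; case: (hk k). Qed.

Lemma sys_sol (F : fieldType) (v : W -> F) q c : injective q -> (forall k, v k != 0) ->
  (forall y, sys_c (unk q c) y = tgt_c v y) -> sol_c v q c.
Proof.
move=> qi v0 h; split=> //.
(* Since 0^-1 = 0, a coincidence c k = q a makes the product 0 for either sign of s a, whereas v k
   is nonzero. *)
- move=> k a; apply/eqP => e; have := h (inr (inr k)) => /= ep.
  have := v0 k; rewrite -ep (bigD1 a)//= e subrr.
  by move: (s0 a); case: (s a) => [[|n]|n] // _; rewrite ?NegzE -?invr_expz -exprnP expr0n /= ?invr0 mul0r eqxx.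
- exact: h (inl None).
- by split; [exact: (h (inl (Some false))) | exact: (h (inl (Some true)))].
by move=> k; split; [exact: (h (inr (inl k))) | exact: (h (inr (inr k)))].
Qed.

Section Interior.
Variables (K : numFieldType) (v : W -> K) (q : I -> K) (c : W -> K).
Hypotheses (vI : injective v) (v0 : forall k, v k != 0) (hs : sol_c v q c).

Definition dsys_c (y : option bool + (W + W)) (w : I + W -> K) : K :=
  match y with
  | inl (Some b) => w (inl (if b then i1 else i0))
  | inl None => \sum_a (s a)%:~R * w (inl a)
  | inr (inl k) => \sum_a (s a)%:~R * - ((w (inr k) - w (inl a)) / (c k - q a) ^+ 2)
  | inr (inr k) => (\prod_a (c k - q a) ^ s a) *
       \sum_a (s a)%:~R * ((w (inr k) - w (inl a)) / (c k - q a))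
  end.

(** A motion of the labels that fixes all critical values is affine by [critical_affine], and zero
    as q i0 and q i1 are fixed. The critical points then stand still because they are simple. *)
Lemma dsys_c_inj w : (forall y, dsys_c y w = 0) -> forall i, w i = 0.
Proof.
move=> h; case: (hs) => qi cq sq [q0 q1] hk.
have char0 n : n != 0 -> n%:~R != 0 :> K by rewrite intr_eq0.
have crit k : \sum_a (s a)%:~R / (c k - q a) = 0 by case: (hk k).
have hy : forall k, predT k -> 0 + \sum_(a | predT a) (s a)%:~R * w (inl a) / (c k - q a) = 0.
  move=> k _; rewrite add0r; have := h (inr (inr k)); rewrite /= (hk k).2 => /eqP.
  rewrite mulf_eq0 (negbTE (v0 k)) /= => /eqP e.
  have : \sum_a (s a)%:~R * ((w (inr k) - w (inl a)) / (c k - q a)) =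
     w (inr k) * (\sum_a (s a)%:~R / (c k - q a)) - \sum_a (s a)%:~R * w (inl a) / (c k - q a).
    by rewrite mulr_sumr -sumrB; apply: eq_bigr => a _; ring.
  by rewrite e crit mulr0 sub0r => /eqP; rewrite eq_sym oppr_eq0 => /eqP.
have [|||||||al [be hab]] := @critical_affine K I W predT predT q c (fun a => (s a)%:~R) _ _ _ _ _ _ i0 isT _ 0 hy.
- by move=> a b _ _; exact: qi.
- by move=> k l _ _; exact: (sol_cI vI hs).
- by move=> k a _ _; exact: cq.
- by move=> a _; apply: char0.
- by move=> k _; exact: crit.
- exact: sol_size hs.
- rewrite scale0r add0r; apply: size_numer_sum0; first exact: (h (inl None)).
  by rewrite (_ : #|predT| = #|I|)// cardIW addn3.
have wE a : w (inl a) = al * q a + be.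
  by apply: (mulfI (char0 _ (s0 a))); rewrite hab.
have w0 := h (inl (Some false)); have w1 := h (inl (Some true)); rewrite /= in w0 w1.
have be0 : be = 0 by move: w0; rewrite wE q0 mulr0 add0r.
have al0 : al = 0 by move: w1; rewrite wE q1 mulr1 be0 addr0.
have wi a : w (inl a) = 0 by rewrite wE al0 be0 mul0r addr0.
case=> [//|k]; have := h (inr (inl k)); rewrite /=.
under eq_bigr do rewrite wi subr0.
have -> : \sum_i (s i)%:~R * - (w (inr k) / (c k - q i) ^+ 2) =
   - w (inr k) * \sum_i (s i)%:~R / (c k - q i) ^+ 2.
  by rewrite mulr_sumr; apply: eq_bigr => a _; ring.
move=> /eqP; rewrite mulf_eq0 oppr_eq0 => /orP[/eqP//|].
by rewrite (negbTE (@critical_simple K I W predT predT q c (fun a => (s a)%:~R)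
  (fun a b _ _ => @qi a b) (fun l m _ _ => @sol_cI _ _ _ _ vI hs l m) (fun l a _ _ => cq l a)
  (fun a _ => char0 _ (s0 a)) (fun l _ => crit l) (sol_size hs) i0 isT k isT)).
Qed.

Lemma dsys_c_deriv (F : fieldType) (p : place F K) (x x' : I + W -> F) (N : F) (w : I + W -> K) :
  N != 0 -> (forall i, dd p N w (x i) (x' i) (unk q c i) (fun z => z i)) ->
  forall y, dd p N w (sys_c x y) (sys_c x' y) (sys_c (unk q c) y) (dsys_c y).
Proof.
move=> N0 h; case: (hs) => qi cq _ _ _.
have hd k a : dd p N w (x (inr k) - x (inl a)) (x' (inr k) - x' (inl a)) (c k - q a)
   (fun z => z (inr k) - z (inl a)) by exact: (dd_sub N0 (h (inr k)) (h (inl a))).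
have hn k a : c k - q a != 0 by rewrite subr_eq0.
case=> [[b|]|[k|k]]; rewrite /=.
- exact: h.
- apply: (dd_sum N0) => a _; apply: (dd_scale N0); first exact: spec_int.
  exact: (h (inl a)).
- apply: (dd_sum N0) => a _; apply: (dd_scale N0); first exact: spec_int.
  exact: (dd_inv N0).
exact: (dd_prodz N0).
Qed.

End Interior.

Lemma card_sys : #|{: I + W}| = #|{: option bool + (W + W)}|.
Proof. by rewrite !card_sum card_option card_bool cardIW; lia. Qed.

Lemma sys_c_upi (R : realType) (u : ultra nat) (x : nat -> I + W -> R[i]) y :
  sys_c (fun i => upi u (fun t => x t i)) y = upi u (fun t => sys_c (x t) y).
Proof.
case: y => [[b|]|[k|k]] //=.
- rewrite -upi_sum; apply: eq_bigr => a _; by rewrite upi_int upiM.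
- by rewrite -upi_sum; apply: eq_bigr => a _; rewrite upi_int upiB upiV upiM.
by rewrite -upi_prod; apply: eq_bigr => a _; rewrite upiB upiXz.
Qed.


(** * Finiteness and local constancy of the number of solutions *)

Section Counting.
Variable R : realType.
Local Notation K := R[i].
Variables (v : W -> K) (vI : injective v) (v0 : forall k, v k != 0).

Definition Sol (tau : K) : set ({ffun I -> K} * {ffun W -> K}) :=
  [set z : {ffun I -> K} * {ffun W -> K} |
   sol_c (fun k => tau * v k) (z.1 : I -> K) (z.2 : W -> K)].

Let mulI (t : K) : t != 0 -> injective (fun k => t * v k).
Proof. by move=> t0 k l /(mulfI t0)/vI. Qed.

Let mul0 (t : K) : t != 0 -> forall k, t * v k != 0.
Proof. by move=> t0 k; rewrite mulf_neq0. Qed.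

Lemma sol_upi (u : ultra nat) (tau : nat -> K) (z : nat -> {ffun I -> K} * {ffun W -> K}) :
  u [set n | Sol (tau n) (z n)] ->
  sol_c (fun k => upi u tau * upi u (fun=> v k)) (fun a => upi u (fun n => (z n).1 a))
    (fun k => upi u (fun n => (z n).2 k)).
Proof.
move=> h; split.
- move=> a b /upi_eq e; have [n [/= [qi _ _ _ _] /qi]] := filter_ex (filterI h e).
  by [].
- move=> k a; apply/eqP => /upi_eq e; have [n [/= [_ cq _ _ _] e']] := filter_ex (filterI h e).
  by move: (cq k a); rewrite e' eqxx.
- under eq_bigr do rewrite upi_int upiM; rewrite upi_sum upi0; apply/upi_eq.
  by apply: ultraS h => n [].
- by rewrite upi0 upi1; split; apply/upi_eq; apply: ultraS h => n [_ _ _ []].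
move=> k; split.
  under eq_bigr do rewrite upi_int upiB upiV upiM; rewrite upi_sum upi0; apply/upi_eq.
  by apply: ultraS h => n [_ _ _ _ /(_ k)[]].
under eq_bigr do rewrite upiB upiXz; rewrite upi_prod upiM; apply/upi_eq.
by apply: ultraS h => n [_ _ _ _ /(_ k)[]].
Qed.

Lemma sol_limit (u : ultra nat) (tau : nat -> K) (t : K) (z : nat -> {ffun I -> K} * {ffun W -> K}) :
  ulim u tau t -> t != 0 -> (forall k, t * v k != 1) -> u [set n | Sol (tau n) (z n)] ->
  exists2 zb, Sol t zb & forall i, ulim u (fun n => unk (z n).1 (z n).2 i) (unk zb.1 zb.2 i).
Proof.
move=> ht t0 t1 /sol_upi hz.
have [||||||qb [cb [h1 h2 h3]]] := @sol_interior _ _ (uplace R u) _ t _ v _ _ _ _ _ _ _ _ hz.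
- by move=> k; apply/spec_upi; exact: ulim_cst.
- exact: v0.
- exact: vI.
- by apply/spec_upi.
- exact: t0.
- exact: t1.
exists (finfun qb, finfun cb).
  case: h1 => qi cq sq [q0 q1] hk; split=> /=.
  - by move=> a b; rewrite !ffunE => /qi.
  - by move=> k a; rewrite !ffunE.
  - by rewrite -[RHS]sq; apply: eq_bigr => a _; rewrite ffunE.
  - by rewrite !ffunE.
  move=> k; have [e1 e2] := hk k; split.
    by rewrite -[RHS]e1; apply: eq_bigr => a _; rewrite !ffunE.
  by rewrite -[RHS]e2; apply: eq_bigr => a _; rewrite !ffunE.
by case=> [a|k] /=; rewrite ffunE; apply/spec_upi.
Qed.

Lemma sol_limit_unique (u : ultra nat) (tau : nat -> K) (t : K)
    (z z' : nat -> {ffun I -> K} * {ffun W -> K}) (zb : {ffun I -> K} * {ffun W -> K}) :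
  t != 0 -> Sol t zb ->
  (forall i, ulim u (fun n => unk (z n).1 (z n).2 i) (unk zb.1 zb.2 i)) ->
  (forall i, ulim u (fun n => unk (z' n).1 (z' n).2 i) (unk zb.1 zb.2 i)) ->
  u [set n | Sol (tau n) (z n)] -> u [set n | Sol (tau n) (z' n)] -> u [set n | z n = z' n].
Proof.
move=> t0 hb l1 l2 /sol_upi s1 /sol_upi s2.
have h := @system_unique R _ _ sys_c (unk zb.1 zb.2) (dsys_c zb.1 zb.2)
  (dsys_c_inj (mulI t0) (mul0 t0) hb) (fun F p x x' N w => @dsys_c_deriv _ _ _ _ hb F p x x' N w)
  _ (uplace R u) (unk (fun a => upi u (fun n => (z n).1 a)) (fun k => upi u (fun n => (z n).2 k)))
  (unk (fun a => upi u (fun n => (z' n).1 a)) (fun k => upi u (fun n => (z' n).2 k))) _ _ _.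
have e : forall i : I + W, u [set n | unk (z n).1 (z n).2 i = unk (z' n).1 (z' n).2 i].
  move=> i; have := h _ _ _ i; case: i => [a|k] /= hi; apply/upi_eq; apply: hi.
  - by case=> [b|l]; apply/spec_upi; [exact: (l1 (inl b))|exact: (l1 (inr l))].
  - by case=> [b|l]; apply/spec_upi; [exact: (l2 (inl b))|exact: (l2 (inr l))].
  - by move=> y; rewrite (sol_sys s1) (sol_sys s2).
  - by case=> [b|l]; apply/spec_upi; [exact: (l1 (inl b))|exact: (l1 (inr l))].
  - by case=> [b|l]; apply/spec_upi; [exact: (l2 (inl b))|exact: (l2 (inr l))].
  - by move=> y; rewrite (sol_sys s1) (sol_sys s2).
apply: ultraS (ultra_allT e) => n /= hn.
case: (z n) (z' n) hn => [q c] [q' c'] /= hn.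
by congr (_, _); apply/ffunP => i; [exact: (hn (inl i))|exact: (hn (inr i))].
Qed.

(** An infinite sequence of distinct solutions would have an ultralimit, again a solution; by
    uniqueness near it, almost all terms would equal the limit. *)
Lemma Sol_finite (t : K) : t != 0 -> (forall k, t * v k != 1) -> exists n, card_is (Sol t) n.
Proof.
move=> t0 t1; apply: contrapT => nf.
have ext (r : seq ({ffun I -> K} * {ffun W -> K})) : exists z, Sol t z /\ (uniq r -> (forall x, x \in r -> Sol t x) -> z \notin r).
  have nf' := nf; apply: contrapT => h; apply: nf.
  have [z0 S0] : exists z, Sol t z.
    apply: contrapT => h0; apply: nf'; exists 0%N, [::]; split=> // x.
    by split=> // Sx; case: h0; exists x.
  have [ur|nur] := boolP (uniq r); last by exfalso; apply: h; exists z0; split=> // ur; rewrite ur in nur.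
  have [ar|nar] := pselect (forall x, x \in r -> Sol t x); last by exfalso; apply: h; exists z0.
  exists (size r), r; split=> // x; split=> [Sx|]; last exact: ar.
  by apply/negPn/negP => xr; apply: h; exists x.
have {ext} [next hnext] := choice ext.
pose sq := fix sq n := if n is n'.+1 then next (sq n') :: sq n' else [::].
have sqP n : uniq (sq n) /\ forall x, x \in sq n -> Sol t x.
  elim: n => [//|n [u1 u2]]; split=> /=; first by rewrite u1 andbT; have [_] := hnext (sq n); apply.
  by move=> x; rewrite inE => /orP[/eqP->|/u2//]; have [] := hnext (sq n).
pose z n := next (sq n).
have zS n : Sol t (z n) by have [] := hnext (sq n).
have zin m n : (n < m)%N -> z n \in sq m.
  elim: m => // m ih; rewrite ltnS leq_eqVlt => /orP[/eqP->|/ih h] /=; rewrite inE ?eqxx// h orbT//.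
have zinj m n : (n < m)%N -> z n != z m.
  move=> nm; have [u1 u2] := sqP m; have [_ /(_ u1 u2)] := hnext (sq m).
  by move=> h; apply/eqP => e; move/negP: h; apply; rewrite -/(z m) -e; exact: zin.
have [u hu] := exists_ultra_nat.
have uS (y : nat -> _) : (forall n, Sol t (y n)) -> u [set n | Sol ((fun=> t) n) (y n)].
  by move=> hy; apply: ultraS (@filterT _ u _) => n _; exact: hy.
have [zb Sb lb] := sol_limit (ulim_cst u t) t0 t1 (uS z zS).
have e := @sol_limit_unique u (fun=> t) t z (fun=> zb) zb t0 Sb lb (fun i => ulim_cst u _)
   (uS z zS) (uS _ (fun=> Sb)).
have [n /= en] := filter_ex e.
have [m [/= em nm]] := filter_ex (filterI e (hu n.+1)).
by have := zinj m n nm; rewrite en em eqxx.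
Qed.

Lemma small_seq_lim (u : ultra nat) (tau : nat -> K) (t : K) :
  (forall n, u [set m | (n <= m)%N]) -> (forall n, normc (tau n - t) < n.+1%:R^-1) ->
  ulim u tau t.
Proof.
move=> hu h e e0; have [n hn] := ltr_add_invr (y := 0) e0.
apply: ultraS (hu n) => m /= nm; apply: (lt_trans (h m)); apply: le_lt_trans hn.
by rewrite add0r lef_pV2 ?posrE// ler_nat ltnS.
Qed.

(** Every solution at t continues to nearby tau by [system_solve], and no others appear: solutions
    along a sequence tending to t have a limit by properness and agree with the branch through it.
    [count_limit] then excludes a sequence with a different count. *)
Lemma Sol_locally_constant (t : K) : t != 0 -> (forall k, t * v k != 1) ->
  exists d n, 0 < d /\ forall tau, normc (tau - t) < d -> card_is (Sol tau) n.
Proof.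
move=> t0 t1; have [n0 [zs [uz sz hz]]] := Sol_finite t0 t1.
have solve : forall z : {ffun I -> K} * {ffun W -> K}, exists xi : K -> {ffun I -> K} * {ffun W -> K}, z \in zs ->
   exists C d : R, [/\ 0 < C, 0 < d & forall tau, normc (tau - t) < d ->
     (forall y, sys_c (unk (xi tau).1 (xi tau).2) y = tgt_c (fun k => tau * v k) y) /\
     nrm (vsub (unk (xi tau).1 (xi tau).2) (unk z.1 z.2)) <= C * normc (tau - t)].
  move=> z; have [zz|nz] := boolP (z \in zs); last by exists (fun=> z).
  have Sz : Sol t z by apply/hz.
  have [C [d [C0 d0 h]]] := @system_solve R _ _ sys_c (unk z.1 z.2) (dsys_c z.1 z.2)
    (dsys_c_inj (mulI t0) (mul0 t0) Sz) (fun F p x x' N w => @dsys_c_deriv _ _ _ _ Sz F p x x' N w)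
    card_sys (@sys_c_upi R).
  pose B : R := \sum_(k : W) normc (v k) + 1.
  have B0 : 0 < B by rewrite ltr_wpDl// sumr_ge0// => k _; exact: normc_ge0.
  have hB tau : nrm (vsub (tgt_c (fun k => tau * v k)) (sys_c (unk z.1 z.2))) <= B * normc (tau - t).
    have -> : sys_c (unk z.1 z.2) = tgt_c (fun k => t * v k) by apply/funext; exact: sol_sys Sz.
    rewrite /nrm big_sumType /= [X in X + _ <= _]big1 ?add0r; last first.
      by move=> [b|] _; rewrite /vsub subrr normc0.
    rewrite big_sumType /= [X in X + _ <= _]big1 ?add0r; last first.
      by move=> k _; rewrite oppr0 expr0n /= addr0 sqrtr0.
    rewrite mulrDl mul1r -[leLHS]addr0 lerD ?normc_ge0// mulr_suml; apply: ler_sum => k _.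
    by rewrite /vsub /= -mulrBl normcM mulrC.
  have ex tau : exists x : {ffun I -> K} * {ffun W -> K}, normc (tau - t) < d / B ->
      (forall y, sys_c (unk x.1 x.2) y = tgt_c (fun k => tau * v k) y) /\
      nrm (vsub (unk x.1 x.2) (unk z.1 z.2)) <= (C * B) * normc (tau - t).
    have [lt|nlt] := pselect (normc (tau - t) < d / B); last by exists z => /nlt.
    have [|x hx1 hx2] := h (tgt_c (fun k => tau * v k)).
      by apply: le_lt_trans (hB tau) _; rewrite mulrC -ltr_pdivlMr.
    exists (finfun (fun a => x (inl a)), finfun (fun k => x (inr k))) => _.
    have -> : unk (finfun (fun a => x (inl a))) (finfun (fun k => x (inr k))) = x.
      by apply/funext => -[a|k] /=; rewrite ffunE.
    by split=> //; apply: (le_trans hx2); rewrite -mulrA ler_pM2l.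
  have [xi hxi] := choice ex; exists xi => _; exists (C * B), (d / B).
  by split; [exact: mulr_gt0 | exact: divr_gt0 | move=> tau /hxi].
have {solve} [xi hxi] := choice solve.
apply: contrapT => nope.
have bad n : exists tau, normc (tau - t) < n.+1%:R^-1 /\ ~ card_is (Sol tau) (size zs).
  apply: contrapT => h; apply: nope; exists n.+1%:R^-1, (size zs); split; first by rewrite invr_gt0.
  by move=> tau htau; apply: contrapT => hc; apply: h; exists tau.
have {bad} [tau htau] := choice bad.
have [u hu] := exists_ultra_nat.
have lt := small_seq_lim hu (fun n => (htau n).1).
have near d : 0 < d -> u [set n | normc (tau n - t) < d] by exact: lt.
pose sol z n := xi z (tau n).
have solS z : z \in zs -> (forall i, ulim u (fun n => unk (sol z n).1 (sol z n).2 i) (unk z.1 z.2 i)) /\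
   u [set n | Sol (tau n) (sol z n)].
  move=> zz; have [C [d [C0 d0 h]]] := hxi z zz.
  have hl : forall i, ulim u (fun n => unk (sol z n).1 (sol z n).2 i) (unk z.1 z.2 i).
    move=> i e e0; have e1 : 0 < e / C by rewrite divr_gt0.
    apply: filterS (filterI (near _ d0) (near _ e1)) => n [/= h1 h2].
    apply: (le_lt_trans (nrm_coord (vsub (unk (sol z n).1 (sol z n).2) (unk z.1 z.2)) i)).
    by apply: (le_lt_trans (h _ h1).2); rewrite mulrC -ltr_pdivlMr.
  split=> //; have Sz : Sol t z by apply/hz.
  have tn0 : u [set n | tau n != 0].
    apply: ultraS (near (normc t) _) => [n /= hn|]; last by rewrite normc_gt0.
    by apply: contraTneq hn => ->; rewrite sub0r normcN' ltxx.
  have qd : u [set n | injective (sol z n).1].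
    have pd : forall ab : I * I, u [set n | ab.1 != ab.2 -> (sol z n).1 ab.1 != (sol z n).1 ab.2].
      move=> [a b] /=; have [->|ab] := eqVneq a b; first by apply: ultraS (@filterT _ u _).
      have l1 := ulimB (hl (inl a)) (hl (inl b)).
      have ne : z.1 a - z.1 b != 0.
        by case: Sz => qi _ _ _ _; rewrite subr_eq0; apply: contra_neq ab => /qi.
      apply: ultraS (l1 (normc (z.1 a - z.1 b)) _) => [n /= hn _|]; last by rewrite normc_gt0.
      apply: contraTneq hn => e; rewrite e subrr sub0r normcN' ltxx//.
    apply: ultraS (ultra_allT pd) => n /= hn a b e; apply/eqP/negPn/negP => /(hn (a, b)).
    by rewrite /= e eqxx.
  apply: filterS (filterI tn0 (filterI qd (near _ d0))) => n [/= g1 [g2 g3]].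
  by apply: (sys_sol g2 (mul0 g1)); exact: (h _ g3).1.
have := @count_limit _ _ (finfun (fun=> 0), finfun (fun=> 0)) u (fun n => Sol (tau n)) zs sol uz.
case/(_ _ _ _)/filter_ex => [z zz|z z' zz zz' e|sg hsg|n /= hn].
- exact: (solS z zz).2.
- have [l1 _] := solS z zz; have [l2 _] := solS z' zz'.
  case: z z' {zz zz'} e l1 l2 => [q c] [q' c'] e l1 l2.
  have ee i : unk q c i = unk q' c' i.
    apply: (ulim_uniq _ (l2 i)); apply: ulim_ae (l1 i); apply: ultraS e => n /= en.
    by rewrite en.
  by congr (_, _); apply/ffunP => i; [exact: (ee (inl i))|exact: (ee (inr i))].
- have [zb Sb lb] := sol_limit lt t0 t1 hsg; exists zb; first by apply/hz.
  have zb' : zb \in zs by apply/hz.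
  have [l1 s1] := solS zb zb'.
  exact: sol_limit_unique t0 Sb lb l1 hsg s1.
by have [_] := htau n.
Qed.

End Counting.
End Solutions.

(** * Solutions with small critical values *)

Section Canonical.
Variable I : finType.
Implicit Types b : {ffun I -> 'I_3}.

Definition surj b := [forall j, exists a, b a == j].
Definition same b b' := [forall a, forall a', (b a == b a') == (b' a == b' a')].
(* Unordered partitions into three blocks are labellings b up to relabelling;
   canon selects one labelling in each class. *)
Definition canon b := odflt b [pick b' | surj b' && same b b'].
Definition can b := surj b && (canon b == b).

Lemma sameP b b' : reflect (forall a a', (b a == b a') = (b' a == b' a')) (same b b').
Proof.
apply: (iffP forallP) => [h a a'|h a]; first by move/forallP: (h a) => /(_ a')/eqP.
by apply/forallP => a'; rewrite h.
Qed.

Lemma surjP b : reflect (forall j, exists a, b a = j) (surj b).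
Proof.
apply: (iffP forallP) => h j; first by have /existsP[a /eqP] := h j; exists a.
by have [a /eqP] := h j => e; apply/existsP; exists a.
Qed.

Lemma canonP b : surj b -> can (canon b) /\ same b (canon b).
Proof.
move=> sb; have h : surj (canon b) /\ same b (canon b).
  rewrite /canon; case: pickP => [b' /andP[]//|/(_ b)]; rewrite sb /=.
  by have -> : same b b by apply/sameP.
split=> //; last by case: h.
case: h => h1 /sameP h2; rewrite /can h1 /=; apply/eqP.
rewrite {1}/canon [RHS]/canon.
have -> : [pick b' | surj b' && same (canon b) b'] = [pick b' | surj b' && same b b'].
  apply: eq_pick => b' /=; congr (_ && _).
  by apply/sameP/sameP => h a a'; rewrite ?h2 -?h// h2.
by case: pickP => // /(_ b); rewrite sb /=; have -> : same b b by apply/sameP.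
Qed.

Lemma can_same b b' : can b -> can b' -> same b b' -> b = b'.
Proof.
move=> /andP[sb /eqP eb] /andP[sb' /eqP eb'] /sameP h; rewrite -eb -eb' /canon.
have -> : [pick x | surj x && same b x] = [pick x | surj x && same b' x].
  by apply: eq_pick => x /=; congr (_ && _); apply/sameP/sameP => g a a'; rewrite ?h -?g// h.
by case: pickP => // /(_ b'); rewrite sb' /=; have -> : same b' b' by apply/sameP.
Qed.

End Canonical.

Lemma ord3P (j : 'I_3) : [\/ j = 0, j = 1 | j = 2%:R].
Proof.
by case: j => -[|[|[|//]]] h; [apply: Or31|apply: Or32|apply: Or33]; exact: val_inj.
Qed.

Lemma prod_expz_neq0 (F : fieldType) (T : finType) (f : T -> F) (n : T -> int) :
  (forall a, n a != 0) -> \prod_a f a ^ n a != 0 -> forall a, f a != 0.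
Proof.
move=> n0 h a; apply: contraNneq h => e; rewrite (bigD1 a)//= e.
by move: (n0 a); case: (n a) => [[|m]|m] // _; rewrite ?NegzE -?invr_expz -exprnP expr0n /= ?invr0 mul0r.
Qed.

Lemma sum_if_block (V : zmodType) (I : finType) (b : I -> 'I_3) (f : I -> V) :
  \sum_a f a = \sum_(a | b a == 0) f a + \sum_(a | b a == 1) f a + \sum_(a | b a == 2%:R) f a.
Proof.
rewrite (partition_big b predT)//= !big_ord_recl big_ord0 addr0 addrA.
by congr (_ + _ + _); apply: eq_bigl => a; rewrite -val_eqE.
Qed.

Section Chart.
Variables (I W : finType) (s : I -> int) (i0 i1 : I).
Hypotheses (s0 : forall a, s a != 0) (ssum : \sum_a s a = 0).
Hypothesis cardIW : (#|I| = #|W| + 3)%N.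
Hypothesis i01 : i0 != i1.

(** A multiple of all positive subset sums. With tau = th ^+ [commonmult] the radii of order
    tau^(1/s_A) become integral powers of th, whatever the clusters are. *)
Definition commonmult : nat :=
  \prod_(A : {set I}) (if (0 < \sum_(a in A) s a)%R then absz (\sum_(a in A) s a)%R else 1%N).

Section Fixed.
Variables (b : {ffun I -> 'I_3}) (g : {ffun W -> 'I_3}).

Definition rp j : I := odflt i0 [pick a | b a == j].
(** A second label of block j, or [rp j] again if there is only one. In a block with several labels
    the two are placed at 0 and 1. *)
Definition rp' j : I := odflt (rp j) [pick a | (b a == j) && (a != rp j)].
Definition multi j := rp' j != rp j.
Definition sB j : int := \sum_(a | b a == j) s a.
Definition ex j : nat := if 0 < sB j then (commonmult %/ `|sB j|)%N else 1%N.

Lemma commonmult_gt0 : (0 < commonmult)%N.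
Proof.
by rewrite /commonmult prodn_gt0// => A; case: ifP => // h; rewrite absz_gt0 gt_eqF.
Qed.

Lemma sB_dvd j : 0 < sB j -> (`|sB j| %| commonmult)%N.
Proof.
move=> h; pose A := [set a | b a == j]%SET.
have e : \sum_(a in A) s a = sB j by apply: eq_bigl => a; rewrite inE.
by rewrite /commonmult (bigD1 A)//= e h dvdn_mulr.
Qed.

Lemma ex_gt0 j : (0 < ex j)%N.
Proof.
rewrite /ex; case: ifP => // h; rewrite divn_gt0 ?absz_gt0 ?gt_eqF//.
by apply: dvdn_leq (sB_dvd h); exact: commonmult_gt0.
Qed.

Lemma ex_mul (F : fieldType) (th : F) j : 0 < sB j -> (th ^+ ex j) ^ sB j = th ^+ commonmult.
Proof.
move=> h; have -> : sB j = `|sB j|%N :> int by rewrite gez0_abs// ltW.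
by rewrite -exprnP -exprM /ex h divnK// sB_dvd.
Qed.

Hypothesis bsurj : surj b.

Lemma b_rp j : b (rp j) = j.
Proof.
rewrite /rp; case: pickP => [a /eqP//|h]; have /surjP/(_ j)[a e] := bsurj.
by have := h a; rewrite e eqxx.
Qed.

Lemma b_rp' j : b (rp' j) = j.
Proof. by rewrite /rp'; case: pickP => [a /andP[/eqP]//|_]; exact: b_rp. Qed.

Lemma single_rp j a : ~~ multi j -> b a = j -> a = rp j.
Proof.
rewrite /multi negbK /rp' => + ba; case: pickP => [a' /andP[_ /negbTE] /= ->//|h _].
by have := h a; rewrite ba eqxx /= => /negbFE/eqP.
Qed.

Lemma sB_sum : sB 0 + sB 1 + sB 2%:R = 0.
Proof. by rewrite -[RHS]ssum (sum_if_block b). Qed.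

(* Coordinates near a degenerate solution: the block j sits at ev j and is rescaled by
   Th j = xt ^+ ex j * xl j, so that xt = 0 is the limit and xt = th <> 0 gives solutions
   with critical values of size th ^+ commonmult; xa and xh are the rescaled positions of
   the labels and of the critical points. *)
Section Values.
Variables (F : fieldType) (x : (I + W) + ('I_3 + unit) -> F).
Definition xa a := x (inl (inl a)).
Definition xh k := x (inl (inr k)).
Definition xl j := x (inr (inl j)).
Definition xt := x (inr (inr tt)).
Definition Th j := xt ^+ ex j * xl j.
Definition ev (j : 'I_3) : F := if j == 0 then 0 else if j == 1 then 1 else
  - (((sB 1)%:~R + \sum_a (s a)%:~R * (Th (b a) * xa a)) * ((sB 2%:R)%:~R)^-1).
Definition Qv a := ev (b a) + Th (b a) * xa a.
Definition Cv k := ev (g k) + Th (g k) * xh k.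
Definition dv k a := if g k == b a then xh k - xa a else Cv k - Qv a.
Definition sys_d (y : ('I_3 + 'I_3) + ((W + W) + unit)) : F :=
  match y with
  | inl (inl j) => xa (rp j)
  | inl (inr j) => if multi j then xa (rp' j) else xl j
  | inr (inl (inl k)) => \sum_a (s a)%:~R * ((if g k == b a then 1 else Th (g k)) * (dv k a)^-1)
  | inr (inl (inr k)) => xl (g k) ^ sB (g k) * \prod_a dv k a ^ s a
  | inr (inr _) => xt
  end.
End Values.

Definition tgt_d (F : fieldType) (v : W -> F) (th : F) (y : ('I_3 + 'I_3) + ((W + W) + unit)) : F :=
  match y with
  | inl (inl j) => 0
  | inl (inr j) => 1
  | inr (inl (inl k)) => 0
  | inr (inl (inr k)) => v k
  | inr (inr _) => th
  end.

Lemma card_d : #|{: (I + W) + ('I_3 + unit)}| = #|{: ('I_3 + 'I_3) + ((W + W) + unit)}|.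
Proof. by rewrite !card_sum !card_ord card_unit cardIW; clear; lia. Qed.

Hypothesis bal : forall j, (#|[pred k | g k == j]| + 1 = #|[pred a | b a == j]|)%N.
Hypothesis sBpos : forall j, multi j -> 0 < sB j.

Lemma g_multi k : multi (g k).
Proof.
apply: contraT => nm; have := bal (g k).
rewrite (cardD1 k) inE eqxx => e; have : (1 < #|[pred a | b a == g k]|)%N by rewrite -e; lia.
move=> /card_gt1P[a [a' [ha ha' ne]]].
by rewrite (single_rp nm (eqP ha)) (single_rp nm (eqP ha')) eqxx in ne.
Qed.

Lemma multi_g j : multi j -> exists k, g k = j.
Proof.
move=> mj; have mj' : rp' j != rp j := mj.
have := bal j; rewrite [in RHS](cardD1 (rp j)) inE b_rp eqxx (cardD1 (rp' j)) !inE.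
rewrite b_rp' eqxx mj' /= => e.
have : (0 < #|[pred k | g k == j]|)%N.
  by move: e; set n := #|[pred k | g k == j]|; set m := #|[predD1 _ & _]|; clearbody n m; lia.
by move=> /card_gt0P[k /eqP]; exists k.
Qed.

Lemma sB_neq0 j : sB j != 0.
Proof.
have [mj|nm] := boolP (multi j); first by rewrite gt_eqF// sBpos.
rewrite /sB (bigD1 (rp j)) ?b_rp//= big1 ?addr0// => a /andP[/eqP ba].
by rewrite (single_rp nm ba) eqxx.
Qed.

(** The third centre in [ev] is chosen to solve this equation, which is therefore absent from
    [sys_d]. *)
Lemma sum_ev (F : fieldType) (x : (I + W) + ('I_3 + unit) -> F) : (sB 2%:R)%:~R != 0 :> F ->
  \sum_a (s a)%:~R * Qv x a = 0.
Proof.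
move=> nz; rewrite (eq_bigr (fun a => (s a)%:~R * ev x (b a) + (s a)%:~R * (Th x (b a) * xa x a))); last first.
  by move=> a _; rewrite /Qv; ring.
rewrite big_split /= (sum_if_block b) (eq_bigr (fun=> 0)) => [|a /eqP->]; last by rewrite /ev eqxx mulr0.
rewrite big1// add0r (eq_bigr (fun a => (s a)%:~R)) => [|a /eqP->]; last by rewrite /ev /= mulr1.
rewrite [X in _ + X + _](eq_bigr (fun a => (s a)%:~R * ev x 2%:R)) => [|a /eqP->//].
rewrite -mulr_suml -!(rmorph_sum intr) -/(sB 1) -/(sB 2%:R) {1}/ev /=.
by field.
Qed.

(** The affine normalisation does not affect f, because the weights sum to 0. The factors [Th]
    within a block multiply to [Th ^ sB], that is th ^+ [commonmult] times a power of [xl]. *)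
Lemma chart_sol (F : fieldType) (x : (I + W) + ('I_3 + unit) -> F) (v : W -> F) (th : F) :
  (forall j, (sB j)%:~R != 0 :> F) -> th != 0 -> (forall k, v k != 0) ->
  (forall y, sys_d x y = tgt_d v th y) -> (forall k, xl x (g k) != 0) -> injective (Qv x) ->
  sol_c s i0 i1 (fun k => th ^+ commonmult * v k)
    (fun a => (Qv x a - Qv x i0) / (Qv x i1 - Qv x i0))
    (fun k => (Cv x k - Qv x i0) / (Qv x i1 - Qv x i0)).
Proof.
move=> sBF th0 v0 hx hl Qi.
have xtE : xt x = th := hx (inr (inr tt)).
have r0 : Qv x i1 - Qv x i0 != 0 by rewrite subr_eq0; apply: contra_neq i01 => /Qi.
have Th0 k : Th x (g k) != 0 by rewrite /Th xtE mulf_neq0 ?expf_neq0.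
have d0 k a : dv x k a != 0.
  have := hx (inr (inl (inr k))); rewrite /= => e.
  apply: (prod_expz_neq0 (n := s) s0 (f := dv x k)).
  by have := v0 k; rewrite -e mulf_eq0 negb_or => /andP[].
have dE k a : Cv x k - Qv x a = (if g k == b a then Th x (g k) else 1) * dv x k a.
  rewrite /dv /Cv /Qv; case: eqP => [<-|_]; by ring.
have rE z z' : (z - Qv x i0) / (Qv x i1 - Qv x i0) - (z' - Qv x i0) / (Qv x i1 - Qv x i0) =
   (z - z') / (Qv x i1 - Qv x i0) by field.
have CQ k a : Cv x k - Qv x a != 0 by rewrite dE mulf_neq0 ?d0//; case: ifP => _; rewrite ?oner_eq0.
split.
- by move=> a a' /(mulIf (invr_neq0 r0))/addIr/Qi.
- by move=> k a; rewrite -subr_eq0 rE mulf_neq0 ?invr_neq0.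
- rewrite (eq_bigr (fun a => ((s a)%:~R * Qv x a - (s a)%:~R * Qv x i0) / (Qv x i1 - Qv x i0))); last first.
    by move=> a _; field.
  rewrite -mulr_suml sumrB sum_ev// -mulr_suml -(rmorph_sum intr) ssum.
  by rewrite mul0r subr0 mul0r.
- by rewrite subrr mul0r mulfV.
move=> k; split.
  rewrite (eq_bigr (fun a => ((s a)%:~R * ((if g k == b a then 1 else Th x (g k)) * (dv x k a)^-1)) *
     ((Qv x i1 - Qv x i0) / Th x (g k)))); last first.
    move=> a _; rewrite rE dE; case: ifP => _; field; by rewrite ?d0 ?Th0 ?r0.
  by rewrite -mulr_suml; have h1 := hx (inr (inl (inl k))); rewrite /= in h1; rewrite h1 mul0r.
rewrite (eq_bigr (fun a => (Qv x i1 - Qv x i0)^-1 ^ s a *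
   ((if g k == b a then Th x (g k) ^ s a else 1) * dv x k a ^ s a))); last first.
  move=> a _; rewrite rE dE expfzMl expfzMl mulrC; congr (_ * (_ * _)).
  by case: ifP => _; rewrite ?exp1rz // /Th expfzMl.
rewrite big_split /= prod_expz ?invr_neq0// ssum expr0z mul1r big_split /=.
have -> : \prod_a (if g k == b a then Th x (g k) ^ s a else 1) = Th x (g k) ^ sB (g k).
  by rewrite -big_mkcond prod_expz//; congr (_ ^ _); apply: eq_bigl => a; rewrite eq_sym.
have e2 := hx (inr (inl (inr k))); rewrite /= in e2; rewrite -e2.
by rewrite /Th xtE expfzMl ex_mul ?sBpos ?g_multi// mulrA.
Qed.

Section Derivative.
Variables (K : numFieldType) (z : (I + W) + ('I_3 + unit) -> K).
Hypotheses (dv0 : forall k a, dv z k a != 0) (xl0 : forall j, xl z j != 0).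

Definition LTh j (w : (I + W) + ('I_3 + unit) -> K) : K :=
  xt z ^+ ex j * xl w j + (ex j)%:R * xt z ^+ (ex j).-1 * xt w * xl z j.
Definition Lev (j : 'I_3) (w : (I + W) + ('I_3 + unit) -> K) : K :=
  if j == 0 then 0 else if j == 1 then 0 else
  - ((sB 2%:R)%:~R^-1 * (0 + \sum_a (s a)%:~R * (Th z (b a) * xa w a + LTh (b a) w * xa z a))).
Definition LQ a w := Lev (b a) w + (Th z (b a) * xa w a + LTh (b a) w * xa z a).
Definition LC k w := Lev (g k) w + (Th z (g k) * xh w k + LTh (g k) w * xh z k).
Definition Ld k a w := if g k == b a then xh w k - xa w a else LC k w - LQ a w.
Definition dsys_d (y : ('I_3 + 'I_3) + ((W + W) + unit)) (w : (I + W) + ('I_3 + unit) -> K) : K :=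
  match y with
  | inl (inl j) => xa w (rp j)
  | inl (inr j) => if multi j then xa w (rp' j) else xl w j
  | inr (inl (inl k)) => \sum_a (s a)%:~R *
      ((if g k == b a then 1 else Th z (g k)) * - (Ld k a w / dv z k a ^+ 2) +
       (if g k == b a then 0 else LTh (g k) w) * (dv z k a)^-1)
  | inr (inl (inr k)) => xl z (g k) ^ sB (g k) *
      ((\prod_a dv z k a ^ s a) * \sum_a (s a)%:~R * (Ld k a w / dv z k a)) +
      (xl z (g k) ^ sB (g k) * ((sB (g k))%:~R * (xl w (g k) / xl z (g k)))) *
        \prod_a dv z k a ^ s a
  | inr (inr _) => xt w
  end.

Lemma dsys_d_deriv (F : fieldType) (p : place F K) (x x' : (I + W) + ('I_3 + unit) -> F) (N : F)
    (w : (I + W) + ('I_3 + unit) -> K) :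
  N != 0 -> (forall i, dd p N w (x i) (x' i) (z i) (fun z => z i)) ->
  forall y, dd p N w (sys_d x y) (sys_d x' y) (sys_d z y) (dsys_d y).
Proof.
move=> N0 h.
have dTh j : dd p N w (Th x j) (Th x' j) (Th z j) (LTh j).
  exact: (dd_mul N0 (dd_expn N0 (ex j) (h (inr (inr tt)))) (h (inr (inl j)))).
have dTx a : dd p N w (Th x (b a) * xa x a) (Th x' (b a) * xa x' a) (Th z (b a) * xa z a)
   (fun w => Th z (b a) * xa w a + LTh (b a) w * xa z a).
  exact: (dd_mul N0 (dTh (b a)) (h (inl (inl a)))).
have dTc k : dd p N w (Th x (g k) * xh x k) (Th x' (g k) * xh x' k) (Th z (g k) * xh z k)
   (fun w => Th z (g k) * xh w k + LTh (g k) w * xh z k).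
  exact: (dd_mul N0 (dTh (g k)) (h (inl (inr k)))).
have dev j : dd p N w (ev x j) (ev x' j) (ev z j) (Lev j).
  rewrite /ev /Lev; case: ifP => _; first by apply: dd_const; exact: spec0.
  case: ifP => _; first by apply: dd_const; exact: spec1.
  rewrite ![_ * (sB 2%:R)%:~R^-1]mulrC; apply: (dd_opp N0); apply: (dd_scale N0).
    by apply: specV; [exact: spec_int | rewrite intr_eq0 sB_neq0].
  apply: (dd_add N0); first by apply: dd_const; exact: spec_int.
  by apply: (dd_sum N0) => a _; apply: (dd_scale N0); [exact: spec_int | exact: dTx].
have dQ a : dd p N w (Qv x a) (Qv x' a) (Qv z a) (LQ a) by exact: (dd_add N0 (dev _) (dTx a)).
have dC k : dd p N w (Cv x k) (Cv x' k) (Cv z k) (LC k) by exact: (dd_add N0 (dev _) (dTc k)).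
have ddv k a : dd p N w (dv x k a) (dv x' k a) (dv z k a) (Ld k a).
  rewrite /dv /Ld; case: ifP => _; last exact: (dd_sub N0 (dC k) (dQ a)).
  exact: (dd_sub N0 (h (inl (inr k))) (h (inl (inl a)))).
case=> [[j|j]|[[k|k]|[]]]; rewrite /=.
- exact: h.
- have -> : dsys_d (inl (inr j)) = fun w => if multi j then xa w (rp' j) else xl w j by [].
  by case: (multi j); exact: h.
- have dm a : dd p N w (if g k == b a then 1 else Th x (g k)) (if g k == b a then 1 else Th x' (g k))
      (if g k == b a then 1 else Th z (g k)) (fun w => if g k == b a then 0 else LTh (g k) w).
    by case: (g k == b a); [apply: dd_const; exact: spec1 | exact: dTh].
  exact: (dd_sum N0 (fun a _ => dd_scale N0 (spec_int p (s a))
    (dd_mul N0 (dm a) (dd_inv N0 (dv0 k a) (ddv k a))))).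
- exact: (dd_mul N0 (dd_expz N0 (sB (g k)) (xl0 _) (h (inr (inl (g k)))))
    (dd_prodz N0 s (P := predT) (fun a _ => dv0 k a) (fun a _ => ddv k a))).
exact: h.
Qed.

Variable v : W -> K.
Hypotheses (vI : injective v) (v0 : forall k, v k != 0).
Hypothesis hz : forall y, sys_d z y = tgt_d v 0 y.
Hypothesis zinj : forall a a', b a = b a' -> xa z a = xa z a' -> a = a'.

Let zt : xt z = 0. Proof. exact: (hz (inr (inr tt))). Qed.
Let Thz j : Th z j = 0. Proof. by rewrite /Th zt expr0n eqn0Ngt ex_gt0 mul0r. Qed.
Let Cvz k : Cv z k = ev z (g k). Proof. by rewrite /Cv Thz mul0r addr0. Qed.
Let critz k : \sum_(a | b a == g k) (s a)%:~R / (xh z k - xa z a) = 0.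
Proof.
have := hz (inr (inl (inl k))); rewrite /= => e; rewrite -[RHS]e [RHS](bigID (fun a => b a == g k)) /=.
rewrite [X in _ = _ + X]big1 ?addr0 => [|a /negbTE h]; last first.
  by rewrite eq_sym h Thz mul0r mulr0.
by apply: eq_bigr => a /eqP h; rewrite /dv h eqxx mul1r.
Qed.

(** At [xt = 0] the blocks decouple. In a block with several labels [critical_affine] applies, now
    with a constant term for the variation of the dilation; fixing two labels kills the affine
    motion, and then the dilation and the critical points. *)
Lemma dsys_d_inj w : (forall y, dsys_d y w = 0) -> forall i, w i = 0.
Proof.
move=> h; have wt : xt w = 0 := h (inr (inr tt)).
have wTh j : LTh j w = 0 by rewrite /LTh wt zt expr0n eqn0Ngt ex_gt0 mulr0 !mul0r addr0.
have wev j : Lev j w = 0.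
  rewrite /Lev; case: ifP => // _; case: ifP => // _.
  by rewrite big1 ?addr0 ?mulr0 ?oppr0// => a _; rewrite Thz wTh !mul0r addr0 mulr0.
have wQ a : LQ a w = 0 by rewrite /LQ wev Thz wTh !mul0r !addr0.
have wC k : LC k w = 0 by rewrite /LC wev Thz wTh !mul0r !addr0.
have wd k a : Ld k a w = if g k == b a then xh w k - xa w a else 0.
  by rewrite /Ld wC wQ subrr.
have prod0 k : \prod_a dv z k a ^ s a != 0.
  by apply/prodf_neq0 => a _; rewrite expfz_neq0.
have key j : multi j -> [/\ forall a, b a = j -> xa w a = 0, xl w j = 0 &
    forall k, g k = j -> xh w k = 0].
  move=> mj; pose A : pred I := fun a => b a == j; pose V : pred W := fun k => g k == j.
  have char0 n : n != 0 -> n%:~R != 0 :> K by rewrite intr_eq0.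
  have qi : {in A &, injective (xa z)}.
    by move=> a a' /eqP ba /eqP ba'; apply: zinj; rewrite ba.
  have dvE k a : V k -> A a -> dv z k a = xh z k - xa z a by move=> /eqP gk /eqP ba; rewrite /dv gk ba eqxx.
  have ci : {in V &, injective (xh z)}.
    move=> k l /eqP gk /eqP gl e; apply: vI.
    have hk := hz (inr (inl (inr k))); have hl := hz (inr (inl (inr l))).
    rewrite /= in hk hl; rewrite -hk -hl gk gl; congr (_ * _).
    by apply: eq_bigr => a _; rewrite /dv gk gl e !Cvz gk gl.
  have cq k a : V k -> A a -> xh z k != xa z a by move=> Vk Aa; rewrite -subr_eq0 -dvE.
  have cr k : V k -> \sum_(a | A a) (s a)%:~R / (xh z k - xa z a) = 0.
    by move=> /eqP gk; rewrite /A -gk critz.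
  have cVA : (#|V| + 1 = #|A|)%N by exact: bal j.
  have sz : (size (numer A (xa z) (fun a => (s a)%:~R)) <= #|V|.+1)%N.
    by rewrite -addn1 cVA; exact: size_numer.
  (* Minus the logarithmic variation of [xl ^ sB], the only effect of the dilation on the critical
     values of the block. *)
  pose H := - ((sB j)%:~R * (xl w j / xl z j)).
  have rel k : V k -> H + \sum_(a | A a) (s a)%:~R * xa w a / (xh z k - xa z a) = 0.
    move=> Vk; have /eqP gk := Vk; have := h (inr (inl (inr k))); rewrite /= gk => e.
    have e1 : \sum_a (s a)%:~R * (Ld k a w / dv z k a) + (sB j)%:~R * (xl w j / xl z j) = 0.
      apply: (mulfI (expfz_neq0 (sB j) (xl0 j))); apply: (mulfI (prod0 k)).
      by rewrite !mulr0 -[RHS]e; ring.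
    have e2 : \sum_a (s a)%:~R * (Ld k a w / dv z k a) =
       xh w k * (\sum_(a | A a) (s a)%:~R / (xh z k - xa z a)) -
       \sum_(a | A a) (s a)%:~R * xa w a / (xh z k - xa z a).
      rewrite (bigID A) /= [X in _ + X]big1 ?addr0 => [|a]; last first.
        by rewrite /A wd gk eq_sym => /negbTE->; rewrite mul0r mulr0.
      rewrite mulr_sumr -sumrB; apply: eq_bigr => a Aa.
      by rewrite wd gk (eqP Aa) eqxx (dvE k)//; ring.
    move: e1; rewrite e2 cr// mulr0 sub0r /H => /eqP; rewrite addrC subr_eq0 => /eqP ->.
    by rewrite addNr.
  have szy : (size (H *: denom A (xa z) + numer A (xa z) (fun a => (s a)%:~R * xa w a))%R <= #|V|.+2)%N.
    rewrite -addn2 -[2%N]/(1 + 1)%N addnA cVA (leq_trans (size_polyD _ _))// geq_max.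
    rewrite (leq_trans (size_scale_leq _ _)) ?size_denom ?addn1//=.
    by rewrite (leq_trans (size_numer _ _ _)).
  have Arp : A (rp j) by rewrite /A b_rp.
  have [al [be hab]] := critical_affine qi ci cq (fun a _ => char0 _ (s0 a)) cr sz Arp rel szy.
  have wE a : A a -> xa w a = al * xa z a + be.
    by move=> Aa; apply: (mulfI (char0 _ (s0 a))); rewrite hab.
  have be0 : be = 0.
    have h1 := hz (inl (inl j)); rewrite /= in h1.
    by have := h (inl (inl j)); rewrite /= wE// h1 mulr0 add0r.
  have Arp' : A (rp' j) by rewrite /A b_rp'.
  have al0 : al = 0.
    have := h (inl (inr j)); rewrite /= mj wE// be0 addr0.
    by have := hz (inl (inr j)); rewrite /= mj => ->; rewrite mulr1.
  have wa a : A a -> xa w a = 0 by move=> Aa; rewrite wE// al0 be0 mul0r addr0.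
  have wl : xl w j = 0.
    have [k gk] := multi_g mj; have := rel k; rewrite /V gk eqxx big1 ?addr0 => [/(_ isT)/eqP|a Aa].
      rewrite /H oppr_eq0 mulf_eq0 intr_eq0 (negbTE (sB_neq0 j)) mulf_eq0 invr_eq0 (negbTE (xl0 j)).
      by rewrite orbF => /eqP.
    by rewrite wa// mulr0 mul0r.
  split=> [a ba||k gk]; [by apply: wa; rewrite /A ba|exact: wl|].
  have Vk : V k by rewrite /V gk.
  have := h (inr (inl (inl k))); rewrite /= (bigID A) /= [X in _ + X]big1 ?addr0 => [|a]; last first.
    rewrite /A gk eq_sym => /negbTE e; rewrite wd gk e Thz wTh !mul0r addr0 mulr0//.
  rewrite (eq_bigr (fun a => - xh w k * ((s a)%:~R / (xh z k - xa z a) ^+ 2))) => [|a Aa]; last first.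
    by rewrite wd gk (eqP Aa) eqxx (dvE k)// wa//; ring.
  rewrite -mulr_sumr => /eqP; rewrite mulf_eq0 oppr_eq0 => /orP[/eqP//|].
  by rewrite (negbTE (critical_simple qi ci cq (fun a _ => char0 _ (s0 a)) cr sz Arp Vk)).
case=> [[a|k]|[j|[]]].
- have [mj|nm] := boolP (multi (b a)); first by have [+ _ _] := key _ mj; apply.
  rewrite (single_rp nm erefl); exact: (h (inl (inl (b a)))).
- by have [_ _ +] := key _ (g_multi k); apply.
- have [mj|nm] := boolP (multi j); first by have [_ + _] := key _ mj.
  by have := h (inl (inr j)); rewrite /= (negbTE nm).
exact: wt.
Qed.

End Derivative.

Section Transfer.
Variables (R : realType) (u : ultra nat) (x : nat -> (I + W) + ('I_3 + unit) -> R[i]).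
Let X i := upi u (fun t => x t i).

Lemma Th_upi j : Th X j = upi u (fun t => Th (x t) j).
Proof. by rewrite /Th /xt /xl /X upiX upiM. Qed.

Lemma ev_upi j : ev X j = upi u (fun t => ev (x t) j).
Proof.
rewrite /ev; case: ifP => _; first exact: upi0.
case: ifP => _; first exact: upi1.
under eq_bigr do rewrite Th_upi upiM upi_int upiM.
by rewrite upi_sum !upi_int upiD upiV upiM upiN.
Qed.

Lemma Qv_upi a : Qv X a = upi u (fun t => Qv (x t) a).
Proof. by rewrite /Qv ev_upi Th_upi upiM upiD. Qed.

Lemma Cv_upi k : Cv X k = upi u (fun t => Cv (x t) k).
Proof. by rewrite /Cv ev_upi Th_upi upiM upiD. Qed.

Lemma sys_d_upi y : sys_d X y = upi u (fun t => sys_d (x t) y).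
Proof.
have ud k a : dv X k a = upi u (fun t => dv (x t) k a).
  by rewrite /dv; case: ifP => _; rewrite ?Qv_upi ?Cv_upi upiB.
case: y => [[j|j]|[[k|k]|[]]] //=.
- by case: ifP.
- rewrite -upi_sum; apply: eq_bigr => a _; rewrite ud upiV upi_int.
  by case: ifP => _; rewrite ?Th_upi ?upi1 !upiM.
rewrite -upiM -upi_prod /xl upiXz; congr (_ * _).
by apply: eq_bigr => a _; rewrite ud upiXz.
Qed.

End Transfer.

End Fixed.
End Chart.

(** * Limit charts and the solutions near them *)

Section Degeneration.
Variables (I W : finType) (s : I -> int) (i0 i1 : I).
Hypotheses (s0 : forall a, s a != 0) (ssum : \sum_a s a = 0).
Hypothesis cardIW : (#|I| = #|W| + 3)%N.
Hypothesis i01 : i0 != i1.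
Notation L := (commonmult s).
Notation XT := ((I + W) + ('I_3 + unit))%type.

Definition balanced (b : {ffun I -> 'I_3}) (g : {ffun W -> 'I_3}) :=
  forall j, (#|[pred k | g k == j]| + 1 = #|[pred a | b a == j]|)%N.
Definition pos_blocks (b : {ffun I -> 'I_3}) := forall j, multi i0 b j -> 0 < sB s b j.

Record limit_chart (K : numFieldType) (v : W -> K) b g (z : XT -> K) : Prop := LimitChart {
  lc_can : can b;
  lc_bal : balanced b g;
  lc_pos : pos_blocks b;
  lc_sys : forall y, sys_d s i0 b g z y = tgt_d v 0 y;
  lc_inj : forall a a', b a = b a' -> xa z a = xa z a' -> a = a' }.

Lemma can_surj (b : {ffun I -> 'I_3}) : can b -> surj b. Proof. by case/andP. Qed.

Section Limit.
Variables (K : numFieldType) (v : W -> K) (b : {ffun I -> 'I_3}) (g : {ffun W -> 'I_3}) (z : XT -> K).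
Hypotheses (bs : surj b) (bal : balanced b g) (bp : pos_blocks b) (zt : xt z = 0).

Lemma Th_limit j : Th s b z j = 0.
Proof. by rewrite /Th zt expr0n eqn0Ngt ex_gt0 mul0r. Qed.

Lemma ev_limit j : ev s b z j = if j == 0 then 0 else if j == 1 then 1 else
  - ((sB s b 1)%:~R / (sB s b 2%:R)%:~R).
Proof.
rewrite /ev; case: ifP => // _; case: ifP => // _.
by rewrite big1 ?addr0// => a _; rewrite Th_limit mul0r mulr0.
Qed.

(** The third centre is not 0 as the weight of block 1 is nonzero, and not 1 as otherwise block 0
    would have weight 0. *)
Lemma ev_limit_inj : injective (ev s b z).
Proof.
have n0 j : (sB s b j)%:~R != 0 :> K by rewrite intr_eq0; apply: sB_neq0 bs bp j.
have r0 : - ((sB s b 1)%:~R / (sB s b 2%:R)%:~R) != 0 :> K.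
  by rewrite oppr_eq0 mulf_neq0 ?invr_eq0.
have r1 : - ((sB s b 1)%:~R / (sB s b 2%:R)%:~R) != 1 :> K.
  apply/eqP => /(congr1 (fun t => t * (sB s b 2%:R)%:~R)); rewrite mulNr mulfVK// mul1r => /eqP.
  rewrite eq_sym -subr_eq0 opprK -rmorphD intr_eq0.
  have := sB_sum ssum b; rewrite -addrA => /eqP; rewrite addr_eq0 addrC => /eqP e.
  by have := sB_neq0 s0 bs bp 0; rewrite e oppr_eq0 addrC => /negbTE->.
move=> j j'; rewrite !ev_limit.
have [->|->|->] := ord3P j; have [->|->|->] := ord3P j' => //=.
- by move/eqP; rewrite eq_sym oner_eq0.
- by move/eqP; rewrite eq_sym (negbTE r0).
- by move/eqP; rewrite oner_eq0.
- by move/eqP; rewrite eq_sym (negbTE r1).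
- by move/eqP; rewrite (negbTE r0).
by move/eqP; rewrite (negbTE r1).
Qed.

Hypotheses (v0 : forall k, v k != 0) (zs : forall y, sys_d s i0 b g z y = tgt_d v 0 y).

Lemma dv_limit k a : dv s b g z k a != 0.
Proof.
have := zs (inr (inl (inr k))); rewrite /= => e.
apply: (prod_expz_neq0 (n := s) s0 (f := dv s b g z k)).
by have := v0 k; rewrite -e mulf_eq0 negb_or => /andP[].
Qed.

Lemma xl_limit j : xl z j != 0.
Proof.
have [mj|nm] := boolP (multi i0 b j); last first.
  by have := zs (inl (inr j)); rewrite /= (negbTE nm) => ->; exact: oner_neq0.
have [k gk] := multi_g ssum cardIW i01 bs bal mj.
have := zs (inr (inl (inr k))); rewrite /= gk => e.
have := v0 k; rewrite -e mulf_eq0 negb_or => /andP[+ _].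
apply: contra => /eqP ->; have := bp mj; case: (sB s b j) => // -[//|n] _.
by rewrite -exprnP expr0n.
Qed.

End Limit.

Section Reduction.
Variables (F : fieldType) (K : numFieldType) (p : place F K) (th : F).
Variables (v' : W -> F) (v : W -> K).
Hypotheses (hv : forall k, spec p (v' k) (v k)) (v0 : forall k, v k != 0) (vI : injective v).
Hypotheses (hth : spec p th 0) (th0 : th != 0).

Lemma spec_Qv b g (x : XT -> F) z : surj b -> pos_blocks b -> xt z = 0 ->
  (forall i, spec p (x i) (z i)) ->
  (forall a, spec p (Qv s b x a) (ev s b z (b a))) /\
  (forall k, spec p (Cv s b g x k) (ev s b z (g k))).
Proof.
move=> bs bp zt hx.
have hTh j : spec p (Th s b x j) 0.
  rewrite -(Th_limit b zt j) /Th; apply: specM; first exact: (specX _ (hx (inr (inr tt)))).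
  exact: hx (inr (inl j)).
have hTx (t : F) (u : K) j : spec p t u -> spec p (Th s b x j * t) 0.
  by move=> h; rewrite -(mul0r u); apply: specM (hTh j) h.
have hev j : spec p (ev s b x j) (ev s b z j).
  rewrite ev_limit// /ev; case: ifP => _; first exact: spec0.
  case: ifP => _; first exact: spec1.
  apply: specN; apply: specM; last by apply: specV; [exact: spec_int | rewrite intr_eq0; exact: (sB_neq0 s0 bs bp)].
  rewrite -[X in spec _ _ X]addr0; apply: specD; first exact: spec_int.
  have -> : 0 = \sum_(a : I) (s a)%:~R * 0 :> K by rewrite big1// => a _; rewrite mulr0.
  apply: spec_sum => a _; apply: specM; first exact: spec_int.
  exact: (hTx _ _ _ (hx (inl (inl a)))).
split=> [a|k]; rewrite /Qv /Cv -[X in spec _ _ X]addr0; apply: specD; rewrite ?hev//.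
  exact: (hTx _ _ _ (hx (inl (inl a)))).
exact: (hTx _ _ _ (hx (inl (inr k)))).
Qed.

Lemma chart_Q_inj b g (x : XT -> F) z : limit_chart v b g z -> (forall i, spec p (x i) (z i)) ->
  (forall y, sys_d s i0 b g x y = tgt_d v' th y) ->
  injective (Qv s b x) /\ (forall j, xl x j != 0).
Proof.
move=> [bc bal bp zs zi] hx xs; have bs := can_surj bc; have zt : xt z = 0 := zs (inr (inr tt)).
have xl0 j : xl x j != 0 by apply: (spec_neq0 (hx (inr (inl j)))); exact: xl_limit zs j.
have [hQ _] := spec_Qv g bs bp zt hx.
split=> // a a' e.
have bb : b a = b a'.
  by apply: (ev_limit_inj bs bp zt); apply: spec_uniq (hQ a) _; rewrite e.
apply: zi => //; have : xa x a = xa x a'.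
  move: e; rewrite /Qv bb => /addrI/mulfI; apply.
  by rewrite /Th mulf_neq0// expf_neq0//; have := xs (inr (inr tt)) => /= ->.
by move=> e'; apply: spec_uniq (hx (inl (inl a))) _; have := hx (inl (inl a')); rewrite -/(xa x a') -e'.
Qed.

(** A solution determines its chart: the blocks are the sets of labels that collide, the canonical
    labelling orders them, and the remaining unknowns are read off from the positions. *)
Lemma chart_rec b g b' g' (x x' : XT -> F) z z' :
  limit_chart v b g z -> limit_chart v b' g' z' ->
  (forall i, spec p (x i) (z i)) -> (forall i, spec p (x' i) (z' i)) ->
  (forall y, sys_d s i0 b g x y = tgt_d v' th y) -> (forall y, sys_d s i0 b' g' x' y = tgt_d v' th y) ->
  (forall a, (Qv s b x a - Qv s b x i0) / (Qv s b x i1 - Qv s b x i0) =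
             (Qv s b' x' a - Qv s b' x' i0) / (Qv s b' x' i1 - Qv s b' x' i0)) ->
  (forall k, (Cv s b g x k - Qv s b x i0) / (Qv s b x i1 - Qv s b x i0) =
             (Cv s b' g' x' k - Qv s b' x' i0) / (Qv s b' x' i1 - Qv s b' x' i0)) ->
  [/\ b = b', g = g' & forall i, x i = x' i].
Proof.
move=> h h' hx hx' xs xs' eQ eC.
have [Qi xl0] := chart_Q_inj h hx xs; have [Qi' xl0'] := chart_Q_inj h' hx' xs'.
case: (h) => bc bal bp zs zi; case: (h') => bc' bal' bp' zs' zi'.
have bs := can_surj bc; have bs' := can_surj bc'.
have zt : xt z = 0 := zs (inr (inr tt)); have zt' : xt z' = 0 := zs' (inr (inr tt)).
have [hQ hC] := spec_Qv g bs bp zt hx; have [hQ' hC'] := spec_Qv g' bs' bp' zt' hx'.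
set D := Qv s b x i1 - Qv s b x i0 in eQ eC; set D' := Qv s b' x' i1 - Qv s b' x' i0 in eQ eC.
have D0 : D != 0 by rewrite subr_eq0; apply: contra_neq i01 => /Qi.
have D0' : D' != 0 by rewrite subr_eq0; apply: contra_neq i01 => /Qi'.
(* B compares the scales of the two charts. B and its inverse are finite, because all centres are
   finite and blocks 0 and 1 are at distance 1 in either chart; hence the same labels collide in
   both. *)
pose B := D' / D; have B0 : B != 0 by rewrite mulf_neq0 ?invr_eq0.
have dQ a a' : Qv s b' x' a - Qv s b' x' a' = B * (Qv s b x a - Qv s b x a').
  have -> : B * (Qv s b x a - Qv s b x a') = D' * ((Qv s b x a - Qv s b x i0) / D) -
     D' * ((Qv s b x a' - Qv s b x i0) / D) by rewrite /B; field.
  by rewrite !eQ; field.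
have dC k a : Cv s b' g' x' k - Qv s b' x' a = B * (Cv s b g x k - Qv s b x a).
  have -> : B * (Cv s b g x k - Qv s b x a) = D' * ((Cv s b g x k - Qv s b x i0) / D) -
     D' * ((Qv s b x a - Qv s b x i0) / D) by rewrite /B; field.
  by rewrite eQ eC; field.
have rp1 : spec p (Qv s b x (rp i0 b 1) - Qv s b x (rp i0 b 0)) 1.
  have := specB (hQ (rp i0 b 1)) (hQ (rp i0 b 0)).
  by rewrite !b_rp// !ev_limit//= subr0.
have rp1' : spec p (Qv s b' x' (rp i0 b' 1) - Qv s b' x' (rp i0 b' 0)) 1.
  have := specB (hQ' (rp i0 b' 1)) (hQ' (rp i0 b' 0)).
  by rewrite !b_rp// !ev_limit//= subr0.
have [be hB] : exists be, spec p B be.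
  have h1 := specB (hQ' (rp i0 b 1)) (hQ' (rp i0 b 0)); rewrite dQ in h1.
  have h2 := specM h1 (specV rp1 (oner_neq0 _)).
  by rewrite mulfK ?(spec_neq0 rp1 (oner_neq0 _))// in h2; eexists; exact: h2.
have [be' hB'] : exists be, spec p B^-1 be.
  have h1 := specB (hQ (rp i0 b' 1)) (hQ (rp i0 b' 0)).
  have h2 := specM h1 (specV rp1' (oner_neq0 _)).
  have e : (Qv s b x (rp i0 b' 1) - Qv s b x (rp i0 b' 0)) /
     (Qv s b' x' (rp i0 b' 1) - Qv s b' x' (rp i0 b' 0)) = B^-1.
    have := spec_neq0 rp1' (oner_neq0 _); rewrite dQ mulf_eq0 negb_or => /andP[_ n0].
    by field; rewrite B0 n0.
  by rewrite e in h2; eexists; exact: h2.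
have bb : b = b'.
  apply: can_same => //; apply/sameP => a a'; apply/eqP/eqP => e.
    have h0 := specB (hQ a) (hQ a'); rewrite e subrr in h0.
    have h1 := specM hB h0; rewrite mulr0 -dQ in h1.
    apply: (ev_limit_inj bs' bp' zt'); apply/eqP; rewrite -subr_eq0; apply/eqP.
    exact: spec_uniq (specB (hQ' a) (hQ' a')) h1.
  have h0 := specB (hQ' a) (hQ' a'); rewrite e subrr dQ in h0.
  have h1 := specM hB' h0; rewrite mulr0 mulKf// in h1.
  apply: (ev_limit_inj bs bp zt); apply/eqP; rewrite -subr_eq0; apply/eqP.
  exact: spec_uniq (specB (hQ a) (hQ a')) h1.
subst b'.
have Qrp j : Qv s b x (rp i0 b j) = ev s b x j.
  by rewrite /Qv b_rp// (xs (inl (inl j)) : xa x _ = _) mulr0 addr0.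
have Qrp' j : Qv s b x' (rp i0 b j) = ev s b x' j.
  by rewrite /Qv b_rp// (xs' (inl (inl j)) : xa x' _ = _) mulr0 addr0.
have B1 : B = 1.
  by have := dQ (rp i0 b 1) (rp i0 b 0); rewrite !Qrp !Qrp' /ev /= subr0 mulr1.
have QQ a : Qv s b x' a = Qv s b x a.
  by have := dQ a (rp i0 b 0); rewrite B1 mul1r Qrp Qrp' /ev /= !subr0.
have CC k : Cv s b g' x' k = Cv s b g x k.
  by have := dC k (rp i0 b 0); rewrite B1 mul1r Qrp Qrp' /ev /= !subr0.
have evv j : ev s b x' j = ev s b x j by rewrite -Qrp -Qrp' QQ.
have gg : g = g'.
  apply/ffunP => k; apply: (ev_limit_inj bs bp zt).
  have := spec_uniq (hC k) _; apply; rewrite -CC.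
  by have := hC' k; rewrite !ev_limit.
subst g'.
have tt' : xt x = th := xs (inr (inr tt)); have ttt : xt x' = th := xs' (inr (inr tt)).
(* In both charts the marked label [rp'] has rescaled position 1, so its distance from the centre of
   the block is [Th] itself. *)
have Thm j : multi i0 b j -> Th s b x j = Th s b x' j.
  move=> mj; have e1 := QQ (rp' i0 b j); rewrite /Qv b_rp'// evv in e1.
  have x1 := xs (inl (inr j)); have x2 := xs' (inl (inr j)); rewrite /= mj in x1 x2.
  by move: e1; rewrite x1 x2 !mulr1 => /addrI.
have Th0 j : Th s b x j != 0 by rewrite /Th tt' mulf_neq0// expf_neq0.
have xll j : xl x j = xl x' j.
  have [mj|nm] := boolP (multi i0 b j); last first.
    by have x1 := xs (inl (inr j)); have x2 := xs' (inl (inr j)); rewrite /= (negbTE nm) in x1 x2; rewrite x1 x2.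
  have := Thm j mj; rewrite /Th tt' ttt => /mulfI; apply.
  by rewrite expf_neq0.
split=> // -[[a|k]|[j|[]]].
- have [mj|nm] := boolP (multi i0 b (b a)); last first.
    have x1 := xs (inl (inl (b a))); have x2 := xs' (inl (inl (b a))); rewrite /= in x1 x2.
    by rewrite (single_rp nm erefl) -/(xa x _) -/(xa x' _) x1 x2.
  have := QQ a; rewrite /Qv evv => /addrI; by rewrite -(Thm _ mj) => /(mulfI (Th0 _))/esym.
- have := CC k; rewrite /Cv evv => /addrI.
  by rewrite -(Thm _ (g_multi ssum cardIW i01 bs bal k)) => /(mulfI (Th0 _))/esym.
- exact: xll.
exact: etrans tt' (esym ttt).
Qed.

End Reduction.
End Degeneration.

(** * Every solution with infinitesimal critical values comes from a limit chart *)

Section DegenerateSolutions.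
Variables (I W : finType) (s : I -> int) (i0 i1 : I).
Hypotheses (s0 : forall a, s a != 0) (ssum : \sum_a s a = 0).
Hypothesis cardIW : (#|I| = #|W| + 3)%N.
Hypothesis i01 : i0 != i1.
Notation L := (commonmult s).

Lemma sum_chi_card (P : pred (I + W)) :
  \sum_(x | P x) (chi x : int) = #|[pred k | P (inr k)]|%:Z - #|[pred a | P (inl a)]|%:Z.
Proof.
rewrite big_sumType /= (eq_bigr (fun=> -1)) // [X in _ + X](eq_bigr (fun=> 1)) //.
by rewrite !sumr_const addrC mulNrn !natz.
Qed.

Section Place.
Variables (F : fieldType) (K : numFieldType) (p : place F K).
Variables (v' : W -> F) (v : W -> K).
Hypotheses (hv : forall k, spec p (v' k) (v k)) (v0 : forall k, v k != 0) (vI : injective v).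

Lemma degenerate_clusters (tau : F) (q : I -> F) (c : W -> F) :
  spec p tau 0 -> tau != 0 -> sol_c s i0 i1 (fun k => tau * v' k) q c ->
  exists B : I + W -> 'I_3,
  [/\ forall j, (#|[pred k | B (inr k) == j]| + 1 = #|[pred a | B (inl a) == j]|)%N,
      exists al ro (e : I + W -> K), [/\ ro != 0,
        forall x, spec p ((pt q c x - al) / ro) (e x) & forall x y, (e x = e y) <-> (B x = B y)] &
      forall x y, x != y -> B x = B y -> 0 < \sum_(a | B (inl a) == B x) s a /\
        exists al' ro' (e' : I + W -> K), [/\ ro' != 0,
          forall w, B w = B x -> spec p ((pt q c w - al') / ro') (e' w) &
          forall w w', B w = B x -> B w' = B x -> e' w = e' w' -> w = w']].
Proof.
move=> ht tau0 hs.
have vI' : injective (fun k => tau * v' k).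
  move=> k l /(mulfI tau0) e; apply: vI; apply: spec_uniq (hv k) _; rewrite e; exact: hv.
have ptI := sol_pt_inj vI' hs.
have char0 := @place_char0 F K p.
have [sg sg0 omE] := sol_factor s0 ssum cardIW char0 vI' hs.
have x01 : inl i0 != inl i1 :> (I + W)%type by apply: contra_neq i01 => -[].
have [y0 [y1 [y01 top]]] := top_disc p ptI x01.
have fE k : fval q s (c k) = tau * v' k by case: hs => _ _ _ _ /(_ k)[].
have hm := degenerate_mult ptI omE s0 ssum sg0 cardIW hv v0 vI fE y01 top ht.
have hch := degenerate_child ptI omE s0 ssum sg0 cardIW hv v0 vI fE y01 top ht.
have [x0 [x1 [x2 [n01 n02 n12 hcl]]]] := degenerate_three ptI omE s0 ssum sg0 cardIW hv v0 vI fE y01 top ht.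
set al := pt q c y0 in top hm hch n01 n02 n12 hcl.
set ro := pt q c y1 - al in top hm hch n01 n02 n12 hcl.
have r0 : ro != 0 := pt_sub_neq0 ptI y01.
have hsp x : spec p (coor al ro (pt q c x)) (ee p q c al ro x) by apply: specP; exact: top.
set E := ee p q c al ro in hm hch n01 n02 n12 hcl hsp.
pose B x : 'I_3 := if E x == E x0 then 0 else if E x == E x1 then 1 else 2%:R.
have BE x y : (E x = E y) <-> (B x = B y).
  rewrite /B; split=> [->//|]; have := hcl x; have := hcl y; rewrite !inE.
  have [->|_] := eqVneq (E x) (E x0); have [->|_] := eqVneq (E y) (E x0) => //=.
  - by case: ifP => _ _ _ /(congr1 val).
  - by case: ifP => _ _ _ /(congr1 val).
  have [->|_] := eqVneq (E x) (E x1); have [->|_] := eqVneq (E y) (E x1) => //=.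
  by move=> /eqP-> /eqP->.
have Bs j : exists x, B x = j.
  have [->|->|->] := ord3P j; [exists x0|exists x1|exists x2]; rewrite /B ?eqxx//.
    by rewrite eq_sym (negbTE n01).
  by rewrite eq_sym (negbTE n02) eq_sym (negbTE n12).
have Bin x w : (inn p q c al ro w && (E w == E x)) = (B w == B x).
  by rewrite top /=; apply/eqP/eqP => /BE.
exists B; split.
- move=> j; have [x <-] := Bs j; have := hm x; rewrite /excess (eq_bigl _ _ (Bin x)) sum_chi_card.
  by move: #|_| #|_| => n m; lia.
- by exists al, ro, E.
move=> x y xy /BE exy.
have [z0 [z1 [z01 hc]]] := exists_child ptI r0 xy (top x) (top y) erefl (esym exy).
have [spos sep] := hch x y z0 z1 xy exy z01 hc.
split.
  by move: spos; rewrite /swtc (eq_bigl _ _ (fun a => Bin x (inl a))).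
have hin : forall w, B w = B x -> inn p q c (pt q c z0) (pt q c z1 - pt q c z0) w.
  by case: hc => _ _ _ h w /eqP bw; rewrite h Bin.
exists (pt q c z0), (pt q c z1 - pt q c z0), (ee p q c (pt q c z0) (pt q c z1 - pt q c z0)).
split; first exact: pt_sub_neq0.
  by move=> w /hin; exact: specP.
by move=> w w' /hin h /hin; exact: sep.
Qed.

End Place.

Section FromSolution.
Variables (F : fieldType) (b : {ffun I -> 'I_3}) (g : {ffun W -> 'I_3}) (Q : I -> F) (C : W -> F).
Variables (th : F) (v' : W -> F).
Hypotheses (char0 : forall n : int, n != 0 -> n%:~R != 0 :> F) (th0 : th != 0).
Hypotheses (bs : surj b) (bal : balanced b g) (bp : pos_blocks s i0 b).
Hypotheses (Qi : injective Q) (CQ : forall k a, C k != Q a) (sQ : \sum_a (s a)%:~R * Q a = 0).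
Hypotheses (Q0 : Q (rp i0 b 0) = 0) (Q1 : Q (rp i0 b 1) = 1).
Hypothesis crit : forall k, \sum_a (s a)%:~R / (C k - Q a) = 0.
Hypothesis cval : forall k, \prod_a (C k - Q a) ^ s a = th ^+ L * v' k.

Definition dil j := Q (rp' i0 b j) - Q (rp i0 b j).
(** The inverse of [chart_sol]: the distance [dil] between the two marked labels serves as the
    radius of a block. *)
Definition chart_of (i : (I + W) + ('I_3 + unit)) : F :=
  match i with
  | inl (inl a) => if multi i0 b (b a) then (Q a - Q (rp i0 b (b a))) / dil (b a) else 0
  | inl (inr k) => (C k - Q (rp i0 b (g k))) / dil (g k)
  | inr (inl j) => if multi i0 b j then dil j / th ^+ ex s b j else 1
  | inr (inr _) => th
  end.
Local Notation x := chart_of.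

Let dil0 j : multi i0 b j -> dil j != 0.
Proof. by move=> mj; rewrite subr_eq0; apply: contra_neq mj => /Qi. Qed.
Let Thx j : multi i0 b j -> Th s b x j = dil j.
Proof. by move=> mj; rewrite /Th /xt /xl /= mj mulrC mulfVK// expf_neq0. Qed.
Let gm k : multi i0 b (g k) := g_multi ssum cardIW i01 bs bal k.
Let Tx a : Th s b x (b a) * xa x a = Q a - Q (rp i0 b (b a)).
Proof.
rewrite /xa /=; case: ifP => [mj|/negbT nm]; first by rewrite Thx// mulrC mulfVK// dil0.
by rewrite mulr0 [in RHS](single_rp nm erefl) b_rp// subrr.
Qed.

Let evx j : ev s b x j = Q (rp i0 b j).
Proof.
have [->|->|->] := ord3P j; rewrite /ev /=; rewrite ?Q0 ?Q1//.
have n2 : (sB s b 2%:R)%:~R != 0 :> F by apply: char0; exact: (sB_neq0 s0 bs bp).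
apply: (mulIf n2); rewrite mulNr mulfVK//.
under eq_bigr do rewrite Tx mulrBr.
rewrite sumrB sQ sub0r (sum_if_block b) !(big_mkcond (fun a => b a == _)) /=.
rewrite -!(big_mkcond (fun a => b a == _)) /=.
rewrite (eq_bigr (fun=> 0)) => [|a /eqP->]; last by rewrite Q0 mulr0.
rewrite big1// add0r (eq_bigr (fun a => (s a)%:~R)) => [|a /eqP->]; last by rewrite Q1 mulr1.
rewrite [X in _ - (_ + X)](eq_bigr (fun a => (s a)%:~R * Q (rp i0 b 2%:R))) => [|a /eqP->//].
rewrite -mulr_suml -!(rmorph_sum intr) -/(sB s b 1) -/(sB s b 2%:R).
by ring.
Qed.

Lemma Qv_chart_of a : Qv s b x a = Q a.
Proof. by rewrite /Qv evx Tx; ring. Qed.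

Lemma Cv_chart_of k : Cv s b g x k = C k.
Proof. by rewrite /Cv evx (Thx (gm k)) /xh /=; field; exact: dil0. Qed.

Lemma dv_chart_of k a : dv s b g x k a = (C k - Q a) / (if g k == b a then dil (g k) else 1).
Proof.
rewrite /dv Qv_chart_of Cv_chart_of; case: eqP => [e|_]; last by rewrite divr1.
by rewrite /xh /xa /= -e gm; field; exact: dil0.
Qed.

Lemma chart_of_sys y : sys_d s i0 b g x y = tgt_d v' th y.
Proof.
have D0 k := dil0 (gm k).
case: y => [[j|j]|[[k|k]|[]]] //=.
- by rewrite /xa /= b_rp// subrr mul0r; case: ifP.
- case: ifP => [mj|nm]; last by rewrite /xl /= nm.
  by rewrite /xa /= b_rp'// mj mulfV// dil0.
- rewrite (eq_bigr (fun a => ((s a)%:~R / (C k - Q a)) * dil (g k))).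
    by rewrite -mulr_suml crit mul0r.
  move=> a _; rewrite dv_chart_of (Thx (gm k)); have := CQ k a; rewrite -subr_eq0 => h.
  case: ifP => _; rewrite ?divr1 ?invf_div ?mul1r; first by rewrite mulrA mulrAC.
  by rewrite mulrA mulrAC.
under eq_bigr do rewrite dv_chart_of expfzMl exprz_inv -invr_expz.
rewrite prodf_div cval.
have -> : \prod_a (if g k == b a then dil (g k) else 1) ^ s a = dil (g k) ^ sB s b (g k).
  rewrite (eq_bigr (fun a => if g k == b a then dil (g k) ^ s a else 1)); last first.
    by move=> a _; case: ifP; rewrite ?exp1rz.
  by rewrite -big_mkcond prod_expz//; congr (_ ^ _); apply: eq_bigl => a; rewrite eq_sym.
rewrite /xl /= gm -(ex_mul th (bp (gm k))).
set A := th ^+ _; rewrite expfzMl exprz_inv -invr_expz.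
have A0 : A ^ sB s b (g k) != 0 by rewrite expfz_neq0// expf_neq0.
have D1 : dil (g k) ^ sB s b (g k) != 0 by rewrite expfz_neq0.
by move: A0 D1; move: (A ^ _) (dil _ ^ _) => x1 x2 h1 h2; field; rewrite h1 h2.
Qed.

End FromSolution.

Section Place2.
Variables (F : fieldType) (K : numFieldType) (p : place F K).
Variables (v' : W -> F) (v : W -> K).
Hypotheses (hv : forall k, spec p (v' k) (v k)) (v0 : forall k, v k != 0) (vI : injective v).

(** After moving the marked labels of blocks 0 and 1 to 0 and 1, all chart coordinates of the
    solution are finite: positions within a block by the separation in [degenerate_clusters], the
    dilations by the critical value equation. Their standard parts form the limit chart. *)
Lemma degenerate_chart (th : F) (q : I -> F) (c : W -> F) :
  spec p th 0 -> th != 0 -> sol_c s i0 i1 (fun k => th ^+ L * v' k) q c ->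
  exists b g (x : (I + W) + ('I_3 + unit) -> F) (z : (I + W) + ('I_3 + unit) -> K),
  [/\ limit_chart s i0 v b g z, forall i, spec p (x i) (z i),
      forall y, sys_d s i0 b g x y = tgt_d v' th y,
      forall a, q a = (Qv s b x a - Qv s b x i0) / (Qv s b x i1 - Qv s b x i0) &
      forall k, c k = (Cv s b g x k - Qv s b x i0) / (Qv s b x i1 - Qv s b x i0)].
Proof.
move=> hth th0 hs; have char0 := @place_char0 F K p.
have htau : spec p (th ^+ L) 0.
  by have := specX L hth; rewrite expr0n eqn0Ngt commonmult_gt0.
have tau0 : th ^+ L != 0 by rewrite expf_neq0.
have [B [Bbal [al [ro [e [r0 he eB]]]] Bch]] := degenerate_clusters hv v0 vI htau tau0 hs.
have Bne j : exists a, B (inl a) = j.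
  have : (0 < #|[pred a | B (inl a) == j]|)%N by rewrite -Bbal addn1.
  by case/card_gt0P => a /eqP; exists a.
pose b0 : {ffun I -> 'I_3} := [ffun a => B (inl a)].
have b0s : surj b0 by apply/surjP => j; have [a <-] := Bne j; exists a; rewrite ffunE.
have [bc /sameP bsame] := canonP b0s; set b := canon b0 in bc bsame.
have bs := can_surj bc.
have [pick pickE] := choice Bne.
(* The canonical relabelling is defined on labels only; a critical point takes the block of a label
   in its cluster. *)
pose g : {ffun W -> 'I_3} := [ffun k => b (pick (B (inr k)))].
pose B' x := match x with inl a => b a | inr k => g k end.
have bB a : b a = b (pick (B (inl a))).
  by apply/eqP; rewrite -bsame !ffunE pickE.
have B'E x : B' x = b (pick (B x)) by case: x => [a|k] /=; rewrite ?ffunE.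
have BB x y : (B' x = B' y) <-> (B x = B y).
  split=> [|h]; last by rewrite !B'E h.
  by rewrite !B'E => /eqP; rewrite -bsame !ffunE !pickE => /eqP.
have BBb x y : (B x == B y) = (B' x == B' y) by apply/eqP/eqP => /BB.
have eB' x y : (e x = e y) <-> (B' x = B' y) by split=> [/eB/BB|/BB/eB].
have bal : balanced b g.
  move=> j; have /surjP/(_ j)[a <-] := bs.
  transitivity #|[pred a' | B (inl a') == B (inl a)]|; last first.
    by apply: eq_card => a' /=; rewrite !inE BBb.
  by rewrite -Bbal; congr (_ + _)%N; apply: eq_card => k /=; rewrite !inE BBb.
have ch j : multi i0 b j -> 0 < sB s b j /\
   exists al' ro' (e' : I + W -> K), [/\ ro' != 0,
     forall w, B' w = j -> spec p ((pt q c w - al') / ro') (e' w) &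
     forall w w', B' w = j -> B' w' = j -> e' w = e' w' -> w = w'].
  move=> mj; have bb : B' (inl (rp i0 b j)) = B' (inl (rp' i0 b j)) by rewrite /= b_rp// b_rp'.
  have [|pos [al' [ro' [e' [r0' h1 h2]]]]] := Bch _ _ _ ((BB _ _).1 bb).
    by apply: contra_neq mj => -[].
  have hB w : B' w = j -> B w = B (inl (rp i0 b j)) by move=> h; apply/BB; rewrite h /= b_rp.
  split.
    move: pos; congr (0 < _); apply: eq_bigl => a.
    by rewrite BBb /= b_rp.
  exists al', ro', e'; split=> // [w /hB|w w' /hB h /hB]; [exact: h1|exact: h2].
have bp : pos_blocks s i0 b by move=> j /ch[].
case: (hs) => qi cq sq [q0 q1] hk.
pose R := q (rp i0 b 1) - q (rp i0 b 0).
have rp01 : rp i0 b 1 != rp i0 b 0.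
  by apply/eqP => /(congr1 b); rewrite !b_rp// => /(congr1 val).
have R0 : R != 0 by rewrite subr_eq0; apply: contra_neq rp01 => /qi.
pose Z t := (t - q (rp i0 b 0)) / R.
have ZB t t' : Z t - Z t' = (t - t') / R by rewrite /Z; field.
pose Q a := Z (q a); pose C k := Z (c k).
have Qi : injective Q by move=> a a' /(mulIf (invr_neq0 R0))/addIr/qi.
have CQ k a : C k != Q a by rewrite -subr_eq0 ZB mulf_neq0 ?invr_neq0// subr_eq0.
have ssF : \sum_a (s a)%:~R = 0 :> F by rewrite -(rmorph_sum intr) ssum.
have sQ : \sum_a (s a)%:~R * Q a = 0.
  rewrite (eq_bigr (fun a => ((s a)%:~R * q a - (s a)%:~R * q (rp i0 b 0)) / R)); last first.
    by move=> a _; rewrite /Q /Z; field.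
  by rewrite -mulr_suml sumrB sq -mulr_suml ssF mul0r subr0 mul0r.
have Q0 : Q (rp i0 b 0) = 0 by rewrite /Q /Z subrr mul0r.
have Q1 : Q (rp i0 b 1) = 1 by rewrite /Q /Z mulfV.
have crit k : \sum_a (s a)%:~R / (C k - Q a) = 0.
  rewrite (eq_bigr (fun a => ((s a)%:~R / (c k - q a)) * R)); last first.
    by move=> a _; rewrite ZB invf_div mulrA mulrAC.
  by rewrite -mulr_suml (hk k).1 mul0r.
have cval k : \prod_a (C k - Q a) ^ s a = th ^+ L * v' k.
  rewrite -(hk k).2 (eq_bigr (fun a => (c k - q a) ^ s a * R^-1 ^ s a)); last first.
    by move=> a _; rewrite ZB expfzMl.
  by rewrite big_split /= prod_expz ?invr_neq0// ssum expr0z mulr1.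
pose x := chart_of b g Q C th.
have xs := chart_of_sys char0 th0 bs bal bp Qi CQ sQ Q0 Q1 crit cval.
have Qx := Qv_chart_of g C char0 th0 bs bp Qi sQ Q0 Q1.
have Cx := Cv_chart_of C char0 th0 bs bal bp Qi sQ Q0 Q1.
have dx := dv_chart_of C char0 th0 bs bal bp Qi sQ Q0 Q1.
rewrite -/x in xs Qx Cx dx.
have gm k : multi i0 b (g k) := g_multi ssum cardIW i01 bs bal k.
have zz j : multi i0 b j -> exists e' : I + W -> K,
   (forall w, B' w = j -> spec p ((Z (pt q c w) - Q (rp i0 b j)) / dil b Q j) (e' w)) /\
   (forall w w', B' w = j -> B' w' = j -> e' w = e' w' -> w = w').
  move=> mj; have [_ [al' [ro' [e' [r0' h1 h2]]]]] := ch j mj.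
  have brp : B' (inl (rp i0 b j)) = j by rewrite /= b_rp.
  have brp' : B' (inl (rp' i0 b j)) = j by rewrite /= b_rp'.
  set d := e' (inl (rp' i0 b j)) - e' (inl (rp i0 b j)).
  have d0 : d != 0 by rewrite subr_eq0; apply: contra_neq mj => /h2 h; case: (h brp' brp).
  exists (fun w => (e' w - e' (inl (rp i0 b j))) / d); split=> [w hw|w w' hw hw']; last first.
    by move/(mulIf (invr_neq0 d0))/addIr/h2; apply.
  have qd : q (rp' i0 b j) - q (rp i0 b j) != 0 by rewrite subr_eq0; apply: contra_neq mj => /qi.
  have -> : (Z (pt q c w) - Q (rp i0 b j)) / dil b Q j =
     ((pt q c w - al') / ro' - (q (rp i0 b j) - al') / ro') /
     ((q (rp' i0 b j) - al') / ro' - (q (rp i0 b j) - al') / ro').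
    rewrite /dil /Q !ZB -!mulrBl !opprB !addrA !subrK; field.
    by rewrite R0 r0' qd.
  apply: specM; last apply: specV => //; apply: specB;
    [exact: h1|exact: (h1 _ brp)|exact: (h1 _ brp')|exact: (h1 _ brp)].
have dfin k a : exists2 u, spec p (dv s b g x k a) u & u != 0.
  rewrite dx; case: eqP => [gb|gb].
    have [e' [h1 h2]] := zz _ (gm k).
    have hk' := h1 (inr k) erefl; have ha := h1 (inl a) (esym gb).
    exists (e' (inr k) - e' (inl a)).
      by have := specB hk' ha; rewrite -mulrBl opprB addrA subrK.
    by rewrite subr_eq0; apply/eqP => /h2 h; have := h erefl (esym gb).
  rewrite divr1; set d := e (inl (rp i0 b 1)) - e (inl (rp i0 b 0)).
  have d0 : d != 0.
    by rewrite subr_eq0; apply/eqP => /eB' /=; rewrite !b_rp// => /(congr1 val).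
  exists ((e (inr k) - e (inl a)) / d); last first.
    by rewrite mulf_neq0 ?invr_neq0// subr_eq0; apply/eqP => /eB'.
  have -> : C k - Q a = ((c k - al) / ro - (q a - al) / ro) /
     ((q (rp i0 b 1) - al) / ro - (q (rp i0 b 0) - al) / ro).
    by rewrite ZB -!mulrBl !opprB !addrA !subrK -/R; field; rewrite R0 r0.
  apply: specM; last apply: specV => //; apply: specB;
    [exact: (he (inr k))|exact: (he (inl a))|exact: (he (inl (rp i0 b 1)))|exact: (he (inl (rp i0 b 0)))].
(* The critical value equation makes a positive power of [xl] a unit, and [fin_expr] passes this to
   [xl]. *)
have xlfin j : exists2 u, spec p (xl x j) u & u != 0.
  have [mj|nm] := boolP (multi i0 b j); last first.
    by exists 1; [rewrite /xl /= (negbTE nm); exact: spec1|exact: oner_neq0].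
  have [k gk] := multi_g ssum cardIW i01 bs bal mj.
  have /choice : forall a, exists u, spec p (dv s b g x k a) u /\ u != 0.
    by move=> a; have [u h1 h2] := dfin k a; exists u.
  move=> [u hu]; have hP := @spec_prod _ _ p _ (index_enum I) predT _ _ (fun a _ => specXz (s a) (hu a).1 (hu a).2).
  have P0 : \prod_a u a ^ s a != 0 by apply/prodf_neq0 => a _; rewrite expfz_neq0// (hu a).2.
  have eP := xs (inr (inl (inr k))); rewrite /= gk in eP.
  have hl : spec p (xl x j ^ sB s b j) (v k / \prod_a u a ^ s a).
    have -> : xl x j ^ sB s b j = v' k / \prod_a dv s b g x k a ^ s a.
      by rewrite -eP mulfK// (spec_neq0 hP P0).
    exact: specM (hv k) (specV hP P0).
  have := bp _ mj; case en : (sB s b j) hl => [[|n]|n] // hl _.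
  have fx : fin p (xl x j) by apply: (@fin_expr _ _ p _ n.+1) => //; case: hl.
  exists (st p (xl x j)); first exact: specP.
  have := spec_uniq (specX n.+1 (specP fx)) hl => h; apply: contra_neq (v0 k) => h0.
  move: h; rewrite h0 expr0n /= => h; apply: (mulIf (invr_neq0 P0)); by rewrite -h mul0r.
have xfin i : fin p (x i).
  case: i => [[a|k]|[j|[]]] /=.
  - case: ifP => [mj|_]; last by case: (spec0 p).
    by have [e' [/(_ (inl a) erefl)[]]] := zz _ mj.
  - by have [e' [/(_ (inr k) erefl)[]]] := zz _ (gm k).
  - by have [u []] := xlfin j.
  by case: hth.
pose z i := st p (x i).
have hx i : spec p (x i) (z i) := specP (xfin i).
have zt : xt z = 0 := spec_uniq (hx (inr (inr tt))) hth.
have zl0 j : xl z j != 0.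
  by have [u hu u0] := xlfin j; rewrite /xl (spec_uniq (hx (inr (inl j))) hu).
have zI a a' : b a = b a' -> xa z a = xa z a' -> a = a'.
  move=> bb; have [mj|nm] := boolP (multi i0 b (b a)); last first.
    by move=> _; rewrite (single_rp nm erefl) (single_rp nm (esym bb)).
  have [e' [h1 h2]] := zz _ mj.
  have ha := hx (inl (inl a)); have ha' := hx (inl (inl a')).
  rewrite /= mj in ha; rewrite /= -bb mj in ha'.
  rewrite /xa (spec_uniq ha (h1 (inl a) erefl)) (spec_uniq ha' (h1 (inl a') (esym bb))).
  by move=> /h2 h; case: (h erefl (esym bb)).
have zd0 k a : dv s b g z k a != 0.
  have [u hu u0] := dfin k a; suff h : spec p (dv s b g x k a) (dv s b g z k a).
    by rewrite (spec_uniq h hu).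
  have [hQ hC] := spec_Qv s0 g bs bp zt hx.
  rewrite /dv; case: ifP => _; first exact: specB (hx (inl (inr k))) (hx (inl (inl a))).
  rewrite /Qv /Cv !(Th_limit s b zt) !mul0r !addr0.
  exact: specB (hC k) (hQ a).
(* Only the first component of [dd] is wanted, that [sys_d x] specialises to [sys_d z]; hence equal
   points, N = 1 and the zero direction. *)
have zs y : sys_d s i0 b g z y = tgt_d v 0 y.
  have h : forall i, @dd F K p 1 _ (fun=> 0) (x i) (x i) (z i) (fun z => z i).
    move=> i; split; [exact: hx|exact: hx| |by split].
    by rewrite subrr mul0r; exact: spec0.
  have [+ _ _ _] := dsys_d_deriv s0 bs bp zd0 zl0 (oner_neq0 F) h y.
  rewrite xs => /spec_uniq; apply.
  case: y => [[j|j]|[[k|k]|[]]] /=; [exact: spec0|exact: spec1|exact: spec0|exact: hv|exact: hth].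
exists b, g, x, z; split=> //.
- by move=> a; rewrite !Qx !ZB q0 q1 !subr0 div1r invrK mulfVK.
by move=> k; rewrite !Qx Cx !ZB q0 q1 !subr0 div1r invrK mulfVK.
Qed.

End Place2.
End DegenerateSolutions.

(** * The number of solutions for small critical values *)

Section DegenerateCount.
Variables (I W : finType) (s : I -> int) (i0 i1 : I).
Hypotheses (s0 : forall a, s a != 0) (ssum : \sum_a s a = 0).
Hypothesis cardIW : (#|I| = #|W| + 3)%N.
Hypothesis i01 : i0 != i1.
Notation L := (commonmult s).
Variable R : realType.
Local Notation K := R[i].
Variables (v : W -> K) (vI : injective v) (v0 : forall k, v k != 0).

Definition chart_data : Type :=
  ({ffun I -> 'I_3} * {ffun W -> 'I_3}) * ({ffun I -> K} * {ffun W -> K} * {ffun 'I_3 -> K}).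
Definition chart_pt (D : chart_data) (i : (I + W) + ('I_3 + unit)) : K :=
  match i with
  | inl (inl a) => D.2.1.1 a
  | inl (inr k) => D.2.1.2 k
  | inr (inl j) => D.2.2 j
  | inr (inr _) => 0
  end.
Definition limits : set chart_data :=
  [set D : chart_data | limit_chart s i0 v D.1.1 D.1.2 (chart_pt D)].

Definition normalise b g (x : (I + W) + ('I_3 + unit) -> K) : {ffun I -> K} * {ffun W -> K} :=
  ([ffun a => (Qv s b x a - Qv s b x i0) / (Qv s b x i1 - Qv s b x i0)],
   [ffun k => (Cv s b g x k - Qv s b x i0) / (Qv s b x i1 - Qv s b x i0)]).

Lemma chart_pt_inj (D D' : chart_data) : D.1 = D'.1 -> chart_pt D =1 chart_pt D' -> D = D'.
Proof.
case: D D' => bg [[x h] l] [bg' [[x' h'] l']] /= <- e.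
congr (_, (_, _, _)); apply/ffunP => i.
- exact: (e (inl (inl i))).
- exact: (e (inl (inr i))).
exact: (e (inr (inl i))).
Qed.

Lemma limits_dv D : limits D -> forall k a, dv s D.1.1 D.1.2 (chart_pt D) k a != 0.
Proof. by move=> [_ _ _ zs _] k a; have := dv_limit s0 v0 zs k a. Qed.

Lemma limits_xl D : limits D -> forall j, xl (chart_pt D) j != 0.
Proof.
by move=> [/can_surj bs bal bp zs _]; exact: (xl_limit ssum cardIW i01 bs bal bp v0 zs).
Qed.

Lemma limits_solve D : limits D -> exists C d : R, [/\ 0 < C, 0 < d & forall th, normc th < d ->
  exists2 x, (forall y, sys_d s i0 D.1.1 D.1.2 x y = tgt_d v th y) &
    nrm (vsub x (chart_pt D)) <= C * normc th].
Proof.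
move=> hD; have d0 := limits_dv hD; have l0 := limits_xl hD.
have [/can_surj bs bal bp zs zi] := hD.
have [C [d [C0 dpos h]]] := @system_solve R _ _ (fun F => @sys_d I W s i0 D.1.1 D.1.2 F)
  (chart_pt D) (dsys_d s i0 D.1.1 D.1.2 (chart_pt D))
  (dsys_d_inj s0 ssum cardIW i01 bs bal bp d0 l0 vI zs zi)
  (fun F p x x' N w => @dsys_d_deriv I W s i0 s0 D.1.1 D.1.2 bs bp K (chart_pt D) d0 l0 F p x x' N w)
  (card_d cardIW) (@sys_d_upi I W s i0 D.1.1 D.1.2 R).
exists C, d; split=> // th hth.
have hN : nrm (vsub (tgt_d v th) (sys_d s i0 D.1.1 D.1.2 (chart_pt D))) = normc th.
  rewrite /nrm (bigD1 (inr (inr tt)))//= big1 ?addr0 => [|y]; first by rewrite /vsub zs /= subr0.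
  by case: y => [[j|j]|[[k|k]|[]]] // _; rewrite /vsub zs subrr normc0.
rewrite -hN; apply: h; rewrite hN.
exact: hth.
Qed.

Lemma normalise_upi (u : ultra nat) b g (x : nat -> (I + W) + ('I_3 + unit) -> K) :
  let X := fun i => upi u (fun n => x n i) in
  (forall a, upi u (fun n => (normalise b g (x n)).1 a) =
     (Qv s b X a - Qv s b X i0) / (Qv s b X i1 - Qv s b X i0)) /\
  (forall k, upi u (fun n => (normalise b g (x n)).2 k) =
     (Cv s b g X k - Qv s b X i0) / (Qv s b X i1 - Qv s b X i0)).
Proof.
move=> X; split=> i; rewrite ?Cv_upi !Qv_upi !upiB upiV upiM;
  by apply/upi_eq; apply: ultraS (@filterT _ u _) => n _ /=; rewrite ffunE.
Qed.

(** Each limit chart extends to a branch of solutions by [limits_solve], distinct charts give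
    distinct branches by [chart_rec], and every solution lies on a branch by [degenerate_chart] and
    uniqueness. A sequence th tending to 0 with another count would contradict [count_limit]. *)
Lemma degenerate_count m : card_is limits m ->
  exists2 d : R, 0 < d & forall th, th != 0 -> normc th < d -> card_is (Sol s i0 i1 v (th ^+ L)) m.
Proof.
move=> [zs [uz sz hz]].
have solve : forall D : chart_data, exists xi : K -> (I + W) + ('I_3 + unit) -> K, D \in zs ->
   exists C d : R, [/\ 0 < C, 0 < d & forall th, normc th < d ->
     (forall y, sys_d s i0 D.1.1 D.1.2 (xi th) y = tgt_d v th y) /\
     nrm (vsub (xi th) (chart_pt D)) <= C * normc th].
  move=> D; have [Dz|nD] := boolP (D \in zs); last by exists (fun=> chart_pt D).
  have [C [d [C0 d0 h]]] := limits_solve ((hz D).2 Dz).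
  have ex th : exists x, normc th < d ->
     (forall y, sys_d s i0 D.1.1 D.1.2 x y = tgt_d v th y) /\
     nrm (vsub x (chart_pt D)) <= C * normc th.
    have [/h[x h1 h2]|nlt] := pselect (normc th < d); first by exists x.
    by exists (chart_pt D) => /nlt.
  have [xi hxi] := choice ex; exists xi => _; exists C, d; split=> // th; exact: hxi.
have {solve} [xi hxi] := choice solve.
apply: contrapT => nope.
have bad n : exists th, [/\ th != 0, normc (th - 0) < n.+1%:R^-1 & ~ card_is (Sol s i0 i1 v (th ^+ L)) m].
  apply: contrapT => h; apply: nope; exists n.+1%:R^-1; first by rewrite invr_gt0.
  move=> th th0 hth; apply: contrapT => hc; apply: h; exists th; split=> //.
  by rewrite subr0.
have {bad} [th hth] := choice bad.
have [u hu] := exists_ultra_nat.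
have lt : ulim u th 0 by apply: (small_seq_lim hu) => n; case: (hth n).
have near d : 0 < d -> u [set n | normc (th n) < d].
  by move=> /lt; apply: filterS => n; rewrite /= subr0.
have hth0 : spec (uplace R u) (upi u th) 0 by apply/spec_upi.
have th0 : upi u th != 0.
  apply/negP => /eqP; rewrite upi0 => /upi_eq/filter_ex[n /= e].
  by have [] := hth n; rewrite e eqxx.
have hv k : spec (uplace R u) (upi u (fun=> v k)) (v k) by apply/spec_upi; exact: ulim_cst.
pose X D i := upi u (fun n => xi D (th n) i).
have XP D : D \in zs -> (forall i, spec (uplace R u) (X D i) (chart_pt D i)) /\
   (forall y, sys_d s i0 D.1.1 D.1.2 (X D) y = tgt_d (fun k => upi u (fun=> v k)) (upi u th) y).
  move=> Dz; have [C [d [C0 d0 h]]] := hxi D Dz; split=> [i|y].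
    apply/spec_upi => e e0; have e1 : 0 < e / C by rewrite divr_gt0.
    apply: filterS (filterI (near _ d0) (near _ e1)) => n [/= h1 h2].
    apply: (le_lt_trans (nrm_coord (vsub (xi D (th n)) (chart_pt D)) i)).
    by apply: (le_lt_trans (h _ h1).2); rewrite mulrC -ltr_pdivlMr.
  rewrite sys_d_upi; case: y => [[j|j]|[[k|k]|[]]] /=; rewrite ?upi0 ?upi1; apply/upi_eq;
    apply: ultraS (near _ d0) => n /= h1.
  - by have := (h _ h1).1 (inl (inl j)).
  - by have := (h _ h1).1 (inl (inr j)).
  - by have := (h _ h1).1 (inr (inl (inl k))).
  - by have := (h _ h1).1 (inr (inl (inr k))).
  by have := (h _ h1).1 (inr (inr tt)).
have Xn D : D \in zs -> injective (Qv s D.1.1 (X D)) /\ (forall j, xl (X D) j != 0).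
  by move=> Dz; have [h1 h2] := XP D Dz; exact: (chart_Q_inj s0 ssum cardIW i01 v0 th0 ((hz D).2 Dz) h1 h2).
pose sol D n := normalise D.1.1 D.1.2 (xi D (th n)).
have solS D : D \in zs -> u [set n | Sol s i0 i1 v (th n ^+ L) (sol D n)].
  move=> Dz; have [C [d [C0 d0 h]]] := hxi D Dz; have [Qi xl0] := Xn D Dz.
  have [/can_surj bs bal bp _ _] := (hz D).2 Dz.
  have U1 : u [set n | injective (Qv s D.1.1 (xi D (th n)))].
    have pd : forall ab : I * I, u [set n | ab.1 != ab.2 ->
        Qv s D.1.1 (xi D (th n)) ab.1 != Qv s D.1.1 (xi D (th n)) ab.2].
      move=> [a a'] /=; have [->|ab] := eqVneq a a'; first by apply: ultraS (@filterT _ u _).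
      have [h1|h1] := in_ultra_setVsetC [set n | Qv s D.1.1 (xi D (th n)) a = Qv s D.1.1 (xi D (th n)) a'] (ultraP u).
        by move: ab; rewrite (Qi a a') ?eqxx// !Qv_upi; apply/upi_eq.
      by apply: ultraS h1 => n /= h1 _; apply/eqP.
    apply: ultraS (ultra_allT pd) => n /= hn a a' e; apply/eqP/negPn/negP => /(hn (a, a')).
    by rewrite /= e eqxx.
  have U2 : u [set n | forall k, xl (xi D (th n)) (D.1.2 k) != 0].
    apply: ultraS (@ultra_allT _ u 'I_3 (fun j => [set n | xl (xi D (th n)) j != 0]) _) => [n /= hn k|j].
      exact: hn.
    have [h1|h1] := in_ultra_setVsetC [set n | xl (xi D (th n)) j = 0] (ultraP u).
      by have := xl0 j; rewrite /xl /X (_ : upi u _ = 0) ?eqxx// upi0; apply/upi_eq.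
    by apply: ultraS h1 => n /= h1; apply/eqP.
  apply: filterS (filterI U1 (filterI U2 (near _ d0))) => n [/= g1 [g2 g3]].
  have [tn0 _ _] := hth n.
  have char0 j : (sB s D.1.1 j)%:~R != 0 :> K by rewrite intr_eq0; exact: (sB_neq0 s0 bs bp).
  have [h1 _] := h _ g3.
  have := chart_sol s0 ssum cardIW i01 bs bal bp char0 tn0 v0 h1 g2 g1.
  by congr (sol_c _ _ _ _ _ _); apply/funext => i /=; rewrite ffunE.
have := @count_limit _ _ ([ffun=> 0], [ffun=> 0]) u (fun n => Sol s i0 i1 v (th n ^+ L)) zs sol uz solS.
case/(_ _ _)/filter_ex => [D D' Dz Dz' e|sg hsg|n /= hn].
- have [h1 h2] := XP D Dz; have [h1' h2'] := XP D' Dz'.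
  have [eQ eC] := normalise_upi u D.1.1 D.1.2 (fun n => xi D (th n)).
  have [eQ' eC'] := normalise_upi u D'.1.1 D'.1.2 (fun n => xi D' (th n)).
  have [| |eb eg ex] := chart_rec s0 ssum cardIW i01 v0 th0 ((hz D).2 Dz) ((hz D').2 Dz') h1 h1' h2 h2'.
  - move=> a; rewrite -eQ -eQ'; apply/upi_eq; apply: ultraS e => n; rewrite /mkset => en.
    by change ((sol D n).1 a = (sol D' n).1 a); rewrite en.
  - move=> k; rewrite -eC -eC'; apply/upi_eq; apply: ultraS e => n; rewrite /mkset => en.
    by change ((sol D n).2 k = (sol D' n).2 k); rewrite en.
  apply: chart_pt_inj => [|i]; first by move: eb eg; case: (D.1) (D'.1) => [? ?] [? ?] /= -> ->.
  by apply: spec_uniq (h1 i) _; rewrite ex.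
- have := sol_upi hsg; rewrite -upiX => hs.
  have [b [g [x [z [hl hx xs eq ec]]]]] := degenerate_chart s0 ssum cardIW i01 hv v0 vI hth0 th0 hs.
  pose D : chart_data := ((b, g), ([ffun a => xa z a], [ffun k => xh z k], [ffun j => xl z j])).
  have Dz i : chart_pt D i = z i.
    case: i => [[a|k]|[j|[]]] /=; rewrite ?ffunE//.
    by case: hl => _ _ _ /(_ (inr (inr tt))) /= <- _.
  have DZ : D \in zs.
    by apply/hz; rewrite /limits /= (_ : chart_pt D = z)//; apply/funext.
  exists D => //; have [h1 h2] := XP D DZ.
  have LD : limits D by apply/hz.
  have [/can_surj bs bal bp zss zi] := LD.
  have hu' := @system_unique R _ _ (fun F => @sys_d I W s i0 b g F)
    (chart_pt D) (dsys_d s i0 b g (chart_pt D))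
    (dsys_d_inj s0 ssum cardIW i01 bs bal bp (limits_dv LD) (limits_xl LD) vI zss zi)
    (fun F p x x' N w => @dsys_d_deriv I W s i0 s0 b g bs bp K (chart_pt D) (limits_dv LD) (limits_xl LD) F p x x' N w)
    _ (uplace R u) x (X D).
  have xX : x = X D.
    apply/funext; apply: hu' => [i|//|y]; first by rewrite Dz; exact: hx.
    by rewrite xs h2.
  have [eQ eC] := normalise_upi u b g (fun n => xi D (th n)).
  have e1 (a : I) : u [set n | (sg n).1 a = (sol D n).1 a].
    by apply/upi_eq; rewrite eq xX eQ.
  have e2 (k : W) : u [set n | (sg n).2 k = (sol D n).2 k].
    by apply/upi_eq; rewrite ec xX eC.
  apply: filterS (filterI (ultra_allT e1) (ultra_allT e2)) => n [g1 g2].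
  apply: (etrans (surjective_pairing _)); apply: esym; apply: (etrans (surjective_pairing _)).
  by congr (_, _); apply/ffunP => i; apply: esym; [exact: g1|exact: g2].
by have [_ _ []] := hth n; rewrite -sz.
Qed.

End DegenerateCount.

(** * The contribution of one cluster *)

Lemma card_is_sum (Z T : eqType) (A : Z -> set T) (zs : seq Z) (n : Z -> nat) : uniq zs ->
  (forall z, z \in zs -> card_is (A z) (n z)) ->
  card_is [set p : Z * T | p.1 \in zs /\ A p.1 p.2] (\sum_(z <- zs) n z).
Proof.
move=> uz h; have h' z : exists s : seq T, z \in zs ->
    [/\ uniq s, size s = n z & forall x, A z x <-> x \in s].
  by have [/h[s hs]|nz] := boolP (z \in zs); [exists s | exists [::]].
have {h'} [t ht] := choice h'.
exists [seq (z, y) | z <- zs, y <- t z]; split.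
- apply: allpairs_uniq_dep => // [z /ht[]//|].
  by case=> [z y] [z' y'] /= _ _ [<- <-].
- rewrite size_allpairs_dep sumnE big_map; apply: eq_big_seq => z /ht[] //.
case=> z y; split=> [[/= zz]|/allpairsPdep[z' [y' [zz yy [-> ->]]]]] /=.
  by have [_ _ hz] := ht z zz; move/hz => yt; apply/allpairsPdep; exists z, y.
by split=> //; have [_ _ ->] := ht z' zz.
Qed.

Lemma card_is_dffun (J : finType) (T : J -> choiceType) (A : forall j, set (T j)) (n : J -> nat) :
  (forall j, card_is (A j) (n j)) ->
  card_is [set f : {dffun forall j, T j} | forall j, A j (f j)] (\prod_j n j)%N.
Proof.
move=> h; have h' j : {s : seq (T j) | [/\ uniq s, size s = n j & forall x, A j x <-> x \in s]}.
  exact: cid (h j).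
pose S j := sval (h' j).
have [uS sS hS] : [/\ forall j, uniq (S j), forall j, size (S j) = n j &
    forall j x, A j x <-> x \in S j].
  by split=> j; case: (svalP (h' j)).
pose lift (f : {dffun forall j, seq_sub (S j)}) : {dffun forall j, T j} := [ffun j => val (f j)].
exists [seq lift f | f <- enum {: {dffun forall j, seq_sub (S j)}}]; split.
- rewrite map_inj_uniq ?enum_uniq// => f f' /ffunP e; apply/ffunP => j; apply: val_inj.
  by have := e j; rewrite !ffunE.
- rewrite size_map -cardE card_dep_ffun foldrE big_map big_enum.
  by apply: eq_bigr => j _; rewrite card_seq_sub.
move=> f; split=> [hf|/mapP[f' _ ->] j].
  apply/mapP; exists [ffun j => SeqSub ((hS j (f j)).1 (hf j))]; first by rewrite mem_enum.
  by apply/ffunP => j; rewrite !ffunE.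
by rewrite ffunE; apply/hS; exact: valP.
Qed.

Lemma card_roots (K : numClosedFieldType) (n : nat) (k : K) : (0 < n)%N -> k != 0 ->
  card_is [set l : K | l ^+ n = k] n.
Proof.
move=> n0 k0; have [r rk] : exists r, r ^+ n = k.
  have /closed_rootP[r /rootP] : size ('X^n - k%:P : {poly K}) != 1%N.
    by rewrite size_XnsubC// gtn_eqF// ltnS.
  by rewrite !hornerE => /eqP; rewrite subr_eq0 => /eqP; exists r.
have r0 : r != 0 by apply: contraNneq k0 => r0; rewrite -rk r0 expr0n gtn_eqF.
have [t e] := closed_field_poly_normal ('X^n - 1 : {poly K}).
have e' : 'X^n - 1 = \prod_(z <- t) ('X - z%:P) :> {poly K}.
  by rewrite e (_ : lead_coef _ = 1) ?scale1r//; apply/monicP; exact: monicXnsubC.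
exists [seq r * z | z <- t]; split.
- rewrite map_inj_uniq; last exact: mulfI.
  by rewrite -separable_prod_XsubC -e' separable_Xn_sub_1 // pnatr_eq0 -lt0n.
- rewrite size_map; have := congr1 (fun p : {poly K} => (size p).-1) e'.
  by rewrite size_prod_XsubC -[1 in LHS]/(1%:P) size_XnsubC.
have rt z : (z \in t) = (z ^+ n == 1).
  by rewrite -root_prod_XsubC -e' /root !hornerE subr_eq0.
move=> l; split=> [hl|/mapP[z + ->]].
  apply/mapP; exists (r^-1 * l); last by rewrite mulVKf.
  by rewrite rt exprMn hl exprVn rk mulVf.
by rewrite rt /mkset exprMn rk => /eqP ->; rewrite mulr1.
Qed.

Lemma big_option (V : Type) (idx : V) (op : Monoid.com_law idx) (A : finType) (F : option A -> V) :
  \big[op/idx]_(o : option A) F o = op (F None) (\big[op/idx]_(a : A) F (Some a)).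
Proof.
rewrite (bigD1 None)//=; congr (op _ _); rewrite (reindex_omap Some id) //=.
  by apply: eq_bigl => a; rewrite eqxx.
by case.
Qed.

Section Blocks.
Variable R : realType.
Local Notation K := R[i].

(* One of the three clusters of a degenerate solution, in a rescaled coordinate:
   the positions x of the labels, the critical points h and a dilation l. *)
Definition blk (A V : finType) (s : A -> int) (a0 a1 : A) (u : V -> K)
    (x : A -> K) (h : V -> K) (l : K) : Prop :=
  [/\ injective x, x a0 = 0, (if a1 != a0 then x a1 = 1 else l = 1) &
      forall k, \sum_a (s a)%:~R / (h k - x a) = 0 /\
        l ^ (\sum_a s a) * \prod_a (h k - x a) ^ s a = u k].

Definition ext (A : finType) (s : A -> int) (o : option A) : int :=
  if o is Some a then s a else - \sum_a s a.

(* The Moebius transformation z |-> c / (c - z). *)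
Lemma moebius_sums (A : finType) (s : A -> int) (x : A -> K) (c h : K) :
  c != 0 -> (forall a, c - x a != 0) -> c - h != 0 -> (forall a, h - x a != 0) ->
  let q o := if o is Some a then c / (c - x a) else 0 in
  \sum_o (ext s o)%:~R / (c / (c - h) - q o) = ((c - h) ^+ 2 / c) * \sum_a (s a)%:~R / (h - x a) /\
  \prod_o (c / (c - h) - q o) ^ ext s o = (\prod_a (h - x a) ^ s a) / \prod_a (c - x a) ^ s a.
Proof.
move=> c0 cx ch hx q.
have dE a : c / (c - h) - c / (c - x a) = c * (h - x a) / ((c - h) * (c - x a)).
  by field; rewrite ch cx.
split.
  rewrite big_option /= subr0 invf_div.
  rewrite mulrNz (rmorph_sum intr) mulNr mulr_suml -sumrN -big_split /= mulr_sumr; apply: eq_bigr => a _.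
  by rewrite dE; field; rewrite c0 hx ch cx.
rewrite big_option /= subr0.
have -> : (c / (c - h)) ^ (- \sum_a s a) = \prod_a (c / (c - h)) ^ (- s a).
  by rewrite prod_expz ?sumrN// mulf_neq0 ?invr_neq0.
rewrite -big_split -prodf_div; apply: eq_bigr => a _ /=.
rewrite dE -exprz_inv -expfzMl invr_expz -exprz_inv -expfzMl; congr (_ ^ _).
by field; rewrite c0 ch cx.
Qed.

Section Multi.
Variables (A V : finType) (s : A -> int) (a0 a1 : A) (u : V -> K) (k0 : V).
Hypotheses (s0 : forall a, s a != 0) (spos : 0 < \sum_a s a) (a01 : a1 != a0).
Hypotheses (uI : injective u) (u0 : forall k, u k != 0).
Notation V' := {k : V | k != k0}.
Let N := `|(\sum_a s a)%R|%N.

Let sN : \sum_a s a = N%:Z. Proof. by rewrite /N gez0_abs// ltW. Qed.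
Let N0 : (0 < N)%N. Proof. by rewrite absz_gt0 gt_eqF. Qed.

Notation sol' := (sol_c (ext s) None (Some a0) (fun k : V' => u (val k) / u k0)).

(** The map z -> c / (c - z), with c the position of k0, sends this critical point to infinity, the
    additional label from infinity to 0 and a0 from 0 to 1. Here it is inverted: c is recovered from
    q a1 = c / (c - 1). *)
Let top q : K := q (Some a1) / (q (Some a1) - 1).
Let xof q a : K := top q * (1 - (q (Some a))^-1).
Let hof q (c : V' -> K) k : K := if insub k is Some k' then top q * (1 - (c k')^-1) else top q.

Let hof0 q c : hof q c k0 = top q.
Proof. by rewrite /hof insubN// eqxx. Qed.
Let hofS q c (k : V') : hof q c (val k) = top q * (1 - (c k)^-1).
Proof. by rewrite /hof valK. Qed.

Lemma blk_of_sol q c l : sol' q c ->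
  l ^+ N = u k0 / \prod_a (top q - xof q a) ^ s a -> blk s a0 a1 u (xof q) (hof q c) l.
Proof.
move=> [qi cq sq [q0 q1] hk] hl.
have qn a : q (Some a) != 0 by rewrite -q0; apply/eqP => /qi.
have cn k : c k != 0 by rewrite -q0.
have qa1 : q (Some a1) - 1 != 0 by rewrite subr_eq0 -q1; apply: contra_neq a01 => /qi[].
have t0 : top q != 0 by rewrite mulf_neq0 ?invr_neq0.
have tx a : top q - xof q a = top q / q (Some a) by rewrite /xof; ring.
have th k : top q - hof q c (val k) = top q / c k by rewrite hofS; ring.
have hx k a : hof q c (val k) - xof q a = top q * (c k - q (Some a)) / (q (Some a) * c k).
  by rewrite hofS /xof; field; rewrite qn cn.
have tx0 a : top q - xof q a != 0 by rewrite tx mulf_neq0 ?invr_neq0.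
have P0 : \prod_a (top q - xof q a) ^ s a != 0.
  by apply/prodf_neq0 => a _; rewrite expfz_neq0.
split.
- move=> a a' /(mulfI t0)/addrI/oppr_inj/invr_inj/qi[] //.
- by rewrite /xof q1 invr1 subrr mulr0.
- by rewrite a01 /xof /top; field; rewrite qn qa1.
move=> k; have [->|kk] := eqVneq k k0.
  rewrite hof0 sN; split; last by rewrite -exprnP hl mulfVK.
  rewrite (eq_bigr (fun a => ((s a)%:~R * q (Some a)) / top q)); last first.
    by move=> a _; rewrite tx invf_div mulrA.
  rewrite -mulr_suml; move: sq; rewrite big_option /= q0 mulr0 add0r => ->.
  by rewrite mul0r.
pose k' : V' := Sub k kk; have -> : k = val k' by [].
have [||e1 e2] := @moebius_sums A s (xof q) (top q) (hof q c (val k')) t0 tx0.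
- by rewrite th mulf_neq0 ?invr_neq0.
- move=> a; rewrite hx; apply: mulf_neq0; last by rewrite invr_neq0// mulf_neq0.
  by apply: mulf_neq0 => //; rewrite subr_eq0.
have cE : top q / (top q - hof q c (val k')) = c k' by rewrite th invf_div mulrC mulfVK.
have qE : (fun o => if o is Some a then top q / (top q - xof q a) else 0) = q.
  by apply/funext => -[a|] //; rewrite tx invf_div mulrC mulfVK.
rewrite cE in e1 e2.
have {}e1 : \sum_o (ext s o)%:~R / (c k' - q o) =
  ((top q - hof q c (val k')) ^+ 2 / top q) * \sum_a (s a)%:~R / (hof q c (val k') - xof q a).
  by rewrite -e1; apply: eq_bigr => o _; rewrite -[in LHS]qE.
have {}e2 : \prod_o (c k' - q o) ^ ext s o =
  (\prod_a (hof q c (val k') - xof q a) ^ s a) / \prod_a (top q - xof q a) ^ s a.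
  by rewrite -e2; apply: eq_bigr => o _; rewrite -[in LHS]qE.
have [h1 h2] := hk k'; split.
  move: e1; rewrite h1 => /esym/eqP; rewrite mulf_eq0 => /orP[|/eqP//].
  by rewrite th mulf_eq0 expf_eq0 invr_eq0 (negbTE t0) orbF /= mulf_eq0 invr_eq0 (negbTE t0) (negbTE (cn _)).
move: e2; rewrite h2 => e2; rewrite sN -exprnP hl mulrAC -mulrA -e2.
by rewrite mulrC mulfVK.
Qed.

Lemma blk_to_sol x h l : blk s a0 a1 u x h l ->
  let q o := if o is Some a then h k0 / (h k0 - x a) else 0 in
  let c (k : V') := h k0 / (h k0 - h (val k)) in
  [/\ sol' q c, l ^+ N = u k0 / \prod_a (top q - xof q a) ^ s a, xof q = x & hof q c = h].
Proof.
move=> [xi x0 x1 hk] q c; rewrite a01 in x1.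
have hx k a : h k - x a != 0.
  have /= := @prod_expz_neq0 _ _ (fun a => h k - x a) s s0; apply.
  by have := u0 k; rewrite -(hk k).2 mulf_eq0 negb_or => /andP[].
have c0 : h k0 != 0 by have := hx k0 a0; rewrite x0 subr0.
have hh (k : V') : h k0 - h (val k) != 0.
  rewrite subr_eq0; apply/negP => /eqP e; case: k e => k /= /negP kk e; apply: kk.
  by apply/eqP/uI; rewrite -(hk k).2 -(hk k0).2 e.
have c1 : h k0 - 1 != 0 by have := hx k0 a1; rewrite x1.
have tE : top q = h k0.
  rewrite /top /q x1 (_ : h k0 / (h k0 - 1) - 1 = (h k0 - 1)^-1) ?invrK ?mulfVK//.
  by field.
have xE : xof q = x.
  by apply/funext => a; rewrite /xof tE /q invf_div; field.
have hE : hof q c = h.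
  apply/funext => k; have [->|kk] := eqVneq k k0; first by rewrite hof0.
  by have -> : k = val (Sub k kk : V') by []; rewrite hofS tE /c invf_div; field.
split=> //; last first.
  have := (hk k0).2; rewrite sN -exprnP tE xE => <-; rewrite mulfK//.
  by apply/prodf_neq0 => a _; rewrite expfz_neq0.
split.
- move=> [a|] [a'|] //=.
  + by move/(mulfI c0)/invr_inj/addrI/oppr_inj/xi => ->.
  + by move/eqP; rewrite mulf_eq0 invr_eq0 (negbTE c0) (negbTE (hx _ _)).
  by move/eqP; rewrite eq_sym mulf_eq0 invr_eq0 (negbTE c0) (negbTE (hx _ _)).
- move=> k [a|] /=; last by rewrite mulf_neq0 ?invr_neq0.
  apply/eqP => /(mulfI c0)/invr_inj/addrI/oppr_inj e.
  by have := hx (val k) a; rewrite e subrr eqxx.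
- rewrite big_option /= mulr0 add0r.
  rewrite (eq_bigr (fun a => h k0 * ((s a)%:~R / (h k0 - x a)))); last by move=> a _; rewrite mulrCA.
  by rewrite -mulr_sumr (hk k0).1 mulr0.
- by split=> //=; rewrite x0 subr0 mulfV.
move=> k; have [e1 e2] := moebius_sums s c0 (hx k0) (hh k) (hx (val k)).
rewrite e1 e2 (hk (val k)).1 mulr0; split=> //.
rewrite -(hk (val k)).2 -(hk k0).2 -mulf_div divff ?mul1r//.
by have := u0 k0; rewrite -(hk k0).2 mulf_eq0 negb_or => /andP[].
Qed.

(** For given positions the critical value at k0 prescribes l ^+ N; the critical values at the other
    points only enter through their ratios to it. So each solution has N lifts. *)
Lemma card_blk n :
  card_is (Sol (ext s) None (Some a0) (fun k : V' => u (val k) / u k0) 1) n ->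
  card_is [set D : {ffun A -> K} * {ffun V -> K} * K | blk s a0 a1 u D.1.1 D.1.2 D.2] (N * n).
Proof.
have SE z : Sol (ext s) None (Some a0) (fun k : V' => u (val k) / u k0) 1 z <-> sol' z.1 z.2.
  have e : (fun k : V' => 1 * (u (val k) / u k0)) = (fun k => u (val k) / u k0).
    by apply/funext => k; rewrite mul1r.
  by rewrite /Sol /mkset e.
move=> [zs [uz sz hz]].
pose kap (z : {ffun option A -> K} * {ffun V' -> K}) := u k0 / \prod_a (top z.1 - xof z.1 a) ^ s a.
have := @card_is_sum _ K (fun z => [set l | l ^+ N = kap z]) zs (fun=> N) uz.
rewrite big_const_seq iter_addn_0 count_predT sz => /(_ _) h.
have kap0 z : Sol (ext s) None (Some a0) (fun k : V' => u (val k) / u k0) 1 z -> kap z != 0.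
  move=> /SE hs; have [q0' _] : z.1 None = 0 /\ z.1 (Some a0) = 1 by case: hs.
  rewrite mulf_neq0 ?invr_neq0//; apply/prodf_neq0 => a _; rewrite expfz_neq0//.
  case: hs => qi cq sq [q0 q1] hk.
  have qa1 : z.1 (Some a1) - 1 != 0 by rewrite subr_eq0 -q1; apply: contra_neq a01 => /qi[].
  have qn a' : z.1 (Some a') != 0 by rewrite -q0; apply/eqP => /qi.
  rewrite (_ : _ - _ = top z.1 / z.1 (Some a)); last by rewrite /xof; ring.
  by rewrite !mulf_neq0 ?invr_neq0.
pose f (p : ({ffun option A -> K} * {ffun V' -> K}) * K) : {ffun A -> K} * {ffun V -> K} * K :=
  ([ffun a => xof p.1.1 a], [ffun k => hof p.1.1 p.1.2 k], p.2).
have fE (p : ({ffun option A -> K} * {ffun V' -> K}) * K) : ((f p).1.1 : A -> K) = xof p.1.1 /\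
    ((f p).1.2 : V -> K) = hof p.1.1 p.1.2 by split; apply/funext => i; rewrite ffunE.
apply: (card_is_bij (f := f)) (h _) => [[z l] [/= zz hl]|[z l] [z' l'] [/= zz hl] [/= zz' hl'] e|[[x hh] l] /= hb|z zz].
- have [-> ->] := fE (z, l) => /=; apply: blk_of_sol => //; exact/SE/hz.
- have [e1 e2] := fE (z, l); have [e1' e2'] := fE (z', l').
  rewrite e in e1 e2; have el : l = l' := congr1 snd e; rewrite /= in e1 e2 e1' e2'.
  have xx : xof z.1 = xof z'.1 by rewrite -e1 e1'.
  have hh : hof z.1 z.2 = hof z'.1 z'.2 by rewrite -e2 e2'.
  have tt : top z.1 = top z'.1 by rewrite -(hof0 z.1 z.2) hh hof0.
  have /SE hs := (hz z).2 zz; have /SE hs' := (hz z').2 zz'.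
  case: hs => qi cq _ [q0 q1] _; case: hs' => qi' cq' _ [q0' q1'] _.
  have t0 : top z.1 != 0.
    rewrite mulf_neq0 ?invr_neq0//; first by rewrite -q0; apply/eqP => /qi.
    by rewrite subr_eq0 -q1; apply: contra_neq a01 => /qi[].
  congr (_, _) => //; move: z z' {zz zz' hl hl' e e1 e2 e1' e2' qi qi' cq cq' q1 q1'} xx hh tt q0 q0' t0.
  move=> [q c] [q' c'] /= xx hh tt q0 q0' t0; congr (_, _); apply/ffunP.
    case=> [a|]; last by rewrite q0 q0'.
    have := congr1 (fun x => x a) xx; rewrite /xof -tt => /(mulfI t0)/addrI/oppr_inj/invr_inj//.
  move=> k; have := congr1 (fun x => x (val k)) hh; rewrite !hofS -tt.
  by move=> /(mulfI t0)/addrI/oppr_inj/invr_inj.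
- have [h1 h2 h3 h4] := blk_to_sol hb.
  pose q o := if o is Some a then hh k0 / (hh k0 - x a) else 0.
  pose c (k : V') := hh k0 / (hh k0 - hh (val k)).
  have qE : ([ffun o => q o] : {ffun _ -> K}) = q :> (_ -> _) by apply/funext => o; rewrite ffunE.
  have cE : ([ffun k => c k] : {ffun _ -> K}) = c :> (_ -> _) by apply/funext => o; rewrite ffunE.
  exists (([ffun o => q o], [ffun k => c k]), l).
    split=> /=; first by apply/hz/SE; rewrite /= qE cE.
    by rewrite /mkset /kap /= qE.
  rewrite /f /= qE cE; congr (_, _, _); apply/ffunP => i; rewrite ffunE; [exact: (congr1 (fun y : A -> K => y i) h3)|exact: (congr1 (fun y : V -> K => y i) h4)].
by apply: card_roots => //; apply/kap0/hz.
Qed.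

End Multi.
End Blocks.

Lemma big_sig (V : Type) (idx : V) (op : Monoid.com_law idx) (T : finType) (P : pred T) (F : T -> V) :
  \big[op/idx]_(x : {x | P x}) F (val x) = \big[op/idx]_(i | P i) F i.
Proof.
rewrite [RHS](reindex_omap (val : {x | P x} -> T) insub) => [|i Pi]; last by rewrite insubT.
by apply: eq_bigl => x; rewrite valK eqxx andbT (valP x).
Qed.

(** * The limit system splits into its three clusters *)

Section LimitBlocks.
Variables (I W : finType) (s : I -> int) (i0 i1 : I).
Hypotheses (s0 : forall a, s a != 0) (ssum : \sum_a s a = 0).
Hypothesis cardIW : (#|I| = #|W| + 3)%N.
Hypothesis i01 : i0 != i1.
Variable R : realType.
Local Notation K := R[i].
Variables (v : W -> K) (vI : injective v) (v0 : forall k, v k != 0).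
Variables (b : {ffun I -> 'I_3}) (g : {ffun W -> 'I_3}).
Hypotheses (bc : can b) (bal : balanced b g) (bp : pos_blocks s i0 b).
Let bs : surj b := can_surj bc.

Definition bval (j : 'I_3) : K := if j == 0 then 0 else if j == 1 then 1 else
  - ((sB s b 1)%:~R / (sB s b 2%:R)%:~R).

Lemma bvalI : injective bval.
Proof.
have zt : xt ((fun=> 0) : (I + W) + ('I_3 + unit) -> K) = 0 by [].
move=> j j' e; apply: (ev_limit_inj s0 ssum bs bp zt).
by rewrite !(ev_limit s b zt).
Qed.

(* The contribution of the other two clusters to the critical values in cluster j. *)
Definition outer (j : 'I_3) : K := \prod_(a | b a != j) (bval j - bval (b a)) ^ s a.

Lemma outer_neq0 j : outer j != 0.
Proof.
apply/prodf_neq0 => a ba; rewrite expfz_neq0// subr_eq0.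
by apply: contra_neq ba => /bvalI.
Qed.

Local Notation A j := {a : I | b a == j}.
Local Notation V j := {k : W | g k == j}.
Let rpP j : b (rp i0 b j) == j. Proof. by rewrite b_rp. Qed.
Let rpP' j : b (rp' i0 b j) == j. Proof. by rewrite b_rp'. Qed.
Definition first j : A j := Sub (rp i0 b j) (rpP j).
Definition second j : A j := Sub (rp' i0 b j) (rpP' j).
Definition block_blk j := @blk R (A j) (V j) (fun a : A j => s (val a)) (first j) (second j)
  (fun k : V j => v (val k) / outer j).
Arguments block_blk : clear implicits.

Lemma multiE j : multi i0 b j = (second j != first j).
Proof. by rewrite -val_eqE. Qed.

(** At [xt = 0] the other clusters affect the equations of cluster j only through the constant
    factor [outer j] in its critical values. *)
Lemma limit_blk (z : (I + W) + ('I_3 + unit) -> K) : xt z = 0 ->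
  limit_chart s i0 v b g z <->
  forall j, block_blk j (fun a : A j => xa z (val a)) (fun k : V j => xh z (val k)) (xl z j).
Proof.
move=> zt.
have cE j (k : V j) : sys_d s i0 b g z (inr (inl (inl (val k)))) =
    \sum_(a : A j) (s (val a))%:~R / (xh z (val k) - xa z (val a)).
  rewrite (big_sig _ (fun a => b a == j) (fun a => (s a)%:~R / (xh z (val k) - xa z a))) /=.
  rewrite [RHS]big_mkcond; apply: eq_bigr => a _; rewrite /dv (eqP (valP k)) eq_sym.
  by case: ifP => _; rewrite ?mul1r// Th_limit// mul0r mulr0.
have vE j (k : V j) : sys_d s i0 b g z (inr (inl (inr (val k)))) =
    xl z j ^ (\sum_(a : A j) s (val a)) *
    \prod_(a : A j) (xh z (val k) - xa z (val a)) ^ s (val a) * outer j.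
  rewrite (big_sig _ (fun a => b a == j) s) /= (eqP (valP k)) -mulrA; congr (_ * _).
  rewrite (big_sig _ (fun a => b a == j) (fun a => (xh z (val k) - xa z a) ^ s a)) /=.
  rewrite (bigID (fun a => b a == j)) /=; congr (_ * _); apply: eq_bigr => a ba.
    by rewrite /dv (eqP (valP k)) (eqP ba) eqxx.
  rewrite /dv (eqP (valP k)) eq_sym (negbTE ba) /Cv /Qv !Th_limit// !mul0r !addr0.
  by rewrite !(ev_limit s b zt) (eqP (valP k)).
split=> [[_ _ _ zs zi] j|h].
  split.
  - move=> a a' e; apply: val_inj; apply: zi => //.
    by rewrite (eqP (valP a)) (eqP (valP a')).
  - exact: (zs (inl (inl j))).
  - have h1 := zs (inl (inr j)); rewrite /= in h1; move: h1; rewrite multiE.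
    by case: ifP.
  move=> k; rewrite -cE zs; split=> //.
  by have := zs (inr (inl (inr (val k)))); rewrite vE /= => <-; rewrite mulfK ?outer_neq0.
split=> // [y|a a' ba e]; last first.
  have [hi _ _ _] := h (b a).
  pose aa : A (b a) := exist _ a (eqxx _); pose aa' : A (b a) := exist _ a' (introT eqP (esym ba)).
  by have := hi aa aa' e => /(congr1 val).
case: y => [[j|j]|[[k|k]|[]]].
- by have [_ h1 _ _] := h j.
- by have [_ _ h1 _] := h j; rewrite /= multiE; move: h1; case: ifP.
- have [_ _ _ /(_ (exist _ k (eqxx (g k))))[h1 _]] := h (g k).
  by rewrite -(cE _ (exist _ k (eqxx (g k)))) in h1.
- have [_ _ _ /(_ (exist _ k (eqxx (g k))))[_ h1]] := h (g k).
  by have := vE _ (exist _ k (eqxx (g k)) : V (g k)); rewrite h1 /= => ->; rewrite mulfVK ?outer_neq0.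
exact: zt.
Qed.

Local Notation T j := ({ffun A j -> K} * {ffun V j -> K} * K)%type.

Lemma card_limit_fiber (nB : 'I_3 -> nat) :
  (forall j, card_is [set D : T j | block_blk j D.1.1 D.1.2 D.2] (nB j)) ->
  card_is [set y | limits s i0 v ((b, g), y)] (\prod_j nB j)%N.
Proof.
move=> hB; have h := @card_is_dffun 'I_3 (fun j => T j) _ nB hB.
pose f (y : {dffun forall j, T j}) : {ffun I -> K} * {ffun W -> K} * {ffun 'I_3 -> K} :=
  ([ffun a => (y (b a)).1.1 (exist (fun a' => b a' == b a) a (eqxx (b a)))], [ffun k => (y (g k)).1.2 (exist (fun k' => g k' == g k) k (eqxx (g k)))],
   [ffun j => (y j).2]).
have f1 y j (a : A j) : (f y).1.1 (val a) = (y j).1.1 a.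
  case: a => a e /=; move: (eqP e) => ej; subst j; rewrite ffunE; congr (fun_of_fin _ _).
  exact: val_inj.
have f2 y j (k : V j) : (f y).1.2 (val k) = (y j).1.2 k.
  case: k => a e /=; move: (eqP e) => ej; subst j; rewrite ffunE; congr (fun_of_fin _ _).
  exact: val_inj.
have f3 y j : (f y).2 j = (y j).2 by rewrite ffunE.
have fP y : limits s i0 v ((b, g), f y) <-> forall j, block_blk j (y j).1.1 (y j).1.2 (y j).2.
  rewrite /limits /mkset limit_blk//; split=> h1 j; have := h1 j; congr block_blk.
  - by apply/funext => a; exact: f1.
  - by apply/funext => a; exact: f2.
  - by rewrite /xl /= ffunE.
  - by apply/esym/funext => a; exact: f1.
  - by apply/esym/funext => a; exact: f2.
  - by rewrite /xl /= ffunE.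
apply: (card_is_bij (f := f)) h => [y hy|y y' _ _ e|[[x hh] l] hy].
- exact/fP.
- apply/ffunP => j; rewrite [LHS]surjective_pairing [RHS]surjective_pairing; congr (_, _); last first.
    by rewrite -!f3 e.
  rewrite [LHS]surjective_pairing [RHS]surjective_pairing; congr (_, _); apply/ffunP => i.
    by rewrite -!f1 e.
  by rewrite -!f2 e.
pose y : {dffun forall j, T j} := [ffun j => ([ffun a : A j => x (val a)], [ffun k : V j => hh (val k)], l j)].
have fy : f y = (x, hh, l).
  by rewrite /f; congr (_, _, _); apply/ffunP => i; rewrite !ffunE //= ffunE.
by exists y => //; move: hy; rewrite -fy => /fP.
Qed.

Lemma card_block_single j : ~~ multi i0 b j -> 
  card_is [set D : T j | block_blk j D.1.1 D.1.2 D.2] 1.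
Proof.
move=> nm; exists [:: ([ffun=> 0], [ffun=> 0], 1)]; split=> // D.
have aE (a : A j) : a = first j.
  by apply: val_inj; rewrite /= (single_rp nm (eqP (valP a))).
have nV (k : V j) : False.
  by have := g_multi ssum cardIW i01 bs bal (val k); rewrite (eqP (valP k)) (negbTE nm).
rewrite inE; split=> [[_ h1 h2 _]|/eqP -> /=].
  case: D h1 h2 => -[x h] l /= h1; rewrite -multiE (negbTE nm) => ->.
  apply/eqP; congr (_, _, _); apply/ffunP => i; rewrite ffunE; first by rewrite (aE i).
  by case: (nV i).
split.
- by move=> a a' _; rewrite (aE a) (aE a').
- by rewrite ffunE.
- by rewrite -multiE (negbTE nm).
by move=> k; case: (nV k).
Qed.

Lemma card_block_multi j (k0 : V j) n : multi i0 b j ->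
  card_is (Sol (ext (fun a : A j => s (val a))) None (Some (first j))
    (fun k : {k : V j | k != k0} => v (val (val k)) / v (val k0)) 1) n ->
  card_is [set D : T j | block_blk j D.1.1 D.1.2 D.2] (`|sB s b j| * n).
Proof.
move=> mj h.
have sE : \sum_(a : A j) s (val a) = sB s b j by exact: (big_sig _ (fun a => b a == j) s).
have := @card_blk R (A j) (V j) (fun a : A j => s (val a)) (first j) (second j)
  (fun k : V j => v (val k) / outer j) k0 (fun a => s0 _) _ _ _ _ n; rewrite sE; apply.
- exact: bp.
- by rewrite -multiE.
- by move=> k l /(mulIf (invr_neq0 (outer_neq0 j)))/vI/val_inj.
- by move=> k; rewrite mulf_neq0 ?invr_neq0 ?outer_neq0.
suff -> : (fun k : {k : V j | k != k0} => v (val (val k)) / outer j / (v (val k0) / outer j)) =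
   (fun k => v (val (val k)) / v (val k0)) by [].
by apply/funext => k; field; rewrite outer_neq0 v0.
Qed.

End LimitBlocks.

(** * The recursion *)

Definition balancedb (I W : finType) (b : {ffun I -> 'I_3}) (g : {ffun W -> 'I_3}) :=
  [forall j, (#|[pred k | g k == j]| + 1 == #|[pred a | b a == j]|)%N].

(* The number of ways to distribute the critical points: a block of k labels receives k - 1. *)
Definition dist (I : finType) (w : nat) (b : {ffun I -> 'I_3}) : nat :=
  #|[pred g : {ffun 'I_w -> 'I_3} | balancedb b g]|.

(** * From small critical values to the given ones *)

Section Path.
Variable R : realType.
Local Notation K := R[i].

Lemma avoid_small (r : seq R) (d : R) : 0 < d -> exists2 y, 0 < y < d & y \notin r.
Proof.
move=> d0; suff [e [e0 ed he]] : exists e, [/\ 0 < e, e <= d & forall y, 0 < y < e -> y \notin r].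
  exists (e / 2%:R); last by apply: he; rewrite divr_gt0//= ltr_pdivrMr// ltr_pMr// ltr1n.
  by rewrite divr_gt0//= (lt_le_trans _ ed)// ltr_pdivrMr// ltr_pMr// ltr1n.
elim: r => [|b r [e [e0 ed he]]]; first by exists d.
exists (if 0 < b then Num.min b e else e); split.
- by case: ifP => // b0; rewrite lt_min b0.
- by case: ifP => // b0; rewrite ge_min ed orbT.
move=> y /andP[y0 ye]; rewrite inE negb_or.
move: ye; case: (ltP 0 b) => b0; first by rewrite lt_min => /andP[yb ye]; rewrite (lt_eqF yb) he ?y0.
by move=> ye; rewrite he ?y0// andbT; apply: contraTneq y0 => ->; rewrite -leNgt.
Qed.

Definition seg (y t : R) : K := Complex (1 - t) (t * y).

Lemma seg_sub y t t' : normc (seg y t - seg y t') <= `|t - t'| * (1 + `|y|).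
Proof.
have -> : seg y t - seg y t' = (t - t')%:C%C * Complex (-1) y.
  by rewrite /seg; simpc; congr Complex; ring.
rewrite normcM normc_real ler_wpM2l//.
have -> : Complex (-1) y = (-1)%:C%C + (Complex 0 1) * y%:C%C by simpc.
apply: (le_trans (normcD _ _)); rewrite normcM !normc_real normrN1 lerD2l.
by rewrite /normc expr0n expr1n add0r sqrtr1 mul1r.
Qed.

(** The supremum of the times up to which P holds lies in the interval, satisfies P, and could be
    increased if it were below 1. *)
Lemma locally_constant_const (P : R -> Prop) :
  (forall t, 0 <= t <= 1 -> exists2 d, 0 < d & forall t', 0 <= t' <= 1 -> `|t' - t| < d -> (P t' <-> P t)) ->
  P 0 -> P 1.
Proof.
move=> h P0; pose A : set R := [set t | 0 <= t <= 1 /\ forall t', 0 <= t' <= t -> P t'].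
have A0 : A 0 by split; rewrite ?lexx ?ler01// => t /andP[a b]; have -> : t = 0 by apply/eqP; rewrite eq_le a b.
have hA : has_sup A by split; [exists 0 | exists 1 => t [/andP[]]].
have ubA t : A t -> t <= sup A by apply: (ub_le_sup hA.2).
have s01 : 0 <= sup A <= 1.
  apply/andP; split; first exact: ubA.
  by apply: ge_sup; [exists 0|move=> t [/andP[]]].
have [d d0 hd] := h _ s01.
have [t At ht] := sup_adherent d0 hA; case: (At) => /andP[t0 t1] hPt.
have ts := ubA _ At.
have Ps : P (sup A).
  apply/(hd t); rewrite ?t0 ?t1//; last by apply: hPt; rewrite t0 lexx.
  by rewrite distrC ger0_norm ?subr_ge0// ltrBlDl -ltrBlDr.
have ball t' : 0 <= t' <= 1 -> t' < sup A + d -> P t'.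
  move=> /andP[a b] c; have [le|gt] := leP t' t; first by apply: hPt; rewrite a le.
  apply/hd => //; first by rewrite a.
  have [le'|gt'] := leP t' (sup A); last by rewrite ger0_norm ?subr_ge0 ?(ltW gt')// ltrBlDl.
  by rewrite distrC ger0_norm ?subr_ge0// ltrBlDl -ltrBlDr (lt_trans _ gt).
pose t2 := Num.min 1 (sup A + d / 2%:R).
have d2 : 0 < d / 2%:R by rewrite divr_gt0.
have At2 : A t2.
  have t20 : 0 <= t2 <= 1.
    by rewrite /t2 le_min ler01 ge_min lexx /= addr_ge0 ?(ltW d2)//; case/andP: s01.
  split=> // t' /andP[a b]; apply: ball.
    by rewrite a (le_trans b)//; case/andP: t20.
  apply: (le_lt_trans b); rewrite /t2 gt_min ltrD2l [X in _ || X](_ : _ = true) ?orbT//.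
  by rewrite ltr_pdivrMr// ltr_pMr// ltr1n.
have t2s := ubA _ At2; suff -> : 1 = t2 by case: At2 => /andP[a b]; apply; rewrite a lexx.
have [h1|h1] := leP 1 (sup A + d / 2%:R); first by rewrite /t2 min_l.
by move: t2s; rewrite /t2 min_r ?(ltW h1)// gerDl leNgt d2.
Qed.

Variables (I W : finType) (s : I -> int) (i0 i1 : I).
Hypotheses (s0 : forall a, s a != 0) (ssum : \sum_a s a = 0).
Hypothesis cardIW : (#|I| = #|W| + 3)%N.
Hypothesis i01 : i0 != i1.
Variables (v : W -> K) (vI : injective v) (v0 : forall k, v k != 0) (v1 : forall k, v k != 1).

(* The count can change along a path t only where some t * v k meets the critical value 1 at
   infinity; a small imaginary y can be reached from 1 without this. *)
Lemma card_Sol_path m : card_is (limits s i0 v) m -> card_is (Sol s i0 i1 v 1) m.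
Proof.
move=> /(degenerate_count s0 ssum cardIW i01 vI v0)[d d0 hd].
(* The segment from 1 to i y meets 1 / v k only at t = 1 - Re (1 / v k), hence only for the listed
   y; t = 0 is excluded by v k != 1. *)
pose bad := [seq complex.Im (v k)^-1 / (1 - complex.Re (v k)^-1) | k <- enum W].
have [y /andP[y0 yd] ybad] := avoid_small bad (exprn_gt0 (commonmult s) d0).
have [th hth] : exists th : K, th ^+ commonmult s = Complex 0 y.
  have /closed_rootP[r /rootP] : size ('X^(commonmult s) - (Complex 0 y)%:P : {poly K}) != 1%N.
    by rewrite size_XnsubC ?commonmult_gt0// gtn_eqF// ltnS commonmult_gt0.
  by rewrite !hornerE => /eqP; rewrite subr_eq0 => /eqP; exists r.
have iy : normc (Complex 0 y) = y by rewrite /normc expr0n add0r sqrtr_sqr ger0_norm// ltW.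
have nth : normc th < d.
  have e : normc th ^+ commonmult s = y.
    by rewrite -iy -hth; elim: (commonmult s) => [|n ih]; rewrite ?expr0 ?normc1// !exprS normcM ih.
  by rewrite -(ltr_pXn2r (commonmult_gt0 s)) ?nnegrE ?normc_ge0 ?(ltW d0)// e.
have th0 : th != 0.
  apply/negP => /eqP e; move: hth; rewrite e expr0n eqn0Ngt commonmult_gt0 /= => /(congr1 (@complex.Im R)) /= e'.
  by move: y0; rewrite -e' ltxx.
have h1 := hd th th0 nth; rewrite hth in h1.
have seg0 t : 0 <= t <= 1 -> seg y t != 0.
  move=> /andP[t0 t1]; apply/eqP => /eqP; rewrite eq_complex /= subr_eq0 mulf_eq0 (gt_eqF y0) orbF.
  by case/andP => /eqP <-; rewrite oner_eq0.
have segv t k : 0 <= t <= 1 -> seg y t * v k != 1.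
  move=> /andP[t0 t1]; apply/eqP => e.
  have {}e : (v k)^-1 = seg y t by apply: (mulIf (v0 k)); rewrite e mulVf.
  have [tz|tn] := eqVneq t 0.
    move: e; rewrite /seg tz subr0 mul0r => e; have := v1 k; rewrite -[v k]invrK e.
    by rewrite (_ : Complex 1 0 = 1) ?invr1 ?eqxx.
  move/negP: ybad; apply; apply/mapP; exists k; rewrite ?mem_enum// e /= opprB addrC subrK mulrC.
  by rewrite mulKf.
suff : card_is (Sol s i0 i1 v (seg y 0)) m by rewrite /seg subr0 mul0r.
have s1 : seg y 1 = Complex 0 y by rewrite /seg subrr mul1r.
rewrite -s1 in h1; apply: contrapT => n0; move: h1.
(* The negation is transported: a wrong count at t = 0 would persist up to t = 1, where [h1]
   holds. *)
apply: (@locally_constant_const (fun t => ~ card_is (Sol s i0 i1 v (seg y t)) m)) n0 => t ht.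
have [d' [n [d'0 hn]]] := Sol_locally_constant s0 ssum cardIW i01 vI v0 (seg0 t ht) (fun k => segv t k ht).
have y1 : 0 < 1 + `|y| by rewrite ltr_pwDl.
exists (d' / (1 + `|y|)); first exact: divr_gt0.
move=> t' ht' tt; have c1 := hn (seg y t'); have c2 := hn (seg y t).
have {}c1 : card_is (Sol s i0 i1 v (seg y t')) n.
  by apply: c1; apply: (le_lt_trans (seg_sub _ _ _)); rewrite -ltr_pdivlMr.
have {}c2 : card_is (Sol s i0 i1 v (seg y t)) n by apply: c2; rewrite subrr normc0.
by split=> h c; apply: h; [rewrite -(card_is_inj c2 c)|rewrite -(card_is_inj c1 c)].
Qed.

End Path.

(* The sum runs over the splittings of the labels into three clusters; a cluster of several
   labels becomes a smaller cover, with one more label for the rest.  n only bounds the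
   recursion. *)
Fixpoint hcount (n : nat) (I : finType) (s : I -> int) : nat :=
  (if n is n'.+1 then
    \sum_(b : {ffun I -> 'I_3} | can b) dist (#|I| - 3) b *
      \prod_(j < 3) (if #|[pred a | b a == j]| == 1 then 1 else
        if (0 < sB s b j)%R
        then absz (sB s b j) * hcount n' (ext (fun a : {a : I | b a == j} => s (val a)))
        else 0)
  else 1)%N.

Lemma dist_card (I W : finType) (b : {ffun I -> 'I_3}) :
  #|[pred g : {ffun W -> 'I_3} | balancedb b g]| = dist #|W| b.
Proof.
pose f (g : {ffun W -> 'I_3}) : {ffun 'I_#|W| -> 'I_3} := [ffun i => g (enum_val i)].
pose f' (g : {ffun 'I_#|W| -> 'I_3}) : {ffun W -> 'I_3} := [ffun k => g (enum_rank k)].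
have fK : cancel f f' by move=> g; apply/ffunP => k; rewrite !ffunE enum_rankK.
have fK' : cancel f' f by move=> g; apply/ffunP => k; rewrite !ffunE enum_valK.
transitivity #|[set g : {ffun W -> 'I_3} | balancedb b g]%SET|; first by rewrite cardsE.
rewrite -(on_card_preimset (f := f')); last by exists f => g _; rewrite ?fK ?fK'.
apply: eq_card => g; rewrite !inE; apply: eq_forallb => j; congr (_ + _ == _)%N.
rewrite -!sum1_card (reindex (@enum_rank W)) /=; last first.
  by exists enum_val => i _; rewrite ?enum_rankK ?enum_valK.
by apply: eq_bigl => k; rewrite !inE ffunE.
Qed.

Lemma card_is0 (T : eqType) (A : set T) : (forall x, ~ A x) -> card_is A 0.
Proof. by move=> h; exists [::]; split=> // x; split=> // /h. Qed.

Lemma multi_card (I : finType) (i0 : I) (b : {ffun I -> 'I_3}) j : surj b ->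
  multi i0 b j = (#|[pred a | b a == j]| != 1%N).
Proof.
move=> bs; rewrite (cardD1 (rp i0 b j)) inE b_rp// eqxx /= add1n eqSS -lt0n.
apply/idP/card_gt0P => [mj|[a]]; first by exists (rp' i0 b j); rewrite !inE b_rp'// eqxx andbT.
rewrite !inE => /andP[ne /eqP ba]; apply: contraNT ne => nm.
by apply/eqP; exact: single_rp nm ba.
Qed.

(** At small values the solutions are counted by limit charts, which for fixed (b, g) form a product
    over the clusters; a cluster with several labels contributes its weight times a count of the
    same kind with fewer labels. *)
Lemma card_Sol (R : realType) (n : nat) (I W : finType) (s : I -> int) (i0 i1 : I) (v : W -> R[i]) :
  (#|I| <= n + 2)%N -> (forall a, s a != 0) -> \sum_a s a = 0 -> (#|I| = #|W| + 3)%N -> i0 != i1 ->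
  injective v -> (forall k, v k != 0) -> (forall k, v k != 1) ->
  card_is (Sol s i0 i1 v 1) (hcount n s).
Proof.
elim: n I W s i0 i1 v => [|n IH] I W s i0 i1 v hn s0 ssum cardIW i01 vI v0 v1.
  (* The value of [hcount] at n = 0 is not reached, as there are at least three labels. *)
  by move: hn; rewrite cardIW; lia.
apply: card_Sol_path => //.
pose fac (b : {ffun I -> 'I_3}) (j : 'I_3) : nat := if #|[pred a | b a == j]| == 1%N then 1%N else
        if (0 < sB s b j)%R
        then (absz (sB s b j) * hcount n (ext (fun a : {a : I | b a == j} => s (val a))))%N
        else 0%N.
pose N (bg : {ffun I -> 'I_3} * {ffun W -> 'I_3}) : nat :=
  if can bg.1 && balancedb bg.1 bg.2 then (\prod_j fac bg.1 j)%N else 0%N.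
have hN bg : card_is [set y | limits s i0 v (bg, y)] (N bg).
  case: bg => b g; rewrite /N /=; case: ifP => [/andP[bc bb]|nv]; last first.
    apply: card_is0 => y [/= bc bal _ _ _]; move: nv; rewrite bc /= => /forallP[] j.
    by apply/eqP; exact: bal.
  have bal : balanced b g by move=> j; apply/eqP; exact: (forallP bb).
  have bs := can_surj bc.
  have [/forallP bp'|] := boolP [forall j, multi i0 b j ==> (0 < sB s b j)]; last first.
    rewrite negb_forall => /existsP[j]; rewrite negb_imply => /andP[mj np].
    rewrite (bigD1 j)//= /fac; move: (mj); rewrite (multi_card _ _ bs) => /negbTE ->.
    rewrite (negbTE np) mul0n; apply: card_is0 => y [/= _ _ bp _ _].
    by move/negP: np; apply; exact: bp.
  have bp : pos_blocks s i0 b by move=> j mj; exact: (implyP (bp' j)).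
  apply: (@card_limit_fiber I W s i0 s0 ssum R v b g bc bal bp (fac b)) => j.
  have [mj|nm] := boolP (multi i0 b j); last first.
    rewrite /fac; move: (nm); rewrite (multi_card _ _ bs) negbK => ->.
      exact: (@card_block_single I W s i0 i1 ssum cardIW i01 R v b g bc bal j nm).
  rewrite /fac; move: (mj); rewrite (multi_card _ _ bs) => /negbTE ->; rewrite bp//.
  have [k gk] := multi_g ssum cardIW i01 bs bal mj.
  pose k0 : {k : W | g k == j} := exist _ k (introT eqP gk).
  apply: (card_block_multi s0 ssum vI v0 bp (k0 := k0)) => //.
  have cA : #|{: {a : I | b a == j}}| = (#|{: {k : W | g k == j}}| + 1)%N.
    by rewrite !card_sig -bal.
  have cV : (#|{: {k : W | g k == j}}| <= #|W|)%N by rewrite card_sig max_card.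
  have cW : (#|{: {k : {k : W | g k == j} | k != k0}}| + 1 = #|{: {k : W | g k == j}}|)%N.
    have p : (0 < #|{: {k : W | g k == j}}|)%N by apply/card_gt0P; exists k0.
    rewrite addn1 -[RHS](prednK p); congr _.+1.
    by rewrite -(cardC1 k0) card_sig; apply: eq_card.
  have sE : \sum_(a : {a : I | b a == j}) s (val a) = sB s b j.
    exact: (big_sig _ (fun a => b a == j) s).
  apply: IH => //.
  - by rewrite card_option cA; move: hn cV; rewrite cardIW; lia.
  - by move=> [a|] /=; rewrite ?s0// sE oppr_eq0 gt_eqF// bp.
  - by rewrite big_option /= addNr.
  - by rewrite card_option cA -cW !addn1 addn3.
  - by move=> l l' /(mulIf (invr_neq0 (v0 _)))/vI/val_inj/val_inj.
  - by move=> l; rewrite mulf_neq0 ?invr_neq0.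
  move=> l; apply/eqP => /(congr1 (fun t => t * v (val k0))); rewrite mulfVK// mul1r.
  by move/vI/val_inj => e; have := valP l; rewrite e eqxx.
have h := card_is_sum (enum_uniq {: {ffun I -> 'I_3} * {ffun W -> 'I_3}}) (fun bg _ => hN bg).
have -> : hcount n.+1 s = (\sum_(bg <- enum {: {ffun I -> 'I_3} * {ffun W -> 'I_3}}) N bg)%N.
  rewrite big_enum /= -(pair_bigA _ (fun b g => N (b, g))) /= [RHS](bigID (fun b => can b)) /=.
  rewrite [X in _ = (_ + X)%N]big1 ?addn0 => [|b /negbTE nc]; last by rewrite big1// => g _; rewrite /N /= nc.
  apply: eq_bigr => b bc; rewrite (eq_bigr (fun g => if balancedb b g then (\prod_j fac b j)%N else 0%N)).
    by rewrite -big_mkcond sum_nat_const cardIW addnK -dist_card.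
  by move=> g _; rewrite /N /= bc.
apply: (card_is_bij (f := fun p : ({ffun I -> 'I_3} * {ffun W -> 'I_3}) * _ => (p : chart_data I W R))) h => [[bg y] []|[bg y] [bg' y'] _ _|[bg y] hy] //.
by exists (bg, y) => //; split=> //; rewrite mem_enum.
Qed.

(** * Moebius transformations and rational maps *)

Section Homogeneous.
Variable K : numClosedFieldType.

(* F of degree at most d as a binary form of degree d. *)
Definition hv (d : nat) (F : {poly K}) (x y : K) : K := \sum_(i < d.+1) F`_i * (x ^+ i * y ^+ (d - i)).

Lemma hvD d F G x y : hv d (F + G) x y = hv d F x y + hv d G x y.
Proof. by rewrite -big_split; apply: eq_bigr => i _; rewrite coefD mulrDl. Qed.

Lemma hvZ d a F x y : hv d (a *: F) x y = a * hv d F x y.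
Proof. by rewrite mulr_sumr; apply: eq_bigr => i _; rewrite coefZ mulrA. Qed.

Lemma hv_scale d F k x y : hv d F (k * x) (k * y) = k ^+ d * hv d F x y.
Proof.
rewrite mulr_sumr; apply: eq_bigr => -[i hi] _ /=; rewrite ltnS in hi.
by rewrite !exprMn -{3}(subnKC hi) exprD; ring.
Qed.

Lemma hv_fin d (F : {poly K}) x : (size F <= d.+1)%N -> hv d F x 1 = F.[x].
Proof.
move=> h; rewrite (horner_coef_wide _ h); apply: eq_bigr => i _.
by rewrite expr1n mulr1.
Qed.

Lemma hv_inf d F x : hv d F x 0 = F`_d * x ^+ d.
Proof.
rewrite /hv big_ord_recr /= subnn expr0 mulr1 big1 ?add0r// => i _.
by rewrite expr0n subn_eq0 leqNgt ltn_ord /= !mulr0.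
Qed.

Lemma hv_ratio d (F : {poly K}) x y : (size F <= d.+1)%N -> y != 0 -> hv d F x y = y ^+ d * F.[x / y].
Proof. by move=> h y0; rewrite -(hv_fin _ h) -hv_scale mulr1 [y * _]mulrC mulfVK. Qed.

(** Coefficients at the formal degrees multiply even if the actual degrees are lower; this is
    multiplicativity of values at infinity. *)
Lemma coef_top (F G : {poly K}) d e : (size F <= d.+1)%N -> (size G <= e.+1)%N ->
  (F * G)`_(d + e) = F`_d * G`_e.
Proof.
move=> hF hG; have hd : (d < (d + e).+1)%N by rewrite ltnS leq_addr.
rewrite coefM (bigD1 (Ordinal hd)) //= addKn big1 ?addr0// => -[i hi] /=.
rewrite -val_eqE /= => ne; have [lt|ge] := ltnP i d; last first.
  by rewrite [F`_i]nth_default ?mul0r// (leq_trans hF)// ltn_neqAle eq_sym ne.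
rewrite [G`__]nth_default ?mulr0// (leq_trans hG)// ltn_subRL.
by rewrite ltn_add2r.
Qed.

Lemma hvM d e (F G : {poly K}) x y : (size F <= d.+1)%N -> (size G <= e.+1)%N ->
  hv (d + e) (F * G) x y = hv d F x y * hv e G x y.
Proof.
move=> hF hG; have [->|y0] := eqVneq y 0.
  by rewrite !hv_inf coef_top// exprD; ring.
have hFG : (size (F * G)%R <= (d + e).+1)%N.
  apply: (leq_trans (size_polyMleq _ _)).
  by move: hF hG; move: (size _) (size _) => a b; lia.
by rewrite !hv_ratio// hornerM exprD; ring.
Qed.

Lemma hv_lin a b x y : hv 1 (a *: 'X + b%:P) x y = a * x + b * y.
Proof.
rewrite /hv !big_ord_recr big_ord0 /= !coefD !coefZ !coefX !coefC /= !subn0 subnn.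
by rewrite !expr0 !expr1; ring.
Qed.

Lemma hv1 d x y : hv d 1 x y = y ^+ d.
Proof.
rewrite /hv big_ord_recl /= coef1 expr0 !mul1r subn0 big1 ?addr0// => i _.
by rewrite coef1 mul0r.
Qed.

Lemma hv_exp (F : {poly K}) k x y : (size F <= 2)%N -> hv k (F ^+ k) x y = hv 1 F x y ^+ k.
Proof.
move=> h; elim: k => [|k ih]; first by rewrite !expr0 hv1 expr0.
rewrite exprS -add1n hvM// ?ih ?exprS//.
by rewrite (leq_trans (size_poly_exp_leq _ _))// ltnS; move: h; case: (size F) => [|[|[|]]] //= _; rewrite ?mul0n ?mul1n.
Qed.

Lemma size_exp2 (F : {poly K}) k : (size F <= 2)%N -> (size (F ^+ k) <= k.+1)%N.
Proof.
move=> h; rewrite (leq_trans (size_poly_exp_leq _ _))// ltnS.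
by move: h; case: (size F) => [|[|[|]]] //= _; rewrite ?mul0n ?mul1n.
Qed.

Lemma size_lin (a b : K) : (size (a *: 'X + b%:P)%R <= 2)%N.
Proof.
rewrite (leq_trans (size_polyD _ _))// geq_max (leq_trans (size_scale_leq _ _)) ?size_polyX//=.
by rewrite (leq_trans (size_polyC_leq1 _)).
Qed.

Lemma poly_ext (F G : {poly K}) : (forall x, F.[x] = G.[x]) -> F = G.
Proof.
move=> h; apply/eqP; rewrite -subr_eq0; apply/eqP.
by apply: (@poly_eq0_cofinite K [::]) => u _; rewrite hornerD hornerN h subrr.
Qed.

(** The linear substitution in the binary form of degree d that F represents; d is kept because the
    degree of the polynomial may drop. *)
Definition pull (al be ga de : K) (d : nat) (F : {poly K}) : {poly K} :=
  \sum_(i < d.+1) F`_i *: ((al *: 'X + be%:P) ^+ i * (ga *: 'X + de%:P) ^+ (d - i)).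

Lemma size_pull al be ga de d F : (size (pull al be ga de d F) <= d.+1)%N.
Proof.
apply: (leq_trans (size_sum _ _ _)); apply/bigmax_leqP => -[i hi] _ /=.
rewrite (leq_trans (size_scale_leq _ _))// (leq_trans (size_polyMleq _ _))//.
have := size_exp2 i (size_lin al be); have := size_exp2 (d - i) (size_lin ga de).
by move: (size _) (size _) => a b; lia.
Qed.

Lemma hv_sum d (T : finType) (F : T -> {poly K}) x y :
  hv d (\sum_t F t) x y = \sum_t hv d (F t) x y.
Proof.
rewrite /hv exchange_big /=; apply: eq_bigr => i _.
by rewrite coef_sum mulr_suml.
Qed.

Lemma hv_pull al be ga de d F x y :
  hv d (pull al be ga de d F) x y = hv d F (al * x + be * y) (ga * x + de * y).
Proof.
rewrite hv_sum; apply: eq_bigr => -[i hi] _ /=; rewrite hvZ; congr (_ * _).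
rewrite -{1}(subnKC (ltnSE hi : (i <= d)%N)) hvM ?size_exp2 ?size_lin//.
by rewrite (hv_exp i _ _ (size_lin al be)) (hv_exp (d - i) _ _ (size_lin ga de)) !hv_lin.
Qed.

Lemma horner_pull al be ga de d F x :
  (pull al be ga de d F).[x] = hv d F (al * x + be) (ga * x + de).
Proof. by rewrite -(hv_fin _ (size_pull _ _ _ _ _ _)) hv_pull !mulr1. Qed.

Lemma pullM al be ga de d e (F G : {poly K}) : (size F <= d.+1)%N -> (size G <= e.+1)%N ->
  pull al be ga de (d + e) (F * G) = pull al be ga de d F * pull al be ga de e G.
Proof. by move=> hF hG; apply: poly_ext => x; rewrite hornerM !horner_pull hvM. Qed.

Lemma pullX al be ga de k (F : {poly K}) : (size F <= 2)%N ->
  pull al be ga de k (F ^+ k) = pull al be ga de 1 F ^+ k.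
Proof. by move=> hF; apply: poly_ext => x; rewrite horner_exp !horner_pull hv_exp. Qed.

Lemma pullD al be ga de d F G : pull al be ga de d (F + G) = pull al be ga de d F + pull al be ga de d G.
Proof. by apply: poly_ext => x; rewrite hornerD !horner_pull hvD. Qed.

Lemma pullZ al be ga de d a F : pull al be ga de d (a *: F) = a *: pull al be ga de d F.
Proof. by apply: poly_ext => x; rewrite hornerZ !horner_pull hvZ. Qed.

Lemma pullK al be ga de d (F : {poly K}) : (size F <= d.+1)%N ->
  pull de (- be) (- ga) al d (pull al be ga de d F) = (al * de - be * ga) ^+ d *: F.
Proof.
move=> hF; apply: poly_ext => x; rewrite horner_pull hv_pull hornerZ -(hv_fin _ hF) -hv_scale.
by congr hv; ring.
Qed.

Lemma pull_neq0 (al be ga de : K) d (F : {poly K}) : al * de - be * ga != 0 -> (size F <= d.+1)%N ->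
  F != 0 -> pull al be ga de d F != 0.
Proof.
move=> D0 hF; apply: contra_neq => e; have := pullK al be ga de hF.
rewrite e => /esym/eqP; rewrite (_ : pull _ _ _ _ _ 0 = 0); last first.
  by rewrite /pull big1// => i _; rewrite coef0 scale0r.
by rewrite scaler_eq0 expf_eq0 (negbTE D0) andbF => /eqP.
Qed.

Definition toP (x y : K) : option K := if y == 0 then None else Some (x / y).
Definition hx (z : option K) : K := if z is Some a then a else 1.
Definition hy (z : option K) : K := if z is Some _ then 1 else 0.

Lemma toP_hxy z : toP (hx z) (hy z) = z.
Proof. by case: z => [a|]; rewrite /toP /= ?eqxx// oner_eq0 divr1. Qed.

Lemma toP_scale k x y : k != 0 -> toP (k * x) (k * y) = toP x y.
Proof.
move=> k0; rewrite /toP mulf_eq0 (negbTE k0) /=; case: eqP => // /eqP y0.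
by rewrite -mulf_div divff ?mul1r.
Qed.

Lemma toP_coords x y : (x != 0) || (y != 0) ->
  exists2 k, k != 0 & x = k * hx (toP x y) /\ y = k * hy (toP x y).
Proof.
rewrite /toP; have [->|y0] := eqVneq y 0; rewrite ?orbF => h.
  by exists x; rewrite ?mulr1 ?mulr0.
by exists y => //; rewrite mulr1 mulrC mulfVK.
Qed.

Definition mob (al be ga de : K) (z : option K) : option K :=
  toP (al * hx z + be * hy z) (ga * hx z + de * hy z).

Lemma mob_None (al be ga de : K) : mob al be ga de None = toP al ga.
Proof. by rewrite /mob /= !mulr1 !mulr0 !addr0. Qed.

Lemma mob_0 (al be ga de : K) : mob al be ga de (Some 0) = toP be de.
Proof. by rewrite /mob /= !mulr1 !mulr0 !add0r. Qed.

Lemma mob_1 (al be ga de : K) : mob al be ga de (Some 1) = toP (al + be) (ga + de).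
Proof. by rewrite /mob /= !mulr1. Qed.

Lemma lin2_neq0 (al be ga de x y : K) : al * de - be * ga != 0 -> (x != 0) || (y != 0) ->
  (al * x + be * y != 0) || (ga * x + de * y != 0).
Proof.
move=> D0; rewrite -!negb_and; apply: contra => /andP[/eqP h1 /eqP h2].
have e1 : (al * de - be * ga) * x = 0.
  by rewrite (_ : _ * x = de * (al * x + be * y) - be * (ga * x + de * y)); [rewrite h1 h2 !mulr0 subr0|ring].
have e2 : (al * de - be * ga) * y = 0.
  by rewrite (_ : _ * y = al * (ga * x + de * y) - ga * (al * x + be * y)); [rewrite h1 h2 !mulr0 subr0|ring].
by move/eqP: e1; move/eqP: e2; rewrite !mulf_eq0 (negbTE D0) /= => -> ->.
Qed.

Lemma hxy_or z : (hx z != 0) || (hy z != 0).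
Proof. by case: z => [a|] /=; rewrite oner_eq0 ?orbT. Qed.

Lemma mob_coords (al be ga de : K) z : al * de - be * ga != 0 -> exists2 k, k != 0 &
  al * hx z + be * hy z = k * hx (mob al be ga de z) /\
  ga * hx z + de * hy z = k * hy (mob al be ga de z).
Proof. by move=> D0; apply: toP_coords; apply: lin2_neq0 D0 (hxy_or z). Qed.

Lemma mob_comp (al be ga de al' be' ga' de' : K) z : al' * de' - be' * ga' != 0 ->
  mob al be ga de (mob al' be' ga' de' z) =
  mob (al * al' + be * ga') (al * be' + be * de') (ga * al' + de * ga') (ga * be' + de * de') z.
Proof.
move=> D0; have [k k0 [e1 e2]] := mob_coords z D0.
rewrite {1}/mob -(toP_scale _ _ k0); rewrite /mob.
by congr toP; rewrite mulrDr !(mulrCA k) -e1 -e2; ring.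
Qed.

Lemma mob_id a z : a != 0 -> mob a 0 0 a z = z.
Proof. by move=> a0; rewrite /mob !mul0r addr0 add0r toP_scale// toP_hxy. Qed.

Lemma mobK (al be ga de : K) z : al * de - be * ga != 0 ->
  mob de (- be) (- ga) al (mob al be ga de z) = z.
Proof.
move=> D0; rewrite mob_comp//.
rewrite (_ : de * be + _ = 0); last by ring.
rewrite (_ : - ga * al + _ = 0); last by ring.
by rewrite (_ : - ga * be + _ = de * al + - be * ga) ?mob_id//; [rewrite mulNr mulrC | ring].
Qed.

Definition mult (d : nat) (F : {poly K}) (z : option K) : nat :=
  if z is Some a then mup a F else (d - (size F).-1)%N.

Lemma mult_factor d (F : {poly K}) z : F != 0 -> (size F <= d.+1)%N -> exists G l : {poly K},
  [/\ F = G * l ^+ mult d F z, hv 1 l (hx z) (hy z) = 0, (size l <= 2)%N,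
      (mult d F z <= d)%N & (size G <= (d - mult d F z).+1)%N].
Proof.
move=> F0 hF; case: z => [a|] /=; last first.
  have p : (0 < size F)%N by rewrite size_poly_gt0.
  exists F, 1; rewrite expr1n mulr1 hv1 expr1 size_poly1 leq_subr; split=> //.
  by move: hF p; move: (size F) => n; lia.
have : ('X - a%:P) ^+ mup a F %| F by rewrite -mup_geq.
case/dvdpP => G e; have G0 : G != 0 by apply: contraNneq F0 => G0; rewrite e G0 mul0r.
have sz : (size F = size G + mup a F)%N.
  by rewrite {1}e size_Mmonic ?monic_exp ?monicXsubC// size_exp_XsubC addnS.
have p : (0 < size G)%N by rewrite size_poly_gt0.
exists G, ('X - a%:P); rewrite size_XsubC; split=> //.
- have -> : 'X - a%:P = 1 *: 'X + (- a)%:P by rewrite scale1r polyCN.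
  by rewrite hv_lin; ring.
- by move: hF p sz; move: (size F) (size G) (mup _ _) => x y z; lia.
by move: hF p sz; move: (size F) (size G) (mup _ _) => x y z; lia.
Qed.

Lemma mult_ge d (F G l : {poly K}) z k : F != 0 -> F = G * l ^+ k -> hv 1 l (hx z) (hy z) = 0 ->
  (size l <= 2)%N -> (k <= d)%N -> (size G <= (d - k).+1)%N -> (k <= mult d F z)%N.
Proof.
move=> F0 eF l0 sl kd sG; case: z l0 => [a|] /= l0.
  rewrite mup_geq// eF dvdp_mull// dvdp_exp2r// dvdp_XsubCl.
  by rewrite /root -(hv_fin a sl) l0.
have sl1 : (size l <= 1)%N.
  move: l0; rewrite hv_inf expr1n mulr1 => l1; apply/leq_sizeP => -[|[|j]] // _.
  by rewrite nth_default// (leq_trans sl).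
have : (size F <= (d - k).+1)%N.
  rewrite eF (leq_trans (size_polyMleq _ _))//.
  have := size_poly_exp_leq l k; rewrite (_ : ((size l).-1 * k)%N = 0%N); last by case: (size l) sl1 => [|[|]].
  by move: sG; move: (size G) (size (l ^+ k)%R) => x y; lia.
have p : (0 < size F)%N by rewrite size_poly_gt0.
by move: p; move: (size F) => n; lia.
Qed.

(** A power of a linear form vanishing at the image point pulls back to the same power of a linear
    form vanishing at z. The inverse substitution later gives the opposite inequality. *)
Lemma mult_pull_ge (al be ga de : K) d (F : {poly K}) z : al * de - be * ga != 0 -> F != 0 -> (size F <= d.+1)%N ->
  (mult d F (mob al be ga de z) <= mult d (pull al be ga de d F) z)%N.
Proof.
move=> D0 F0 hF; have [G [l [eF l0 sl kd sG]]] := mult_factor (mob al be ga de z) F0 hF.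
set k := mult d F _ in eF l0 sl kd sG *.
apply: (@mult_ge _ _ (pull al be ga de (d - k) G) (pull al be ga de 1 l)); rewrite ?size_pull ?pull_neq0//.
  by rewrite -pullX// -pullM ?size_exp2// subnK// -eF.
have [k' k0 [e1 e2]] := mob_coords z D0.
by rewrite hv_pull e1 e2 hv_scale l0 mulr0.
Qed.

Lemma multZ d a (F : {poly K}) z : a != 0 -> F != 0 -> mult d (a *: F) z = mult d F z.
Proof.
move=> a0 F0; case: z => [x|] /=; last by rewrite size_scale.
by rewrite -mul_polyC mupMr// rootC.
Qed.

Lemma mult_pull (al be ga de : K) d (F : {poly K}) z : al * de - be * ga != 0 -> F != 0 -> (size F <= d.+1)%N ->
  mult d (pull al be ga de d F) z = mult d F (mob al be ga de z).
Proof.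
move=> D0 F0 hF; apply/eqP; rewrite eqn_leq mult_pull_ge// andbT.
have D1 : de * al - - be * - ga != 0 by rewrite mulrNN mulrC.
have := mult_pull_ge (mob al be ga de z) D1 (pull_neq0 D0 hF F0) (size_pull _ _ _ _ _ _).
by rewrite mobK// pullK// multZ// expf_neq0.
Qed.

End Homogeneous.

(** * Rational maps in homogeneous coordinates and their pullbacks *)

Section RationalMaps.
Variable R : realType.
Local Notation K := R[i].
Implicit Types (f g : ratmap R) (z : CP1 R).

Lemma size_num f : (size (num f) <= (degree f).+1)%N.
Proof. by rewrite /degree (leq_trans _ (leqSpred _))// leq_max leqnn. Qed.

Lemma size_den f : (size (den f) <= (degree f).+1)%N.
Proof. by rewrite /degree (leq_trans _ (leqSpred _))// leq_max leqnn orbT. Qed.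

Lemma revalE f z : reval f z =
  toP (hv (degree f) (num f) (hx z) (hy z)) (hv (degree f) (den f) (hx z) (hy z)).
Proof.
case: z => [a|] /=; first by rewrite !hv_fin ?size_num ?size_den.
by rewrite !hv_inf expr1n !mulr1.
Qed.

Lemma top_coef f : ((num f)`_(degree f) != 0) || ((den f)`_(degree f) != 0).
Proof.
have nz : (num f != 0) || (den f != 0).
  rewrite -negb_and; apply/negP => /andP[/eqP n0 /eqP d0].
  by have := num_den_coprime f; rewrite n0 d0 /coprimep gcd0p size_poly0.
rewrite /degree; have [le|lt] := leqP (size (num f)) (size (den f)).
  rewrite -/(lead_coef (den f)) lead_coef_eq0; apply/orP; right.
  apply: contraL nz => /eqP d0; rewrite d0 eqxx orbF negbK -size_poly_eq0 -leqn0.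
  by rewrite (leq_trans le)// d0 size_poly0.
rewrite -/(lead_coef (num f)) lead_coef_eq0; apply/orP; left.
by rewrite -size_poly_gt0 (leq_ltn_trans _ lt).
Qed.

Lemma hv_ratmap_neq0 f x y : (x != 0) || (y != 0) ->
  (hv (degree f) (num f) x y != 0) || (hv (degree f) (den f) x y != 0).
Proof.
have [->|y0 _] := eqVneq y 0.
  rewrite orbF => x0; rewrite !hv_inf !mulf_eq0 !expf_eq0 (negbTE x0) !andbF !orbF.
  exact: top_coef.
rewrite !hv_ratio ?size_num ?size_den// !mulf_eq0 !expf_eq0 (negbTE y0) !andbF /= -negb_and.
apply/negP => /andP[n0 d0]; have := coprimep_root (num_den_coprime f) n0.
by rewrite d0.
Qed.

Lemma degree_eq (N D : {poly K}) (h : coprimep N D) d : (size N <= d.+1)%N -> (size D <= d.+1)%N ->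
  (N`_d != 0) || (D`_d != 0) -> degree (RatMap h) = d.
Proof.
move=> hN hD; rewrite /degree /= => c; suff -> : maxn (size N) (size D) = d.+1 by [].
apply/eqP; rewrite eqn_leq geq_max hN hD leq_max /=.
case/orP: c => c; apply/orP; [left|right]; rewrite ltnNge; apply: contra c => /leq_sizeP -> //.
Qed.

Lemma fibre_poly_neq0 f b : (0 < degree f)%N -> fibre_poly f b != 0.
Proof.
move=> dp; have co := num_den_coprime f; case: b => [w|] /=; last first.
  apply: contraTneq dp => d0; rewrite d0 coprimep0 in co.
  by move: co; rewrite -size_poly_eq1 /degree d0 size_poly0 maxn0 => /eqP ->.
apply: contraTneq dp => /eqP; rewrite subr_eq0 => /eqP e.
have : size (den f) == 1%N.
  rewrite size_poly_eq1; move/coprimepP: co => /(_ (den f)); rewrite e.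
  by rewrite -mul_polyC dvdp_mull ?dvdpp//; apply.
move=> /eqP sd; rewrite /degree e sd.
have : (size (w *: den f) <= 1)%N by rewrite -sd size_scale_leq.
by case: (size _) => [|[|]].
Qed.

Lemma size_fibre_poly f b : (size (fibre_poly f b) <= (degree f).+1)%N.
Proof.
case: b => [w|] /=; last exact: size_den.
rewrite (leq_trans (size_polyD _ _))// geq_max size_num size_polyN.
by rewrite (leq_trans (size_scale_leq _ _))// size_den.
Qed.

Lemma ram_indexE f z : ram_index f z = mult (degree f) (fibre_poly f (reval f z)) z.
Proof. by []. Qed.

Section Pullback.
Variables (al be ga de : K) (D0 : al * de - be * ga != 0) (f : ratmap R).
Let d := degree f.
Let N := pull al be ga de d (num f).
Let D := pull al be ga de d (den f).

Lemma pullback_coprime : coprimep N D.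
Proof.
apply/Pdiv.ClosedField.coprimepP => x; rewrite /root !horner_pull => n0; apply/negP => d0.
have := @hv_ratmap_neq0 f (al * x + be) (ga * x + de); rewrite (eqP n0) (eqP d0) eqxx /=.
have := lin2_neq0 D0 (x := x) (y := 1); rewrite !mulr1 oner_eq0 orbT => /(_ isT) ->.
by move/(_ isT).
Qed.

Definition pullback := RatMap pullback_coprime.

Lemma degree_pullback : degree pullback = d.
Proof.
apply: degree_eq; rewrite ?size_pull//.
have e F : (pull al be ga de d F)`_d = hv d F al ga.
  by have := hv_pull al be ga de d F 1 0; rewrite hv_inf expr1n !mulr1 !mulr0 !addr0.
rewrite !e; apply: hv_ratmap_neq0.
by have := lin2_neq0 D0 (x := 1) (y := 0); rewrite !mulr1 !mulr0 !addr0 oner_eq0; apply.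
Qed.

Lemma reval_pullback z : reval pullback z = reval f (mob al be ga de z).
Proof.
rewrite !revalE degree_pullback /= /N /D !hv_pull.
have [k k0 [-> ->]] := mob_coords z D0.
by rewrite !hv_scale toP_scale// expf_neq0.
Qed.

Lemma fibre_pullback b : fibre_poly pullback b = pull al be ga de d (fibre_poly f b).
Proof. by case: b => [w|] //=; rewrite -[in RHS]scaleNr pullD pullZ scaleNr. Qed.

Lemma ram_index_pullback z : (0 < degree f)%N ->
  ram_index pullback z = ram_index f (mob al be ga de z).
Proof.
move=> dp; rewrite !ram_indexE degree_pullback reval_pullback fibre_pullback mult_pull//.
  exact: fibre_poly_neq0.
exact: size_fibre_poly.
Qed.

End Pullback.

(** A vanishing determinant would give the numerator and the denominator a common zero in
    homogeneous coordinates, against coprimality. *)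
Lemma degree1_mob g : degree g = 1%N -> exists al be ga de,
  al * de - be * ga != 0 /\ reval g = mob al be ga de.
Proof.
move=> dg; exists (num g)`_1, (num g)`_0, (den g)`_1, (den g)`_0.
have hv1E F (x y : K) : hv 1 F x y = F`_1 * x + F`_0 * y.
  by rewrite /hv !big_ord_recr big_ord0 /= !subn0 subnn !expr0 !expr1; ring.
split; last by apply/funext => z; rewrite revalE dg !hv1E.
apply/negP => /eqP e; have tc := top_coef g; rewrite dg in tc.
have := @hv_ratmap_neq0 g (- (num g)`_0) (num g)`_1; rewrite dg !hv1E.
have := @hv_ratmap_neq0 g (- (den g)`_0) (den g)`_1; rewrite dg !hv1E.
rewrite (_ : (num g)`_1 * - (num g)`_0 + _ = 0); last by ring.
rewrite (_ : (den g)`_1 * - (den g)`_0 + _ = 0); last by ring.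
rewrite (_ : (num g)`_1 * - (den g)`_0 + _ = - ((num g)`_1 * (den g)`_0 - (num g)`_0 * (den g)`_1)); last by ring.
rewrite (_ : (den g)`_1 * - (num g)`_0 + _ = (num g)`_1 * (den g)`_0 - (num g)`_0 * (den g)`_1); last by ring.
rewrite e oppr0.
rewrite eqxx /=; case/orP: tc => -> ; rewrite ?orbT; first by move=> _ /(_ isT).
by move/(_ isT).
Qed.

Lemma mob_degree1 (al be ga de : K) : al * de - be * ga != 0 ->
  exists2 g, degree g = 1%N & reval g = mob al be ga de.
Proof.
move=> D0; have co : coprimep ('X : {poly K}) 1 by rewrite coprimep1.
have d1 : degree (RatMap co) = 1%N by rewrite /degree /= size_polyX size_poly1.
exists (pullback D0 (RatMap co)); first by rewrite degree_pullback.
apply/funext => z; rewrite reval_pullback revalE d1 /= hv1 expr1.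
have -> x y : hv 1 'X x y = x :> K.
  by rewrite /hv !big_ord_recr big_ord0 /= !coefX /= subnn expr0 expr1 mul0r !add0r mul1r mulr1.
exact: toP_hxy.
Qed.

End RationalMaps.

(** * Transport of covers by Moebius transformations *)

Section Transport.
Variable R : realType.
Local Notation K := R[i].
Implicit Types (f g : ratmap R) (z : CP1 R).

Lemma den_neq0 f : (0 < degree f)%N -> den f != 0.
Proof. exact: (@fibre_poly_neq0 R f None). Qed.

(** The cross products agree away from the poles, hence as polynomials; coprimality then makes each
    denominator divide the other. *)
Lemma reval_proportional f g : (0 < degree f)%N -> (0 < degree g)%N -> reval f = reval g ->
  exists2 a : K, a != 0 & num g = a *: num f /\ den g = a *: den f.
Proof.
move=> df dg e; have f0 := den_neq0 df; have g0 := den_neq0 dg.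
have cross : num f * den g = num g * den f.
  have [rf ef] := closed_field_poly_normal (den f).
  have [rg eg] := closed_field_poly_normal (den g).
  apply/eqP; rewrite -subr_eq0; apply/eqP; apply: (@poly_eq0_cofinite K (rf ++ rg)) => x.
  rewrite mem_cat negb_or => /andP[xf xg]; have := congr1 (fun F => F (Some x)) e; rewrite /reval.
  have hf : (den f).[x] != 0.
    by rewrite ef hornerZ mulf_neq0 ?lead_coef_eq0// -/(root _ x) root_prod_XsubC.
  have hg : (den g).[x] != 0.
    by rewrite eg hornerZ mulf_neq0 ?lead_coef_eq0// -/(root _ x) root_prod_XsubC.
  rewrite (negbTE hf) (negbTE hg) => -[h]; rewrite hornerD hornerN !hornerM.
  have -> : (num f).[x] = (num g).[x] / (den g).[x] * (den f).[x] by rewrite -h mulfVK.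
  by field.
have d1 : den f %| den g.
  have co : coprimep (den f) (num f) by rewrite coprimep_sym; exact: num_den_coprime.
  by rewrite -(Gauss_dvdpr _ co) cross dvdp_mull.
have d2 : den g %| den f.
  have co : coprimep (den g) (num g) by rewrite coprimep_sym; exact: num_den_coprime.
  by rewrite -(Gauss_dvdpr _ co) -cross dvdp_mull.
have : den g %= den f by rewrite /eqp d1 d2.
case/eqpP => -[a b] /= /andP[a0 b0] eab.
have dE : den g = (a^-1 * b) *: den f by rewrite -scalerA -eab scalerA mulVf ?scale1r.
exists (a^-1 * b); first by rewrite mulf_neq0 ?invr_neq0.
split=> //; apply: (mulIf f0); rewrite -cross dE -!mul_polyC; ring.
Qed.

Lemma reval_ram f g : (0 < degree f)%N -> (0 < degree g)%N -> reval f = reval g ->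
  degree f = degree g /\ forall z, ram_index f z = ram_index g z.
Proof.
move=> df dg e; have [a a0 [en ed]] := reval_proportional df dg e.
have dE : degree f = degree g by rewrite /degree en ed !size_scale.
split=> // z; rewrite !ram_indexE -e -dE.
have -> : fibre_poly g (reval f z) = a *: fibre_poly f (reval f z).
  by case: (reval f z) => [w|] //=; rewrite en ed scalerBr !scalerA [w * a]mulrC.
by rewrite multZ// fibre_poly_neq0.
Qed.

Definition mobius (phi : CP1 R -> CP1 R) := exists al be ga de : K,
  al * de - be * ga != 0 /\ phi = mob al be ga de.

Lemma mobiusP phi : mobius phi <-> exists2 g : ratmap R, degree g = 1%N & phi = reval g.
Proof.
split=> [[al [be [ga [de [D0 ->]]]]]|[g dg ->]].
  by have [g dg e] := mob_degree1 D0; exists g.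
by have [al [be [ga [de [D0 e]]]]] := degree1_mob dg; exists al, be, ga, de.
Qed.

Lemma mobius_id : mobius id.
Proof.
exists 1, 0, 0, 1; split; first by rewrite mulr1 mul0r subr0 oner_neq0.
by apply/funext => z; rewrite mob_id ?oner_neq0.
Qed.

Lemma mobius_comp phi psi : mobius phi -> mobius psi -> mobius (phi \o psi).
Proof.
move=> [al [be [ga [de [D0 ->]]]]] [al' [be' [ga' [de' [D0' ->]]]]].
exists (al * al' + be * ga'), (al * be' + be * de'), (ga * al' + de * ga'), (ga * be' + de * de').
split; last by apply/funext => z /=; rewrite mob_comp.
have -> : (al * al' + be * ga') * (ga * be' + de * de') - (al * be' + be * de') * (ga * al' + de * ga')
   = (al * de - be * ga) * (al' * de' - be' * ga') by ring.
exact: mulf_neq0.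
Qed.

Lemma mobius_inv phi : mobius phi -> exists psi, [/\ mobius psi, cancel phi psi & cancel psi phi].
Proof.
move=> [al [be [ga [de [D0 ->]]]]]; have D1 : de * al - - be * - ga != 0 by rewrite mulrNN mulrC.
exists (mob de (- be) (- ga) al); split.
- by exists de, (- be), (- ga), al.
- by move=> z; rewrite mobK.
by move=> z; have := mobK z D1; rewrite !opprK.
Qed.

Lemma exists_mobius (p a b : CP1 R) : p != a -> p != b -> a != b ->
  exists phi, [/\ mobius phi, phi None = p, phi (Some 0) = a & phi (Some 1) = b].
Proof.
pose det (x y : CP1 R) : K := hx x * hy y - hx y * hy x.
have det0 x y : x != y -> det x y != 0.
  apply: contra_neq; rewrite /det; case: x y => [x|] [y|] //=; rewrite ?mulr1 ?mulr0 ?mul1r ?subr0 ?sub0r.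
  - by move/eqP; rewrite subr_eq0 => /eqP ->.
  - by move/eqP; rewrite oppr_eq0 oner_eq0.
  by move/eqP; rewrite oner_eq0.
move=> pa pb ab; have d1 := det0 _ _ pa; have d2 := det0 _ _ pb; have d3 := det0 _ _ ab.
(* From the relation det(p, a) b = det(p, b) a - det(a, b) p: scaled by these factors, the
   coordinate vectors of p and a add up to a multiple of that of b. *)
pose la := - det a b; pose m := det p b.
have D0 : (la * hx p) * (m * hy a) - (m * hx a) * (la * hy p) != 0.
  rewrite (_ : _ - _ = la * m * det p a); last by rewrite /det; ring.
  by rewrite !mulf_neq0// oppr_eq0.
exists (mob (la * hx p) (m * hx a) (la * hy p) (m * hy a)); split.
- by exists (la * hx p), (m * hx a), (la * hy p), (m * hy a).
- by rewrite mob_None toP_scale ?toP_hxy// oppr_eq0.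
- by rewrite mob_0 toP_scale ?toP_hxy.
rewrite mob_1 -[RHS]toP_hxy -[RHS](toP_scale _ _ d1) /la /m /det.
by congr toP; ring.
Qed.

Lemma mobius_fix phi : mobius phi -> phi None = None -> phi (Some 0) = Some 0 ->
  phi (Some 1) = Some 1 -> phi = id.
Proof.
move=> [al [be [ga [de [D0 ->]]]]]; rewrite mob_None mob_0 mob_1 /toP.
case: eqP => // g0 _; rewrite g0 add0r; rewrite g0 mulr0 subr0 mulf_eq0 negb_or in D0.
case/andP: D0 => a0 d0; rewrite (negbTE d0) => -[/eqP]; rewrite mulf_eq0 invr_eq0 (negbTE d0) orbF => /eqP b0.
rewrite b0 addr0 => -[/(congr1 (fun t => t * de))]; rewrite mulfVK// mul1r => ad.
by rewrite ad; apply/funext => z; rewrite mob_id.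
Qed.

Variables (m n : nat).
Implicit Types (c : labelled_map R m n).

Lemma isoP c c' phi : isomorphism c c' phi <-> [/\ mobius phi,
  reval (cover_map c') \o phi = reval (cover_map c),
  forall i, phi (pole c i) = pole c' i & forall j, phi (zero c j) = zero c' j].
Proof.
by split=> -[h1 h2 h3 h4]; split=> //; apply/mobiusP.
Qed.

Lemma iso_id c : isomorphism c c id.
Proof. by apply/isoP; split=> //; exact: mobius_id. Qed.

Lemma iso_comp c c' c'' phi psi : isomorphism c c' phi -> isomorphism c' c'' psi ->
  isomorphism c c'' (psi \o phi).
Proof.
move=> /isoP[h1 h2 h3 h4] /isoP[g1 g2 g3 g4]; apply/isoP; split.
- exact: mobius_comp.
- by rewrite compA g2 h2.
- by move=> i /=; rewrite h3 g3.
by move=> i /=; rewrite h4 g4.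
Qed.

Lemma iso_inv c c' phi : isomorphism c c' phi ->
  exists psi, [/\ isomorphism c' c psi, cancel phi psi & cancel psi phi].
Proof.
move=> /isoP[h1 h2 h3 h4]; have [psi [p1 p2 p3]] := mobius_inv h1.
exists psi; split=> //; apply/isoP; split=> //.
- by rewrite -h2; apply/funext => z /=; rewrite p3.
- by move=> i; rewrite -h3 p2.
by move=> i; rewrite -h4 p2.
Qed.

Lemma iso_ram c c' phi : (0 < degree (cover_map c))%N -> (0 < degree (cover_map c'))%N ->
  isomorphism c c' phi -> forall z, ram_index (cover_map c) z = ram_index (cover_map c') (phi z).
Proof.
move=> dc dc' /isoP[[al [be [ga [de [D0 ->]]]]] h2 _ _] z.
rewrite -(ram_index_pullback D0)//; apply: (reval_ram _ _ _).2 => //; first by rewrite degree_pullback.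
by rewrite -h2; apply/funext => y; rewrite reval_pullback.
Qed.

Lemma cover_pullback mu nu w c phi : (0 < degree (cover_map c))%N -> is_cover mu nu w c -> mobius phi ->
  exists c', [/\ is_cover mu nu w c', isomorphism c' c phi &
    forall z, ram_index (cover_map c') z = ram_index (cover_map c) (phi z)].
Proof.
move=> dc [dE [p1 p2 p3] [z1 z2 z3] sb ur] mphi.
have [psi [mpsi K1 K2]] := mobius_inv mphi; have [al [be [ga [de [D0 ephi]]]]] := mphi.
pose f' := pullback D0 (cover_map c).
pose c' := LabelledMap f' (psi \o pole c) (psi \o zero c).
have rv z : reval f' z = reval (cover_map c) (phi z) by rewrite reval_pullback ephi.
have ram z : ram_index f' z = ram_index (cover_map c) (phi z).
  by rewrite ram_index_pullback// ephi.
have rng (T : Type) (P : T -> CP1 R) b : range P = reval (cover_map c) @^-1` [set b] ->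
    range (psi \o P) = reval f' @^-1` [set b].
  move=> e; apply/seteqP; split=> [_ [i _ <-]|z /= hz].
    by rewrite /= rv K2; have : (reval (cover_map c) @^-1` [set b]) (P i) by rewrite -e; exists i.
  have : range P (phi z) by rewrite e /= -rv.
  by case=> i _ h; exists i => //=; rewrite h K1.
exists c'; split=> //.
  split=> /=.
  - by rewrite -dE degree_pullback.
  - split; [by apply: inj_comp p1; exact: can_inj K2|exact: rng|].
    by move=> i; rewrite ram /= K2.
  - split; [by apply: inj_comp z1; exact: can_inj K2|exact: rng|].
    by move=> i; rewrite ram /= K2.
  - move=> k; have [z [e1 e2 e3]] := sb k; exists (psi z); split.
    + by rewrite rv K2.
    + by rewrite ram K2.
    move=> z'; rewrite rv ram => h ne; apply: e3 => // e.
    by apply: ne; rewrite -e K1.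
  by move=> b b0 bw z; rewrite rv ram; exact: ur b b0 bw _.
apply/isoP; split=> //=.
- by apply/funext => z /=; rewrite rv.
Qed.

End Transport.

(** * Ramification and the Wronskian *)

Section Wronskian.
Variable K : numClosedFieldType.
Implicit Types (N D G : {poly K}).

Definition wronskian N D : {poly K} := N^`() * D - N * D^`().

Lemma wronskian_sub N D (b : K) : wronskian (N - b *: D) D = wronskian N D.
Proof. by rewrite /wronskian derivB derivZ -!mul_polyC; ring. Qed.

Lemma mup_wronskian G D a : D.[a] != 0 -> G.[a] = 0 -> G != 0 ->
  mup a G = (mup a (wronskian G D)).+1.
Proof.
move=> Da Ga G0; set k := mup a G.
have k0 : (0 < k)%N by rewrite -XsubC_dvd// dvdp_XsubCl; apply/rootP.
have : ('X - a%:P) ^+ k %| G by rewrite -mup_geq.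
case/dvdpP => H e; have Ha : H.[a] != 0.
  apply/negP => Hr; have /factor_theorem[H' e'] : root H a by exact: Hr.
  have : (k.+1 <= k)%N; last by rewrite ltnn.
  by rewrite mup_geq// e e' -mulrA -exprS dvdp_mulIr.
have [k' ek] : exists k', k = k'.+1 by exists k.-1; rewrite prednK.
rewrite ek in e *; set L := 'X - a%:P.
have -> : wronskian G D = (k'.+1%:R * H * D + L * wronskian H D) * L ^+ k'.
  rewrite /wronskian e -/L derivM deriv_exp derivXsubC mul1r /= -(mulr_natl _ k'.+1) exprS.
  move: (k'.+1%:R : {poly K}) (L ^+ k') H^`() D^`() => c M H' D'; ring.
have r : ~~ root (k'.+1%:R * H * D + L * wronskian H D) a.
  rewrite /root hornerD !hornerM hornerXsubC subrr mul0r addr0 -polyC_natr hornerC.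
  by rewrite !mulf_neq0// pnatr_eq0.
by rewrite mupMr// mup_XsubCX eqxx.
Qed.

(** The top coefficient is the difference of the two distinct degrees times the leading
    coefficients, nonzero in characteristic 0. *)
Lemma size_wronskian G D d : size D = d.+1 -> G != 0 -> (size G <= d)%N ->
  size (wronskian G D) = ((size G).-1 + d)%N.
Proof.
move=> sD G0 sG; have p : (0 < size G)%N by rewrite size_poly_gt0.
case: d sD sG => [|d] sD sG; first by move: sG p; case: (size G).
case eG : (size G) p sG => [//|e] _ /= sG.
have D0 : D`_d.+1 != 0.
  by have := lead_coef_eq0 D; rewrite lead_coefE sD /= => ->; rewrite -size_poly_eq0 sD.
have g0 : G`_e != 0.
  by have := lead_coef_eq0 G; rewrite lead_coefE eG /= => ->.
have s1 : (size (G^`() * D)%R <= (e + d).+1)%N.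
  apply: (leq_trans (size_polyMleq _ _)); rewrite sD.
  have := lt_size_deriv G0; rewrite eG; move: (size _) => t; lia.
have s2 : (size (G * D^`())%R <= (e + d).+1)%N.
  apply: (leq_trans (size_polyMleq _ _)); rewrite eG.
  have D1 : D != 0 by rewrite -size_poly_eq0 sD.
  have := lt_size_deriv D1; rewrite sD; move: (size _) => t; lia.
have c2 : (G * D^`())`_(e + d) = G`_e * (D`_d.+1 *+ d.+1).
  rewrite coef_top ?eG ?coef_deriv//.
  have D1 : D != 0 by rewrite -size_poly_eq0 sD.
  by have := lt_size_deriv D1; rewrite sD.
have c1 : (G^`() * D)`_(e + d) = (G`_e *+ e) * D`_d.+1.
  case: e eG sG g0 {s1 s2 c2} => [|e] eG sG g0.
    by rewrite (size1_polyC (eq_leq eG)) derivC mul0r coef0 mulr0n mul0r.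
  rewrite addSnnS coef_top ?sD// ?coef_deriv//.
  by have := lt_size_deriv G0; rewrite eG.
have c : (wronskian G D)`_(e + d) != 0.
  rewrite coefB c1 c2 -mulr_natl -(mulr_natl _ d.+1).
  rewrite (_ : _ - _ = (e%:R - d.+1%:R) * (G`_e * D`_d.+1)); last by ring.
  by rewrite !mulf_neq0// subr_eq0 eqr_nat neq_ltn sG.
apply/eqP; rewrite addnS eqn_leq; apply/andP; split.
  by rewrite (leq_trans (size_polyD _ _))// geq_max s1 size_polyN s2.
by rewrite ltnNge; apply: contra c => /leq_sizeP ->.
Qed.

Section Factored.
Variables (I : finType) (q : I -> K) (qi : injective q).

Definition fact (A : pred I) (e : I -> nat) : {poly K} := \prod_(a | A a) ('X - (q a)%:P) ^+ e a.

Lemma fact_monic (A : pred I) (e : I -> nat) : fact A e \is monic.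
Proof. by apply: monic_prod => a _; rewrite monic_exp// monicXsubC. Qed.

Lemma size_fact (A : pred I) (e : I -> nat) : size (fact A e) = (\sum_(a | A a) e a).+1.
Proof.
rewrite /fact; elim/big_rec2: _ => [|a n F _ ih]; first by rewrite size_poly1.
have F0 : F != 0 by rewrite -size_poly_eq0 ih.
by rewrite size_monicM ?monic_exp ?monicXsubC// size_exp_XsubC ih addSn addnS.
Qed.

Lemma horner_fact (A : pred I) (e : I -> nat) x : (fact A e).[x] = \prod_(a | A a) (x - q a) ^+ e a.
Proof. by rewrite horner_prod; apply: eq_bigr => a _; rewrite horner_exp hornerXsubC. Qed.

Lemma fact_root0 (A : pred I) (e : I -> nat) a : A a -> (0 < e a)%N -> (fact A e).[q a] = 0.
Proof. by move=> Aa ea; rewrite horner_fact (bigD1 a)//= subrr expr0n gtn_eqF// mul0r. Qed.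

Lemma fact_neq0 (A : pred I) (e : I -> nat) x : (forall a, A a -> x != q a) -> (fact A e).[x] != 0.
Proof.
by move=> h; rewrite horner_fact; apply/prodf_neq0 => a Aa; rewrite expf_neq0// subr_eq0 h.
Qed.

Lemma fact_fin_root (A : pred I) (e : I -> nat) x : (fact A e).[x] = 0 -> exists2 a, A a & x = q a.
Proof.
rewrite horner_fact => /eqP/prodf_eq0[a Aa]; rewrite expf_eq0 subr_eq0 => /andP[_ /eqP].
by exists a.
Qed.

Lemma mup_fact (A : pred I) (e : I -> nat) a : A a -> mup (q a) (fact A e) = e a.
Proof.
move=> Aa; rewrite /fact (bigD1 a)//= mupMl ?mup_XsubCX ?eqxx//.
rewrite /root horner_prod; apply/prodf_neq0 => b /andP[_ ba].
by rewrite horner_exp hornerXsubC expf_neq0// subr_eq0; apply: contra_neq ba => /qi.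
Qed.

Lemma deriv_fact (A : pred I) (e : I -> nat) x : (forall a, A a -> x != q a) ->
  (fact A e)^`().[x] = (fact A e).[x] * \sum_(a | A a) (e a)%:R / (x - q a).
Proof.
move=> h; rewrite /fact; elim/big_rec2: _ => [|a y F Aa ih].
  by rewrite derivC horner0 mulr0.
rewrite derivM hornerD !hornerM ih deriv_exp derivXsubC mul1r hornerMn !horner_exp hornerXsubC.
have xa : x - q a != 0 by rewrite subr_eq0 h.
case: (e a) => [|n]; first by rewrite mulr0n !mul0r !add0r expr0 !mul1r.
by rewrite /= exprS -(mulr_natl _ n.+1); field.
Qed.

Variables (s : I -> int) (s0 : forall a, s a != 0).
Notation e := (fun a => `|s a|%N).
Definition zeros_of := fact (fun a => 0 < s a) (fun a => `|s a|%N).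
Definition poles_of := fact (fun a => s a < 0) (fun a => `|s a|%N).

Lemma horner_ratio x : (forall a, x != q a) -> zeros_of.[x] / poles_of.[x] = \prod_a (x - q a) ^ s a.
Proof.
move=> h; rewrite !horner_fact [RHS](bigID (fun a => 0 < s a)) /=; congr (_ * _).
  by apply: eq_bigr => a sa; rewrite -{2}[s a]gtz0_abs// exprnP.
rewrite -prodfV; apply: eq_big => a; first by rewrite -leNgt lt_neqAle s0.
by move=> sa; rewrite exprnP abszE ltr0_norm// invr_expz opprK.
Qed.

(** The Wronskian is the product of both polynomials with the logarithmic derivative, whose simple
    poles remove one power of each factor. *)
Lemma wronskian_fact : wronskian zeros_of poles_of =
  numer predT q (fun a => (s a)%:~R) * fact predT (fun a => `|s a|.-1)%N.
Proof.
apply/eqP; rewrite -subr_eq0; apply/eqP; apply: (@poly_eq0_cofinite K (codom q)) => x hx.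
have xq a : x != q a by apply: contraNneq hx => ->; exact: codom_f.
rewrite hornerD hornerN; apply/eqP; rewrite subr_eq0; apply/eqP.
rewrite [in LHS]/wronskian hornerD hornerN !hornerM !deriv_fact// horner_numer; last by [].
set Z := zeros_of.[x]; set P := poles_of.[x].
transitivity (Z * P * \sum_a (s a)%:~R / (x - q a)).
  rewrite [in RHS](bigID (fun a => 0 < s a)) /= [X in _ = _ * (_ + X)](eq_bigl (fun a => s a < 0)); last first.
    by move=> a; rewrite -leNgt lt_neqAle s0.
  rewrite [X in _ = _ * (X + _)](eq_bigr (fun a => `|s a|%N%:R / (x - q a))) => [|a sa]; last first.
    by rewrite -{1}[s a]gtz0_abs.
  rewrite [X in _ = _ * (_ + X)](eq_bigr (fun a => - (`|s a|%N%:R / (x - q a)))) => [|a sa]; last first.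
    rewrite -mulNr; congr (_ / _); rewrite -[in LHS](opprK (s a)) mulrNz.
    by rewrite -(ltr0_norm sa) -abszE.
  by rewrite sumrN; ring.
have -> : Z * P = (denom predT q).[x] * (fact predT (fun a => `|s a|.-1)%N).[x]; last by ring.
rewrite /Z /P !horner_fact horner_denom -big_split /= [in RHS](bigID (fun a => 0 < s a)) /=.
have h a : (x - q a) * (x - q a) ^+ `|s a|.-1 = (x - q a) ^+ `|s a|.
  by rewrite -exprS prednK// absz_gt0.
congr (_ * _); apply: eq_big => a //; by rewrite -leNgt lt_neqAle s0.
Qed.

End Factored.
End Wronskian.

(** * From solutions to covers and back *)

Section DivisorMap.
Variable R : realType.
Local Notation K := R[i].
Variables (I : finType) (s : I -> int) (q : I -> K) (w0 : K) (f : ratmap R).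
Hypotheses (s0 : forall a, s a != 0) (ssum : \sum_a s a = 0) (i0 : I).
Hypotheses (qi : injective q) (w00 : w0 != 0).
Hypotheses (fN : num f = w0 *: zeros_of q s) (fD : den f = poles_of q s).

Definition pos_deg : nat := (\sum_(a | (0 < s a)%R) `|s a|)%N.

Lemma pos_degE : pos_deg = (\sum_(a | (s a < 0)%R) `|s a|)%N.
Proof.
apply/eqP; rewrite -eqz_nat /pos_deg !(big_morph Posz PoszD erefl) -subr_eq0.
rewrite (eq_bigr s) => [|a sa]; last by rewrite gtz0_abs.
rewrite [X in _ - X](eq_bigr (fun a => - s a)) => [|a sa]; last by rewrite abszE ltr0_norm.
rewrite sumrN opprK -[X in _ == X]ssum [X in _ == X](bigID (fun a => 0 < s a)) /=.
by apply/eqP; congr (_ + _); apply: eq_bigl => a; rewrite -leNgt lt_neqAle s0.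
Qed.

Lemma pos_deg_sum : (\sum_a `|s a| = pos_deg + pos_deg)%N.
Proof.
rewrite {2}pos_degE (bigID (fun a => (0 < s a)%R)) /=; congr (_ + _)%N.
by apply: eq_bigl => a; rewrite -leNgt lt_neqAle s0.
Qed.

Lemma pos_deg_gt0 : (0 < pos_deg)%N.
Proof.
have : (0 < \sum_a `|s a|)%N by rewrite (bigD1 i0)//= addn_gt0 absz_gt0 s0.
by rewrite pos_deg_sum addnn double_gt0.
Qed.

Let sZ : size (zeros_of q s) = pos_deg.+1. Proof. exact: size_fact. Qed.
Let sP : size (poles_of q s) = pos_deg.+1. Proof. by rewrite size_fact -pos_degE. Qed.

Lemma divisor_degree : degree f = pos_deg.
Proof. by rewrite /degree fN fD size_scale// sZ sP maxnn. Qed.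

Let topZ : (zeros_of q s)`_pos_deg = 1.
Proof. by have := fact_monic q (fun a => 0 < s a) (fun a => `|s a|%N); rewrite monicE lead_coefE sZ => /eqP. Qed.
Let topP : (poles_of q s)`_pos_deg = 1.
Proof. by have := fact_monic q (fun a => s a < 0) (fun a => `|s a|%N); rewrite monicE lead_coefE sP => /eqP. Qed.

Lemma divisor_inf : reval f None = Some w0.
Proof.
by rewrite /reval divisor_degree fN fD coefZ topZ topP oner_eq0 mulr1 divr1.
Qed.

Let Pn x : (forall a, x != q a) -> (poles_of q s).[x] != 0.
Proof. by move=> h; apply: fact_neq0. Qed.
Lemma divisor_val x : (forall a, x != q a) -> reval f (Some x) = Some (w0 * \prod_a (x - q a) ^ s a).
Proof.
move=> h; rewrite /reval fN fD (negbTE (Pn h)) hornerZ -mulrA.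
by rewrite (horner_ratio s0 h).
Qed.

Lemma divisor_pt a : reval f (Some (q a)) = if 0 < s a then Some 0 else None.
Proof.
rewrite /reval fN fD hornerZ; have [sa|sa] := boolP (0 < s a); last first.
  by rewrite [(poles_of q s).[_]]fact_root0 ?eqxx ?absz_gt0// lt_neqAle s0 leNgt.
rewrite [(zeros_of q s).[_]]fact_root0 ?absz_gt0// mulr0 mul0r ifN//.
apply/eqP => /fact_fin_root[b sb /qi e]; rewrite e in sa.
by have := lt_trans sa sb; rewrite ltxx.
Qed.

Lemma divisor_ram_pt a : ram_index f (Some (q a)) = `|s a|%N.
Proof.
rewrite /ram_index divisor_pt; case: ifPn => sa /=.
  rewrite scale0r subr0 fN -mul_polyC mupMr ?rootC//.
  exact: (mup_fact qi (fun a => `|s a|%N) sa).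
rewrite fD; apply: (mup_fact qi (fun a => `|s a|%N)); by rewrite lt_neqAle s0 leNgt.
Qed.

Let dp : (0 < degree f)%N. Proof. by rewrite divisor_degree pos_deg_gt0. Qed.

Let wr b : wronskian (num f - b *: den f) (den f) =
  w0 *: (numer predT q (fun a => (s a)%:~R) * fact q predT (fun a => `|s a|.-1)%N).
Proof.
by rewrite wronskian_sub fN fD -wronskian_fact// /wronskian derivZ -!scalerAl -scalerBr.
Qed.

Lemma divisor_ram x : (forall a, x != q a) ->
  ram_index f (Some x) = (mup x (numer predT q (fun a => (s a)%:~R))).+1.
Proof.
move=> h; have rv := divisor_val h; set b := w0 * _ in rv.
rewrite /ram_index rv; have G0 := fibre_poly_neq0 (Some b) dp.
have Dx : (den f).[x] != 0 by rewrite fD Pn.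
rewrite (mup_wronskian Dx) ?wr//=.
  rewrite -mul_polyC mupMr ?rootC// mupMl//; apply: fact_neq0 => a _; exact: h.
rewrite hornerD hornerN hornerZ; move: rv; rewrite /reval (negbTE Dx) => -[<-].
by rewrite mulfVK// subrr.
Qed.

(** The Riemann-Hurwitz count with the contribution of infinity separated: the size of the Wronskian
    is computed from the fibre through infinity and from its factorisation. *)
Lemma divisor_ram_inf : (ram_index f None + size (numer predT q (fun a => (s a)%:~R)))%N = #|I|.
Proof.
rewrite /ram_index divisor_inf divisor_degree.
have G0 := fibre_poly_neq0 (Some w0) dp; set G := fibre_poly _ _ in G0 *.
have sG : (size G <= pos_deg)%N.
  have : (size G <= pos_deg.+1)%N by rewrite -divisor_degree; exact: size_fibre_poly.
  rewrite leq_eqVlt => /orP[/eqP e|//].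
  have : lead_coef G = 0 by rewrite lead_coefE e /= coefB fN fD !coefZ topZ topP !mulr1 subrr.
  by move/eqP; rewrite lead_coef_eq0 (negbTE G0).
have sD : size (den f) = pos_deg.+1 by rewrite fD.
have := size_wronskian sD G0 sG; rewrite [wronskian _ _]wr size_scale//.
have n0 : numer predT q (fun a => (s a)%:~R) != 0.
  by apply: (@numer_neq0 _ _ predT q _ i0) => //; [move=> ? ? _ _; exact: qi|rewrite intr_eq0].
rewrite mulrC size_monicM ?fact_monic// size_fact.
have e : (\sum_(a | predT a) `|s a|.-1 + #|I| = pos_deg + pos_deg)%N.
  rewrite -pos_deg_sum -sum1_card -big_split; apply: eq_bigr => a _ /=.
  by rewrite addn1 prednK// absz_gt0.
have pG : (0 < size G)%N by rewrite size_poly_gt0.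
move: e sG pG; move: (size G) (size (numer _ _ _)) (\sum_(a | _) _)%N pos_deg #|I| => x y z t i.
lia.
Qed.

(** The converse of [size_numer_sum00]: a nonzero second moment would leave a term of full degree in
    ['X ^+ 2] times the numerator. *)
Lemma size_numer_sumsq : (size (numer predT q (fun a => (s a)%:~R)) + 2 <= #|I|)%N ->
  \sum_a (s a)%:~R * q a = 0.
Proof.
move=> h; have c0 : \sum_a (s a)%:~R = 0 :> K by rewrite -(rmorph_sum intr) ssum.
have e1 := mulX_numer predT q (fun a => (s a)%:~R); rewrite c0 scale0r add0r in e1.
have e2 := mulX_numer predT q (fun a => (s a)%:~R * q a); rewrite -e1 in e2.
apply/eqP/negPn/negP => n0.
have : (size ((\sum_(a | predT a) (s a)%:~R * q a) *: denom predT q) <= #|I|)%N.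
  rewrite (_ : _ *: _ = 'X * ('X * numer predT q (fun a => (s a)%:~R)) -
     numer predT q (fun a => (s a)%:~R * q a * q a)); last by rewrite e2 addrK.
  rewrite (leq_trans (size_polyD _ _))// geq_max size_polyN; apply/andP; split.
    have hX p : (size ('X * p)%R <= (size (p : {poly K})).+1)%N.
      by rewrite (leq_trans (size_polyMleq _ _)) ?size_polyX.
    by apply: leq_trans h; rewrite addn2 (leq_trans (hX _)) ?ltnS.
  exact: size_numer.
by rewrite size_scale// size_denom ltnn.
Qed.

End DivisorMap.

Lemma fact_dvd (K : numClosedFieldType) (I : finType) (q : I -> K) (A : pred I) (e : I -> nat) (p : {poly K}) :
  injective q -> p != 0 -> (forall a, A a -> (e a <= mup (q a) p)%N) -> fact q A e %| p.
Proof.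
move=> qi p0 h; rewrite /fact.
elim: (index_enum I) (index_enum_uniq I) => [|a r ih] /=; first by rewrite big_nil dvd1p.
case/andP => ar ur; rewrite big_cons; case: ifP => [Aa|_]; last exact: ih.
rewrite Gauss_dvdp; first by rewrite -mup_geq// h//= ih.
apply: coprimep_expl; rewrite coprimep_sym coprimep_XsubC /root horner_prod.
rewrite prodf_seq_neq0; apply/allP => b br; apply/implyP => Ab.
rewrite horner_exp hornerXsubC expf_neq0// subr_eq0; apply: contraNneq ar => /qi ab.
by rewrite ab.
Qed.

Section Covers.
Variables (R : realType) (m n : nat).
Local Notation K := R[i].
Variables (mu : 'I_m -> nat) (nu : 'I_n -> nat) (w : 'I_(m + n - 2) -> K).
Hypotheses (mu0 : forall i, (0 < mu i)%N) (nu0 : forall j, (0 < nu j)%N).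
Hypotheses (sums : (\sum_i mu i = \sum_j nu j)%N) (mn3 : (3 <= m + n)%N).
Hypotheses (wI : injective w) (w0 : forall k, w k != 0).
Variable r : 'I_(m + n - 2).
Local Notation I := ('I_m + 'I_n)%type.
Local Notation W := {k : 'I_(m + n - 2) | k != r}.
Variables (i0 i1 : I) (i01 : i0 != i1).

Definition weight (a : I) : int := match a with inl i => - (mu i)%:Z | inr j => (nu j)%:Z end.
Definition ratio (k : W) : K := w (val k) / w r.
Local Notation s := weight.

Lemma weight_neq0 a : s a != 0.
Proof. by case: a => [i|j] /=; rewrite ?oppr_eq0 eqz_nat -lt0n. Qed.

Lemma weight_sum : \sum_a s a = 0.
Proof. by rewrite big_sumType /= sumrN -!(big_morph Posz PoszD erefl) sums addNr. Qed.

Lemma weight_pos a : (0 < s a) = if a is inr _ then true else false.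
Proof. by case: a => [i|j] /=; rewrite ?oppr_gt0 ltz_nat ?nu0. Qed.

Lemma weight_deg : pos_deg s = (\sum_i mu i)%N.
Proof.
rewrite /pos_deg (eq_bigl _ _ weight_pos) big_sumType /= big_pred0_eq add0n sums.
by apply: eq_bigr => j _; rewrite ?absz_nat.
Qed.

Lemma card_weights : (#|{: I}| = #|{: W}| + 3)%N.
Proof.
rewrite card_sum !card_ord card_sig; have := cardC1 r; rewrite card_ord => e.
rewrite (_ : #|_| = (m + n - 2).-1); last by rewrite -e; apply: eq_card.
by move: mn3; clear; lia.
Qed.

Lemma ratioI : injective ratio.
Proof. by move=> k l /(mulIf (invr_neq0 (w0 r)))/wI/val_inj. Qed.
Lemma ratio_neq0 k : ratio k != 0.
Proof. by rewrite mulf_neq0 ?invr_neq0. Qed.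
Lemma ratio_neq1 k : ratio k != 1.
Proof.
apply/eqP => /(congr1 (fun t => t * w r)); rewrite mulfVK// mul1r => /wI e.
by have := valP k; rewrite e eqxx.
Qed.

(* The normal form of a cover: the critical point over w r is at infinity. *)
Definition standard (q : I -> K) (c : labelled_map R m n) :=
  [/\ num (cover_map c) = w r *: zeros_of q s, den (cover_map c) = poles_of q s,
      forall i, pole c i = Some (q (inl i)) & forall j, zero c j = Some (q (inr j))].

Lemma exists_standard q : injective q -> exists c, standard q c.
Proof.
move=> qi; have co : coprimep (w r *: zeros_of q s) (poles_of q s).
  apply/Pdiv.ClosedField.coprimepP => x; rewrite /root hornerZ mulf_eq0 (negbTE (w0 r)) /=.
  move=> /eqP/fact_fin_root[a sa ->]; apply/eqP => /fact_fin_root[b sb /qi e].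
  by rewrite e in sa; have := lt_trans sa sb; rewrite ltxx.
by exists (LabelledMap (RatMap co) (fun i => Some (q (inl i))) (fun j => Some (q (inr j)))).
Qed.

Let s0 := weight_neq0.
Let ssum := weight_sum.

(** Away from the labels the ramification is read off the numerator, which has the c k as simple
    roots, and infinity is double by its degree. So no ramification is left over other values. *)
Lemma sol_cover q c cm : sol_c s i0 i1 ratio q c -> standard q cm ->
  [/\ is_cover mu nu w cm, ram_index (cover_map cm) None = 2%N,
      reval (cover_map cm) None = Some (w r) &
      forall k : W, ram_index (cover_map cm) (Some (c k)) = 2%N /\
        reval (cover_map cm) (Some (c k)) = Some (w (val k))].
Proof.
move=> hs [fN fD hp hz]; set f := cover_map cm in fN fD *.
have [qi cq sq [q0 q1] hk] := hs.
have char0 (t : int) : t != 0 -> t%:~R != 0 :> K by rewrite intr_eq0.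
have [sg sg0 nE] := sol_numer s0 ssum card_weights char0 ratioI hs.
have cI := sol_cI ratioI hs.
have nF : \prod_k ('X - (c k)%:P) = fact c predT (fun=> 1%N).
  by apply: eq_bigr => k _; rewrite expr1.
have i0' := i0.
have wr0 := w0 r.
have vl x := @divisor_val R I s q (w r) f s0 fN fD x.
have pt a := @divisor_pt R I s q (w r) f s0 qi fN fD a.
have rp a := @divisor_ram_pt R I s q (w r) f s0 qi wr0 fN fD a.
have ram x := @divisor_ram R I s q (w r) f s0 ssum i0 wr0 fN fD x.
have vinf : reval f None = Some (w r) := divisor_inf s0 ssum wr0 fN fD.
have rinf : ram_index f None = 2%N.
  have := divisor_ram_inf s0 ssum i0 qi wr0 fN fD; rewrite nE size_scale// nF size_fact.
  rewrite sum1_card card_weights -[3%N]/(2 + 1)%N addnA [(_ + 2)%N]addnC addn1.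
  by rewrite addnS => -[/addIn].
have rk x : (forall a, x != q a) -> ram_index f (Some x) = (x \in codom c).+1.
  move=> h; rewrite ram// nE -mul_polyC mupMr ?rootC// nF; congr _.+1.
  have [/codomP[k ->]|xc] := boolP (x \in codom c); first exact: (mup_fact cI (fun=> 1%N)).
  apply: mupNroot; apply: fact_neq0 => k _; apply: contraNneq xc => ->; exact: codom_f.
have vk k : reval f (Some (c k)) = Some (w (sval k)).
  by rewrite vl// (hk k).2 /ratio mulrC mulfVK.
have rck k : ram_index f (Some (c k)) = 2%N by rewrite rk// codom_f.
have off x b : reval f (Some x) = Some b -> b != 0 -> forall a, x != q a.
  move=> h b0 a; apply/negP => /eqP xa; move: h; rewrite xa pt; case: ifP => // _ [] h.
  by rewrite -h eqxx in b0.
split=> //; split.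
- by rewrite -/f (divisor_degree s0 ssum wr0 fN fD) weight_deg.
- split; [by move=> i i'; rewrite !hp => -[/qi[]]| |by move=> i; rewrite hp rp /= abszN absz_nat].
  apply/seteqP; split=> [_ [i _ <-]|[x|] /=]; rewrite ?hp /=; [|move=> hx|by rewrite -/f vinf].
    by rewrite -/f pt weight_pos.
  have [/codomP[[i|j] xi]|xc] := boolP (x \in codom q).
  + by exists i => //; rewrite hp xi.
  + by move: hx; rewrite -/f xi pt weight_pos.
  by move: hx; rewrite -/f vl// => a; apply: contraNneq xc => ->; exact: codom_f.
- split; [by move=> i i'; rewrite !hz => -[/qi[]]| |by move=> i; rewrite hz rp].
  apply/seteqP; split=> [_ [i _ <-]|[x|] /=]; rewrite ?hz /=; [|move=> hx|].
  + by rewrite -/f pt weight_pos.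
  + have [/codomP[[i|j] xi]|xc] := boolP (x \in codom q).
    * by move: hx; rewrite -/f xi pt weight_pos.
    * by exists j => //; rewrite hz xi.
    have xn a : x != q a by apply: contraNneq xc => ->; exact: codom_f.
    move: hx; rewrite -/f vl// => -[] /eqP; rewrite mulf_eq0 (negbTE (w0 r)) /= => /prodf_eq0[a _].
    by rewrite expfz_eq0 subr_eq0 (negbTE (xn a)) andbF.
  by rewrite -/f vinf => -[] /eqP; rewrite (negbTE (w0 r)).
- move=> k; have [->|kr] := eqVneq k r.
    exists None; split=> // -[x|] // hx _; rewrite rk; last exact: off hx (w0 _).
    case: (boolP (x \in codom c)) => // /codomP[k' xk]; move: hx; rewrite -/f xk vk => -[/wI e].
    by have := valP k'; rewrite /= e eqxx.
  pose k' : W := exist _ k kr; exists (Some (c k')); split; [exact: vk k'|exact: rck|].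
  move=> [x|] hx ne; last first.
    by move: hx; rewrite -/f vinf => -[/wI e]; move: (kr); rewrite -e eqxx.
  rewrite rk; last exact: off hx (w0 _).
  case: (boolP (x \in codom c)) => // /codomP[l xl]; case: ne; move: hx; rewrite -/f xl vk => -[/wI e].
  by congr (Some (c _)); exact: val_inj.
move=> b b0 bw [x|] hx; last by move: hx; rewrite -/f vinf => -[e]; have := bw r; rewrite e eqxx.
rewrite rk; last exact: off hx b0.
case: (boolP (x \in codom c)) => // /codomP[l xl]; move: hx; rewrite -/f xl vk => -[e].
by have := bw (sval l); rewrite e eqxx.
Qed.

Definition pt_of (cm : labelled_map R m n) (a : I) : CP1 R :=
  match a with inl i => pole cm i | inr j => zero cm j end.

(** Numerator and denominator are divisible by the prescribed products and have the same degree, so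
    they are multiples of them, and the value at infinity fixes the constant. Ramification 2 at
    infinity gives the vanishing second moment. *)
Lemma cover_sol cm : is_cover mu nu w cm -> ram_index (cover_map cm) None = 2%N ->
  reval (cover_map cm) None = Some (w r) -> pt_of cm i0 = Some 0 -> pt_of cm i1 = Some 1 ->
  exists q c, sol_c s i0 i1 ratio q c /\ forall cm', standard q cm' -> isomorphism cm' cm id.
Proof.
move=> [dE [p1 p2 p3] [z1 z2 z3] sb ur] r2 vinf e0 e1; set f := cover_map cm in dE p2 p3 z2 z3 sb ur r2 vinf.
have rpole i : reval f (pole cm i) = None.
  by have : (reval f @^-1` [set None]) (pole cm i) by rewrite -p2; exists i.
have rzero j : reval f (zero cm j) = Some 0.
  by have : (reval f @^-1` [set Some 0]) (zero cm j) by rewrite -z2; exists j.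
have fin a : exists x, pt_of cm a = Some x.
  case: a => [i|j] /=.
    by case e: (pole cm i) => [x|]; [exists x|have := rpole i; rewrite e vinf].
  case e: (zero cm j) => [x|]; first by exists x.
  by have := rzero j; rewrite e vinf => -[/eqP]; rewrite (negbTE (w0 r)).
have [q hq] := choice fin.
have hp i : pole cm i = Some (q (inl i)) := hq (inl i).
have hz j : zero cm j = Some (q (inr j)) := hq (inr j).
have qi : injective q.
  move=> [i|j] [i'|j'] e.
  - by congr inl; apply: p1; rewrite !hp e.
  - by have := rpole i; rewrite hp e -hz rzero.
  - by have := rpole i'; rewrite hp -e -hz rzero.
  by congr inr; apply: z1; rewrite !hz e.
pose d := pos_deg s; have dd : degree f = d by rewrite dE /d weight_deg.
have dp : (0 < degree f)%N by rewrite dd; exact: pos_deg_gt0 s0 ssum i0.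
have sP : size (poles_of q s) = d.+1 by rewrite size_fact /d (pos_degE s0 ssum).
have sZ : size (zeros_of q s) = d.+1 by exact: size_fact.
have prop (F G : {poly K}) : F %| G -> G != 0 -> size F = d.+1 -> (size G <= d.+1)%N ->
    exists2 a, a != 0 & G = a *: F.
  move=> FG G0 sF sG; have e : F %= G by rewrite -dvdp_size_eqp// eqn_leq dvdp_leq// sF sG.
  have /eqpP[[a b] /= /andP[a0 b0] eab] := e.
  exists (b^-1 * a); first by rewrite mulf_neq0 ?invr_neq0.
  by rewrite -scalerA eab scalerA mulVf ?scale1r.
have n0 : num f != 0.
  by have := fibre_poly_neq0 (Some 0) dp; rewrite /= scale0r subr0.
have d0 : den f != 0 := fibre_poly_neq0 None dp.
have [a a0 numE] : exists2 a, a != 0 & num f = a *: zeros_of q s.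
  apply: prop => //; last by rewrite -dd; exact: size_num.
  apply: fact_dvd => // -[i|j] sa; first by rewrite weight_pos in sa.
  have := z3 j; rewrite /ram_index rzero hz /= scale0r subr0 => <-.
  by [].
have [b b0 denE] : exists2 b, b != 0 & den f = b *: poles_of q s.
  apply: prop => //; last by rewrite -dd; exact: size_den.
  apply: fact_dvd => // -[i|j] sa; last by move: sa; rewrite /= ltz_nat ltn0.
  have := p3 i; rewrite /ram_index rpole hp /= => <-.
  by rewrite abszN absz_nat.
have ab : a / b = w r.
  have mZ : (zeros_of q s)`_d = 1.
    by have := fact_monic q (fun a => 0 < s a) (fun a => `|s a|%N); rewrite monicE lead_coefE sZ => /eqP.
  have mP : (poles_of q s)`_d = 1.
    by have := fact_monic q (fun a => s a < 0) (fun a => `|s a|%N); rewrite monicE lead_coefE sP => /eqP.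
  move: vinf; rewrite /reval dd numE denE !coefZ mZ mP !mulr1 (negbTE b0) => -[] //.
have [cm0 st0] := exists_standard qi; have [fN fD _ _] := st0; set g := cover_map cm0 in fN fD.
have dg : degree g = d := divisor_degree s0 ssum (w0 r) fN fD.
have rfg : reval f = reval g.
  apply/funext => z; rewrite !revalE dd dg numE denE fN fD !hvZ -ab.
  rewrite -[RHS](toP_scale _ _ b0); congr toP; by field.
have rams z : ram_index f z = ram_index g z.
  by apply: (reval_ram _ _ rfg).2 => //; rewrite dg -dd.
have vl x := @divisor_val R I s q (w r) g s0 fN fD x.
have pt a := @divisor_pt R I s q (w r) g s0 qi fN fD a.
have ram x := @divisor_ram R I s q (w r) g s0 ssum i0 (w0 r) fN fD x.
have sq : \sum_a (s a)%:~R * q a = 0.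
  apply: (size_numer_sumsq ssum).
  by rewrite -(divisor_ram_inf s0 ssum i0 qi (w0 r) fN fD) -rams r2 addnC.
have crit (k : W) : exists x, (forall a, x != q a) /\ (\sum_a (s a)%:~R / (x - q a) = 0 /\
    \prod_a (x - q a) ^ s a = ratio k).
  have [[x|] [e2 e3 _]] := sb (val k); last first.
    by move: e2; rewrite vinf => -[/wI e]; move/eqP: (valP k) => /=; case.
  have xq c : x != q c.
    apply/negP => /eqP xc; move: e2; rewrite -/f rfg xc pt; case: ifP => // _ [/eqP].
    by rewrite eq_sym (negbTE (w0 _)).
  exists x; split=> //; split.
    have := e3; rewrite -/f rams ram// => -[e4].
    have : root (numer predT q (fun a => (s a)%:~R)) x.
      by apply/negPn/negP => /mupNroot; rewrite e4.
    rewrite /root horner_numer// mulf_eq0 horner_denom => /orP[/prodf_eq0[c _]|/eqP//].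
    by rewrite subr_eq0 (negbTE (xq c)).
  move: e2; rewrite -/f rfg vl// => -[e]; apply: (mulfI (w0 r)).
  by rewrite e /ratio mulrC mulfVK.
have [c hc] := choice crit.
exists q, c; split.
  split=> //; [by move=> k; have [] := hc k| |by move=> k; have [] := hc k].
  by have := hq i0; have := hq i1; rewrite e0 e1 => -[<-] [<-].
move=> cm' [gN gD gp gz]; apply/isoP; split; first exact: mobius_id.
- have dg' : degree (cover_map cm') = d := divisor_degree s0 ssum (w0 r) gN gD.
  apply/funext => z /=; rewrite -/f rfg !revalE dg dg' fN fD gN gD//.
- by move=> i; rewrite gp hp.
by move=> j; rewrite gz hz.
Qed.

End Covers.

Lemma xget_indep (T : choiceType) (P : set T) x y : (exists z, P z) -> xget x P = xget y P.
Proof.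
move=> [z Pz]; rewrite /xget; case: pselect => // -[]; exists z; exact/asboolP.
Qed.

(** * Isomorphism classes of covers as solutions *)

Section Count.
Variables (R : realType) (m n : nat).
Local Notation K := R[i].
Variables (mu : 'I_m -> nat) (nu : 'I_n -> nat) (w : 'I_(m + n - 2) -> K).
Hypotheses (mu0 : forall i, (0 < mu i)%N) (nu0 : forall j, (0 < nu j)%N).
Hypotheses (sums : (\sum_i mu i = \sum_j nu j)%N) (mn3 : (3 <= m + n)%N).
Hypotheses (wI : injective w) (w0 : forall k, w k != 0).
Variable r : 'I_(m + n - 2).
Local Notation I := ('I_m + 'I_n)%type.
Local Notation W := {k : 'I_(m + n - 2) | k != r}.
Variables (i0 i1 : I) (i01 : i0 != i1).
Local Notation s := (weight mu nu).
Local Notation ratio := (@ratio R m n w r).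
Local Notation standard := (@standard R m n mu nu w r).

Lemma iso_pt (c c' : labelled_map R m n) phi : isomorphism c c' phi ->
  forall a, phi (pt_of c a) = pt_of c' a.
Proof. by case=> _ _ h1 h2 [i|j] /=. Qed.

Lemma standard_pt q c : standard q c -> forall a, pt_of c a = Some (q a).
Proof. by case=> _ _ h1 h2 [i|j] /=. Qed.

Lemma cover_degree c : is_cover mu nu w c -> (0 < degree (cover_map c))%N.
Proof.
case=> -> _ _ _ _.
have := pos_deg_gt0 (weight_neq0 mu0 nu0) (weight_sum sums) i0.
by rewrite (weight_deg nu0 sums).
Qed.

(** Infinity is the only double point over w r, so phi fixes it, and it fixes the labels at 0 and 1;
    hence it is the identity. The c k are then recovered as the double points over the other branch
    points. *)
Lemma standard_iso q c q' c' cm cm' phi :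
  sol_c s i0 i1 ratio q c -> sol_c s i0 i1 ratio q' c' -> standard q cm -> standard q' cm' ->
  isomorphism cm cm' phi -> [/\ phi = id, q =1 q' & c =1 c'].
Proof.
move=> hs hs' st st' iso.
have [C r2 v2 hc] := sol_cover mu0 nu0 sums mn3 wI w0 hs st.
have [C' r2' v2' hc'] := sol_cover mu0 nu0 sums mn3 wI w0 hs' st'.
have ram := iso_ram (cover_degree C) (cover_degree C') iso.
have rev z : reval (cover_map cm') (phi z) = reval (cover_map cm) z.
  by case: iso => _ <- _ _.
have uniq2 k z z' : ram_index (cover_map cm') z = 2%N -> ram_index (cover_map cm') z' = 2%N ->
    reval (cover_map cm') z = Some (w k) -> reval (cover_map cm') z' = Some (w k) -> z = z'.
  case: C' => _ _ _ /(_ k)[y [_ _ hy]] _ a1 a2 b1 b2.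
  have e x : ram_index (cover_map cm') x = 2%N -> reval (cover_map cm') x = Some (w k) -> x = y.
    by move=> h1 h2; apply: contrapT => ne; have := hy x h2 ne; rewrite h1.
  by rewrite (e z)// (e z').
have finf : phi None = None by apply: (uniq2 r); rewrite -?ram ?rev.
have hp a : phi (Some (q a)) = Some (q' a).
  by rewrite -(standard_pt st) -(standard_pt st'); exact: iso_pt.
have [_ _ _ [q0 q1] _] := hs; have [_ _ _ [q0' q1'] _] := hs'.
have idp : phi = id.
  apply: mobius_fix => //; first by case/isoP: iso.
    by have := hp i0; rewrite q0 q0'.
  by have := hp i1; rewrite q1 q1'.
split=> // [a|k]; first by have := hp a; rewrite idp => -[].
have [h1 h2] := hc k; have [h1' h2'] := hc' k.
have g1 : ram_index (cover_map cm') (Some (c k)) = 2%N by rewrite -h1 ram idp.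
have g2 : reval (cover_map cm') (Some (c k)) = Some (w (val k)) by rewrite -h2 -rev idp.
by have [] := uniq2 (val k) _ _ g1 h1' g2 h2'.
Qed.

Lemma cover_iso_sol cm : is_cover mu nu w cm -> exists q c, sol_c s i0 i1 ratio q c /\
  forall cm', standard q cm' -> exists phi, isomorphism cm' cm phi.
Proof.
move=> C; have [p [rp vp _]] : simple_branching (cover_map cm) (Some (w r)) by case: C.
have rpole i : reval (cover_map cm) (pole cm i) = None.
  case: C => _ [_ p2 _] _ _ _.
  by have : (reval (cover_map cm) @^-1` [set None]) (pole cm i) by rewrite -p2; exists i.
have rzero j : reval (cover_map cm) (zero cm j) = Some 0.
  case: C => _ _ [_ p2 _] _ _.
  by have : (reval (cover_map cm) @^-1` [set Some 0]) (zero cm j) by rewrite -p2; exists j.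
have pa a : p != pt_of cm a.
  apply/eqP => e; move: rp; rewrite e; case: a {e} => [i|j] /=; first by rewrite rpole.
  by rewrite rzero => -[/eqP]; rewrite eq_sym (negbTE (w0 r)).
have ptI : injective (pt_of cm).
  case: C => _ [pI _ _] [zI _ _] _ _ [i|j] [i'|j'] /= e.
  - by rewrite (pI _ _ e).
  - by have := rpole i; rewrite e rzero.
  - by have := rpole i'; rewrite -e rzero.
  by rewrite (zI _ _ e).
have [phi [mphi f1 f2 f3]] := exists_mobius (pa i0) (pa i1) (contra_neq (@ptI i0 i1) i01).
have [c' [C' iso' ram']] := cover_pullback (cover_degree C) C mphi.
have [psi [_ K1 _]] := mobius_inv mphi.
have r2 : ram_index (cover_map c') None = 2%N by rewrite ram' f1.
have v2 : reval (cover_map c') None = Some (w r).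
  by case: iso' => _ <- _ _ /=; rewrite f1.
have e0 : pt_of c' i0 = Some 0.
  by apply: (can_inj K1); rewrite (iso_pt iso') f2.
have e1 : pt_of c' i1 = Some 1.
  by apply: (can_inj K1); rewrite (iso_pt iso') f3.
have [q [c [hs hq]]] := cover_sol mu0 nu0 sums wI w0 C' r2 v2 e0 e1.
exists q, c; split=> // cm' st; exists (phi \o id).
exact: iso_comp (hq _ st) iso'.
Qed.

(** Classes correspond to solutions, each with trivial automorphism group by [standard_iso], so
    every term of the sum is 1. *)
Lemma hurwitz0E N : (#|{: I}| <= N + 2)%N -> hurwitz0 mu nu w = ((hcount N s)%:R)%:E.
Proof.
move=> hN; pose S := Sol s i0 i1 ratio 1.
have cS : card_is S (hcount N s).
  apply: card_Sol => //; [exact: weight_neq0|exact: weight_sum|exact: card_weights|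
    exact: ratioI|exact: ratio_neq0|exact: ratio_neq1].
have SE z : S z <-> sol_c s i0 i1 ratio z.1 z.2.
  have e : (fun k : W => 1 * ratio k) = ratio by apply/funext => k; rewrite mul1r.
  by rewrite /S /Sol /mkset e.
have ex z : exists cm, S z -> standard z.1 cm.
  have [/SE hs|ns] := pselect (S z).
    by have [cm st] := exists_standard mu nu w0 r (let: And5 a _ _ _ _ := hs in a); exists cm.
  (* A dummy value for z that is not a solution. *)
  by exists (LabelledMap (RatMap (coprimep1 0)) (fun=> None) (fun=> None)) => /ns.
have [std hstd] := choice ex.
pose cls c := iso_class mu nu w c.
have self c : is_cover mu nu w c -> cls c c by move=> C; split=> //; exists id; exact: iso_id.
have clsE c c' phi : is_cover mu nu w c -> is_cover mu nu w c' -> isomorphism c c' phi -> cls c = cls c'.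
  move=> C C' h; have [psi [h' _ _]] := iso_inv h.
  apply/seteqP; split=> x [Cx [f hf]]; split=> //.
    by exists (f \o psi); exact: iso_comp h' hf.
  by exists (f \o phi); exact: iso_comp h hf.
have Scov z : S z -> is_cover mu nu w (std z).
  by move=> Sz; have [] := sol_cover mu0 nu0 sums mn3 wI w0 ((SE z).1 Sz) (hstd z Sz).
pose rep z := xget (std z) (cls (std z)).
have repP z : S z -> cls (std z) (rep z).
  by move=> Sz; apply: (@xgetPex _ (std z) (cls (std z))); exists (std z); exact/self/Scov.
have card : card_is (cover_reps mu nu w) (hcount N s).
  apply: (card_is_bij (f := rep)) cS => [z Sz|z z' Sz Sz' e|_ [c C <-]].
  - by exists (std z) => //; exact: Scov.
  - have [C [phi h]] := repP z Sz; have [_ [phi' h']] := repP z' Sz'; rewrite -e in h'.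
    have [psi [g _ _]] := iso_inv h'.
    have [_ eq ec] := standard_iso ((SE z).1 Sz) ((SE z').1 Sz') (hstd z Sz) (hstd z' Sz') (iso_comp h g).
    move: z z' eq ec {Sz Sz' e C h h' g psi phi phi'} => [q c] [q' c'] /= eq ec.
    by congr (_, _); exact/ffunP.
  have [q [c' [hs hiso]]] := cover_iso_sol C.
  have qE : ([ffun a => q a] : {ffun I -> K}) = q :> (_ -> _) by apply/funext => a; rewrite ffunE.
  have cE : ([ffun a => c' a] : {ffun W -> K}) = c' :> (_ -> _) by apply/funext => a; rewrite ffunE.
  pose z := ([ffun a => q a] : {ffun I -> K}, [ffun a => c' a] : {ffun W -> K}).
  have Sz : S z by apply/SE; rewrite /= qE cE.
  exists z => //; have [|phi hphi] := hiso (std z); first by rewrite -qE; exact: hstd.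
  rewrite /rep (clsE _ _ _ (Scov z Sz) C hphi); apply: xget_indep; exists c; exact: self.
have aut c : cover_reps mu nu w c -> automorphisms c = [set id].
  move=> hc; have [c0 C0 e0] := hc.
  have [C [phi0 h0]] : cls c0 c by rewrite -e0; apply: (@xgetPex _ c0 (cls c0)); exists c0; exact: self.
  have [q [c' [hs hiso]]] := cover_iso_sol C.
  have qi : injective q by case: hs.
  have [cm st] := exists_standard mu nu w0 r qi.
  have [psi hpsi] := hiso cm st; have [psi' [hpsi' K1 K2]] := iso_inv hpsi.
  apply/seteqP; split=> [phi h|_ ->]; last exact: iso_id.
  have [e _ _] := standard_iso hs hs st st (iso_comp hpsi (iso_comp h hpsi')).
  apply/funext => z; have := congr1 (fun f => f (psi' z)) e; rewrite /= K2 => e'.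
  by rewrite -[LHS]K2 e' K2.
have [t [ut st ht]] := card.
have tE : cover_reps mu nu w = [set` t] by apply/seteqP; split=> x; rewrite /= ht.
rewrite /hurwitz0 esum_fset; first last.
- by move=> c _; rewrite lee_fin.
- by rewrite tE; exact: finite_seq.
rewrite tE -fsbig_seq// (eq_big_seq (fun=> (1 : R)%:E)) => [|c /ht hc]; last first.
  by rewrite aut// fset_set1 cardfs1 invr1.
by rewrite sumEFin big_const_seq count_predT st iter_addr_0.
Qed.

End Count.

(** * Polynomiality *)

Section Polynomiality.
Variables (R : realType) (V : nat).
Implicit Types (p q : mpoly V R).
Local Notation homog d p := (p \is ishomog1 d mdeg).

Lemma homogM d e p q : homog d p -> homog e q -> homog (d + e) (p * q).
Proof. by move=> hp hq; apply: dhomogM. Qed.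

Lemma homog_sum (T : finType) (P : pred T) (F : T -> mpoly V R) d :
  (forall t, P t -> homog d (F t)) -> homog d (\sum_(t | P t) F t).
Proof. by move=> h; apply: rpred_sum. Qed.

Lemma homog_prod (T : finType) (F : T -> mpoly V R) (d : T -> nat) :
  (forall t, homog (d t) (F t)) -> homog (\sum_t d t) (\prod_t F t).
Proof.
move=> h; elim/big_rec2: _ => [|t q k _ ih]; first exact: dhomog1.
exact: homogM.
Qed.

Lemma homog_nat k p d : homog d p -> homog d (k%:R * p).
Proof. by move=> h; rewrite mulr_natl; apply: rpredMn. Qed.

(* Where no subset sum changes sign, the same terms of hcount contribute, each a product of
   such sums. *)
Lemma hcount_poly N (I : finType) (l : I -> mpoly V R) (X : ('I_V -> R) -> (I -> int) -> Prop) :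
  (3 <= #|I| <= N + 2)%N -> (forall a, homog 1 (l a)) ->
  (forall x s, X x s -> forall a, (s a)%:~R = meval x (l a)) ->
  (forall J : pred I, (forall x s, X x s -> 0 <= \sum_(a | J a) s a) \/
                      (forall x s, X x s -> \sum_(a | J a) s a <= 0)) ->
  exists P : mpoly V R, homog (#|I| - 3) P /\ forall x s, X x s -> (hcount N s)%:R = meval x P.
Proof.
elim: N I l X => [|N IH] I l X hI hl hX hJ; first by move: hI; lia.
pose fac (b : {ffun I -> 'I_3}) (j : 'I_3) (s : I -> int) : nat := if #|[pred a | b a == j]| == 1%N then 1%N else
        if (0 < sB s b j)%R
        then (absz (sB s b j) * hcount N (ext (fun a : {a : I | b a == j} => s (val a))))%N
        else 0%N.
have key b : can b -> dist (#|I| - 3) b != 0%N -> forall j, exists P : mpoly V R,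
    homog (#|[pred a | b a == j]|.-1) P /\ forall x s, X x s -> (fac b j s)%:R = meval x P.
  move=> bc db j; rewrite /fac; have [e1|ne1] := eqVneq #|[pred a | b a == j]| 1%N.
    by exists 1; rewrite e1; split; [exact: dhomog1|move=> x s _; rewrite meval1].
  (* The sign of the block sum is the same on the whole family; if it is never positive, the block
     contributes 0 throughout. *)
  have [pos|neg] := hJ (fun a => b a == j); last first.
    exists 0; split=> [|x s h]; first exact: dhomog0.
    by rewrite meval0 ltNge /sB (neg x s h).
  have cA : #|{: {a : I | b a == j}}| = #|[pred a | b a == j]| by rewrite card_sig.
  have cA2 : (2 <= #|[pred a | b a == j]|)%N.
    have /surjP/(_ j)[a e] := can_surj bc; rewrite ltn_neqAle eq_sym ne1.
    by apply/card_gt0P; exists a; rewrite inE e.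
  have bal : (#|[pred a | b a == j]| + 2 <= #|I|)%N.
    move: db; rewrite -lt0n => /card_gt0P[g]; rewrite inE => /forallP/(_ j)/eqP e.
    have := max_card [pred k | g k == j]; rewrite card_ord -e; move: hI; move: #|I| #|_| => x y.
    lia.
  pose X' x (s' : option {a : I | b a == j} -> int) := exists2 s, X x s &
    s' = ext (fun a : {a : I | b a == j} => s (val a)).
  pose l' (o : option {a : I | b a == j}) := if o is Some a then l (val a) else - \sum_(a : {a : I | b a == j}) l (val a).
  have [|a|x _ [s h ->] a|J|P [hP vP]] := IH _ l' X'.
  - by rewrite card_option cA; move: cA2 bal hI; move: #|I| #|_| => x y; lia.
  - case: a => [a|] /=; first exact: hl.
    by rewrite rpredN; apply: homog_sum => a _; exact: hl.
  - case: a => [a|] /=; first exact: hX.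
    rewrite mevalN mulrNz; congr (- _).
    by rewrite (rmorph_sum intr) raddf_sum; apply: eq_bigr => a _; apply: hX.
  (* A subset sum of the extended weights is a subset sum of the block or, when it contains the
     additional label, minus the sum over the complement in the block. So its sign is constant as
     well. *)
  - pose J1 (a : I) := if insub a is Some a' then J (Some (a' : {a : I | b a == j})) else false.
    pose J2 (a : I) := (b a == j) && ~~ J1 a.
    have J1E (s : I -> int) : \sum_(a : {a : I | b a == j} | J (Some a)) s (val a) = \sum_(a | J1 a) s a.
      rewrite [RHS](reindex_omap (val : {a : I | b a == j} -> I) insub) => [|a].
        by apply: eq_bigl => a; rewrite /J1 valK eqxx andbT.
      by rewrite /J1; case: insubP => // a' _ <-.
    have J12 (s : I -> int) : \sum_(a : {a : I | b a == j}) s (val a) = \sum_(a | J1 a) s a + \sum_(a | J2 a) s a.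
      rewrite (big_sig _ (fun a => b a == j) s) (bigID J1) /=; congr (_ + _).
      apply: eq_bigl => a; rewrite /J1; case: insubP => [a' -> _//|/negbTE ->//].
    have sE (s : I -> int) : \sum_(o | J o) ext (fun a : {a : I | b a == j} => s (val a)) o =
        if J None then - \sum_(a | J2 a) s a else \sum_(a | J1 a) s a.
      rewrite big_mkcond big_option /= -big_mkcond J1E J12; case: ifP => _; last by rewrite add0r.
      by rewrite opprD addrAC addNr add0r.
    case eJ : (J None); [have [h|h] := hJ J2|have [h|h] := hJ J1].
    + by right=> x _ [s hs ->]; rewrite sE eJ oppr_le0; apply: h hs.
    + by left=> x _ [s hs ->]; rewrite sE eJ oppr_ge0; apply: h hs.
    + by left=> x _ [s hs ->]; rewrite sE eJ; apply: h hs.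
    by right=> x _ [s hs ->]; rewrite sE eJ; apply: h hs.
  exists ((\sum_(a | b a == j) l a) * P); split.
    have -> : #|[pred a | b a == j]|.-1 = (1 + (#|{: option {a : I | b a == j}}| - 3))%N.
      by rewrite card_option cA; move: cA2; move: #|_| => y; lia.
    by apply: homogM => //; apply: homog_sum.
  move=> x s h; have sp := pos x s h.
  rewrite mevalM raddf_sum -(vP x _ (ex_intro2 _ _ s h erefl)).
  have -> : \sum_(a | b a == j) meval x (l a) = (sB s b j)%:~R.
    by rewrite /sB (rmorph_sum intr); apply: eq_bigr => a _; exact/esym/(hX x s h).
  (* On a wall the block sum is 0: the count drops the term and the linear factor of the polynomial
     vanishes. This makes the formula valid on the closure. *)
  move: sp; rewrite le_eqVlt -/(sB s b j) => /orP[/eqP <-|sp].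
    by rewrite ltxx mul0r.
  by rewrite sp natrM -{2}(gtz0_abs sp).
have ex b : exists P : mpoly V R, homog (#|I| - 3) P /\
    forall x s, X x s -> (if can b then (dist (#|I| - 3) b * \prod_j fac b j s)%N else 0%N)%:R = meval x P.
  have [bc|_] := boolP (can b); last by exists 0; split; [exact: dhomog0|move=> x s _; rewrite meval0].
  have [d0|d0] := eqVneq (dist (#|I| - 3) b) 0%N.
    by exists 0; split; [exact: dhomog0|move=> x s _; rewrite meval0 d0 mul0n].
  have [P hP] := choice (key b bc d0).
  exists ((dist (#|I| - 3) b)%:R * \prod_j P j); split.
    (* A block of k labels contributes degree k - 1, which is the number of critical points
       distributed to it; these numbers add up to |I| - 3. *)
    apply: homog_nat; have -> : (#|I| - 3 = \sum_(j < 3) #|[pred a | b a == j]|.-1)%N.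
      move: d0; rewrite -lt0n => /card_gt0P[g]; rewrite inE => /forallP bal.
      rewrite -[LHS]card_ord -sum1_card (partition_big g predT) //=; apply: eq_bigr => j _.
      by rewrite sum1_card -(eqP (bal j)) addn1.
    by apply: homog_prod => j; have [] := hP j.
  move=> x s h; rewrite natrM mevalM rmorph_nat natr_prod [in RHS]rmorph_prod; congr (_ * _).
  by apply: eq_bigr => j _; have [_ h'] := hP j; rewrite (h' x s h).
have [P hP] := choice ex; exists (\sum_b P b); split.
  by apply: homog_sum => b _; have [] := hP b.
move=> x s h; have -> : hcount N.+1 s = (\sum_b (if can b then dist (#|I| - 3) b * \prod_j fac b j s else 0))%N.
  by rewrite -big_mkcond.
rewrite natr_sum [in RHS]raddf_sum.
by apply: eq_bigr => b _; have [_ h'] := hP b; rewrite (h' x s h).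
Qed.

End Polynomiality.

(** * Signs of subset sums on the closure of a chamber *)

Lemma connected_pos (R : realType) (T : topologicalType) (C : set T) (L : T -> R) v :
  connected C -> continuous L -> (forall u, C u -> L u != 0) -> C v -> 0 < L v ->
  forall u, closure C u -> 0 <= L u.
Proof.
move=> cC cL L0 Cv Lv u.
have pC : C `<=` L @^-1` [set x | 0 <= x].
  move=> t Ct /=; rewrite leNgt; apply/negP => Lt.
  have /connected_intervalP cI := connected_continuous_connected cC (continuous_subspaceT cL).
  have [z Cz z0] : (L @` C) 0.
    by apply: (cI (L t) (L v)); [exists t|exists v|rewrite !ltW].
  by have := L0 z Cz; rewrite z0 eqxx.
have cl : closed (L @^-1` [set x | 0 <= x]) by apply: preimage_closed => //; exact: closed_ge.
by move=> /(closure_subset pC); rewrite -((closure_id _).1 cl).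
Qed.

Lemma connected_sign (R : realType) (T : topologicalType) (C : set T) (L : T -> R) :
  connected C -> continuous L -> (forall u, C u -> L u != 0) ->
  (forall u, closure C u -> 0 <= L u) \/ (forall u, closure C u -> L u <= 0).
Proof.
move=> cC cL L0; have [[v Cv]|C0] := pselect (C !=set0); last first.
  by have /nonemptyPn -> := C0; left=> u; rewrite closure0.
have [Lv|Lv|Lv] := ltgtP 0 (L v).
- by left; apply: connected_pos Lv.
- right=> u Cu; rewrite -oppr_ge0; apply: (@connected_pos _ _ C (fun u => - L u) v) Cu => //.
  + by move=> x; apply: continuousN; exact: cL.
  + by move=> t Ct; rewrite oppr_eq0 L0.
  + by rewrite oppr_gt0.
by have := L0 v Cv; rewrite -Lv eqxx.
Qed.

Section Chamber.
Variables (R : realType) (m n : nat) (C : set 'rV[R]_(m + n)).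
Hypothesis chamberC : chamber C.

(** Such a difference vanishes exactly on a resonance, which the connected set C avoids. *)
Lemma chamber_sign (I : pred 'I_m) (J : pred 'I_n) :
  (exists i, I i) -> (exists i, ~~ I i) -> (exists j, J j) -> (exists j, ~~ J j) ->
  let L (v : 'rV[R]_(m + n)) := \sum_(j | J j) ycoord v j - \sum_(i | I i) xcoord v i in
  (forall v, closure C v -> 0 <= L v) \/ (forall v, closure C v -> L v <= 0).
Proof.
move=> [i Ii] [i' Ii'] [j Jj] [j' Jj'] L.
case: chamberC => v0 Av0 ->; apply: connected_sign; first exact: component_connected.
  have cS k (Q : pred 'I_k) (f : 'I_k -> 'I_(m + n)) :
      continuous (fun v : 'rV[R]_(m + n) => \sum_(i | Q i) v 0 (f i)).
    by apply: continuous_big => [|l _]; [exact: add_continuous|exact: coord_continuous].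
  by move=> v; apply: continuousB; exact: cS.
move=> u /connected_component_sub[_ nr]; apply/eqP => L0; apply: nr.
exists [set k | I k]%SET, [set k | J k]%SET; split.
- by apply/set0Pn; exists i; rewrite inE.
- by apply/properP; split; [exact: finset.subsetT|exists i'; rewrite ?inE].
- by apply/set0Pn; exists j; rewrite inE.
- by apply/properP; split; [exact: finset.subsetT|exists j'; rewrite ?inE].
rewrite /resonance /=; under eq_bigl do rewrite inE; under [RHS]eq_bigl do rewrite inE.
by apply/esym/eqP; rewrite -subr_eq0 -/(L u) L0.
Qed.

Lemma weight_sign (J : pred ('I_m + 'I_n)) :
  let S mu nu := \sum_(a | J a) @weight m n mu nu a in
  let X (mu : 'I_m -> nat) (nu : 'I_n -> nat) :=
    (\sum_i mu i = \sum_j nu j)%N /\ closure C (param_point R mu nu) in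
  (forall mu nu, X mu nu -> 0 <= S mu nu) \/ (forall mu nu, X mu nu -> S mu nu <= 0).
Proof.
move=> S X.
have SE mu nu : S mu nu = \sum_(j | J (inr j)) (nu j)%:Z - \sum_(i | J (inl i)) (mu i)%:Z.
  by rewrite /S big_sumType /= sumrN addrC.
have SE' mu nu : X mu nu -> S mu nu = \sum_(i | ~~ J (inl i)) (mu i)%:Z - \sum_(j | ~~ J (inr j)) (nu j)%:Z.
  move=> [e _]; rewrite SE.
  have : \sum_i (mu i)%:Z = \sum_j (nu j)%:Z by move: (congr1 Posz e); rewrite -!natz !natr_sum; under eq_bigr do rewrite natz; under [RHS]eq_bigr do rewrite natz.
  rewrite (bigID (fun i => J (inl i))) /= [RHS](bigID (fun j => J (inr j))) /=.
  by move: (\sum_(i | J (inl i)) _) (\sum_(i | ~~ J (inl i)) _) (\sum_(j | J (inr j)) _)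
    (\sum_(j | ~~ J (inr j)) _) => a b c f; clear; lia.
have nn (T : finType) (P : pred T) (f : T -> nat) : 0 <= \sum_(t | P t) (f t)%:Z.
  by apply: sumr_ge0.
(* If J or its complement contains no pole or no zero, the sign is evident, as the weights sum to 0.
   Otherwise J defines a resonance. *)
have [/existsP i1|/existsPn i0] := boolP [exists i, J (inl i)]; last first.
  by left=> mu nu _; rewrite SE [X in _ - X]big1 ?subr0// => i Ji; have := i0 i; rewrite Ji.
have [/existsP i2|/existsPn i0] := boolP [exists i, ~~ J (inl i)]; last first.
  by right=> mu nu h; rewrite SE'// [X in X - _]big1 ?sub0r ?oppr_le0// => i Ji; have := i0 i; rewrite Ji.
have [/existsP j1|/existsPn j0] := boolP [exists j, J (inr j)]; last first.
  by right=> mu nu _; rewrite SE [X in X - _]big1 ?sub0r ?oppr_le0// => i Ji; have := j0 i; rewrite Ji.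
have [/existsP j2|/existsPn j0] := boolP [exists j, ~~ J (inr j)]; last first.
  by left=> mu nu h; rewrite SE'// [X in _ - X]big1 ?subr0// => i Ji; have := j0 i; rewrite Ji.
have LE mu nu : \sum_(j | J (inr j)) ycoord (param_point R mu nu) j -
    \sum_(i | J (inl i)) xcoord (param_point R mu nu) i = (S mu nu)%:~R.
  rewrite SE rmorphB !(rmorph_sum intr); congr (_ - _); apply: eq_bigr => k _.
    by rewrite /ycoord row_mxEr mxE.
  by rewrite /xcoord row_mxEl mxE.
by have [h|h] := chamber_sign i1 i2 j1 j2; [left|right] => mu nu [_ /h]; rewrite LE ?ler0z ?lerz0.
Qed.

End Chamber.

Theorem theorem1p1 (R : realType) (m n : nat) (m_gt0 : (0 < m)%N)
    (n_gt0 : (0 < n)%N) (mn_ge3 : (3 <= m + n)%N)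
    (C : set 'rV[R]_(m + n)) (chamberC : chamber C) :
  exists P : mpoly (m + n) R,
    P \is ishomog1 (m + n - 3) mdeg /\
    forall w : 'I_(m + n - 2) -> complex R,
      injective w -> (forall k, w k != 0) ->
    forall (d : nat) (mu : 'I_m -> nat) (nu : 'I_n -> nat),
      is_partition d mu -> is_partition d nu ->
      closure C (param_point R mu nu) ->
      hurwitz0 mu nu w = (meval (fun k => param_point R mu nu 0 k) P)%:E.
Proof.
pose X (x : 'I_(m + n) -> R) (s : 'I_m + 'I_n -> int) := exists mu nu,
  [/\ (\sum_i mu i = \sum_j nu j)%N, closure C (param_point R mu nu),
     x = (fun k => param_point R mu nu 0 k) & s = weight mu nu].
pose var k : mpoly (m + n) R := mpolyX R (mnm1 k).
have hvar k : var k \is ishomog1 1 mdeg.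
  by rewrite dhomogX /= mdeg1.
have cI : #|{: 'I_m + 'I_n}| = (m + n)%N by rewrite card_sum !card_ord.
have [||x s [mu [nu [e cl -> ->]]] [i|j]|J|P [hP vP]] := @hcount_poly R (m + n) (m + n) ('I_m + 'I_n)%type
  (fun a => match a with inl i => - var (lshift n i) | inr j => var (rshift m j) end) X.
- by rewrite cI mn_ge3 leq_addr.
- by case=> k; rewrite ?rpredN.
- by rewrite /= mevalN mevalXU row_mxEl mxE mulrNz.
- by rewrite /= mevalXU row_mxEr mxE.
- have [h|h] := weight_sign chamberC J; [left|right] => x s [mu [nu [e cl _ ->]]]; exact: h.
exists P; split=> [|w wI w0 d mu nu [_ mu0 smu] [_ nu0 snu] cl]; first by move: hP; rewrite cI.
(* There is a branch point to be placed at infinity; a pole and a zero serve as the labels at 0 and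
   1. *)
have lt0 : (0 < m + n - 2)%N by lia.
rewrite (@hurwitz0E _ _ _ _ _ _ mu0 nu0 _ mn_ge3 wI w0 (Ordinal lt0) (inl (Ordinal m_gt0))
  (inr (Ordinal n_gt0)) isT (m + n)) ?cI ?leq_addr//; last by rewrite smu snu.
by congr (_%:E); apply: vP; exists mu, nu; rewrite smu snu.
Qed.
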